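(* Let $G=\{(z+w,zw): z,w\in\mathbb C,\ |z|<1,\ |w|<1\}\subset\mathbb C^2$, and let $\mathcal R=\{(2z,z^2): z\in\mathbb C,\ |z|<1\}$. A set $V$ is an algebraic subset of $G$ having the norm-preserving extension property if and only if either $V$ is a retract in $G$ or $V=\mathcal R\cup\mathcal D$ where $\mathcal D$ is a flat geodesic in $G$.
   Context: $\mathbb D=\{z\in\mathbb C:|z|<1\}$. An algebraic subset of $G$ is a set of the form $G\cap A$, where $A=\{\lambda\in\mathbb C^2: p(\lambda)=0 \text{ for all } p\in S\}$ for some set $S$ of polynomials in two variables. A function $f$ on a subset $V$ of a domain $U$ is analytic on $V$ if for every $z\in V$ there are a neighborhood $W$ of $z$ in $U$ and an analytic function $h$ on $W$ that agrees with $f$ on $W\cap V$. A subset $V$ of a domain $U$ has the norm-preserving extension property if for every bounded analytic function $f$ on $V$ there exists an analytic function $g$ on $U$ such that $g|V=f$ and $\sup_U|g|=\sup_V|f|$. A retract in $U$ is the range of a holomorphic map $\rho:U\to U$ with $\rho\circ\rho=\rho$ (singletons and $U$ itself are retracts). A complex geodesic of $G$ is a set $k(\mathbb D)$ where $k:\mathbb D\to G$ is holomorphic and has a holomorphic left inverse $C:G\to\mathbb D$, $C\circ k=\mathrm{id}_{\mathbb D}$. A flat geodesic of $G$ is a complex geodesic of $G$ that is the intersection of $G$ with a complex line. *)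

(* Defs.v *)
From HB Require Import structures.
From mathcomp Require Import all_boot all_order all_algebra.
From mathcomp Require Import all_classical all_reals all_analysis.
From mathcomp Require Import complex polyXY.
Set Implicit Arguments.
Unset Strict Implicit.
Unset Printing Implicit Defensive.
Import Order.TTheory GRing.Theory Num.Theory numFieldNormedType.Exports.
Local Open Scope classical_set_scope.
Local Open Scope ring_scope.
Local Open Scope complex_scope.

(* The complex numbers as a normed space over themselves: on [R[i]^o] and its
   products, [differentiable] is complex (Frechet) differentiability. *)
Notation Cplx R := (R[i]^o).
Notation Cplx2 R := (Cplx R * Cplx R)%type.

(* Functions are total; only their values on the relevant subset matter.
   The set [U] is meant to be open, so differentiability at its points does
   not depend on values outside [U]. *)
Definition holomorphic_on (R : realType) (X Y : normedModType R[i])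
    (U : set X) (f : X -> Y) : Prop :=
  forall x, U x -> differentiable f x.

Definition analytic_on_subset (R : realType) (X : normedModType R[i])
    (U V : set X) (f : X -> Cplx R) : Prop :=
  forall z, V z -> exists W : set X,
    [/\ open W, W z, W `<=` U &
        exists h : X -> Cplx R,
          holomorphic_on W h /\ forall x, W x -> V x -> h x = f x].

Definition bounded_on (R : realType) (X : Type) (V : set X)
    (f : X -> Cplx R) : Prop :=
  exists M : R, forall x, V x -> ComplexField.Normc.normc (f x) <= M.

(* The supremum is taken in the extended reals: it is [+oo] for an unbounded
   function, and [-oo] over the empty set, so that the empty set does not have
   the norm-preserving extension property in a nonempty [U]. *)
Definition sup_norm (R : realType) (X : Type) (V : set X)
    (f : X -> Cplx R) : \bar R :=
  ereal_sup [set (ComplexField.Normc.normc (f x))%:E | x in V].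

Definition norm_preserving_extension (R : realType) (X : normedModType R[i])
    (U V : set X) : Prop :=
  V `<=` U /\
  forall f : X -> Cplx R, analytic_on_subset U V f -> bounded_on V f ->
    exists g : X -> Cplx R,
      [/\ holomorphic_on U g,
          forall x, V x -> g x = f x &
          sup_norm U g = sup_norm V f].

Definition retract_in (R : realType) (X : normedModType R[i])
    (U V : set X) : Prop :=
  exists rho : X -> X,
    [/\ holomorphic_on U rho,
        forall x, U x -> U (rho x),
        forall x, U x -> rho (rho x) = rho x &
        V = rho @` U].

Definition unit_disc (R : realType) : set (Cplx R) := [set z | `|z| < 1].
Arguments unit_disc : clear implicits.

Definition complex_geodesic (R : realType) (X : normedModType R[i])
    (U D : set X) : Prop :=
  exists (k : Cplx R -> X) (c : X -> Cplx R),
    [/\ holomorphic_on (unit_disc R) k /\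
          (forall z, unit_disc R z -> U (k z)),
        holomorphic_on U c /\ (forall x, U x -> unit_disc R (c x)),
        forall z, unit_disc R z -> c (k z) = z &
        D = k @` (unit_disc R)].

Definition complex_line (R : realType) (X : normedModType R[i])
    (L : set X) : Prop :=
  exists a b : X, b != 0 /\ L = [set x | exists t : R[i], x = a + t *: b].

Definition flat_geodesic (R : realType) (X : normedModType R[i])
    (U D : set X) : Prop :=
  complex_geodesic U D /\ exists2 L : set X, complex_line L & D = U `&` L.

Definition algebraic_subset (R : realType) (U V : set (Cplx2 R)) : Prop :=
  exists S : set {poly {poly R[i]}},
    V = U `&` [set x : Cplx2 R | forall p, S p -> p.[x.1, x.2] = 0].

Definition symmetrized_bidisc (R : realType) : set (Cplx2 R) :=
  [set s | exists z w : Cplx R,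
             [/\ `|z| < 1, `|w| < 1 & s = (z + w, z * w)]].
Arguments symmetrized_bidisc : clear implicits.

Definition royal_variety (R : realType) : set (Cplx2 R) :=
  [set s | exists z : Cplx R, `|z| < 1 /\ s = (2 * z, z ^+ 2)].
Arguments royal_variety : clear implicits.

(* Main.v *)
(* The points (z + w, z w) of G are described, for each om on the unit circle, by
   the chart (m, D) = ((a + b) / 2, ((a - b) / 2)^2), where a and b are the images
   of om z and om w under the Cayley transform onto the right half-plane. Any two
   points of G lie, in a suitable chart, on a curve D = al m^2 + i be m - ga with
   real coefficients: choose om so that m separates the two points as much as
   possible. These curves are the complex geodesics of G, the flat ones being those
   with al = 1 (in all charts), and R is the curve D = 0. They are retracts, they are
   uniquely determined by two of their points or by a point and a tangent, and a
   retract other than a point and G is one of them.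

   Let V have the extension property. If V contains two points of a geodesic that
   is not flat, perturbing the coordinate of the geodesic gives a function on V
   without norm-preserving extension, unless the closure of V contains the node
   (2 / om, 1 / om^2) of the chart. If R is not contained in V, only finitely many
   nodes are possible because V is algebraic, and a regular arc of V must then lie,
   together with any given point of V, on one geodesic; hence V is a geodesic. If R is
   contained in V, similar perturbations show that V contains the flat geodesic
   through each of its points outside R, and that there is only one of these.

   Conversely, let f be given on the union of R and a flat geodesic F. An
   automorphism of G moves F to the points (0, q). The Cayley transforms of the
   restrictions of f to R and to F are limits of convex combinations of Moebius
   functions with unimodular parameters c and d, and the functions
   (2 d p + c s) / (2 + d conj(c) s) interpolate the pairs. *)

Require Import Defs.
From HB Require Import structures.
From mathcomp Require Import all_boot all_order all_algebra.
From mathcomp Require Import all_classical all_reals all_analysis.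
From mathcomp Require Import complex polyXY ring lra.
Set Implicit Arguments.
Unset Strict Implicit.
Unset Printing Implicit Defensive.
Import Order.TTheory GRing.Theory Num.Theory numFieldNormedType.Exports.
Local Open Scope classical_set_scope.
Local Open Scope ring_scope.
Local Open Scope complex_scope.

(* [lra] inspects every hypothesis, which is slow in large contexts. *)
Ltac slim := repeat match goal with
  | H : forall _, _ |- _ => clear H
  | H : ex _ |- _ => clear H
  | H : ex2 _ _ |- _ => clear H
  | H : @eq ?T _ _ |- _ => unify T (complex _); clear H
  | H : is_true (~~ _) |- _ => clear H
  end.
Ltac arith := slim; lra.
Ltac narith := slim; nra.

(** All function theory here rests on one positivity: Cauchy's formula is a limit of means over
    roots of unity, so a Pick form is a limit of means of [F] times a squared modulus. The Schwarz
    lemma, its two uniqueness cases and the constancy of real-valued holomorphic functions are Pick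
    forms at two or three points with suitable weights.

    A quadratic curve has three real coefficients, while two points impose four real equations. The
    missing condition is the vanishing of a cubic coefficient, and optimality of the chart supplies
    it. A holomorphic section of [cm] makes its own chart optimal for any two of its points, so
    every such section is one of these curves; uniqueness of geodesics and the description of
    retracts follow.

    A perturbation contradicts the extension property if it points inwards wherever the original
    function is unimodular on the closure of [V], yet raises a value that the Schwarz lemma bounds
    along a geodesic. For a curve that is not flat the inward direction is built by dividing by
    [1 - al], which is how flat geodesics escape the argument. *)

Notation cn := ComplexField.Normc.normc.
Notation rp := (@complex.Re _).
Notation ip := (@complex.Im _).
Notation cj := (@conjc _).

(** * Modulus, real and imaginary parts *)

Section ModulusBasics.
Variable R : realType.
Implicit Types z w : R[i].

(** The norm on [R[i]] takes values in [R[i]]; [cn] is its real-valued form, in which all estimates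
    are made. *)
Lemma cnoE (z : Cplx R) : `|z| = (cn z)%:C. Proof. by []. Qed.
Lemma cn0 : cn (0 : R[i]) = 0. Proof. exact: ComplexField.Normc.normc0. Qed.
Lemma cn1 : cn (1 : R[i]) = 1. Proof. exact: ComplexField.Normc.normc1. Qed.
Lemma cnM z w : cn (z * w) = cn z * cn w. Proof. exact: ComplexField.Normc.normcM. Qed.
Lemma cnV z : cn z^-1 = (cn z)^-1. Proof. exact: ComplexField.Normc.normcV. Qed.
Lemma cnN z : cn (- z) = cn z. Proof. exact: normcN. Qed.
Lemma cnD z w : cn (z + w) <= cn z + cn w. Proof. exact: le_normcD. Qed.
Lemma cn_ge0 z : 0 <= cn z. Proof. by case: z => a b; exact: sqrtr_ge0. Qed.
Lemma cn_eq0 z : (cn z == 0) = (z == 0).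
Proof. by apply/eqP/eqP => [/ComplexField.Normc.eq0_normc//|->]; exact: cn0. Qed.
Lemma cn_gt0 z : (0 < cn z) = (z != 0).
Proof. by rewrite lt_def cn_ge0 andbT cn_eq0. Qed.
Lemma cnBC z w : cn (z - w) = cn (w - z). Proof. by rewrite -cnN opprB. Qed.
Lemma cnB z w : cn (z - w) <= cn z + cn w. Proof. by rewrite -(cnN w) cnD. Qed.
Lemma cn_tri x z w : cn (z - w) <= cn (z - x) + cn (x - w).
Proof. by rewrite -[z - w](subrKA x) cnD. Qed.
Lemma cnX z n : cn (z ^+ n) = cn z ^+ n.
Proof. by elim: n => [|n IH]; rewrite ?expr0 ?cn1// !exprS cnM IH. Qed.
Lemma cnJ z : cn (cj z) = cn z.
Proof. by case: z => a b /=; rewrite sqrrN. Qed.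
Lemma cnR (x : R) : cn x%:C = `|x|.
Proof. by rewrite /= expr0n addr0 sqrtr_sqr. Qed.
Lemma cn_sqr z : cn z ^+ 2 = rp z ^+ 2 + ip z ^+ 2.
Proof. by case: z => a b /=; rewrite sqr_sqrtr// addr_ge0 ?sqr_ge0. Qed.
Lemma rp_le_cn z : `|rp z| <= cn z.
Proof. by case: z => a b /=; rewrite -sqrtr_sqr ler_wsqrtr// lerDl sqr_ge0. Qed.
Lemma ip_le_cn z : `|ip z| <= cn z.
Proof. by case: z => a b /=; rewrite -sqrtr_sqr ler_wsqrtr// lerDr sqr_ge0. Qed.
Lemma cn_le_ReIm z : cn z <= `|rp z| + `|ip z|.
Proof.
rewrite [z in cn z]complexE; apply: le_trans (cnD _ _) _.
rewrite cnM !cnR lerD2l [X in X * _](_ : _ = 1) ?mul1r//=.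
by rewrite expr0n expr1n add0r sqrtr1.
Qed.
Lemma cn_distD z w : cn z - cn w <= cn (z + w).
Proof. by rewrite lerBlDr -(cnN w); apply: le_trans (cnD _ _); rewrite addrK. Qed.
Lemma cn_sum (I : Type) (s : seq I) (P : pred I) (F : I -> R[i]) :
  cn (\sum_(i <- s | P i) F i) <= \sum_(i <- s | P i) cn (F i).
Proof.
elim/big_rec2: _ => [|i x y _ h]; first by rewrite cn0.
by apply: le_trans (cnD _ _) _; rewrite lerD2l.
Qed.
Lemma rpD z w : rp (z + w) = rp z + rp w. Proof. by case: z; case: w. Qed.
Lemma rpN z : rp (- z) = - rp z. Proof. by case: z. Qed.
Lemma rpB z w : rp (z - w) = rp z - rp w. Proof. by rewrite rpD rpN. Qed.
Lemma ipD z w : ip (z + w) = ip z + ip w. Proof. by case: z; case: w. Qed.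
Lemma ipN z : ip (- z) = - ip z. Proof. by case: z. Qed.
Lemma ipB z w : ip (z - w) = ip z - ip w. Proof. by rewrite ipD ipN. Qed.
Lemma rpM z w : rp (z * w) = rp z * rp w - ip z * ip w. Proof. by case: z; case: w. Qed.
Lemma ipM z w : ip (z * w) = rp z * ip w + ip z * rp w.
Proof. by case: z => a b; case: w => c d. Qed.
Lemma rpJ z : rp (cj z) = rp z. Proof. by case: z. Qed.
Lemma ipJ z : ip (cj z) = - ip z. Proof. by case: z. Qed.
Lemma rp0 : rp (0 : R[i]) = 0. Proof. by []. Qed.
Lemma rp1 : rp (1 : R[i]) = 1. Proof. by []. Qed.
Lemma ip1 : ip (1 : R[i]) = 0. Proof. by []. Qed.
Lemma cxP z w : rp z = rp w -> ip z = ip w -> z = w.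
Proof. by case: z => a b; case: w => c d /= -> ->. Qed.
End ModulusBasics.

(** * Cauchy's formula as a limit of means over circles *)

Section RealIntegral.
Variable R : realType.
Implicit Types (f g : R -> R) (a b c x : R).

(* Primitives are only claimed on ]-2, +oo[: the rest of the line is not needed,
   and the library constructs them from a fixed base point. *)
Lemma primitive_ex f : continuous f ->
  exists A : R -> R, forall x, -2 < x -> is_derive x 1 A (f x).
Proof.
move=> cf.
exists (fun x => \int[@lebesgue_measure R]_(t in `[-2, x]) f t)%R => x x2.
have [||d1 d2] := @continuous_FTC1_closed _ f (-2) x (x + 1) _ _ x2 (cf x).
- by rewrite ltrDl.
- apply: continuous_compact_integrable; first exact: segment_compact.
  exact: continuous_subspaceT.
- by apply: DeriveDef; [exact: d1|rewrite -derive1E; exact: d2].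
Qed.

Definition prim f : R -> R :=
  get [set A : R -> R | forall x, -2 < x -> is_derive x 1 A (f x)].

Lemma primP f : continuous f -> forall x, -2 < x -> is_derive x 1 (prim f) (f x).
Proof. by move=> cf; have := getPex (primitive_ex cf). Qed.

(** Using one chosen primitive makes additivity immediate for any order of the endpoints, so
    reversed intervals carry the sign they should. *)
Definition rint f a b := prim f b - prim f a.

Lemma rintD f a b c : rint f a b + rint f b c = rint f a c.
Proof. by rewrite /rint; arith. Qed.

Lemma prim_unique f A a b : continuous f -> -2 < a -> -2 < b ->
  (forall x, -2 < x -> is_derive x 1 A (f x)) -> rint f a b = A b - A a.
Proof.
move=> cf; wlog ab : a b / a <= b.
  move=> H a2 b2 hA; case: (leP a b) => [ab|/ltW ba]; first exact: H.
  by have := H _ _ ba b2 a2 hA; rewrite /rint => ?; arith.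
move=> a2 b2 hA.
have hd x : -2 < x -> is_derive x 1 (prim f - A) 0.
  move=> x2; have ? := primP cf x2; have ? := hA _ x2.
  by apply: is_derive_eq; rewrite subrr.
have [| |z _] := @MVT_segment _ (prim f - A) (fun=> 0) a b ab.
- by move=> x; rewrite in_itv/= => /andP[ax _]; apply: hd; exact: lt_trans ax.
- apply: derivable_within_continuous => x; rewrite in_itv/= => /andP[ax _].
  by have [] := hd x (lt_le_trans a2 ax).
rewrite mul0r => /eqP; rewrite subr_eq0 => /eqP e.
have {}e : prim f b - A b = prim f a - A a by exact: e.
by rewrite /rint; arith.
Qed.

Lemma rint_lin f g k l a b : continuous f -> continuous g -> -2 < a -> -2 < b ->
  rint (fun x => k * f x + l * g x) a b = k * rint f a b + l * rint g a b.
Proof.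
move=> cf cg a2 b2.
have cfg : continuous (fun x => k * f x + l * g x).
  by move=> x; apply: cvgD; apply: cvgM; [exact: cvg_cst|exact: cf|exact: cvg_cst|exact: cg].
have H x : -2 < x ->
    is_derive x 1 (fun x => k * prim f x + l * prim g x) (k * f x + l * g x).
  move=> x2; have h1 := primP cf x2; have h2 := primP cg x2.
  have h3 := @is_deriveZ R R^o R^o (prim f) k x 1 (f x) h1.
  have h4 := @is_deriveZ R R^o R^o (prim g) l x 1 (g x) h2.
  exact: (is_deriveD h3 h4).
by rewrite (prim_unique cfg a2 b2 H) /rint; ring.
Qed.

Lemma rint_bound f a b M : continuous f -> -2 < a -> -2 < b ->
  (forall x, Num.min a b <= x <= Num.max a b -> `|f x| <= M) ->
  `|rint f a b| <= M * `|b - a|.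
Proof.
move=> cf; wlog ab : a b / a <= b.
  move=> H a2 b2 hM; case: (leP a b) => [ab|/ltW ba]; first exact: H.
  have -> : rint f a b = - rint f b a by rewrite /rint opprB.
  rewrite distrC normrN.
  by apply: H => // x; rewrite minC maxC; exact: hM.
move=> a2 b2; rewrite (min_idPl ab) (max_idPr ab) => hM.
have [| |z] := @MVT_segment _ (prim f) f a b ab.
- by move=> x; rewrite in_itv/= => /andP[ax _]; apply: primP => //; exact: lt_trans ax.
- apply: derivable_within_continuous => x; rewrite in_itv/= => /andP[ax _].
  by have [] := primP cf (lt_le_trans a2 ax).
rewrite in_itv/= => zab; rewrite /rint => ->; rewrite normrM ler_wpM2r//.
exact: hM.
Qed.

Lemma rint_cst k a b : -2 < a -> -2 < b -> rint (fun=> k) a b = k * (b - a).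
Proof.
move=> a2 b2; have H x : -2 < x -> is_derive x 1 (fun x => k * x : R^o) k.
  move=> _; have h := @is_deriveZ R R^o R^o id k x 1 1 (is_derive_id _ _).
  by apply: is_derive_eq; rewrite /GRing.scale/= mulr1.
have cc : continuous (fun _ : R => k) by move=> x; exact: cvg_cst.
by rewrite (prim_unique cc a2 b2 H) mulrBr.
Qed.

Lemma rint_id a b : -2 < a -> -2 < b -> rint id a b = (b ^+ 2 - a ^+ 2) / 2.
Proof.
move=> a2 b2.
have H x : -2 < x -> is_derive x 1 (fun x => 2^-1 * (x * x) : R^o) x.
  move=> _; have h := @is_deriveM R R^o id id x 1 1 1 (is_derive_id _ _) (is_derive_id _ _).
  have h2 := @is_deriveZ R R^o R^o _ 2^-1 x 1 _ h.
  by apply: is_derive_eq; rewrite /GRing.scale/=; arith.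
have cc : continuous (@id R) by move=> x; exact: cvg_id.
by rewrite (prim_unique cc a2 b2 H); arith.
Qed.

Lemma rint_same f a : rint f a a = 0. Proof. by rewrite /rint subrr. Qed.
End RealIntegral.

(** * Bisection as a form of compactness *)

Section Bisection.
Variable R : realType.

Lemma pow2_small (s d : R) : 0 < d -> exists n, s / 2 ^+ n < d.
Proof.
move=> d0; exists (Num.bound (s / d)).
rewrite ltr_pdivrMr ?exprn_gt0// mulrC -ltr_pdivrMr//.
have [h|h] := lerP 0 (s / d); last by apply: lt_le_trans h _; apply: exprn_ge0.
apply: lt_le_trans (archi_boundP h) _.
by rewrite -natrX ler_nat ltnW// ltn_expl.
Qed.

(** A failing rectangle has a failing quarter; the nested quarters shrink to a point, where the
    local hypothesis is contradicted. All rectangles have sides [s] and [k s], so a single length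
    describes them. Goursat's lemma and uniform continuity are both obtained this way. *)
Lemma bisection (P : R -> R -> R -> Prop) (k : R) : 0 <= k ->
  (forall a c s, 0 <= s -> P a c (s / 2) -> P (a + s / 2) c (s / 2) ->
     P a (c + k * (s / 2)) (s / 2) -> P (a + s / 2) (c + k * (s / 2)) (s / 2) ->
     P a c s) ->
  forall a c s, 0 <= s ->
  (forall x y, a <= x <= a + s -> c <= y <= c + k * s -> exists2 d, 0 < d &
     forall a' c' s', 0 <= s' < d -> a' <= x <= a' + s' -> c' <= y <= c' + k * s' ->
       a <= a' -> a' + s' <= a + s -> c <= c' -> c' + k * s' <= c + k * s ->
       P a' c' s') ->
  P a c s.
Proof.
move=> k0 hP a c s s0 hloc; apply: contrapT => nP.
(* A quarter on which [P] fails: once the first three hold, [hP] makes the fourth fail. *)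
pose step (t : R * R * R) := let: (a, c, s) := t in
  if `[< ~ P a c (s / 2) >] then (a, c, s / 2) else
  if `[< ~ P (a + s / 2) c (s / 2) >] then (a + s / 2, c, s / 2) else
  if `[< ~ P a (c + k * (s / 2)) (s / 2) >] then (a, c + k * (s / 2), s / 2)
  else (a + s / 2, c + k * (s / 2), s / 2).
pose st n := iter n step (a, c, s).
pose A n := (st n).1.1. pose B n := (st n).1.2. pose S n := (st n).2.
have stE n : st n = (A n, B n, S n) by rewrite /A /B /S; case: (st n) => [[]].
have stS n : st n.+1 = step (st n) by [].
have SE n : S n = s / 2 ^+ n.
  elim: n => [|n IH]; first by rewrite /S/= expr0 divr1.
  have -> : S n.+1 = S n / 2.
    by rewrite /S stS stE /step; case: ifP => //; case: ifP => //; case: ifP.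
  by rewrite IH exprS invfM mulrA mulrAC.
have S0 n : 0 <= S n by rewrite SE divr_ge0// exprn_ge0.
have mono n : [/\ A n <= A n.+1, A n.+1 + S n.+1 <= A n + S n,
    B n <= B n.+1 & B n.+1 + k * S n.+1 <= B n + k * S n].
  have := S0 n; have : 0 <= k * S n by rewrite mulr_ge0.
  rewrite [A n.+1]/A [B n.+1]/B [S n.+1]/S stS stE /step.
  by do ?case: ifP => _ /=; rewrite ?mulrA; split; arith.
have nPn n : ~ P (A n) (B n) (S n).
  elim: n => // n; rewrite [A n.+1]/A [B n.+1]/B [S n.+1]/S stS stE /step.
  case: ifPn => [/asboolP//|/asboolP/contrapT h1].
  case: ifPn => [/asboolP//|/asboolP/contrapT h2].
  case: ifPn => [/asboolP//|/asboolP/contrapT h3] h4 h5 /=.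
  by apply: h4; apply: hP.
have Amono n m : (n <= m)%N -> A n <= A m.
  by move=> /subnK<-; elim: (_ - _)%N => // i IH; apply: le_trans IH _; have [] := mono (i + n)%N.
have Adec n m : (n <= m)%N -> A m + S m <= A n + S n.
  by move=> /subnK<-; elim: (_ - _)%N => // i IH; apply: le_trans IH; have [] := mono (i + n)%N.
have Bmono n m : (n <= m)%N -> B n <= B m.
  by move=> /subnK<-; elim: (_ - _)%N => // i IH; apply: le_trans IH _; have [] := mono (i + n)%N.
have Bdec n m : (n <= m)%N -> B m + k * S m <= B n + k * S n.
  by move=> /subnK<-; elim: (_ - _)%N => // i IH; apply: le_trans IH; have [] := mono (i + n)%N.
have Aub n m : A m <= A n + S n.
  case/orP: (leq_total n m) => h.
    by apply: le_trans (Adec _ _ h); rewrite lerDl.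
  by apply: le_trans (Amono _ _ h) _; rewrite lerDl.
have Bub n m : B m <= B n + k * S n.
  case/orP: (leq_total n m) => h.
    by apply: le_trans (Bdec _ _ h); rewrite lerDl mulr_ge0.
  by apply: le_trans (Bmono _ _ h) _; rewrite lerDl mulr_ge0.
(* The lower left corners increase and stay below every right and upper side, so their suprema give
   a point common to all the rectangles. *)
pose x := sup (range A). pose y := sup (range B).
have hx n : A n <= x <= A n + S n.
  apply/andP; split.
    apply: ub_le_sup; last by exists n.
    by exists (A 0%N + S 0%N) => _ [m _ <-].
  by apply: ge_sup; [exists (A 0%N), 0%N|move=> _ [m _ <-]].
have hy n : B n <= y <= B n + k * S n.
  apply/andP; split.
    apply: ub_le_sup; last by exists n.
    by exists (B 0%N + k * S 0%N) => _ [m _ <-].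
  by apply: ge_sup; [exists (B 0%N), 0%N|move=> _ [m _ <-]].
have [d d0 hd] := hloc x y (hx 0%N) (hy 0%N).
have [n hn] := pow2_small s d0.
apply: (nPn n); apply: hd => //.
- by rewrite S0 SE.
- exact: (Amono 0%N).
- exact: (Adec 0%N).
- exact: (Bmono 0%N).
- exact: (Bdec 0%N).
Qed.
End Bisection.

Section ComplexIntegral.
Variable R : realType.
Notation C := R[i].
Implicit Types (f g : R -> C) (a b c : R).

Definition ccont f := continuous (fun t => rp (f t)) /\ continuous (fun t => ip (f t)).

Definition cint f a b : C :=
  rint (fun t => rp (f t)) a b +i* rint (fun t => ip (f t)) a b.

Lemma cint_add f a b c : cint f a b + cint f b c = cint f a c.
Proof. by apply: cxP; rewrite ?rpD ?ipD /= rintD. Qed.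

Lemma cint_same f a : cint f a a = 0.
Proof. by apply: cxP; rewrite /= rint_same. Qed.

Lemma ccont_lin f g (k l : C) : ccont f -> ccont g ->
  ccont (fun t => k * f t + l * g t).
Proof.
move=> [f1 f2] [g1 g2].
have H (p q r s : R) : continuous (fun t => p * rp (f t) + q * ip (f t) +
    (r * rp (g t) + s * ip (g t))).
  by move=> x; apply: cvgD; apply: cvgD; apply: cvgM; (try exact: cvg_cst);
    [exact: f1|exact: f2|exact: g1|exact: g2].
split.
  rewrite (_ : (fun t => _) = (fun t => rp k * rp (f t) + (- ip k) * ip (f t) +
    (rp l * rp (g t) + (- ip l) * ip (g t)))); first exact: H.
  by apply/funext => t; rewrite rpD !rpM !mulNr.
rewrite (_ : (fun t => _) = (fun t => ip k * rp (f t) + rp k * ip (f t) +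
    (ip l * rp (g t) + rp l * ip (g t)))); first exact: H.
by apply/funext => t; rewrite ipD !ipM; ring.
Qed.

Lemma cint_lin f g (k l : C) a b : ccont f -> ccont g -> -2 < a -> -2 < b ->
  cint (fun t => k * f t + l * g t) a b = k * cint f a b + l * cint g a b.
Proof.
move=> cf cg a2 b2; have [f1 f2] := cf; have [g1 g2] := cg.
have c0 (u v : R -> R) p q : continuous u -> continuous v ->
    continuous (fun t => p * u t + q * v t).
  by move=> cu cv x; apply: cvgD; apply: cvgM; (try exact: cvg_cst); [exact: cu|exact: cv].
have H (p q r s : R) : rint (fun t => 1 * (p * rp (f t) + q * ip (f t)) +
    1 * (r * rp (g t) + s * ip (g t))) a b =
   p * rint (fun t => rp (f t)) a b + q * rint (fun t => ip (f t)) a b +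
   (r * rint (fun t => rp (g t)) a b + s * rint (fun t => ip (g t)) a b).
  by rewrite rint_lin ?rint_lin ?mul1r//; exact: c0.
apply: cxP.
  rewrite rpD !rpM /= -mulNr -[- (ip l * _)]mulNr -H; congr rint; apply/funext => t.
  by rewrite rpD !rpM; ring.
rewrite ipD !ipM /= [rp k * _ + _]addrC [rp l * _ + _]addrC -H; congr rint; apply/funext => t.
by rewrite ipD !ipM; ring.
Qed.

(** The factor 2 comes from bounding the real and imaginary parts separately. *)
Lemma cint_bound f a b M : ccont f -> -2 < a -> -2 < b ->
  (forall x, Num.min a b <= x <= Num.max a b -> cn (f x) <= M) ->
  cn (cint f a b) <= 2 * M * `|b - a|.
Proof.
move=> [f1 f2] a2 b2 hM; apply: le_trans (cn_le_ReIm _) _ => /=.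
have h1 : `|rint (fun t => rp (f t)) a b| <= M * `|b - a|.
  by apply: rint_bound => // x hx; apply: le_trans (hM x hx); exact: rp_le_cn.
have h2 : `|rint (fun t => ip (f t)) a b| <= M * `|b - a|.
  by apply: rint_bound => // x hx; apply: le_trans (hM x hx); exact: ip_le_cn.
by arith.
Qed.

Lemma cint_cst (k : C) a b : -2 < a -> -2 < b -> cint (fun=> k) a b = k * (b - a)%:C.
Proof.
move=> a2 b2; apply: cxP; rewrite ?rpM ?ipM /= rint_cst//; first by rewrite mulr0 subr0.
by rewrite mulr0 add0r.
Qed.

Lemma cint_id a b : -2 < a -> -2 < b ->
  cint (fun t => t%:C) a b = ((b ^+ 2 - a ^+ 2) / 2)%:C.
Proof. by move=> a2 b2; apply: cxP => /=; rewrite ?rint_id ?rint_cst ?mul0r. Qed.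

Lemma ccont_cst (k : C) : ccont (fun=> k).
Proof. by split=> x; exact: cvg_cst. Qed.
Lemma ccont_id : ccont (fun t => t%:C).
Proof. by split=> x; [exact: cvg_id|exact: cvg_cst]. Qed.

Definition ctn (g : C -> C) (w : C) := forall e : R, 0 < e ->
  exists2 d : R, 0 < d & forall v, cn (v - w) < d -> cn (g v - g w) < e.

Lemma ctn_path (g : C -> C) (p : R -> C) : (forall w, ctn g w) ->
  (forall s t, cn (p s - p t) <= `|s - t|) -> ccont (fun t => g (p t)).
Proof.
move=> cg hp.
have H (h : C -> R) : (forall u v, `|h u - h v| <= cn (u - v)) ->
    continuous (fun t => h (g (p t))).
  move=> hh t; apply/cvgrPdist_lt => e e0.
  have [d d0 hd] := cg (p t) e e0.
  near=> s; apply: le_lt_trans (hh _ _) _; rewrite cnBC; apply: hd.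
  apply: le_lt_trans (hp _ _) _; rewrite distrC.
  by near: s; apply: (@cvgr_dist_lt _ R).
split; apply: H => u v; first by rewrite -rpB; exact: rp_le_cn.
by rewrite -ipB; exact: ip_le_cn.
Unshelve. all: by end_near. Qed.
End ComplexIntegral.

Section Rectangles.
Variable R : realType.
Notation C := R[i].
Variable g : C -> C.
Hypothesis cg : forall w, ctn g w.
Implicit Types a b c d x y t : R.

Lemma cn_diffh s t y : cn (s +i* y - t +i* y : C) <= `|s - t|.
Proof. by simpc; rewrite -/((s - t)%:C) cnR. Qed.
Lemma cn_diffv s t x : cn (x +i* s - x +i* t : C) <= `|s - t|.
Proof. by simpc; rewrite /= expr0n add0r sqrtr_sqr. Qed.

Lemma ccont_h y : ccont (fun t => g (t +i* y)).
Proof. by apply: ctn_path => // s t; exact: cn_diffh. Qed.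
Lemma ccont_v x : ccont (fun t => g (x +i* t)).
Proof. by apply: ctn_path => // s t; exact: cn_diffv. Qed.

(** Boundary integral of the rectangle over [[a, b]] and [[c, d]], counterclockwise when both
    intervals are increasing. Reversed endpoints are allowed and change the sign, so subdivisions
    become additions. *)
Definition rectint a b c d : C :=
  cint (fun t => g (t +i* c)) a b - cint (fun t => g (t +i* d)) a b +
  'i * (cint (fun t => g (b +i* t)) c d - cint (fun t => g (a +i* t)) c d).

Lemma rectint_addh a b b' c d :
  rectint a b c d + rectint b b' c d = rectint a b' c d.
Proof.
rewrite /rectint -!(@cint_add _ _ a b b').
set X1 := cint _ _ _; set X2 := cint _ _ _; set X3 := cint _ _ _; set X4 := cint _ _ _.
set X5 := cint _ _ _; set X6 := cint _ _ _; set X7 := cint _ _ _.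
ring.
Qed.

Lemma rectint_addv a b c d d' :
  rectint a b c d + rectint a b d d' = rectint a b c d'.
Proof.
rewrite /rectint -!(@cint_add _ _ c d d').
set X1 := cint _ _ _; set X2 := cint _ _ _; set X3 := cint _ _ _; set X4 := cint _ _ _.
set X5 := cint _ _ _; set X6 := cint _ _ _; set X7 := cint _ _ _.
ring.
Qed.

Lemma rectint_bound a b c d M : -2 < a -> -2 < b -> -2 < c -> -2 < d ->
  (forall x y, Num.min a b <= x <= Num.max a b -> Num.min c d <= y <= Num.max c d ->
     cn (g (x +i* y)) <= M) ->
  cn (rectint a b c d) <= 4 * M * (`|b - a| + `|d - c|).
Proof.
move=> a2 b2 c2 d2 hM.
have mm (u v : R) : Num.min u v <= u <= Num.max u v by rewrite ge_min le_max lexx.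
have mm' (u v : R) : Num.min u v <= v <= Num.max u v by rewrite ge_min le_max lexx !orbT.
have h1 : cn (cint (fun t => g (t +i* c)) a b) <= 2 * M * `|b - a|.
  by apply: cint_bound => //; [exact: ccont_h|move=> x hx; exact: hM].
have h2 : cn (cint (fun t => g (t +i* d)) a b) <= 2 * M * `|b - a|.
  by apply: cint_bound => //; [exact: ccont_h|move=> x hx; exact: hM].
have h3 : cn (cint (fun t => g (b +i* t)) c d) <= 2 * M * `|d - c|.
  by apply: cint_bound => //; [exact: ccont_v|move=> x hx; exact: hM].
have h4 : cn (cint (fun t => g (a +i* t)) c d) <= 2 * M * `|d - c|.
  by apply: cint_bound => //; [exact: ccont_v|move=> x hx; exact: hM].
apply: le_trans (cnD _ _) _; rewrite cnM [cn 'i](_ : _ = 1); last first.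
  by rewrite /= expr0n expr1n add0r sqrtr1.
rewrite mul1r; have := lerD (le_trans (cnB _ _) (lerD h1 h2)) (le_trans (cnB _ _) (lerD h3 h4)).
by move=> h; apply: (le_trans h); arith.
Qed.
End Rectangles.

(** * Goursat's lemma for rectangles *)

Section Goursat.
Variable R : realType.
Notation C := R[i].

Definition cdif (g : C -> C) (w l : C) := forall e : R, 0 < e ->
  exists2 d : R, 0 < d & forall v, cn (v - w) < d ->
    cn (g v - g w - l * (v - w)) <= e * cn (v - w).

Lemma cxE (x y : R) : x +i* y = x%:C + 'i * y%:C.
Proof. exact: (complexE (x +i* y)). Qed.

Lemma rectint_affine (k l : C) (a b c d : R) : -2 < a -> -2 < b -> -2 < c -> -2 < d ->
  rectint (fun w => k + l * w) a b c d = 0.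
Proof.
move=> a2 b2 c2 d2.
have Hh y u v : -2 < u -> -2 < v -> cint (fun t => k + l * (t +i* y)) u v =
    l * ((v ^+ 2 - u ^+ 2) / 2)%:C + (k + l * 'i * y%:C) * (v - u)%:C.
  move=> u2 v2; rewrite -cint_id// -[X in _ + _ * X]mul1r -[(v-u)%:C]mul1r.
  rewrite mulrA mulr1 -(cint_cst 1)// -cint_lin//; [|exact: ccont_id|exact: ccont_cst].
  congr cint; apply/funext => t; rewrite (cxE t y); ring.
have Hv x u v : -2 < u -> -2 < v -> cint (fun t => k + l * (x +i* t)) u v =
    l * 'i * ((v ^+ 2 - u ^+ 2) / 2)%:C + (k + l * x%:C) * (v - u)%:C.
  move=> u2 v2; rewrite -cint_id// -[(v-u)%:C]mul1r.
  rewrite -(cint_cst 1)// -cint_lin//; [|exact: ccont_id|exact: ccont_cst].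
  congr cint; apply/funext => t; rewrite (cxE x t); ring.
rewrite /rectint !Hh// !Hv// !(rmorphB, rmorphM) /=.
have i2 : ('i : C) * 'i = -1 by rewrite -expr2 sqr_i.
ring: i2.
Qed.

Variable g : C -> C.
Hypothesis cg : forall w, ctn g w.

Lemma rectint_sub_affine (k l : C) (a b c d : R) :
  -2 < a -> -2 < b -> -2 < c -> -2 < d ->
  rectint (fun w => g w - (k + l * w)) a b c d = rectint g a b c d.
Proof.
move=> a2 b2 c2 d2.
rewrite -[RHS]subr0 -(rectint_affine k l a2 b2 c2 d2).
have ca (p : R -> C) : ccont p -> ccont (fun t => k + l * p t).
  move=> cp; have := ccont_lin k l (ccont_cst 1) cp.
  by congr ccont; apply/funext => t; rewrite mulr1.
have cih (y : R) : ccont (fun t => t +i* y).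
  by split=> x; [exact: cvg_id|exact: cvg_cst].
have civ (y : R) : ccont (fun t => y +i* t).
  by split=> x; [exact: cvg_cst|exact: cvg_id].
have H (p q : R -> C) u v : -2 < u -> -2 < v -> ccont p -> ccont q ->
    cint (fun t => p t - q t) u v = cint p u v - cint q u v.
  move=> u2 v2 cp cq; rewrite -[cint p u v]mul1r -mulN1r -cint_lin//.
  by congr cint; apply/funext => t; rewrite mul1r mulN1r.
rewrite /rectint !H//; try exact: ccont_h; try exact: ccont_v; try exact: ca.
ring.
Qed.

(** Bisection with the claim that the integral is at most [e s^2], a bound that four quarters of
    side [s / 2] hand on exactly. Near a point the affine approximation integrates to zero, so only
    the differentiability error is left. *)
Lemma goursat (a b c d : R) : -2 < a -> a <= b -> -2 < c -> c <= d ->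
  (forall x y, a <= x <= b -> c <= y <= d -> exists l, cdif g (x +i* y) l) ->
  rectint g a b c d = 0.
Proof.
move=> a2 ab c2 cd hg.
have [/eqP ->|anb] := boolP (a == b).
  by rewrite /rectint !cint_same !subrr mulr0 addr0.
have s0 : 0 < b - a by rewrite subr_gt0 lt_neqAle anb.
pose k := (d - c) / (b - a).
have k0 : 0 <= k by rewrite divr_ge0// ?subr_ge0// ltW.
have bE : a + (b - a) = b by rewrite addrC subrK.
have dE : c + k * (b - a) = d by rewrite /k divfK ?gt_eqF//; arith.
suff H e : 0 < e -> cn (rectint g a b c d) <= e * (b - a) ^+ 2.
  apply/eqP; rewrite -cn_eq0 eq_le cn_ge0 andbT leNgt; apply/negP => I0.
  have s20 : 0 < (b - a) ^+ 2 by rewrite exprn_gt0.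
  have := H (cn (rectint g a b c d) / (2 * (b - a) ^+ 2)).
  rewrite divr_gt0// ?mulr_gt0// => /(_ isT).
  have -> (I S : R) : 0 < S -> I / (2 * S) * S = I / 2.
    by move=> S0; field; rewrite gt_eqF.
  by arith.
  by [].
move=> e0.
pose P (a' c' s : R) := a <= a' -> a' + s <= b -> c <= c' -> c' + k * s <= d ->
   cn (rectint g a' (a' + s) c' (c' + k * s)) <= e * s ^+ 2.
suff : P a c (b - a) by rewrite /P bE dE; apply.
apply: (bisection k0) => [a' c' s s0' P1 P2 P3 P4 ha hb hc hd||].
- set m := a' + s / 2; set n := c' + k * (s / 2).
  have ms : m + s / 2 = a' + s by rewrite /m; arith.
  have ns : n + k * (s / 2) = c' + k * s by rewrite /n -addrA -mulrDr; congr (_ + k * _); arith.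
  have ks0 : 0 <= k * (s / 2) by rewrite mulr_ge0// divr_ge0.
  rewrite -ms -ns -(rectint_addh _ _ m) -(rectint_addv _ a' m _ n) -(rectint_addv _ m _ _ n).
  have h1 : cn (rectint g a' m c' n) <= e * (s / 2) ^+ 2 by apply: P1; rewrite -/m -/n; clear - ha hb hc hd ms ns ks0 s0'; lra.
  have h2 : cn (rectint g m (m + s / 2) c' n) <= e * (s / 2) ^+ 2.
    by apply: P2; rewrite -/m -/n; clear - ha hb hc hd ms ns ks0 s0'; lra.
  have h3 : cn (rectint g a' m n (n + k * (s / 2))) <= e * (s / 2) ^+ 2.
    by apply: P3; rewrite -/m -/n; clear - ha hb hc hd ms ns ks0 s0'; lra.
  have h4 : cn (rectint g m (m + s / 2) n (n + k * (s / 2))) <= e * (s / 2) ^+ 2.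
    by apply: P4; rewrite -/m -/n; clear - ha hb hc hd ms ns ks0 s0'; lra.
  apply: le_trans (le_trans (cnD _ _) (lerD (le_trans (cnD _ _) (lerD h1 h3))
     (le_trans (cnD _ _) (lerD h2 h4)))) _.
  by rewrite exprMn; clear - e0; lra.
- exact: ltW.
move=> x y; rewrite bE dE => hx hy.
have [l hl] := hg x y hx hy.
(* The error is at most [(e / K) s (1 + k)] on a rectangle whose two sides add up to [s (1 + k)];
   [rectint_bound] then gives [4 (e / K) s^2 (1 + k)^2], half of what is allowed. *)
pose K := 8 * (1 + k) ^+ 2.
have K0 : 0 < K by rewrite mulr_gt0// exprn_gt0//; clear - k0; lra.
have [dl dl0 hdl] := hl (e / K) (divr_gt0 e0 K0).
exists (dl / (2 * (1 + k))); first by rewrite divr_gt0// mulr_gt0//; clear - k0; lra.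
move=> a' c' s /andP[s0' sd] /andP[ax xa] /andP[cy yc] aa ab' cc cd' _ _ _ _.
have ks0 : 0 <= k * s by rewrite mulr_ge0.
rewrite -(rectint_sub_affine (g (x +i* y) - l * (x +i* y)) l); [|(clear - a2 aa s0' c2 cc ks0; lra)..].
have sd' : s * (2 * (1 + k)) < dl by rewrite -ltr_pdivlMr// mulr_gt0//; clear - k0; lra.
have := @rectint_bound R (fun w => g w - (g (x +i* y) - l * (x +i* y) + l * w)) _
  a' (a' + s) c' (c' + k * s) (e / K * (s * (1 + k))).
move=> H; apply: le_trans (H _ _ _ _ _ _) _; [|clear - a2 aa s0' c2 cc ks0; lra|clear - a2 aa s0' c2 cc ks0; lra|clear - a2 aa s0' c2 cc ks0; lra|clear - a2 aa s0' c2 cc ks0; lra| |].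
- move=> w ep ep0; have [d1 d10 h1] := cg w (divr_gt0 ep0 (ltr0n R 2)).
  have L0 : 0 < ep / (2 * (cn l + 1)).
    by rewrite divr_gt0// mulr_gt0//; have := cn_ge0 l; clear - l; lra.
  exists (Num.min d1 (ep / (2 * (cn l + 1)))); first by rewrite lt_min d10.
  move=> v; rewrite lt_min => /andP[v1 v2].
  rewrite (_ : _ - _ - _ = (g v - g w) - l * (v - w)); last by ring.
  apply: le_lt_trans (cnB _ _) _; rewrite cnM.
  have := h1 _ v1; suff : cn l * cn (v - w) <= ep / 2 by clear - l; lra.
  move: v2; rewrite ltr_pdivlMr; last by rewrite mulr_gt0//; have := cn_ge0 l; clear - l; lra.
  by have := cn_ge0 l; have := cn_ge0 (v - w); clear - l; nra.
- have as' : a' <= a' + s by rewrite lerDl.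
  have cs' : c' <= c' + k * s by rewrite lerDl.
  move=> u v; rewrite (min_idPl as') (max_idPr as') (min_idPl cs') (max_idPr cs').
  move=> hu hv.
  have uvb : cn (u +i* v - x +i* y : C) <= s * (1 + k).
    apply: le_trans (cn_le_ReIm _) _ => /=.
    have h1 : `|u - x| <= s by rewrite ler_norml; clear - hu ax xa; lra.
    have h2 : `|v - y| <= k * s by rewrite ler_norml; clear - hv cy yc; lra.
    by clear - h1 h2; lra.
  rewrite (_ : _ - _ = g (u +i* v) - g (x +i* y) - l * (u +i* v - x +i* y)); last by ring.
  apply: le_trans (hdl _ _) _; first by clear - uvb sd' dl0; lra.
  by rewrite ler_wpM2l// divr_ge0// ltW.
- have -> : a' + s - a' = s by ring.
  have -> : c' + k * s - c' = k * s by ring.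
  rewrite !ger0_norm//.
  rewrite (_ : 4 * _ * _ = e * s ^+ 2 * ((4 * (1 + k) ^+ 2) / K)); last by ring.
  have es0 : 0 <= e * s ^+ 2 by rewrite mulr_ge0 ?sqr_ge0// ltW.
  rewrite ler_piMr// ler_pdivrMr// /K mul1r.
  by have := sqr_ge0 (1 + k); clear - k0; lra.
Qed.
End Goursat.

Section CircleSums.
Variable R : realType.
Notation C := R[i].

(** Uniform continuity on a square, by bisection. Only [w] is confined to the square; [v] may leave
    it. *)
Lemma unif_ctn (g : C -> C) : (forall w, ctn g w) -> forall e : R, 0 < e ->
  exists2 d : R, 0 < d & forall w v : C, `|rp w| <= 1 -> `|ip w| <= 1 ->
     cn (v - w) < d -> cn (g v - g w) < e.
Proof.
move=> cg e e0.
pose P (a c s : R) := exists2 d : R, 0 < d & forall w v : C, a <= rp w <= a + s ->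
  c <= ip w <= c + 1 * s -> cn (v - w) < d -> cn (g v - g w) < e.
have : P (-1) (-1) 2.
  apply: (@bisection _ P 1) => //.
    move=> a c s s0 [d1 d10 h1] [d2 d20 h2] [d3 d30 h3] [d4 d40 h4].
    exists (Num.min (Num.min d1 d2) (Num.min d3 d4)).
      by rewrite !lt_min d10 d20 d30 d40.
    move=> w v hx hy; rewrite !lt_min => /andP[/andP[v1 v2] /andP[v3 v4]].
    case/orP: (le_total (rp w) (a + s / 2)) => hw;
      case/orP: (le_total (ip w) (c + 1 * (s / 2))) => hi.
    - by apply: h1 v1; arith.
    - by apply: h3 v3; arith.
    - by apply: h2 v2; arith.
    - by apply: h4 v4; arith.
  move=> x y _ _; have [d d0 hd] := cg (x +i* y) _ (divr_gt0 e0 (ltr0n R 2)).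
  exists (d / 4); first by arith.
  move=> a c s /andP[s0 sd] /andP[ax xa] /andP[cy yc] _ _ _ _.
  exists (d / 2); first by arith.
  move=> w v hx hy vw.
  have wxy : cn (w - x +i* y) < d / 2.
    apply: le_lt_trans (cn_le_ReIm _) _; rewrite rpB ipB /=.
    have h1 : `|rp w - x| <= s by rewrite ler_norml; arith.
    have h2 : `|ip w - y| <= s by rewrite ler_norml; arith.
    arith.
  have h1 := hd w _; have h2 := hd v _.
  have : cn (g v - g w) <= cn (g v - g (x +i* y)) + cn (g w - g (x +i* y)).
    by rewrite (cnBC (g w)) cn_tri.
  have h3 := cn_tri w v (x +i* y).
  have {}h1 := h1 ltac:(arith); have {}h2 := h2 ltac:(arith); arith.
move=> [d d0 hd]; exists d => // w v; rewrite !ler_norml => hx hy; apply: hd; arith.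
Qed.

Definition between (a b x : R) := Num.min a b <= x <= Num.max a b.

Lemma betweenP a b x : between a b x <-> (a <= x <= b) \/ (b <= x <= a).
Proof.
rewrite /between ge_min le_max; split.
  by case: (leP a b) => ab /andP[/orP[h1|h1] /orP[h2|h2]]; arith.
by case=> /andP[-> ->]; rewrite ?orbT.
Qed.

Variables (g : C -> C) (rho : R) (z0 : C).
Hypothesis rho1 : rho <= 1.
Hypothesis cg : forall w, ctn g w.
Hypothesis dg : forall w, cn w < rho -> w != z0 -> exists l, cdif g w l.

Lemma rectint_antih a b c d : rectint g b a c d = - rectint g a b c d.
Proof.
by apply/eqP; rewrite -addr_eq0 rectint_addh /rectint !cint_same !subrr mulr0 addr0.
Qed.
Lemma rectint_antiv a b c d : rectint g a b d c = - rectint g a b c d.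
Proof.
by apply/eqP; rewrite -addr_eq0 rectint_addv /rectint !cint_same subrr !subrr mulr0 addr0.
Qed.

Lemma goursat_signed a b c d : -2 < a -> -2 < b -> -2 < c -> -2 < d ->
  (forall x y, between a b x -> between c d y -> cn (x +i* y : C) < rho /\ x +i* y != z0) ->
  rectint g a b c d = 0.
Proof.
wlog ab : a b / a <= b.
  move=> H a2 b2 c2 d2 h; case: (leP a b) => [ab|/ltW ba]; first exact: H.
  rewrite rectint_antih H ?oppr0// => x y hx; apply: h.
  by apply/betweenP; move/betweenP: hx => [?|?]; [right|left].
wlog cd : c d / c <= d.
  move=> H a2 b2 c2 d2 h; case: (leP c d) => [cd|/ltW dc]; first exact: H.
  rewrite rectint_antiv H ?oppr0// => x y hx hy; apply: h => //.
  by apply/betweenP; move/betweenP: hy => [?|?]; [right|left].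
move=> a2 b2 c2 d2 h; apply: goursat => // x y hx hy.
have hx' : between a b x by apply/betweenP; left.
have hy' : between c d y by apply/betweenP; left.
by have [h1 h2] := h x y hx' hy'; exact: dg.
Qed.

Lemma cn_lt1_gtN2 (x y : R) : cn (x +i* y : C) < rho -> -2 < x /\ -2 < y.
Proof.
move=> h; have h1 : `|x| <= cn (x +i* y : C) := rp_le_cn (x +i* y).
have h2 : `|y| <= cn (x +i* y : C) := ip_le_cn (x +i* y).
have H (r : R) : r < rho -> `|x| <= r -> `|y| <= r -> -2 < x /\ -2 < y.
  by rewrite !ler_norml => h3 h4 h5; have := rho1; split; arith.
exact: (H _ h h1 h2).
Qed.

(** Cut off at the corner [z0] a similar rectangle with ratio [th]. The two remaining pieces avoid
    [z0] and contribute nothing; the small one contributes at most a constant times [th], because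
    [g] is continuous at [z0]. *)
Lemma rectint_corner (x y : R) : 
  (forall u v, between (rp z0) x u -> between (ip z0) y v -> cn (u +i* v : C) < rho) ->
  rectint g (rp z0) x (ip z0) y = 0.
Proof.
have z0E : z0 = rp z0 +i* ip z0 by case: z0.
move: (rp z0) (ip z0) z0E => x0 y0 z0E h.
have [->|xn0] := eqVneq x x0; first by rewrite /rectint !cint_same !subrr mulr0 addr0.
have [->|yn0] := eqVneq y y0; first by rewrite /rectint !cint_same !subrr mulr0 addr0.
have bl a b : between a b a by apply/betweenP; case/orP: (le_total a b); [left|right]; arith.
have br a b : between a b b by apply/betweenP; case/orP: (le_total a b); [left|right]; arith.
have [x02 y02] := cn_lt1_gtN2 (h _ _ (bl _ _) (bl _ _)).
have [x2 y2] := cn_lt1_gtN2 (h _ _ (br _ _) (br _ _)).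
have [dl dl0 hdl] := cg (x0 +i* y0) ltr01.
set M := cn (g (x0 +i* y0)) + 1.
have M0 : 0 < M by rewrite ltr_wpDl ?cn_ge0.
set L := `|x - x0| + `|y - y0|.
have L0 : 0 < L by rewrite ltr_wpDr// normr_gt0 subr_eq0.
have key th : 0 < th -> th < 1 -> th * L < dl ->
    cn (rectint g x0 x y0 y) <= 4 * M * L * th.
  move=> th0 th1 thd.
  pose x' := x0 + th * (x - x0); pose y' := y0 + th * (y - y0).
  have bx a b u : between a (a + th * (b - a)) u -> between a b u /\ `|u - a| <= th * `|b - a|.
    move=> /betweenP hu; case: (leP a b) => ab.
    - rewrite [`|b - a|]ger0_norm ?subr_ge0//.
      have k1 : 0 <= th * (b - a) by rewrite mulr_ge0// ?subr_ge0// ltW.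
      have k2 : th * (b - a) <= b - a by rewrite ler_piMl ?subr_ge0// ltW.
      have k3 : 0 <= u - a <= th * (b - a) by case: hu => hu; clear - hu k1 k2 ab; lra.
      split; first by apply/betweenP; left; clear - k1 k2 k3 ab; lra.
      by rewrite ger0_norm; clear - k1 k2 k3 ab; lra.
    - rewrite [`|b - a|]ltr0_norm ?subr_lt0// opprB.
      have k1 : 0 <= th * (a - b) by rewrite mulr_ge0// ?subr_ge0// ltW.
      have k2 : th * (a - b) <= a - b by rewrite ler_piMl ?subr_ge0// ltW.
      have k3 : 0 <= a - u <= th * (a - b) by case: hu => hu; clear - hu k1 k2 ab; lra.
      split; first by apply/betweenP; right; clear - k1 k2 k3 ab; lra.
      by rewrite distrC ger0_norm; clear - k1 k2 k3 ab; lra.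
  have bx' a b u : a != b -> between (a + th * (b - a)) b u -> between a b u /\ u != a.
    move=> anb /betweenP hu; case: (ltgtP a b) anb => // ab _.
    - have k1 : 0 < th * (b - a) by rewrite mulr_gt0// subr_gt0.
      have k2 : th * (b - a) < b - a by rewrite gtr_pMl// subr_gt0.
      have k3 : a < u <= b by case: hu => hu; clear - hu k1 k2 ab; lra.
      split; first by apply/betweenP; left; clear - k1 k2 k3 ab; lra.
      by rewrite gt_eqF//; clear - k1 k2 k3 ab; lra.
    - have k1 : 0 < th * (a - b) by rewrite mulr_gt0// subr_gt0.
      have k2 : th * (a - b) < a - b by rewrite gtr_pMl// subr_gt0.
      have k3 : b <= u < a by case: hu => hu; clear - hu k1 k2 ab; lra.
      split; first by apply/betweenP; right; clear - k1 k2 k3 ab; lra.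
      by rewrite lt_eqF//; clear - k1 k2 k3 ab; lra.
  have [bx1 _] := bx x0 x x' (br _ _); have [by1 _] := bx y0 y y' (br _ _).
  have [x'2 y'2] := cn_lt1_gtN2 (h _ _ bx1 by1).
  rewrite -(rectint_addh _ _ x') -(rectint_addv _ x0 x' _ y').
  have -> : rectint g x0 x' y' y = 0.
    apply: goursat_signed => // u v hu hv.
    have [hu1 _] := bx _ _ _ hu; have [|hv1 hv2] := bx' y0 y v _ hv; first by rewrite eq_sym.
    split; first exact: h.
    by apply/eqP => e; case/eqP: hv2; move: e; rewrite z0E; case.
  have -> : rectint g x' x y0 y = 0.
    apply: goursat_signed => // u v hu hv.
    have [|hu1 hu2] := bx' x0 x u _ hu; first by rewrite eq_sym.
    by split; [exact: h|]; apply/eqP => e; case/eqP: hu2; move: e; rewrite z0E; case.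
  rewrite !addr0; apply: le_trans (rectint_bound (M := M) cg _ _ _ _ _) _ => //.
    move=> u v /bx[_ hu] /bx[_ hv].
    have : cn (u +i* v - x0 +i* y0 : C) < dl.
      apply: le_lt_trans (cn_le_ReIm _) _ => /=; apply: le_lt_trans thd.
      by rewrite mulrDr lerD.
    move/hdl => h3; rewrite -[g _](subrK (g (x0 +i* y0))).
    by apply: le_trans (cnD _ _) _; rewrite addrC lerD2l ltW.
  rewrite /x' /y' !(addrAC _ _ (- _)) !subrr !add0r !normrM (gtr0_norm th0) -mulrDr.
  by rewrite -/L; arith.
apply/eqP; rewrite -cn_eq0 eq_le cn_ge0 andbT leNgt; apply/negP => I0.
set I := cn _ in I0 key.
pose th := Num.min (2^-1) (Num.min (dl / (2 * L)) (I / (8 * M * L))).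
have p1 : 0 < 2 * L by rewrite mulr_gt0.
have p2 : 0 < 8 * M * L by rewrite !mulr_gt0.
have th0 : 0 < th by rewrite !lt_min (divr_gt0 dl0 p1) (divr_gt0 I0 p2) invr_gt0 ltr0n.
have t1 : th <= 2^-1 by rewrite ge_min lexx.
have t2 : th * (2 * L) <= dl by rewrite -ler_pdivlMr// !ge_min lexx orbT.
have t3 : th * (8 * M * L) <= I by rewrite -ler_pdivlMr// !ge_min lexx !orbT.
have th1 : th < 1 by move: t1; rewrite (_ : 2^-1 = 1 / 2); [clear; lra|rewrite mul1r].
have tL : th * L < dl by clear - t2 dl0; lra.
by have := key th th0 th1 tL; clear - t3 I0; lra.
Qed.
End CircleSums.

Section PuncturedPrimitive.
Variable R : realType.
Notation C := R[i].
Variables (g : C -> C) (rho : R) (z0 : C).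
Hypothesis rho1 : rho <= 1.
Hypothesis cg : forall w, ctn g w.
Hypothesis dg : forall w, cn w < rho -> w != z0 -> exists l, cdif g w l.

Lemma between_sub (a b c d x : R) : between a b c -> between a b d -> between c d x ->
  between a b x.
Proof. by move=> /betweenP h1 /betweenP h2 /betweenP h3; apply/betweenP; arith. Qed.
Lemma between_l (a b : R) : between a b a.
Proof. by apply/betweenP; case/orP: (le_total a b); [left|right]; arith. Qed.
Lemma between_r (a b : R) : between a b b.
Proof. by apply/betweenP; case/orP: (le_total a b); [left|right]; arith. Qed.

(** If the exceptional point lies in the rectangle, it cuts it into four rectangles having that
    point as a corner. *)
Lemma goursat_punctured (a b c d : R) :
  (forall x y, between a b x -> between c d y -> cn (x +i* y : C) < rho) ->
  rectint g a b c d = 0.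
Proof.
move=> h.
have [a2 c2] := cn_lt1_gtN2 rho1 (h _ _ (between_l _ _) (between_l _ _)).
have [b2 d2] := cn_lt1_gtN2 rho1 (h _ _ (between_r _ _) (between_r _ _)).
have [/andP[zx zy]|nz] := boolP (between a b (rp z0) && between c d (ip z0)).
  have corner x y : between a b x -> between c d y -> rectint g (rp z0) x (ip z0) y = 0.
    move=> hx hy; apply: (rectint_corner rho1 cg dg) => u v hu hv.
    by apply: h; [exact: between_sub hu|exact: between_sub hv].
  rewrite -(rectint_addh _ a (rp z0)) -!(rectint_addv _ _ _ c (ip z0) d).
  rewrite (rectint_antih _ (rp z0) a) (rectint_antih _ (rp z0) a).
  rewrite (rectint_antiv _ _ _ (ip z0) c) (rectint_antiv _ _ _ (ip z0) c).
  by rewrite !corner ?oppr0 ?addr0//; (exact: between_l || exact: between_r).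
apply: (@goursat_signed _ g rho z0) => // x y hx hy; split; first exact: h.
by apply: contra nz => /eqP<-; apply/andP.
Qed.

(** Integral from 0 along a horizontal and then a vertical segment; the modulus along such a path
    never exceeds that of its endpoint. *)
Definition primz (x y : R) : C := cint (fun t => g (t +i* 0)) 0 x + 'i * cint (fun t => g (x +i* t)) 0 y.

Lemma primz_path (x y x' y' : R) :
  (forall u v, between x x' u -> between 0 y v -> cn (u +i* v : C) < rho) ->
  primz x' y' - primz x y =
    cint (fun t => g (t +i* y)) x x' + 'i * cint (fun t => g (x' +i* t)) y y'.
Proof.
move=> h; have := goursat_punctured h; rewrite /rectint /primz.
rewrite -(cint_add (fun t => g (t +i* 0)) 0 x x') -(cint_add (fun t => g (x' +i* t)) 0 y y').
set X1 := cint _ _ _; set X2 := cint _ _ _; set X3 := cint _ _ _; set X4 := cint _ _ _.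
set X5 := cint _ _ _; set X6 := cint _ _ _ => /eqP; rewrite addr_eq0 => /eqP e.
have -> : X1 = X2 - 'i * (X3 - X4) by rewrite -[X1](subrK X2) e; ring.
ring.
Qed.

Lemma ccont_sub_cst (p : R -> C) k : ccont p -> ccont (fun t => p t - k).
Proof.
move=> cp; have := ccont_lin 1 (- k) cp (ccont_cst 1); congr ccont.
by apply/funext => t; rewrite mul1r mulr1.
Qed.

Lemma cint_sub_cst (p : R -> C) k a b : ccont p -> -2 < a -> -2 < b ->
  cint p a b = cint (fun t => p t - k) a b + k * (b - a)%:C.
Proof.
move=> cp a2 b2; rewrite -cint_cst//.
rewrite -[cint (fun t => _ - _) a b]mul1r -[cint (fun=> k) a b]mul1r.
rewrite -cint_lin//; [|exact: ccont_sub_cst|exact: ccont_cst].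
by congr cint; apply/funext => t; ring.
Qed.

(** Moving the endpoint horizontally and then vertically changes the primitive by the integral along
    that path, because the rectangle closing the two paths lies in the disc. On this path the
    integrand differs from [g w] by at most [e]. *)
Lemma primz_step (w w' : C) (e d : R) : 0 <= e ->
  cn w < rho -> cn (w' - w) < rho - cn w -> cn (w' - w) < d ->
  (forall v, cn (v - w) < 2 * d -> cn (g v - g w) <= e) ->
  cn (primz (rp w') (ip w') - primz (rp w) (ip w) - g w * (w' - w)) <= 4 * e * cn (w' - w).
Proof.
move=> e0 wr ww wd hd.
set r := cn (w' - w) in ww wd *.
have r1 : `|rp w' - rp w| <= r by rewrite -rpB; exact: rp_le_cn.
have r2 : `|ip w' - ip w| <= r by rewrite -ipB; exact: ip_le_cn.
have bt (a b t : R) : between a b t -> `|t - a| <= `|b - a|.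
  move=> /betweenP; case: (leP a b) => ab ht.
    by rewrite (@ger0_norm _ (b - a)) ?ger0_norm; arith.
  by rewrite (@ltr0_norm _ (b - a)) ?(@ler0_norm _ (t - a)); arith.
have hull u v : between (rp w) (rp w') u -> between 0 (ip w) v -> cn (u +i* v : C) < rho.
  move=> /bt hu /bt; rewrite !subr0 => hv.
  have : cn (u +i* v : C) <= cn (u +i* (ip w) : C).
    rewrite /= ler_wsqrtr// lerD2l -[v ^+ 2]real_normK ?num_real//.
    by rewrite -[ip w ^+ 2]real_normK ?num_real// lerXn2r ?nnegrE.
  have : cn (u +i* ip w : C) <= cn w + `|u - rp w|.
    rewrite -cnR (_ : u +i* ip w = w + (u - rp w)%:C); first exact: cnD.
    by apply: cxP; rewrite ?rpD ?ipD /=; ring.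
  have : `|u - rp w| <= r by apply: le_trans r1.
  by move=> h1 h2 h3; apply: le_lt_trans h3 _; apply: le_lt_trans h2 _; rewrite -ltrBrDl; apply: le_lt_trans ww.
have [x2 y2] : -2 < rp w /\ -2 < ip w by apply: (cn_lt1_gtN2 rho1); case: (w) wr.
have wr' : cn w' < rho.
  rewrite -(subrK w w'); apply: le_lt_trans (cnD _ _) _; rewrite -/r; arith.
have [x2' y2'] : -2 < rp w' /\ -2 < ip w' by apply: (cn_lt1_gtN2 rho1); case: (w') wr'.
rewrite primz_path//.
have -> : w' - w = (rp w' - rp w)%:C + 'i * (ip w' - ip w)%:C.
  by apply: cxP; rewrite ?rpB ?ipB ?rpD ?ipD ?rpM ?ipM /=; ring.
have -> : cint (fun t => g (t +i* ip w)) (rp w) (rp w') =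
   cint (fun t => g (t +i* ip w) - g w) (rp w) (rp w') + g w * (rp w' - rp w)%:C.
  by apply: cint_sub_cst => //; exact: ccont_h.
have -> : cint (fun t => g (rp w' +i* t)) (ip w) (ip w') =
   cint (fun t => g (rp w' +i* t) - g w) (ip w) (ip w') + g w * (ip w' - ip w)%:C.
  by apply: cint_sub_cst => //; exact: ccont_v.
set I1 := cint _ _ _; set I2 := cint _ _ _.
have h1 : cn I1 <= 2 * e * `|rp w' - rp w|.
  apply: cint_bound => //; first exact/ccont_sub_cst/ccont_h.
  move=> t /bt ht; apply: hd; apply: le_lt_trans (cn_le_ReIm _) _; rewrite rpB ipB /= subrr normr0 addr0.
  have := cn_ge0 (w' - w); rewrite -/r; arith.
have h2 : cn I2 <= 2 * e * `|ip w' - ip w|.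
  apply: cint_bound => //; first exact/ccont_sub_cst/ccont_v.
  move=> t /bt ht; apply: hd; apply: le_lt_trans (cn_le_ReIm _) _; rewrite rpB ipB /=.
  by have := cn_ge0 (w' - w); rewrite -/r; arith.
rewrite (_ : _ - _ = I1 + 'i * I2); last by ring.
apply: le_trans (cnD _ _) _; rewrite cnM [cn 'i](_ : _ = 1) ?mul1r; last first.
  by rewrite /= expr0n expr1n add0r sqrtr1.
have : 2 * e * `|rp w' - rp w| <= 2 * e * r by rewrite ler_wpM2l// mulr_ge0.
have : 2 * e * `|ip w' - ip w| <= 2 * e * r by rewrite ler_wpM2l// mulr_ge0.
by arith.
Qed.

(** The points [z_j = r om^j] satisfy [z_(j+1) - z_j = (om - 1) z_j], so the sum times [om - 1] is a
    Riemann sum for the closed contour integral. It is compared with the telescoping differences of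
    the primitive, whose total is zero since [om^N = 1], and the common factor [cn (om - 1)] is
    divided out. *)
Lemma circle_sum (r e : R) : 0 < r -> r < rho -> 0 < e ->
  exists2 d : R, 0 < d & forall N (om : C), om ^+ N = 1 -> om != 1 -> cn om = 1 ->
    cn (om - 1) < d ->
    cn (\sum_(j < N) g (r%:C * om ^+ j) * (r%:C * om ^+ j)) <= e * N%:R.
Proof.
move=> r0 rr e0.
pose e' := e / (4 * r).
have e'0 : 0 < e' by rewrite divr_gt0// mulr_gt0.
have [d d0 hd] := unif_ctn cg e'0.
pose d' := Num.min (d / 2) (rho - r).
have d'0 : 0 < d' by rewrite lt_min divr_gt0//= subr_gt0.
exists (d' / r); first by rewrite divr_gt0.
move=> N om omN om1 omn omd.
pose z (j : nat) : C := r%:C * om ^+ j.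
have zn j : cn (z j) = r by rewrite cnM cnX omn expr1n mulr1 cnR gtr0_norm.
have zS j : z j.+1 - z j = (om - 1) * z j by rewrite /z exprS; ring.
have zSn j : cn (z j.+1 - z j) = r * cn (om - 1) by rewrite zS cnM zn mulrC.
have zSd j : cn (z j.+1 - z j) < d' by rewrite zSn mulrC -ltr_pdivlMr.
pose F j := primz (rp (z j)) (ip (z j)).
have sumF : \sum_(j < N) (F j.+1 - F j) = 0.
  rewrite -(big_mkord xpredT (fun j => F j.+1 - F j)) telescope_sumr//.
  by rewrite /F /z omN expr0 subrr.
have step (j : nat) : cn (F j.+1 - F j - g (z j) * (z j.+1 - z j)) <= 4 * e' * (r * cn (om - 1)).
  rewrite -(zSn j); have := zSd j; rewrite lt_min => /andP[k1 k2].
  apply: (@primz_step _ _ _ (d / 2)) => //; rewrite ?zn// ?ltW//.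
  move=> v; rewrite mulrC divfK// => hv; apply/ltW/hd => //.
    by apply: le_trans (rp_le_cn _) _; rewrite zn; have := rho1; arith.
  by apply: le_trans (ip_le_cn _) _; rewrite zn; have := rho1; arith.
have : cn (\sum_(j < N) g (z j) * (z j.+1 - z j)) <= N%:R * (4 * e' * (r * cn (om - 1))).
  have -> : \sum_(j < N) g (z j) * (z j.+1 - z j) =
      - \sum_(j < N) (F j.+1 - F j - g (z j) * (z j.+1 - z j)).
    by rewrite sumrB sumF sub0r opprK.
  rewrite cnN; apply: le_trans (cn_sum _ _ _) _.
  apply: (@le_trans _ _ (\sum_(j < N) (4 * e' * (r * cn (om - 1))))).
    by apply: ler_sum => j _; exact: step.
  by rewrite sumr_const card_ord -[X in X <= _]mulr_natl.
under eq_bigr do rewrite zS mulrCA.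
rewrite -mulr_sumr cnM.
have om0 : 0 < cn (om - 1) by rewrite cn_gt0 subr_eq0.
rewrite (_ : N%:R * _ = cn (om - 1) * (e * N%:R)) ?ler_pM2l//.
rewrite /e'; field; exact: lt0r_neq0.
Qed.
End PuncturedPrimitive.

(** * Roots of unity *)

Section RootsOfUnity.
Variable R : realType.
Notation C := R[i].
Definition expi (t : R) : C := cos t +i* sin t.
Lemma expiD s t : expi (s + t) = expi s * expi t.
Proof. by rewrite /expi cosD sinD; apply: cxP; rewrite /= ?rpM ?ipM /=; ring. Qed.
Lemma expi0 : expi 0 = 1. Proof. by rewrite /expi cos0 sin0. Qed.
Lemma expiX t n : expi t ^+ n = expi (t *+ n).
Proof. by elim: n => [|n IH]; rewrite ?expr0 ?mulr0n ?expi0// exprS mulrS expiD IH. Qed.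
Lemma cn_expi t : cn (expi t) = 1.
Proof. by rewrite /= cos2Dsin2 sqrtr1. Qed.

Definition rootu (N : nat) : C := expi (2 * pi / N%:R).
Lemma cn_rootu N : cn (rootu N) = 1. Proof. exact: cn_expi. Qed.
Lemma rootuX N : (0 < N)%N -> rootu N ^+ N = 1.
Proof.
move=> N0; rewrite expiX -[_ *+ N]mulr_natr divfK ?pnatr_eq0 -?lt0n//.
by rewrite /expi mulr_natl cos2pi sin2pi.
Qed.
Lemma rootu_prim N k : (0 < k < N)%N -> rootu N ^+ k != 1.
Proof.
move=> /andP[k0 kN]; have N0 : (0 < N)%N by exact: leq_trans kN.
rewrite expiX; set t := (2 * pi / N%:R) *+ k.
have tE : t = 2 * pi * (k%:R / N%:R) by rewrite /t -[_ *+ k]mulr_natr -!mulrA [N%:R^-1 * _]mulrC.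
have q0 : 0 < k%:R / N%:R :> R by rewrite divr_gt0 ?ltr0n.
have q1 : k%:R / N%:R < 1 :> R by rewrite ltr_pdivrMr ?ltr0n// mul1r ltr_nat.
have pi0 := pi_gt0 R.
have t2 : 0 < t / 2 < pi by rewrite tE; narith.
have s0 : 0 < sin (t / 2) by apply: sin_gt0_pi; case/andP: t2 => -> ->.
apply/eqP => /(congr1 (@complex.Re R)) /=.
have -> : t = (t / 2) *+ 2 by rewrite -[_ *+ 2]mulr_natr divfK ?pnatr_eq0.
rewrite cos_mulr2n cos2sin2; narith.
Qed.
Lemma rootu_near1 (d : R) : 0 < d -> exists N0, forall N, (N0 <= N)%N -> cn (rootu N - 1) < d.
Proof.
move=> d0.
have d20 : 0 < d / 2 by rewrite divr_gt0.
have h1 : \forall t \near (0 : R), `|cos 0 - cos t| < d / 2.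
  by have /cvgrPdist_lt/(_ _ d20) := @continuous_cos R 0.
have h2 : \forall t \near (0 : R), `|sin 0 - sin t| < d / 2.
  by have /cvgrPdist_lt/(_ _ d20) := @continuous_sin R 0.
have [dl /= dl0 hdl] : \forall t \near (0 : R), `|cos 0 - cos t| < d / 2 /\ `|sin 0 - sin t| < d / 2.
  by near=> t; split; near: t.
have pi0 := pi_gt0 R.
exists (Num.bound (2 * pi / dl)).+1 => N hN.
have N0 : 0 < N%:R :> R by rewrite ltr0n; apply: leq_trans hN.
have tN : 0 < 2 * pi / N%:R :> R by rewrite divr_gt0// mulr_gt0.
have : 2 * pi / N%:R < dl.
  rewrite ltr_pdivrMr// [dl * _]mulrC -ltr_pdivrMr//.
  have := @archi_boundP _ (2 * pi / dl) _.
  rewrite divr_ge0 ?mulr_ge0 ?ltW//= => /(_ isT) h; apply: lt_le_trans h _.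
  by rewrite ler_nat; apply: leq_trans hN.
move=> tdl; have [] := hdl (2 * pi / N%:R); first by rewrite /= sub0r normrN gtr0_norm.
rewrite cos0 sin0 distrC sub0r normrN => c1 c2.
move=> *; apply: (le_lt_trans (cn_le_ReIm (rootu N - 1))). 
rewrite rpB ipB rp1 ip1 subr0 /=; arith.
Unshelve. all: by end_near. Qed.
End RootsOfUnity.

Section Bridge.
Variable R : realType.
Notation C := R[i].

Lemma pos_complexE (e : C) : 0 < e -> e = (rp e)%:C /\ 0 < rp e.
Proof. by case: e => a b; rewrite ltcE /= => /andP[/eqP-> h]. Qed.

Lemma posC (e : R) : (0 < e%:C :> C) = (0 < e). Proof. exact: ltcR. Qed.

Lemma nbhs_normC (V : normedModType C) (w : V) (P : set V) :
  nbhs w P <-> exists2 d : R, 0 < d & forall v, `|v - w| < d%:C -> P v.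
Proof.
split.
  move=> /nbhs_normP[d /= d0 h]; have [dE d0'] := pos_complexE d0.
  by exists (rp d) => // v hv; apply: h; rewrite /= dE distrC.
move=> [d d0 h]; apply/nbhs_normP; exists d%:C; first by rewrite /= posC.
by move=> v /=; rewrite distrC; exact: h.
Qed.

Lemma differentiable_eps (V W : normedModType C) (f : V -> W) (x : V) :
  differentiable f x -> forall e : R, 0 < e -> exists2 d : R, 0 < d &
    forall h : V, `|h| < d%:C -> `|f (h + x) - f x - 'd f x h| <= e%:C * `|h|.
Proof.
move=> /diff_locallyP[_ /eqaddoP H] e e0.
have e0' : 0 < e%:C :> C by rewrite posC.
have /nbhs_normC[d d0 hd] := H _ e0'.
exists d => // h hh; have /= := hd h; rewrite subr0 => /(_ hh).
rewrite -![(_ + _ : V -> W) h]/(_ + _) -![(- _ : V -> W) h]/(- _) /= /cst.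
by rewrite opprD addrA.
Qed.

Lemma eps_differentiable (V W : normedModType C) (f : V -> W) (x : V) (g : {linear V -> W}) :
  continuous g -> (forall e : R, 0 < e -> exists2 d : R, 0 < d &
    forall h : V, `|h| < d%:C -> `|f (h + x) - f x - g h| <= e%:C * `|h|) ->
  differentiable f x.
Proof.
move=> cg H.
have E : f \o shift x = cst (f x) + g +o_ (0 : V) id.
  apply/eqaddoP => e e0; have [eE e0'] := pos_complexE e0.
  have [d d0 hd] := H _ e0'; apply/nbhs_normC; exists d => // h; rewrite subr0 => /hd.
  rewrite -eE -![(_ + _ : V -> W) h]/(_ + _) -![(- _ : V -> W) h]/(- _) /= /cst.
  by rewrite opprD addrA.
by apply/diff_locallyP; rewrite (diff_unique cg E).
Qed.

Lemma differentiable_cdif (f : Cplx R -> Cplx R) (w : Cplx R) :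
  differentiable f w -> exists l, cdif f w l.
Proof.
move=> df; exists ('d f w 1) => e e0.
have [d d0 hd] := differentiable_eps df e0.
exists d => // v hv; have := hd (v - w); rewrite subrK cnoE ltcR => /(_ hv).
have -> : 'd f w (v - w) = ('d f w 1) * (v - w).
  have -> : 'd f w 1 * (v - w) = (v - w) *: ('d f w 1 : Cplx R) by rewrite mulrC.
  by rewrite -linearZ /= [_ *: _]mulr1.
by rewrite !cnoE -rmorphM lecR.
Qed.

Lemma cdif_local (f g : C -> C) (w l : C) (d : R) : 0 < d ->
  (forall v, cn (v - w) < d -> f v = g v) -> cdif f w l -> cdif g w l.
Proof.
move=> d0 fg hf e e0; have [d1 d10 h1] := hf e e0.
exists (Num.min d d1); first by rewrite lt_min d0.
move=> v; rewrite lt_min => /andP[v1 v2]; rewrite -!fg//; first exact: h1.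
by rewrite subrr cn0.
Qed.

Lemma cdif_ctn (f : C -> C) (w l : C) : cdif f w l -> ctn f w.
Proof.
move=> hf e e0; have [d d0 h] := hf 1 ltr01.
have l0 := cn_ge0 l.
have L0 : 0 < cn l + 1 by arith.
exists (Num.min d (e / (cn l + 1))); first by rewrite lt_min d0 divr_gt0.
move=> v; rewrite lt_min => /andP[/h hv]; rewrite ltr_pdivlMr// => hv2.
rewrite -[f v - f w](subrK (l * (v - w))); apply: le_lt_trans (cnD _ _) _.
rewrite cnM; arith.
Qed.

Lemma ctn_comp_lip (f p : C -> C) (w : C) : ctn f (p w) ->
  (forall v, cn (p v - p w) <= 2 * cn (v - w)) -> ctn (fun v => f (p v)) w.
Proof.
move=> hf hp e e0; have [d d0 hd] := hf e e0.
exists (d / 2); first by rewrite divr_gt0.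
by move=> v hv; apply: hd; apply: le_lt_trans (hp _) _; rewrite mulrC -ltr_pdivlMr.
Qed.
End Bridge.

Section RadialClamp.
Variable R : realType.
Notation C := R[i].
(** Radial retraction onto the closed disc of radius [r]. Composition with it turns a function
    continuous on a disc into one continuous on the whole plane, as the integration lemmas
    require. *)
Definition clampr (r : R) (w : C) : C := (r / Num.max r (cn w))%:C * w.

Lemma clampr_id r w : 0 < r -> cn w <= r -> clampr r w = w.
Proof. by move=> r0 wr; rewrite /clampr (max_idPl wr) divff ?gt_eqF// mul1r. Qed.

Lemma clampr_le r w : 0 < r -> cn (clampr r w) <= r.
Proof.
move=> r0; rewrite cnM cnR ger0_norm; last by rewrite divr_ge0 ?ltW// lt_max r0.
have m0 : 0 < Num.max r (cn w) by rewrite lt_max r0.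
by rewrite mulrAC ler_pdivrMr// ler_pM2l// le_max lexx orbT.
Qed.

Lemma clampr_lip r v w : 0 < r -> cn (clampr r v - clampr r w) <= 2 * cn (v - w).
Proof.
move=> r0; rewrite /clampr.
set M := Num.max r (cn v); set N := Num.max r (cn w).
have M0 : 0 < M by rewrite lt_max r0.
have N0 : 0 < N by rewrite lt_max r0.
have rM : r <= M by rewrite le_max lexx.
have vM : cn v <= M by rewrite le_max lexx orbT.
have wN : cn w <= N by rewrite le_max lexx orbT.
have MN : `|M - N| <= cn (v - w).
  have : `|cn v - cn w| <= cn (v - w).
    have h1 : cn v <= cn (v - w) + cn w by rewrite -{1}[v](subrK w) cnD.
    have h2 : cn w <= cn (v - w) + cn v by rewrite cnBC -{1}[w](subrK v) cnD.
    by rewrite ler_norml; arith.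
  apply: le_trans; rewrite /M /N.
  case: (leP r (cn v)) => h1; case: (leP r (cn w)) => h2; rewrite ?subrr ?normr0 ?normr_ge0//.
    by rewrite !ger0_norm; arith.
  by rewrite !ler0_norm; arith.
rewrite (_ : _ - _ = (r / M)%:C * (v - w) + (r / M - r / N)%:C * w); last first.
  by rewrite rmorphB /=; ring.
apply: le_trans (cnD _ _) _; rewrite !cnM !cnR.
have rM0 : 0 <= r / M by rewrite divr_ge0 ?ltW.
have h1 : `|r / M| <= 1 by rewrite (ger0_norm rM0) ler_pdivrMr ?mul1r.
have -> : r / M - r / N = (r / M) * ((N - M) / N) by field; rewrite !gt_eqF.
rewrite (normrM (r / M)) (normrM (N - M)) (normfV N) (gtr0_norm N0) (distrC N).
have h2 : `|M - N| / N * cn w <= cn (v - w).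
  rewrite mulrAC ler_pdivrMr//; apply: ler_pM => //; exact: cn_ge0.
have h3 : 0 <= `|M - N| / N * cn w by rewrite !mulr_ge0 ?cn_ge0// invr_ge0 ltW.
have := cn_ge0 (v - w); narith.
Qed.
End RadialClamp.

Section ComplexLimits.
Variable R : realType.
Notation C := R[i].
Implicit Types (u v : nat -> C) (l k : C).

Definition clim u l := forall e : R, 0 < e ->
  exists N0 : nat, forall N, (N0 <= N)%N -> cn (u N - l) < e.

Lemma clim_cst l : clim (fun=> l) l.
Proof. by move=> e e0; exists 0%N => N _; rewrite subrr cn0. Qed.

Lemma climD u v l k : clim u l -> clim v k -> clim (fun n => u n + v n) (l + k).
Proof.
move=> hu hv e e0; have e20 : 0 < e / 2 by rewrite divr_gt0.
have [N1 h1] := hu _ e20; have [N2 h2] := hv _ e20.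
exists (maxn N1 N2) => N; rewrite geq_max => /andP[n1 n2].
rewrite (_ : _ - _ = (u N - l) + (v N - k)); last by ring.
by apply: le_lt_trans (cnD _ _) _; have := h1 _ n1; have := h2 _ n2; arith.
Qed.

Lemma climZ u l k : clim u l -> clim (fun n => k * u n) (k * l).
Proof.
move=> hu e e0; have k0 := cn_ge0 k.
have [N h] := hu (e / (cn k + 1)) ltac:(by rewrite divr_gt0//; arith).
exists N => n /h hn; rewrite -mulrBr cnM.
move: hn; rewrite ltr_pdivlMr; last by arith.
by have := cn_ge0 (u n - l); narith.
Qed.

Lemma climJ u l : clim u l -> clim (fun n => (cj (u n))) (cj l).
Proof.
move=> hu e e0; have [N h] := hu e e0; exists N => n /h.
by rewrite -rmorphB /= cnJ.
Qed.

Lemma clim_sum n (u : 'I_n -> nat -> C) (l : 'I_n -> C) :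
  (forall i, clim (u i) (l i)) -> clim (fun N => \sum_(i < n) u i N) (\sum_(i < n) l i).
Proof.
elim: n u l => [|n IH] u l h.
  rewrite big_ord0 (_ : (fun _ => _) = fun=> 0); first exact: clim_cst.
  by apply/funext => N; rewrite big_ord0.
rewrite big_ord_recl (_ : (fun _ => _) = (fun N => u ord0 N + \sum_(i < n) u (lift ord0 i) N)).
  by apply: climD => //; apply: IH.
by apply/funext => N; rewrite big_ord_recl.
Qed.

Lemma clim_near u v l : (exists N0 : nat, forall N, (N0 <= N)%N -> u N = v N) ->
  clim u l -> clim v l.
Proof.
move=> [N1 h1] hu e e0; have [N h] := hu e e0.
exists (maxn N1 N) => n; rewrite geq_max => /andP[n1 n2].
by rewrite -h1// h.
Qed.

Lemma clim_rp_ge0 u l : clim u l -> (forall n, 0 <= rp (u n)) -> 0 <= rp l.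
Proof.
move=> hu h; rewrite leNgt; apply/negP => l0.
have [N hN] := hu (- rp l) ltac:(by rewrite oppr_gt0).
have := hN N (leqnn N); have := rp_le_cn (u N - l); rewrite rpB ler_norml.
have := h N; arith.
Qed.

Lemma clim_cn_le u l M : clim u l -> (forall n, cn (u n) <= M) -> cn l <= M.
Proof.
move=> hu h; rewrite leNgt; apply/negP => l0.
have [N hN] := hu (cn l - M) ltac:(by rewrite subr_gt0).
have := hN N (leqnn N); have := h N; have := cn_distD (u N) (l - u N).
have := cnD (u N) (l - u N); rewrite addrC subrK cnBC; arith.
Qed.

End ComplexLimits.

(** * Means over circles and Cauchy's formula *)

Section Cauchy.
Variable R : realType.
Notation C := R[i].

Definition circ (N : nat) (r : R) (j : nat) : C := r%:C * rootu R N ^+ j.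

(** Discrete substitute for [1 / (2 pi i)] times the contour integral of [F(w) dw / w] over the
    circle of radius [r]. *)
Definition cmean (r : R) (F : C -> C) (N : nat) : C :=
  N%:R^-1 * \sum_(j < N) F (circ N r j).

Lemma cn_circ N r j : 0 < r -> cn (circ N r j) = r.
Proof. by move=> r0; rewrite cnM cnX cn_rootu expr1n mulr1 cnR gtr0_norm. Qed.

Lemma cmean_lin r (F G : C -> C) k l N :
  cmean r (fun w => k * F w + l * G w) N = k * cmean r F N + l * cmean r G N.
Proof. by rewrite /cmean big_split /= -!mulr_sumr; ring. Qed.

Lemma eq_cmean r (F G : C -> C) N : 0 < r -> (forall w, cn w = r -> F w = G w) ->
  cmean r F N = cmean r G N.
Proof. by move=> r0 h; congr (_ * _); apply: eq_bigr => j _; apply: h; rewrite cn_circ. Qed.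

Lemma cmean_J r (F : C -> C) N : (cj (cmean r F N)) = cmean r (fun w => (cj (F w))) N.
Proof. by rewrite /cmean rmorphM fmorphV /= rmorph_nat rmorph_sum. Qed.

Lemma cmean_rp_ge0 r (F : C -> C) N : 0 < r -> (forall w, cn w = r -> 0 <= rp (F w)) ->
  0 <= rp (cmean r F N).
Proof.
move=> r0 h; rewrite /cmean -[N%:R]/(N%:R) -(rmorph_nat (real_complex R)) -fmorphV rpM mul0r subr0.
rewrite mulr_ge0 ?invr_ge0//.
elim/big_ind: _ => // [x y hx hy|j _]; first by rewrite rpD addr_ge0.
by apply: h; rewrite cn_circ.
Qed.

(** With [u = z / r], a finite geometric sum expands the kernel at the point of index [j] in the
    powers [om^(- j k)] for [k < N]; averaging over [j] leaves only [k = 0]. The value is exact for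
    each [N]. *)
Lemma cmean_kernel (r : R) (z : C) N : (0 < N)%N -> cn z < r ->
  cmean r (fun w => w / (w - z)) N = (1 - (z / r%:C) ^+ N)^-1.
Proof.
move=> N0 zr; have r0 : 0 < r by apply: le_lt_trans zr; exact: cn_ge0.
have rC0 : r%:C != 0 :> C by rewrite -cn_eq0 cnR gtr0_norm ?gt_eqF.
set u := z / r%:C; have u1 : cn u < 1.
  by rewrite cnM cnV cnR gtr0_norm// ltr_pdivrMr ?mul1r.
pose om := rootu R N.
have om0 : om != 0 by rewrite -cn_gt0 cn_rootu.
have nz (x : C) : cn x < 1 -> 1 - x != 0.
  move=> x1; apply/eqP => /subr0_eq e; move: x1; rewrite -e cn1; arith.
have uj j : cn (u * om ^- j) < 1.
  by rewrite cnM cnV cnX cn_rootu expr1n invr1 mulr1.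
have uN1 : cn (u ^+ N) < 1.
  by rewrite cnX exprn_ilt1 ?cn_ge0// -lt0n.
have E (j : nat) : circ N r j / (circ N r j - z) =
    (1 - u ^+ N)^-1 * \sum_(k < N) u ^+ k * (om ^- k) ^+ j.
  have -> : circ N r j / (circ N r j - z) = (1 - u * om ^- j)^-1.
    have cj0 : om ^+ j != 0 by rewrite expf_neq0.
    have := nz _ (uj j); rewrite /circ /u -/om.
    move: (om ^+ j) cj0 => o o0 h; move: (r%:C) rC0 h => c c0 h.
    have e1 : 1 - z / c / o = (c * o - z) / (c * o) by field; rewrite c0 o0.
    have h2 : c * o - z != 0 by apply: contra h; rewrite e1 => /eqP ->; rewrite mul0r.
    by rewrite e1 invf_div.
  apply: (mulfI (nz _ (uj j))); rewrite divff ?nz// mulrCA.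
  rewrite (_ : \sum_(k < N) _ = \sum_(k < N) (u * om ^- j) ^+ k); last first.
    apply: eq_bigr => k _; rewrite [RHS]exprMn; congr (_ * _).
    by rewrite -!exprVn -!exprM mulnC.
  rewrite -[1 - u * _]opprB mulNr -subrX1.
  have -> : (u * om ^- j) ^+ N = u ^+ N.
    by rewrite [LHS]exprMn -exprVn -exprM mulnC exprM exprVn rootuX// invr1 expr1n mulr1.
  by rewrite opprB mulVf// nz.
rewrite /cmean; under eq_bigr do rewrite E.
rewrite -mulr_sumr exchange_big /= (bigD1 (Ordinal N0))//=.
rewrite [X in _ * (_ * (_ + X))]big1 ?addr0.
  rewrite (eq_bigr (fun=> 1)) => [|i _]; last by rewrite expr0 invr1 expr1n mulr1.
  by rewrite sumr_const card_ord mulrCA -[1 *+ N]/(N%:R) mulVf ?mulr1// pnatr_eq0 -lt0n.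
move=> k; rewrite -val_eqE /= -lt0n => k0; rewrite -mulr_sumr.
suff -> : \sum_(i < N) (om ^- k) ^+ i = 0 by rewrite mulr0.
have k1 : om ^- k != 1.
  rewrite -invr1 (inj_eq invr_inj); apply: rootu_prim; by rewrite k0 /=.
apply: (mulfI (x := om ^- k - 1)); first by rewrite subr_eq0.
by rewrite -subrX1 exprVn -exprM mulnC exprM rootuX// expr1n invr1 subrr mulr0.
Qed.

Lemma clim_geom (u : C) : cn u < 1 -> clim (fun N => u ^+ N) 0.
Proof.
move=> u1 e e0.
have [N h] : exists N, cn u ^+ N < e.
  have [->|u0] := eqVneq (cn u) 0; first by exists 1%N; rewrite expr1.
  have c0 : 0 < cn u by rewrite lt_def u0 cn_ge0.
  have b1 : 1 < (cn u)^-1 by rewrite invf_gt1.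
  pose b := (cn u)^-1 - 1; have b0 : 0 < b by rewrite subr_gt0.
  exists (Num.bound (1 / (e * b))).
  have := archi_boundP (divr_ge0 ler01 (ltW (mulr_gt0 e0 b0))).
  set n := Num.bound _; rewrite ltr_pdivrMr ?mulr_gt0// => h.
  have : 1 + n%:R * b <= (1 + b) ^+ n.
    elim: n {h} => [|n IH]; first by rewrite mul0r addr0 expr0.
    rewrite exprS -natr1; have : 0 <= n%:R * b by rewrite mulr_ge0 ?ler0n ?ltW.
    by narith.
  have -> : 1 + b = (cn u)^-1 by rewrite addrC subrK.
  rewrite exprVn => h2; rewrite -[X in X < _]invrK invf_plt ?posrE ?invr_gt0 ?exprn_gt0//.
  apply: lt_le_trans h2; rewrite -[X in X < _]mulr1 ltr_pdivrMl//; narith.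
exists N => n /subnK <-; rewrite subr0 cnX exprD.
by apply: le_lt_trans h; rewrite ler_piMl ?exprn_ge0 ?cn_ge0// exprn_ile1 ?cn_ge0 ?ltW.
Qed.

Lemma climV (u : nat -> C) l : l != 0 -> clim u l -> clim (fun n => (u n)^-1) l^-1.
Proof.
move=> l0 hu e e0; have cl0 : 0 < cn l by rewrite cn_gt0.
have m0 : 0 < Num.min (cn l / 2) (e * cn l ^+ 2 / 2).
  by rewrite lt_min; apply/andP; split; rewrite divr_gt0// mulr_gt0// exprn_gt0.
have [N h] := hu _ m0.
exists N => n /h; rewrite lt_min => /andP[h1 h2].
have un : cn l / 2 < cn (u n).
  by have := cnD (u n) (l - u n); rewrite addrC subrK cnBC; arith.
have u0 : u n != 0 by rewrite -cn_gt0; arith.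
rewrite (_ : _ - _ = (l - u n) / (u n * l)); last by field; rewrite l0 u0.
rewrite cnM cnV cnM cnBC ltr_pdivrMr; last by rewrite mulr_gt0//; arith.
have u2 : 0 < cn (u n) - cn l / 2 by rewrite subr_gt0.
have := mulr_gt0 (mulr_gt0 e0 cl0) u2; arith.
Qed.

(** The mean of [f] against the kernel is [f z] times the mean of the kernel plus the mean of
    [q(w) w], with [q] the divided difference at [z]. The latter mean tends to zero because [q] is
    continuous, and differentiable except at [z]. *)
Theorem cauchy_lim (f : Cplx R -> Cplx R) (r : R) (z : C) :
  holomorphic_on (unit_disc R) f -> r < 1 -> cn z < r ->
  clim (cmean r (fun w => f w * (w / (w - z)))) (f z).
Proof.
move=> hf r1 zr; have r0 : 0 < r by apply: le_lt_trans zr; exact: cn_ge0.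
have inD (w : C) : cn w < 1 -> exists l, cdif f w l.
  by move=> w1; apply: differentiable_cdif; apply: hf; rewrite /unit_disc /= cnoE ltcR.
pose rho := (r + 1) / 2; have rr : r < rho < 1 by rewrite /rho; arith.
have /andP[rr1 rr2] := rr; have rho0 : 0 < rho by arith.
have [l hl] := inD z (lt_trans zr r1).
pose q (w : C) : C := if w == z then l else (f w - f z) / (w - z).
have qz : q z = l by rewrite /q eqxx.
have qdif (w : C) : cn w < 1 -> w != z -> exists l, cdif q w l.
  move=> w1 wz.
  have wz0 : w - z != 0 by rewrite subr_eq0.
  have [l1 hl1] : exists l, cdif (fun v => (f v - f z) * (v - z)^-1) w l.
    apply: differentiable_cdif; apply: differentiableM.
      by apply: differentiableB; [apply: hf; rewrite /unit_disc /= cnoE ltcR|exact: differentiable_cst].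
    apply: differentiableV => //; apply: differentiableB => //; exact: differentiable_cst.
  exists l1; apply: (cdif_local (d := cn (w - z))) hl1; first by rewrite cn_gt0.
  move=> v hv; rewrite /q; case: eqP => // vz.
  by move: hv; rewrite vz cnBC ltxx.
have qctn (w : C) : cn w < 1 -> ctn q w.
  move=> w1; have [->|wz] := eqVneq w z; last by have [l1 /cdif_ctn] := qdif _ w1 wz.
  move=> e e0; have [d d0 hd] := hl (e / 2) ltac:(by rewrite divr_gt0).
  exists d => // v hv; rewrite qz /q; case: eqP => [_|/eqP vz]; first by rewrite subrr cn0.
  have vz0 : v - z != 0 by rewrite subr_eq0.
  rewrite (_ : _ - l = (f v - f z - l * (v - z)) / (v - z)); last by field.
  rewrite cnM cnV ltr_pdivrMr ?cn_gt0//; apply: le_lt_trans (hd _ hv) _.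
  by rewrite ltr_pM2r ?cn_gt0//; arith.
(* Continuity is required on the whole plane, so [q] is composed with the radial retraction onto a
   disc slightly larger than the circle. *)
pose g (w : C) := q (clampr rho w).
have gq w : cn w <= rho -> g w = q w by move=> h; rewrite /g clampr_id.
have cg w : ctn g w.
  apply: (@ctn_comp_lip _ q (clampr rho)) => [|v]; last exact: clampr_lip.
  by apply: qctn; apply: le_lt_trans rr2; exact: clampr_le.
have dg w : cn w < rho -> w != z -> exists l, cdif g w l.
  move=> wr wz; have [l1 hl1] := qdif w (lt_trans wr rr2) wz.
  exists l1; apply: (cdif_local (d := rho - cn w)) hl1; first by rewrite subr_gt0.
  move=> v hv; rewrite gq//; have := cnD (v - w) w; rewrite subrK; arith.
have H0 : clim (cmean r (fun w => g w * w)) 0.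
  move=> e e0; have [d d0 hd] := circle_sum (ltW rr2) cg dg r0 rr1 (divr_gt0 e0 (ltr0n R 2)).
  have [N0 hN0] := rootu_near1 d0.
  exists (maxn N0 2) => N; rewrite geq_max => /andP[n1 n2].
  have N0' : (0 < N)%N by exact: leq_trans n2.
  rewrite subr0 cnM cnV (_ : cn N%:R = N%:R); last first.
    by rewrite -(rmorph_nat (real_complex R)) cnR ger0_norm.
  rewrite mulrC ltr_pdivrMr ?ltr0n//.
  apply: le_lt_trans (hd N (rootu R N) (rootuX _ N0') _ (cn_rootu _ _) (hN0 _ n1)) _.
    by have := @rootu_prim R N 1; rewrite expr1; apply.
  by rewrite ltr_pM2r ?ltr0n//; arith.
have H1 : clim (cmean r (fun w => w / (w - z))) 1.
  have H : clim (fun N => (1 - (z / r%:C) ^+ N)^-1) 1.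
    rewrite -[X in clim _ X]invr1; apply: climV; first exact: oner_neq0.
    rewrite -[X in clim _ X]addr0 -[X in _ + X](mulr0 (-1)).
    rewrite (_ : (fun _ => _) = (fun N => 1 + (-1) * (z / r%:C) ^+ N)); last first.
      by apply/funext => N; rewrite mulN1r.
    apply: climD; first exact: clim_cst.
    apply: climZ; apply: clim_geom.
    by rewrite cnM cnV cnR gtr0_norm// ltr_pdivrMr ?mul1r.
  apply: clim_near H; exists 1%N => N N0; exact/esym/cmean_kernel.
have := climD H0 (climZ (f z) H1); rewrite add0r mulr1.
congr clim; apply/funext => N; rewrite -[cmean r _ N]mul1r -cmean_lin.
apply: eq_cmean => // w wr.
have wz : w != z by apply/eqP => wz; move: zr; rewrite -wz wr ltxx.
have wz0 : w - z != 0 by rewrite subr_eq0.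
by rewrite gq ?wr ?ltW// /q (negPf wz); field.
Qed.
End Cauchy.

(** * Rules for complex differentiability *)

Section Combinators.
Variable R : realType.
Notation C := R[i].

Lemma differentiable_fst (x : Cplx2 R) : differentiable (fst : Cplx2 R -> Cplx R) x.
Proof. by apply: linear_differentiable => ?; exact: cvg_fst. Qed.

Lemma differentiable_snd (x : Cplx2 R) : differentiable (snd : Cplx2 R -> Cplx R) x.
Proof. by apply: linear_differentiable => ?; exact: cvg_snd. Qed.

Section Pointwise.
Variables (U V : normedModType C) (x : U).
Implicit Types f g : U -> Cplx R.

Lemma dfc (k : C) : differentiable (fun _ : U => k : Cplx R) x.
Proof. exact: differentiable_cst. Qed.
Lemma dfD f g : differentiable f x -> differentiable g x ->
  differentiable (fun y => (f y : C) + g y : Cplx R) x.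
Proof. exact: differentiableD. Qed.
Lemma dfB f g : differentiable f x -> differentiable g x ->
  differentiable (fun y => (f y : C) - g y : Cplx R) x.
Proof. exact: differentiableB. Qed.
Lemma dfM f g : differentiable f x -> differentiable g x ->
  differentiable (fun y => (f y : C) * g y : Cplx R) x.
Proof. exact: differentiableM. Qed.
Lemma dfV f : differentiable f x -> (f x : C) != 0 ->
  differentiable (fun y => (f y : C)^-1 : Cplx R) x.
Proof. by move=> df f0; exact: differentiableV. Qed.
Lemma df_div f g : differentiable f x -> differentiable g x -> (g x : C) != 0 ->
  differentiable (fun y => (f y : C) / g y : Cplx R) x.
Proof. by move=> df dg g0; exact: dfM df (dfV dg g0). Qed.
Lemma dfX f n : differentiable f x -> differentiable (fun y => (f y : C) ^+ n : Cplx R) x.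
Proof.
move=> df; elim: n => [|n IH]; first exact: dfc.
rewrite (_ : (fun y => _) = (fun y => (f y : C) * (f y : C) ^+ n : Cplx R)); first exact: dfM.
by apply/funext => y; rewrite exprS.
Qed.
Lemma dfcomp (h : U -> V) (W : normedModType C) (k : V -> W) :
  differentiable h x -> differentiable k (h x) -> differentiable (fun y => k (h y)) x.
Proof. exact: differentiable_comp. Qed.
End Pointwise.

Lemma dfid (x : Cplx R) : differentiable (fun y : Cplx R => y) x.
Proof. by []. Qed.
End Combinators.

(** * Pick's theorem and the Schwarz lemma *)

Section PickDisc.
Variable R : realType.
Notation C := R[i].

Lemma cjM (z w : C) : (cj (z * w)) = (cj z) * (cj w). Proof. exact: rmorphM. Qed.
Lemma cjD (z w : C) : (cj (z + w)) = (cj z) + (cj w). Proof. exact: rmorphD. Qed.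
Lemma cjN (z : C) : (cj (- z)) = - (cj z). Proof. exact: rmorphN. Qed.
Lemma cjV (z : C) : (cj (z^-1)) = ((cj z))^-1. Proof. exact: fmorphV. Qed.
Lemma cjR (r : R) : (cj (r%:C)) = r%:C :> C. Proof. exact: conjc_real. Qed.
Lemma cj1 : (cj (1 : C)) = 1. Proof. exact: rmorph1. Qed.
Lemma cj0 : (cj (0 : C)) = 0. Proof. exact: rmorph0. Qed.
Lemma cjnat n : (cj (n%:R : C)) = n%:R. Proof. exact: rmorph_nat. Qed.
Lemma cjK (z : C) : (cj (cj z)) = z. Proof. exact: conjcK. Qed.
Lemma mulcJ (z : C) : z * cj z = (cn z ^+ 2)%:C.
Proof. by rewrite cn_sqr; case: z => a b; apply: cxP => /=; ring. Qed.
Definition cjE := (cjM, cjD, cjN, cjV, cjR, cj1, cj0, cjnat, cjK).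

Lemma rC_neq0 (r : R) : 0 < r -> r%:C != 0 :> C.
Proof. by move=> r0; rewrite -cn_gt0 cnR normr_gt0 gt_eqF. Qed.

Lemma cauchy_lim_radius (f : Cplx R -> Cplx R) (rho r : R) (z : C) :
  (forall w : Cplx R, cn w < rho -> differentiable f w) -> r < rho -> cn z < r ->
  clim (cmean r (fun w => f w * (w / (w - z)))) (f z).
Proof.
move=> hf rr zr; have r0 : 0 < r by apply: le_lt_trans zr; exact: cn_ge0.
have p0 : 0 < rho by exact: lt_trans rr.
have pC := rC_neq0 p0.
pose g (w : Cplx R) : Cplx R := f (rho%:C * w).
have hg : holomorphic_on (unit_disc R) g.
  move=> w; rewrite /unit_disc /= cnoE ltcR => w1.
  apply: (@differentiable_comp _ _ _ _ (fun w : Cplx R => (rho%:C : C) *: w) f).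
    exact: differentiableZ.
  by apply: hf; rewrite cnM cnR gtr0_norm// gtr_pMr.
have r1 : r / rho < 1 by rewrite ltr_pdivrMr ?mul1r.
have z1 : cn (z / rho%:C) < r / rho by rewrite cnM cnV cnR gtr0_norm// ltr_pM2r ?invr_gt0.
have := cauchy_lim hg r1 z1.
rewrite [g (z / _)](_ : _ = f z); last by rewrite /g mulrC divfK.
congr clim; apply/funext => N; congr (_ * _); apply: eq_bigr => j _.
rewrite /g /circ rmorphM fmorphV /=; set o := _ ^+ j.
set c := rho%:C in pC *; set d := r%:C.
have -> : c * (d / c * o) = d * o by field.
congr (_ * _).
have dz : d * o - z != 0.
  rewrite subr_eq0; apply/eqP => e; move: zr; rewrite -e /d /o cnM cnX cn_rootu expr1n mulr1 cnR gtr0_norm//.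
  by rewrite ltxx.
rewrite (_ : d / c * o - z / c = (d * o - z) / c); last by field.
by field; rewrite pC dz.
Qed.

(** On the circle [cj v = r^2 / v], which turns the conjugated kernel into [r / (r - v cj z')],
    holomorphic on a slightly larger disc. Cauchy's formula is applied to the product of this
    function with [F]. *)
Lemma clim_kernel (F : Cplx R -> Cplx R) (z z' : C) (r : R) : holomorphic_on (unit_disc R) F ->
  0 < r -> r < 1 -> cn z < 1 -> cn z' < 1 ->
  clim (cmean r (fun v => F v * (v / (v - r%:C * z) * cj (v / (v - r%:C * z')))))
    (F (r%:C * z) / (1 - z * cj z')).
Proof.
move=> hF r0 r1 hz hz'; have rC := rC_neq0 r0.
pose B (v : Cplx R) : Cplx R := F v * (r%:C / (r%:C - v * cj z')).
(* A radius beyond [r] within which [r - v cj z'] has no zero: [r] is divided by a number strictly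
   between [cn z'] and 1. *)
pose rho := Num.min 1 (r / (cn z' + (1 - cn z') / 2)).
have zj1 : cn z' + (1 - cn z') / 2 < 1 by arith.
have zj0 : 0 < cn z' + (1 - cn z') / 2 by have := cn_ge0 z'; arith.
have rr : r < rho by rewrite lt_min r1 ltr_pdivlMr// gtr_pMr.
have den (v : C) : cn v < rho -> r%:C - v * cj z' != 0.
  rewrite lt_min => /andP[_]; rewrite ltr_pdivlMr// => h.
  rewrite subr_eq0; apply/eqP => e; have : cn (r%:C : C) = cn v * cn z' by rewrite e cnM cnJ.
  by rewrite cnR gtr0_norm// => e2; have := cn_ge0 v; narith.
have hB (v : Cplx R) : cn v < rho -> differentiable B v.
  move=> hv; have Fv : differentiable F v.
    by apply: hF; rewrite /unit_disc /= cnoE ltcR; move: hv; rewrite lt_min => /andP[].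
  exact: (dfM Fv (df_div (dfc v r%:C) (dfB (dfc v r%:C) (dfM (dfid v) (dfc v (cj z')))) (den v hv))).
have zr : cn (r%:C * z) < r by rewrite cnM cnR gtr0_norm// gtr_pMr.
have := cauchy_lim_radius hB rr zr.
have -> : B (r%:C * z) = F (r%:C * z) / (1 - z * cj z').
  rewrite /B; congr (_ * _); rewrite -mulrA -[X in X - _]mulr1 -mulrBr.
  by rewrite invfM mulrA divff// mul1r.
congr clim; apply/funext => N; apply: eq_cmean => // v vr.
rewrite /B -mulrA; congr (_ * _); rewrite mulrC; congr (_ * _).
have vv : v * cj v = r%:C ^+ 2 by rewrite mulcJ vr rmorphXn.
have v0 : v != 0 by rewrite -cn_gt0 vr.
have vE : cj v = r%:C ^+ 2 / v by rewrite -vv mulrC mulKf.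
have := den v; rewrite vr => /(_ rr) dv.
rewrite !cjE vE; move: (r%:C) (cj z') rC dv => c y rC dv.
have e1 : c ^+ 2 / v - c * y = c * (c - v * y) / v by field.
by rewrite e1; field; rewrite v0 rC dv.
Qed.

Lemma rp_mulJ_ge0 (a x : C) : 0 <= rp x -> 0 <= rp (x * (a * (cj a))).
Proof.
case: a => a b; case: x => x y /= x0; rewrite [X in _ - X](_ : _ = 0) ?subr0.
  by rewrite mulr_ge0// mulrN opprK addr_ge0// -expr2 sqr_ge0.
by ring.
Qed.

Variables (F : Cplx R -> Cplx R).
Hypothesis hF : holomorphic_on (unit_disc R) F.
Hypothesis F0 : forall z : C, cn z < 1 -> 0 <= rp (F z).

(** Each entry is a limit of means in which the kernels combine to [F v] times the squared modulus
    of [sum w_i K_i v]. The form is not Hermitian; its real part is half of the usual one with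
    [F (z i) + cj (F (z j))]. *)
Lemma pick_disc_r n (z w : 'I_n -> C) (r : R) : 0 < r -> r < 1 -> (forall i, cn (z i) < 1) ->
  0 <= rp (\sum_(i < n) \sum_(j < n) w i * (cj (w j)) * (F (r%:C * z i) / (1 - z i * (cj (z j))))).
Proof.
move=> r0 r1 hz; have rC := rC_neq0 r0.
pose K (i : 'I_n) (v : C) := v / (v - r%:C * z i).
pose T i j N := cmean r (fun v => F v * (K i v * (cj (K j v)))) N.
have hT i j : clim (T i j) (F (r%:C * z i) / (1 - z i * (cj (z j)))).
  exact: (clim_kernel hF r0 r1 (hz i) (hz j)).
have := @clim_sum R n (fun i N => \sum_(j < n) w i * (cj (w j)) * T i j N) _
  (fun i => @clim_sum R n _ _ (fun j => climZ (w i * (cj (w j))) (hT i j))).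
move=> /clim_rp_ge0; apply => N.
rewrite (_ : \sum_(i < n) _ = cmean r (fun v => F v *
    ((\sum_(i < n) w i * K i v) * (cj (\sum_(i < n) w i * K i v)))) N).
  by apply: cmean_rp_ge0 => // v vr; apply: rp_mulJ_ge0; apply: F0; rewrite vr.
rewrite /cmean; under eq_bigr do under eq_bigr do rewrite /T /cmean mulrCA mulr_sumr.
under eq_bigr do rewrite -mulr_sumr exchange_big /=.
rewrite -mulr_sumr exchange_big /=; congr (_ * _); apply: eq_bigr => k _.
rewrite rmorph_sum /= mulr_suml mulr_sumr; apply: eq_bigr => i _.
rewrite mulr_sumr mulr_sumr; apply: eq_bigr => j _.
rewrite !cjE; ring.
Qed.

Lemma pick_disc n (z w : 'I_n -> C) : (forall i, cn (z i) < 1) ->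
  0 <= rp (\sum_(i < n) \sum_(j < n) w i * (cj (w j)) * (F (z i) / (1 - z i * (cj (z j))))).
Proof.
move=> hz.
pose r (N : nat) : R := 1 - (N.+2%:R)^-1.
have rN N : 0 < r N /\ r N < 1.
  have h : 0 < (N.+2%:R)^-1 :> R by rewrite invr_gt0.
  have h2 : (N.+2%:R)^-1 < 1 :> R by rewrite invf_lt1// ltr1n.
  by rewrite /r; move: (N.+2%:R^-1) h h2 => q h h2; split; arith.
have hr : clim (fun N => (r N)%:C) (1 : C).
  move=> e e0; exists (Num.bound e^-1) => N hN.
  rewrite (_ : _ - 1 = - (N.+2%:R^-1)%:C); last first.
    by rewrite /r rmorphB rmorph1 addrAC subrr sub0r.
  rewrite cnN cnR gtr0_norm ?invr_gt0//.
  rewrite invf_plt ?posrE// ; apply: lt_le_trans (archi_boundP _) _.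
    by rewrite invr_ge0 ltW.
  by rewrite ler_nat; apply: leq_trans hN _; rewrite !leqW.
have hFz i : clim (fun N => F ((r N)%:C * z i)) (F (z i)).
  have [l /cdif_ctn cF] : exists l, cdif F (z i) l.
    by apply: differentiable_cdif; apply: hF; rewrite /unit_disc /= cnoE ltcR.
  move=> e e0; have [d d0 hd] := cF e e0.
  have := climZ (z i) hr; rewrite mulr1 => /(_ d d0)[N hN].
  by exists N => n' /hN h; apply: hd; rewrite mulrC.
have := @clim_sum R n (fun i N => \sum_(j < n) w i * (cj (w j)) * ((1 - z i * (cj (z j)))^-1 * F ((r N)%:C * z i))) _
  (fun i => @clim_sum R n _ _ (fun j => climZ (w i * (cj (w j))) (climZ _ (hFz i)))).
move=> /clim_rp_ge0 h.
rewrite (_ : \sum_(i < n) _ = \sum_(i < n) \sum_(j < n) w i * (cj (w j)) * ((1 - z i * (cj (z j)))^-1 * F (z i))); last first.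
  by apply: eq_bigr => i _; apply: eq_bigr => j _; rewrite [F _ / _]mulrC.
apply: h => N; have [r0 r1] := rN N; have := pick_disc_r w r0 r1 hz.
by congr (0 <= rp _); apply: eq_bigr => i _; apply: eq_bigr => j _; rewrite [F _ / _]mulrC.
Qed.
End PickDisc.

(** * Pick forms and the Schwarz lemma on the right half-plane *)

Section PickHalfPlane.
Variable R : realType.
Notation C := R[i].

Definition half_plane : set (Cplx R) := [set m | 0 < rp m].

Lemma hp_sum_neq0 (x y : C) : 0 < rp x -> 0 < rp y -> x + cj y != 0.
Proof.
move=> hx hy; apply/eqP => /(congr1 (@complex.Re _)); rewrite rpD rpJ /=; arith.
Qed.

Lemma hp1_neq0 (x : C) : 0 < rp x -> x + 1 != 0.
Proof. by move=> hx; have := hp_sum_neq0 hx (ltr01 : 0 < rp (1 : C)); rewrite cj1. Qed.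

Lemma hp_cayley (z : C) : cn z < 1 -> 0 < rp ((1 + z) / (1 - z)).
Proof.
move=> z1; have z2 : cn z ^+ 2 < 1 by rewrite expr_lt1// cn_ge0.
have n0 : 1 - z != 0 by apply/eqP => /subr0_eq e; move: z1; rewrite -e cn1 ltxx.
have s0 : 0 < cn (1 - z) ^+ 2 by rewrite exprn_gt0// cn_gt0.
have -> : (1 + z) / (1 - z) = ((cn (1 - z) ^+ 2)^-1)%:C * ((1 + z) * cj (1 - z)).
  have c0 : cj (1 - z) != 0 by rewrite conjc_eq0.
  by rewrite fmorphV /= -mulcJ; move: (cj _) c0 => y c0; field; rewrite n0 c0.
rewrite rpM /= mul0r subr0 mulr_gt0 ?invr_gt0//.
move: z2; rewrite cn_sqr; case: (z) => a b /=; narith.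
Qed.

Lemma cn_cayley (m : C) : 0 < rp m -> cn ((m - 1) / (m + 1)) < 1.
Proof.
move=> m0; have n0 := hp1_neq0 m0.
rewrite cnM cnV ltr_pdivrMr ?cn_gt0// mul1r -(@ltr_pXn2r _ 2) ?nnegrE ?cn_ge0//.
by rewrite !cn_sqr; case: (m) m0 => a b /= *; narith.
Qed.

Lemma cayleyK (m : C) : m + 1 != 0 -> (1 + (m - 1) / (m + 1)) / (1 - (m - 1) / (m + 1)) = m.
Proof.
move=> n0; have two : (2 : C) != 0 by rewrite pnatr_eq0.
have -> : 1 - (m - 1) / (m + 1) = 2 / (m + 1) by field.
by field; rewrite ?two ?n0.
Qed.

(** Transfer by the Cayley transform; the weights [w i / (m i + 1)] absorb the factors by which
    [1 - z_i cj z_j] differs from [m_i + cj m_j]. *)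
Lemma pick_hp (F : Cplx R -> Cplx R) n (m w : 'I_n -> C) :
  holomorphic_on half_plane F -> (forall x : C, 0 < rp x -> 0 <= rp (F x)) ->
  (forall i, 0 < rp (m i)) ->
  0 <= rp (\sum_(i < n) \sum_(j < n) w i * cj (w j) * (F (m i) / (m i + cj (m j)))).
Proof.
move=> hF F0 hm.
pose G (z : Cplx R) : Cplx R := F ((1 + z) / (1 - z)).
have hG : holomorphic_on (unit_disc R) G.
  move=> z; rewrite /unit_disc /= cnoE ltcR => z1.
  have n0 : 1 - z != 0 by apply/eqP => /subr0_eq e; move: z1; rewrite -e cn1 ltxx.
  apply: (@differentiable_comp _ _ _ _ (fun z : Cplx R => (1 + z) / (1 - z) : Cplx R) F).
    apply: differentiableM.
      by apply: differentiableD => //; exact: differentiable_cst.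
    apply: differentiableV => //; apply: differentiableB => //; exact: differentiable_cst.
  by apply: hF; exact: hp_cayley.
have G0 z : cn z < 1 -> 0 <= rp (G z) by move=> z1; apply: F0; exact: hp_cayley.
pose z i := (m i - 1) / (m i + 1).
have hz i : cn (z i) < 1 by exact: cn_cayley.
have := pick_disc hG G0 (fun i => w i / (m i + 1)) hz.
have E i j : w i / (m i + 1) * cj (w j / (m j + 1)) * (G (z i) / (1 - z i * cj (z j))) =
    (2^-1)%:C * (w i * cj (w j) * (F (m i) / (m i + cj (m j)))).
  rewrite /G /z cayleyK ?hp1_neq0// !cjE.
  have n1 := hp1_neq0 (hm i).
  have n2 : cj (m j) + 1 != 0 by apply: hp1_neq0; rewrite rpJ.
  have n3 := hp_sum_neq0 (hm i) (hm j).
  have two : (2 : C) != 0 by rewrite pnatr_eq0.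
  rewrite fmorphV /= rmorph_nat.
  move: (m i) (cj (m j)) n1 n2 n3 => x y n1 n2 n3.
  have -> : 1 - (x - 1) / (x + 1) * ((y - 1) / (y + 1)) = 2 * (x + y) / ((x + 1) * (y + 1)).
    by field; rewrite n1 n2.
  by field; rewrite ?n1 ?n2 ?n3 ?two.
under eq_bigr do under eq_bigr do rewrite E.
under eq_bigr do rewrite -mulr_sumr.
rewrite -mulr_sumr rpM /= mul0r subr0 pmulr_rge0//.
Qed.

(** The half-plane form is applied to [(1 + t g) / (1 - t g)] with weights multiplied by [1 - t g];
    added to its conjugate it becomes twice [A - t^2 B]. The factor [t < 1] keeps the denominators
    away from zero and is removed by taking it close to 1. *)
Lemma schur_pick (g : Cplx R -> Cplx R) n (m w : 'I_n -> C) :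
  holomorphic_on half_plane g -> (forall x : C, 0 < rp x -> cn (g x) <= 1) ->
  (forall i, 0 < rp (m i)) ->
  0 <= rp (\sum_(i < n) \sum_(j < n) w i * cj (w j) *
     ((1 - g (m i) * cj (g (m j))) / (m i + cj (m j)))).
Proof.
move=> hg g1 hm.
pose A : C := \sum_(i < n) \sum_(j < n) w i * cj (w j) / (m i + cj (m j)).
pose B : C := \sum_(i < n) \sum_(j < n) w i * cj (w j) * (g (m i) * cj (g (m j))) / (m i + cj (m j)).
have AB : \sum_(i < n) \sum_(j < n) w i * cj (w j) *
     ((1 - g (m i) * cj (g (m j))) / (m i + cj (m j))) = A - B.
  rewrite -sumrB; apply: eq_bigr => i _; rewrite -sumrB; apply: eq_bigr => j _; ring.
rewrite AB rpB subr_ge0.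
have key (t : R) : 0 < t -> t < 1 -> t ^+ 2 * rp B <= rp A.
  move=> t0 t1.
  have tg (x : C) : 0 < rp x -> cn (t%:C * g x) < 1.
    move=> x0; rewrite cnM cnR gtr0_norm//; have := g1 x x0; have := cn_ge0 (g x); narith.
  have tn (x : C) : 0 < rp x -> 1 - t%:C * g x != 0.
    by move=> /tg h; apply/eqP => /subr0_eq e; move: h; rewrite -e cn1 ltxx.
  pose F (x : Cplx R) : Cplx R := (1 + t%:C * g x) / (1 - t%:C * g x).
  have hF : holomorphic_on half_plane F.
    move=> x x0; have dtg : differentiable (fun x : Cplx R => t%:C * g x : Cplx R) x.
      by apply: differentiableM; [exact: differentiable_cst|exact: hg].
    apply: differentiableM.
      by apply: differentiableD => //; exact: differentiable_cst.
    apply: differentiableV; last exact: tn.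
    by apply: differentiableB => //; exact: differentiable_cst.
  have F0 x : 0 < rp x -> 0 <= rp (F x) by move=> x0; apply/ltW/hp_cayley/tg.
  have := @pick_hp F n m (fun i => w i * (1 - t%:C * g (m i))) hF F0 hm.
  set S := \sum_(i < n) _; have SE : S + cj S = 2 * (A - (t%:C) ^+ 2 * B).
    rewrite {2}/S raddf_sum /=; under [X in _ + X]eq_bigr do rewrite raddf_sum /=.
    rewrite [X in _ + X]exchange_big /= -big_split /=.
    rewrite mulr_sumr -sumrB mulr_sumr; apply: eq_bigr => i _.
    rewrite -big_split /= mulr_sumr -sumrB mulr_sumr; apply: eq_bigr => j _.
    have n1 := tn _ (hm i); have n2 := tn _ (hm j).
    have n3 := hp_sum_neq0 (hm i) (hm j).
    have n4 : 1 - t%:C * cj (g (m j)) != 0.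
      by have := n2; rewrite -conjc_eq0 !cjE.
    rewrite /F !cjE addrC; move: (g (m i)) (g (m j)) (cj (g (m j))) n1 n2 n4 => a b c n1 n2 n4.
    rewrite [cj (m j) + _]addrC; move: (m i + cj (m j)) n3 => d n3.
    by field; rewrite n1 n3 n4.
  have : rp S + rp S = 2 * (rp A - t ^+ 2 * rp B).
    move: (congr1 (@complex.Re _) SE); rewrite rpD rpJ => ->.
    by rewrite -rmorphXn; move: {AB} (A) (B) => [a1 a2] [b1 b2] /=; ring.
  arith.
rewrite leNgt; apply/negP => BA.
have := key; move: (rp A) (rp B) BA => a b ab {}key.
have n0 : 0 < `|b| + 1 by rewrite ltr_wpDl.
pose e := Num.min (2^-1) ((b - a) / (4 * (`|b| + 1))).
have e0 : 0 < e by rewrite lt_min invr_gt0 ltr0n divr_gt0 ?mulr_gt0// subr_gt0.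
have e1 : e <= 2^-1 by rewrite ge_min lexx.
have e2 : e * (4 * (`|b| + 1)) <= b - a by rewrite -ler_pdivlMr ?mulr_gt0// ge_min lexx orbT.
have {}e1 : 2 * e <= 1 by move: e1; rewrite -(@ler_pM2l _ 2)// divff// pnatr_eq0.
have := key (1 - e) ltac:(arith) ltac:(arith).
have b1 : b <= `|b| by exact: ler_norm.
have b2 : 0 <= `|b| by [].
have b3 : 0 <= (2 * e - e ^+ 2) * (`|b| - b) by rewrite mulr_ge0 ?subr_ge0//; narith.
have b4 : 0 <= e ^+ 2 * `|b| by rewrite mulr_ge0// sqr_ge0.
have b5 : 0 <= e * `|b| by rewrite mulr_ge0// ltW.
arith.
Qed.

Definition pk (g : C -> C) (x y : C) := (1 - g x * cj (g y)) / (x + cj y).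

Lemma schur_pick2 (g : Cplx R -> Cplx R) (x y u v : C) :
  holomorphic_on half_plane g -> (forall x : C, 0 < rp x -> cn (g x) <= 1) ->
  0 < rp x -> 0 < rp y ->
  0 <= rp (u * cj u * pk g x x + u * cj v * pk g x y + (v * cj u * pk g y x + v * cj v * pk g y y)).
Proof.
move=> hg g1 hx hy.
have := @schur_pick g 2 (fun i => nth 0 [:: x; y] i) (fun i => nth 0 [:: u; v] i) hg g1.
rewrite !big_ord_recl !big_ord0 /= !addr0; apply; by case=> [[|[|i]]].
Qed.

Lemma schur_pick3 (g : Cplx R -> Cplx R) (x y z u v w : C) :
  holomorphic_on half_plane g -> (forall x : C, 0 < rp x -> cn (g x) <= 1) ->
  0 < rp x -> 0 < rp y -> 0 < rp z ->
  0 <= rp (u * cj u * pk g x x + (u * cj v * pk g x y + u * cj w * pk g x z) +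
          (v * cj u * pk g y x + (v * cj v * pk g y y + v * cj w * pk g y z) +
          (w * cj u * pk g z x + (w * cj v * pk g z y + w * cj w * pk g z z)))).
Proof.
move=> hg g1 hx hy hz.
have := @schur_pick g 3 (fun i => nth 0 [:: x; y; z] i) (fun i => nth 0 [:: u; v; w] i) hg g1.
rewrite !big_ord_recl !big_ord0 /= !addr0; apply; by case=> [[|[|[|i]]]].
Qed.

(** The weight at [m0] is the one that eliminates [m0] from the two-point form, since
    [pk g m0 m0 = 1 / (2 rp m0)]; what remains is the Schwarz inequality. *)
Lemma schwarz_hp (g : Cplx R -> Cplx R) (m0 m1 : C) :
  holomorphic_on half_plane g -> (forall x : C, 0 < rp x -> cn (g x) <= 1) ->
  0 < rp m0 -> 0 < rp m1 -> g m0 = 0 -> cn (g m1) * cn (m1 + cj m0) <= cn (m1 - m0).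
Proof.
move=> hg g1 h0 h1 e0.
have := schur_pick2 (- (2 * rp m0)%:C / (m1 + cj m0)) 1 hg g1 h0 h1.
rewrite /pk e0 !cjE.
have n1 := hp_sum_neq0 h1 h0; have n2 := hp_sum_neq0 h0 h1.
have E0 : m0 + cj m0 = (2 * rp m0)%:C by case: (m0) => a b; apply: cxP => /=; ring.
have E1 : m1 + cj m1 = (2 * rp m1)%:C by case: (m1) => a b; apply: cxP => /=; ring.
have c0 : (2 * rp m0)%:C != 0 :> C by apply: rC_neq0; arith.
have c1 : (2 * rp m1)%:C != 0 :> C by apply: rC_neq0; arith.
rewrite E0 E1 mulcJ.
rewrite (_ : cj m1 + m0 = m0 + cj m1); last by rewrite addrC.
set X := _ + _ => hX.
have rc (A B P Q : R) : ((1 - A) / Q - P / B)%:C = (1 - A%:C) / Q%:C - P%:C / B%:C :> C.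
  by rewrite rmorphB rmorphM fmorphV rmorphB rmorph1 rmorphM fmorphV.
have BE : (cn (m1 + cj m0) ^+ 2)%:C = (m1 + cj m0) * (m0 + cj m1).
  by rewrite -mulcJ !cjE [cj m1 + m0]addrC.
have XE : X = ((1 - cn (g m1) ^+ 2) / (2 * rp m1) - 2 * rp m0 / cn (m1 + cj m0) ^+ 2)%:C.
  rewrite rc BE /X; move: ((2 * rp m0)%:C) ((2 * rp m1)%:C) c0 c1 => p q p0 q0.
  by field; rewrite ?p0 ?q0 ?n1 ?n2.
move: hX; rewrite XE /= subr_ge0.
have s0 : 0 < cn (m1 + cj m0) ^+ 2 by rewrite exprn_gt0// cn_gt0.
have p1 : 0 < 2 * rp m1 by arith.
rewrite ler_pdivrMr// mulrAC ler_pdivlMr// => h.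
rewrite -(@ler_pXn2r _ 2) ?nnegrE ?mulr_ge0 ?cn_ge0// exprMn.
have : cn (m1 + cj m0) ^+ 2 = cn (m1 - m0) ^+ 2 + 2 * rp m0 * (2 * rp m1).
  by rewrite !cn_sqr rpD rpB ipD ipB rpJ ipJ; ring.
by move: h; move: (cn (m1 + cj m0) ^+ 2) (cn (m1 - m0) ^+ 2) (cn (g m1) ^+ 2) => *; arith.
Qed.

Lemma lin_ge0_eq0 (c : C) (k : R) : (forall v : C, 0 <= rp (c * v) + k) -> c = 0.
Proof.
move=> h; apply/eqP; rewrite -cn_eq0; apply/eqP/eqP; rewrite -sqrf_eq0 eq_le sqr_ge0 andbT leNgt.
apply/negP => c0; have := h (- (`|k| + 1)%:C / c).
have cn0 : c != 0 by apply/eqP => e; move: c0; rewrite e cn0 expr0n ltxx.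
rewrite mulrCA divff// mulr1 rpN /=; have := ler_norm k; arith.
Qed.

(** For the Cayley map itself the Pick kernel is [2 / ((x + 1) (cj y + 1))], a form of rank one. The
    weights used here annihilate it for every [v], because divided by [m_i + 1] they add up to
    [cj v - (1 + cj v) + 1 = 0]. Only terms containing the deviation [E] at [m] survive; they are
    affine in [v], and an affine real part that is nonnegative everywhere has no linear term. *)
Lemma schwarz_unique (g : Cplx R -> Cplx R) (m0 m1 m : C) :
  holomorphic_on half_plane g -> (forall x : C, 0 < rp x -> cn (g x) <= 1) ->
  0 < rp m0 -> 0 < rp m1 -> 0 < rp m -> m0 != m1 ->
  g m0 = (m0 - 1) / (m0 + 1) -> g m1 = (m1 - 1) / (m1 + 1) ->
  g m = (m - 1) / (m + 1).
Proof.
move=> hg g1 h0 h1 h2 m01 e0 e1.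
have [E EE] : exists E : C, E = g m - (m - 1) / (m + 1) by exists (g m - (m - 1) / (m + 1)).
suff : E = 0 by rewrite EE => /subr0_eq.
have a0 := hp1_neq0 h0; have a1 := hp1_neq0 h1; have a2 := hp1_neq0 h2.
have b0 : cj m0 + 1 != 0 by apply: hp1_neq0; rewrite rpJ.
have b1 : cj m1 + 1 != 0 by apply: hp1_neq0; rewrite rpJ.
have b2 : cj m + 1 != 0 by apply: hp1_neq0; rewrite rpJ.
have k20 := hp_sum_neq0 h2 h0; have k21 := hp_sum_neq0 h2 h1; have k22 := hp_sum_neq0 h2 h2.
have d01 : cj m0 - cj m1 != 0.
  by apply: contra m01 => /eqP h; rewrite -subr_eq0 -conjc_eq0 !cjE h.
pose c : C := - E * (m + 1) * ((m + 1) * (cj m0 - cj m1)) / ((m + cj m0) * (m + cj m1)).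
suff : c = 0.
  move/eqP; rewrite /c; rewrite !mulf_eq0 invr_eq0 !mulf_eq0 oppr_eq0.
  by rewrite (negPf a2) (negPf d01) (negPf k20) (negPf k21) !orbF => /eqP.
pose d : C := E * (m + 1) * ((cj m1 - 1) / (m + cj m1)).
pose K : C := - (E * cj ((m - 1) / (m + 1))) - ((m - 1) / (m + 1)) * cj E - E * cj E.
pose e : C := (m + 1) * (cj m + 1) * K / (m + cj m).
have base (x y : C) : x + 1 != 0 -> y + 1 != 0 -> x + y != 0 ->
    (1 - (x - 1) / (x + 1) * ((y - 1) / (y + 1))) / (x + y) = 2 / ((x + 1) * (y + 1)).
  by move=> x1 y1 xy; field; rewrite x1 y1 xy.
have gm : g m = (m - 1) / (m + 1) + E by rewrite EE addrC subrK.
suff : c *+ 2 = 0 by move/eqP; rewrite mulrn_eq0 => /eqP.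
apply: (@lin_ge0_eq0 (c *+ 2) (rp (d *+ 2 + e))) => v.
have := schur_pick3 (cj v * (m0 + 1)) ((- 1 - cj v) * (m1 + 1)) (m + 1) hg g1 h0 h1 h2.
rewrite /pk e0 e1 gm !cjE.
have k02 := hp_sum_neq0 h0 h2; have k12 := hp_sum_neq0 h1 h2.
have k00 := hp_sum_neq0 h0 h0; have k11 := hp_sum_neq0 h1 h1.
have k01 := hp_sum_neq0 h0 h1; have k10 := hp_sum_neq0 h1 h0.
set X := (X in rp X).
pose P := c * v + d.
suff -> : X = P + cj P + e.
  have idn (p q r s : C) : p *+ 2 * s + (q *+ 2 + r) = (p * s + q) + (p * s + q) + r by ring.
  have idr (p q : C) : rp (p + cj p + q) = rp (p + p + q) by case: p; case: q.
  by rewrite -rpD idn -/P idr.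
rewrite /X /P /c /d /e /K !cjE.
move: (cj m0) (cj m1) (cj m) (cj v) (cj E) b0 b1 b2 d01 k20 k21 k22 k02 k12 k00 k11 k01 k10
  => n0 n1 n v' E' b0 b1 b2 d01 k20 k21 k22 k02 k12 k00 k11 k01 k10.
have s20 (p q : C) : (1 - ((m - 1) / (m + 1) + E) * p) / q = (1 - (m - 1) / (m + 1) * p) / q - E * p / q by ring.
have s02 (p q : C) : (1 - p * ((n - 1) / (n + 1) + E')) / q = (1 - p * ((n - 1) / (n + 1))) / q - p * E' / q by ring.
have s22 (p q : C) : (1 - (p + E) * (q + E')) = (1 - p * q) + (- (E * q) - p * E' - E * E') by ring.
rewrite s22 !s20 !s02 [(_ + _) / (m + n)]mulrDl !base//.
have k20' : n0 + m != 0 by rewrite addrC.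
have k21' : n1 + m != 0 by rewrite addrC.
rewrite [n + m0]addrC [n + m1]addrC.
by field; rewrite ?a0 ?a1 ?a2 ?b0 ?b1 ?b2 ?k20 ?k21 ?k22 ?k02 ?k12.
Qed.
End PickHalfPlane.

(** * Charts of the symmetrized bidisc and its geodesics *)

Section Fit.
Variable R : realType.
Notation C := R[i].

Lemma cubic_ge0 (c3 c2 c1 c0 : R) :
  (forall b, 0 <= c3 * b ^+ 3 + c2 * b ^+ 2 + c1 * b + c0) -> c3 = 0.
Proof.
move=> h; apply/eqP; apply: contraT => c30.
pose M := (`|c2| + `|c1| + `|c0| + 1) / `|c3|.
have c3p : 0 < `|c3| by rewrite normr_gt0.
have M0 : 0 < M.
  by rewrite divr_gt0// !addr_ge0 ?ltr_wpDl// !addr_ge0.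
pose B := 1 + M.
have B1 : 1 < B by rewrite ltrDl.
have cB : `|c3| * B > `|c2| + `|c1| + `|c0|.
  by rewrite /B mulrDr mulr1 /M mulrC divfK ?gt_eqF//; arith.
have h1 := h B; have h2 := h (- B).
have a2 : `|c2 * B ^+ 2| <= `|c2| * B ^+ 2 by rewrite normrM (ger0_norm (sqr_ge0 B)).
have a1 : `|c1 * B| <= `|c1| * B ^+ 2.
  by rewrite normrM (gtr0_norm (_ : 0 < B)) ?ler_wpM2l//; narith.
have a0 : `|c0| <= `|c0| * B ^+ 2 by rewrite ler_peMr//; narith.
have c3B : `|c3| * B ^+ 3 <= `|c2| * B ^+ 2 + `|c1| * B ^+ 2 + `|c0| * B ^+ 2.
  move: a2 a1 a0; rewrite !ler_norml.
  case: (lerP 0 c3) => s; rewrite ?(ger0_norm s) ?(ltr0_norm s) => *; arith.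
have B2 : 0 < B ^+ 2 by rewrite exprn_gt0//; arith.
have : `|c3| * B ^+ 3 = `|c3| * B * B ^+ 2 by ring.
by narith.
Qed.

(* Membership of the pair ((a+b)/2, ((a-b)/2)^2) for a, b in the right
   half-plane: the symmetrized bidisc seen from a point of its distinguished
   boundary. *)
Definition Hs (m D : C) := 0 < rp m /\
  ip D ^+ 2 < 4 * rp m ^+ 2 * (rp m ^+ 2 - rp D).

Definition quad (al be ga : R) (m : C) : C :=
  al%:C * m ^+ 2 + 'i * be%:C * m - ga%:C.
(** Minus the value of [quad al be ga] at ['i * b], which is real. *)
Definition Rb (al be ga b : R) := al * b ^+ 2 + be * b + ga.
(** Conditions that keep the curve in [Hs]: leading coefficient at most one, values on the imaginary
    axis nonpositive, and strictly negative when [al = 1]. *)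
Definition good_quad (al be ga : R) := [/\ al <= 1, forall b, 0 <= Rb al be ga b &
  al = 1 -> forall b, 0 < Rb al be ga b].

Lemma quadE al be ga x y : quad al be ga (x +i* y) =
  (al * (x ^+ 2 - y ^+ 2) - be * y - ga) +i* (2 * al * x * y + be * x).
Proof. by rewrite /quad; apply: cxP => /=; ring. Qed.

(** With [u = al y + be / 2] the defect in the inequality of [Hs] is [4 x^2] times
    [(1 - al) (x^2 + u^2) + Rb (y - u)]. *)
Lemma good_quad_Hs al be ga m : good_quad al be ga -> 0 < rp m -> Hs m (quad al be ga m).
Proof.
move=> [a1 h h1]; case: m => x y /= x0; rewrite quadE; split => //=.
have [a1'|a1'] := ltP al 1.
  have h2 := h (y - (2 * al * x * y + be * x) / (2 * x)); move: h2.
  rewrite (_ : y - _ = y - (al * y + be / 2)); last by field; rewrite gt_eqF.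
  rewrite /Rb => h2; set u := al * y + be / 2 in h2.
  have : 0 < 4 * x ^+ 2 * ((1 - al) * (x ^+ 2 + u ^+ 2) + (al * (y - u) ^+ 2 + be * (y - u) + ga)).
    rewrite mulr_gt0 ?mulr_gt0 ?exprn_gt0// ltr_wpDr// mulr_gt0 ?subr_gt0//.
    by rewrite ltr_pwDl ?sqr_ge0// exprn_gt0.
  by move=> h3; rewrite -subr_gt0; apply: (eq_ind _ (fun t => 0 < t) h3); rewrite /u; field.
have {a1' a1}a1 : al = 1 by apply/eqP; rewrite eq_le a1 a1'.
have := h1 a1 (y - (2 * al * x * y + be * x) / (2 * x)).
rewrite (_ : y - _ = y - (al * y + be / 2)); last by field; rewrite gt_eqF.
rewrite a1 /Rb => h2; have : 0 < 4 * x ^+ 2 * (1 * (y - (1 * y + be / 2)) ^+ 2 + be * (y - (1 * y + be / 2)) + ga).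
  by rewrite mulr_gt0// mulr_gt0// exprn_gt0.
by move=> h3; rewrite -subr_gt0; apply: (eq_ind _ (fun t => 0 < t) h3); field.
Qed.

(** In the chart [om * ub b], [Lpol] and [Npol] are, up to factors that cancel in [chart_dist], the
    real part of [cm] at a point and the squared distance of two such values. [Fpol b >= 0] says
    that this chart separates the points no better than the chart [om]. *)
Definition Npol (x0 y0 P0 Q0 x1 y1 P1 Q1 b : R) : R :=
  let t0 := y0 - b in let t1 := y1 - b in let dx := x0 - x1 in let dy := y0 - y1 in
  let u := x0 * x1 - t0 * t1 in let v := x0 * t1 + x1 * t0 in
  (dx * u - dy * v - (P0 * x1 - Q0 * t1) + (P1 * x0 - Q1 * t0)) ^+ 2 +
  (dx * v + dy * u - (P0 * t1 + Q0 * x1) + (P1 * t0 + Q1 * x0)) ^+ 2.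
Definition Lpol (x y P Q b : R) : R :=
  x * (x ^+ 2 + (y - b) ^+ 2) - (P * x + Q * (y - b)).
Definition Fpol (x0 y0 P0 Q0 x1 y1 P1 Q1 b : R) : R :=
  ((x0 - x1) ^+ 2 + (y0 - y1) ^+ 2) * Lpol x0 y0 P0 Q0 b * Lpol x1 y1 P1 Q1 b -
  Npol x0 y0 P0 Q0 x1 y1 P1 Q1 b * (x0 * x1).

(** The terms of degree four cancel; the other coefficients are read off by interpolation at 0, 1
    and -1. *)
Lemma Fpol_cubic x0 y0 P0 Q0 x1 y1 P1 Q1 :
  let c3 := ((x0 - x1) ^+ 2 + (y0 - y1) ^+ 2) * (Q0 * x1 + Q1 * x0) -
    2 * x0 * x1 * ((x0 - x1) * (Q0 - Q1) - (y0 - y1) * (P0 - P1)) in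
  exists c2 c1 c0, forall b, Fpol x0 y0 P0 Q0 x1 y1 P1 Q1 b =
    c3 * b ^+ 3 + c2 * b ^+ 2 + c1 * b + c0.
Proof.
move=> c3; pose f := Fpol x0 y0 P0 Q0 x1 y1 P1 Q1.
exists ((f 1 + f (-1)) / 2 - f 0), ((f 1 - f (-1)) / 2 - c3), (f 0) => b.
by rewrite /c3 /f /Fpol /Npol /Lpol; field.
Qed.

Lemma Hs_Lpol x y P Q b : Hs (x +i* y) (P +i* Q) -> 0 < Lpol x y P Q b.
Proof.
move=> [/= x0 h]; rewrite /Lpol.
have : 0 < (4 * x) * (x * (x ^+ 2 + (y - b) ^+ 2) - (P * x + Q * (y - b))).
  have : 0 <= (2 * x * (y - b) - Q) ^+ 2 by exact: sqr_ge0.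
  by move: h; move: (y - b) => t; narith.
by rewrite pmulr_rgt0// mulr_gt0.
Qed.

(** A cubic that is nonnegative everywhere has no leading term, and [c3 = 0] is the one real
    condition under which a curve with three real coefficients fits two complex values. With it
    [Fpol] factors as a positive number times [(1 - al) Rb]; its sign and the positivity of [Lpol]
    yield [good_quad]. *)
Lemma fit_real x0 y0 P0 Q0 x1 y1 P1 Q1 : Hs (x0 +i* y0) (P0 +i* Q0) ->
  Hs (x1 +i* y1) (P1 +i* Q1) -> ~ (x0 = x1 /\ y0 = y1) ->
  (forall b, 0 <= Fpol x0 y0 P0 Q0 x1 y1 P1 Q1 b) ->
  exists al be ga, [/\ good_quad al be ga,
    P0 +i* Q0 = quad al be ga (x0 +i* y0) & P1 +i* Q1 = quad al be ga (x1 +i* y1)].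
Proof.
move=> hs0 hs1 ne hF; have [x00 _] := hs0; have [x10 _] := hs1; rewrite /= in x00 x10.
have [c2 [c1 [c0 hc]]] := Fpol_cubic x0 y0 P0 Q0 x1 y1 P1 Q1.
have c3 := cubic_ge0 (fun b => eq_ind _ (fun t => 0 <= t) (hF b) _ (hc b)).
set d := (x0 - x1) ^+ 2 + (y0 - y1) ^+ 2 in c3.
have d0 : 0 < d.
  rewrite lt_def addr_ge0 ?sqr_ge0// andbT; apply/eqP => /eqP.
  rewrite paddr_eq0 ?sqr_ge0// !sqrf_eq0 !subr_eq0 => /andP[/eqP e1 /eqP e2]; exact: ne.
(* the slope S = (D1 - D0)/(m1 - m0) *)
pose k0 := Q0 / x0.
pose SR := ((x1 - x0) * (P1 - P0) + (y1 - y0) * (Q1 - Q0)) / d.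
pose SI := ((x1 - x0) * (Q1 - Q0) - (y1 - y0) * (P1 - P0)) / d.
pose e := (x0 + x1) ^+ 2 + (y1 - y0) ^+ 2.
have e0 : 0 < e by rewrite ltr_pwDl ?sqr_ge0// exprn_gt0// addr_gt0.
pose al := (SR * (x0 + x1) + (SI - k0) * (y1 - y0)) / e.
pose be := k0 - 2 * al * y0.
pose ga := - (P0 + k0 * y0 - al * (x0 ^+ 2 + y0 ^+ 2)).
have Q0E : Q0 = k0 * x0 by rewrite /k0 divfK// gt_eqF.
have SIE : 2 * SI = k0 + Q1 / x1.
  have : 2 * SI * (d * x0 * x1) = (k0 + Q1 / x1) * (d * x0 * x1).
    rewrite (_ : 2 * SI * _ = 2 * x0 * x1 * ((x0 - x1) * (Q0 - Q1) - (y0 - y1) * (P0 - P1))).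
      rewrite (_ : (k0 + _) * _ = d * (Q0 * x1 + Q1 * x0)); first by apply/eqP; rewrite eq_sym -subr_eq0 c3.
      by rewrite /k0; field; rewrite !gt_eqF.
    by rewrite /SI; field; rewrite gt_eqF.
  by apply: mulIf; rewrite !mulf_neq0// gt_eqF.
have imz : (SI - k0) * (x0 + x1) - SR * (y1 - y0) = 0.
  have h : SI * (x1 - x0) + SR * (y1 - y0) = Q1 - Q0.
    by rewrite /SR /SI; move: (gt_eqF d0); rewrite /d => dn; field; rewrite dn.
  have h2 : Q1 = (2 * SI - k0) * x1 by rewrite SIE addrAC subrr add0r divfK// gt_eqF.
  by move: h; rewrite h2 Q0E; arith.
have alR : SR = al * (x0 + x1).
  have h : (SI - k0) * (x0 + x1) = SR * (y1 - y0) by arith.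
  rewrite /al; apply: (mulIf (lt0r_neq0 e0)).
  rewrite [RHS](_ : _ = SR * (x0 + x1) * (x0 + x1) + (SI - k0) * (x0 + x1) * (y1 - y0)).
    by rewrite h /e; ring.
  by field; exact: lt0r_neq0.
have alI : SI - k0 = al * (y1 - y0).
  have x01 : x0 + x1 != 0 by rewrite gt_eqF// addr_gt0.
  apply: (mulIf x01); have -> : (SI - k0) * (x0 + x1) = SR * (y1 - y0) by arith.
  by rewrite alR; ring.
have P1E : P1 = P0 + (x1 - x0) * SR - (y1 - y0) * SI.
  by rewrite /SR /SI; move: (gt_eqF d0); rewrite /d => dn; field; rewrite dn.
have Q1E : Q1 = Q0 + (x1 - x0) * SI + (y1 - y0) * SR.
  by rewrite /SR /SI; move: (gt_eqF d0); rewrite /d => dn; field; rewrite dn.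
have SIE' : SI = k0 + al * (y1 - y0) by rewrite -alI; ring.
have D0E : P0 +i* Q0 = quad al be ga (x0 +i* y0).
  by rewrite quadE; congr (_ +i* _); rewrite ?Q0E /be /ga; ring.
have D1E : P1 +i* Q1 = quad al be ga (x1 +i* y1).
  by rewrite quadE; congr (_ +i* _); rewrite ?P1E ?Q1E alR SIE' ?Q0E /be /ga; ring.
have FE b : Fpol x0 y0 P0 Q0 x1 y1 P1 Q1 b = x0 * x1 * d * e * ((1 - al) * Rb al be ga b).
  rewrite Q1E P1E alR SIE' Q0E /Fpol /Npol /Lpol /d /e /Rb /be /ga.
  by clear; ring.
have hR b : 0 <= (1 - al) * Rb al be ga b.
  by have := hF b; rewrite FE pmulr_rge0// !mulr_gt0.
have L0 b : Lpol x0 y0 P0 Q0 b = x0 * ((1 - al) * (x0 ^+ 2 + (y0 - b) ^+ 2) + Rb al be ga b).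
  by rewrite Q0E /Lpol /Rb /be /ga; ring.
have m0 b : 0 < (1 - al) * (x0 ^+ 2 + (y0 - b) ^+ 2) + Rb al be ga b.
  by have := Hs_Lpol b hs0; rewrite L0 pmulr_rgt0.
have q0 b : 0 < x0 ^+ 2 + (y0 - b) ^+ 2 by rewrite ltr_pwDl ?sqr_ge0// exprn_gt0.
exists al, be, ga; split => //; split.
- rewrite leNgt; apply/negP => a1; have := m0 0; have := hR 0; have := q0 0.
  have : 1 - al < 0 by rewrite subr_lt0.
  move: (Rb _ _ _ _) (x0 ^+ 2 + _) (1 - al) => r q a; narith.
- move=> b; have := m0 b; have := hR b; have := q0 b.
  move: (Rb _ _ _ _) (x0 ^+ 2 + _) => r q q1 h1 h2.
  have [a1|a1|a1] := ltgtP (1 - al) 0; last 1 first.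
  + by move: h2; rewrite a1 mul0r add0r => /ltW.
  + narith.
  + by move: h1; rewrite pmulr_rge0.
- by move=> a1 b; have := m0 b; rewrite a1 subrr mul0r add0r.
Qed.
End Fit.

(** * Charts and their inverses *)

Section Charts.
Variable R : realType.
Notation C := R[i].
Notation G := (symmetrized_bidisc R).

Lemma G_cn (x : Cplx2 R) : G x <-> exists z w : C, [/\ cn z < 1, cn w < 1 & x = (z + w, z * w)].
Proof.
by split=> -[z [w [h1 h2 h3]]]; exists z, w; split => //; move: h1 h2; rewrite !cnoE !ltcR.
Qed.

Lemma hs_ab (a b : C) : 0 < rp a -> 0 < rp b -> Hs ((a + b) / 2) (((a - b) / 2) ^+ 2).
Proof.
case: a => a1 a2; case: b => b1 b2 /= ha hb.
have h2 : (2 : C)^-1 = (2^-1)%:C by rewrite fmorphV /= rmorph_nat.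
rewrite h2 expr2; split; rewrite /= ?mulr0 ?subr0 ?addr0 ?add0r; first by rewrite mulr_gt0 ?invr_gt0//; arith.
rewrite [X in _ < X](_ : _ = ((a1 + b1) / 2) ^+ 2 * 4 * (((a1 + b1) / 2) ^+ 2 - ((a1 - b1) / 2) ^+ 2 + ((a2 - b2) / 2) ^+ 2)); last by field.
have xu : 0 < ((a1 + b1) / 2) ^+ 2 - ((a1 - b1) / 2) ^+ 2.
  rewrite (_ : _ - _ = a1 * b1); [exact: mulr_gt0|by field].
have x0 : 0 < ((a1 + b1) / 2) ^+ 2 by rewrite exprn_gt0// divr_gt0// addr_gt0.
rewrite [X in X < _](_ : _ = 4 * (((a1 - b1) / 2) ^+ 2 * ((a2 - b2) / 2) ^+ 2)); last by field.
move: (((a1 + b1) / 2) ^+ 2) (((a1 - b1) / 2) ^+ 2) (((a2 - b2) / 2) ^+ 2) (sqr_ge0 ((a2 - b2) / 2)) xu x0 => X U W W0 XU X0.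
narith.
Qed.

Lemma Hs_sqrt (m D : C) : Hs m D -> exists d : C, [/\ D = d ^+ 2, 0 < rp (m + d) & 0 < rp (m - d)].
Proof.
move=> [m0 h]; exists (sqrtc D); rewrite sqr_sqrtc; move: h; rewrite -{1 2}(sqr_sqrtc D).
case: (sqrtc D) => u v; case: m m0 => x y /= x0; rewrite expr2 /= => h.
have : 0 < (x ^+ 2 - u ^+ 2) * (x ^+ 2 + v ^+ 2) by narith.
rewrite pmulr_lgt0; last by rewrite ltr_pwDl ?sqr_ge0// exprn_gt0.
by rewrite subr_gt0 => h2; split => //; narith.
Qed.

(* For [x = (z + w, z w)] and [om] on the unit circle, put
   [a = (1 + om z) / (1 - om z)] and [b] likewise with [w]; then
   [cm om x = (a + b) / 2] and [cD om x = ((a - b) / 2) ^ 2], and the node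
   [(2 / om, 1 / om ^ 2)] of the chart is sent to infinity. *)
Definition cden (om : C) (x : Cplx2 R) : C := 1 - om * x.1 + om ^+ 2 * x.2.
Definition cm (om : C) (x : Cplx2 R) : C := (1 - om ^+ 2 * x.2) / cden om x.
Definition cD (om : C) (x : Cplx2 R) : C :=
  (om ^+ 2 * x.1 ^+ 2 - 4 * (om ^+ 2 * x.2)) / cden om x ^+ 2.
Definition cinv (om m D : C) : Cplx2 R :=
  (om^-1 * (2 * (m ^+ 2 - D - 1) / (m ^+ 2 - D + 2 * m + 1)),
   om ^- 2 * ((m ^+ 2 - D - 2 * m + 1) / (m ^+ 2 - D + 2 * m + 1))).

Lemma unit_neq0 (om : C) : cn om = 1 -> om != 0.
Proof. by move=> h; rewrite -cn_gt0 h. Qed.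

Lemma lt1_neq (z : C) : cn z < 1 -> 1 - z != 0.
Proof. by move=> z1; apply/eqP => /subr0_eq e; move: z1; rewrite -e cn1 ltxx. Qed.

Lemma two_neq0 : (2 : C) != 0. Proof. by rewrite pnatr_eq0. Qed.

Lemma G_ab (om : C) (x : Cplx2 R) : cn om = 1 -> G x -> exists a b : C,
  [/\ 0 < rp a, 0 < rp b, cden om x = 4 / ((a + 1) * (b + 1)),
      cm om x = (a + b) / 2 & cD om x = ((a - b) / 2) ^+ 2].
Proof.
move=> om1 /G_cn[z [w [z1 w1 ->]]]; have om0 := unit_neq0 om1.
have oz : cn (om * z) < 1 by rewrite cnM om1 mul1r.
have ow : cn (om * w) < 1 by rewrite cnM om1 mul1r.
exists ((1 + om * z) / (1 - om * z)), ((1 + om * w) / (1 - om * w)).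
have nz := lt1_neq oz; have nw := lt1_neq ow; have two := two_neq0.
split; rewrite ?hp_cayley// /cm /cD /cden /=.
all: have -> : 1 - om * (z + w) + om ^+ 2 * (z * w) = (1 - om * z) * (1 - om * w) by ring.
all: have e2 : om ^+ 2 * (z * w) = (om * z) * (om * w) by ring.
all: have e3 : om ^+ 2 * (z + w) ^+ 2 = (om * z + om * w) ^+ 2 by ring.
all: rewrite ?e3 ?e2; move: (om * z) (om * w) nz nw {e2 e3 oz ow} => p q nz nw.
- have e1 : (1 + p) / (1 - p) + 1 = 2 / (1 - p) by field.
  have e2 : (1 + q) / (1 - q) + 1 = 2 / (1 - q) by field.
  by rewrite e1 e2; field; rewrite ?nz ?nw.
- by field; rewrite ?nz ?nw.
- by field; rewrite ?nz ?nw.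
Qed.

Lemma G_Hs (om : C) (x : Cplx2 R) : cn om = 1 -> G x -> Hs (cm om x) (cD om x).
Proof. by move=> o1 /(G_ab o1)[a [b [a0 b0 _ -> ->]]]; exact: hs_ab. Qed.

Lemma cden_neq0 (om : C) (x : Cplx2 R) : cn om = 1 -> G x -> cden om x != 0.
Proof.
move=> o1 /(G_ab o1)[a [b [a0 b0 -> _ _]]].
by rewrite mulf_neq0 ?invr_neq0 ?mulf_neq0 ?hp1_neq0// pnatr_eq0.
Qed.

Lemma cm_gt0 (om : C) (x : Cplx2 R) : cn om = 1 -> G x -> 0 < rp (cm om x).
Proof. by move=> o1 /(G_Hs o1)[]. Qed.

Lemma Hs_den_neq0 (m D : C) : Hs m D -> m ^+ 2 - D + 2 * m + 1 != 0.
Proof.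
move=> /Hs_sqrt[d [-> h1 h2]].
rewrite (_ : _ + 1 = (m + d + 1) * (m - d + 1)); last by ring.
by rewrite mulf_neq0// hp1_neq0.
Qed.

Lemma cinvK (om : C) (x : Cplx2 R) : cn om = 1 -> G x -> cinv om (cm om x) (cD om x) = x.
Proof.
move=> o1 Gx; have d0 := cden_neq0 o1 Gx; have om0 := unit_neq0 o1.
have := Hs_den_neq0 (G_Hs o1 Gx); rewrite /cinv.
have two := two_neq0.
have four : (4 : C) != 0 by rewrite pnatr_eq0.
have -> : cm om x ^+ 2 - cD om x + 2 * cm om x + 1 = 4 / cden om x.
  move: (d0); rewrite /cm /cD /cden; case: x {Gx d0} => s p /= d0; field; exact: d0.
have -> : cm om x ^+ 2 - cD om x - 1 = 2 * om * x.1 / cden om x.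
  move: (d0); rewrite /cm /cD /cden; case: x {Gx d0} => s p /= d0; field; exact: d0.
have -> : cm om x ^+ 2 - cD om x - 2 * cm om x + 1 = 4 * om ^+ 2 * x.2 / cden om x.
  move: (d0); rewrite /cm /cD /cden; case: x {Gx d0} => s p /= d0; field; exact: d0.
move: (cden om x) d0 => d d0 _; case: x {Gx} => s p /=.
by congr pair; field; rewrite ?om0 ?d0.
Qed.

Lemma Hs_G (om m D : C) : cn om = 1 -> Hs m D ->
  [/\ G (cinv om m D), cm om (cinv om m D) = m & cD om (cinv om m D) = D].
Proof.
move=> o1 h; have om0 := unit_neq0 o1; have d0 := Hs_den_neq0 h.
have [d [DE h1 h2]] := Hs_sqrt h.
have a1 := hp1_neq0 h1; have b1 := hp1_neq0 h2.
have two := two_neq0.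
have four : (4 : C) != 0 by rewrite pnatr_eq0.
have dE : cden om (cinv om m D) = 4 / (m ^+ 2 - D + 2 * m + 1).
  by rewrite /cden /cinv /=; field; rewrite ?om0 ?d0.
split.
- apply/G_cn; exists (om^-1 * ((m + d - 1) / (m + d + 1))), (om^-1 * ((m - d - 1) / (m - d + 1))).
  split; rewrite ?cnM ?cnV ?o1 ?invr1 ?mul1r; rewrite -?cnV -?cnM ?cn_cayley//.
  have dd : m ^+ 2 - d ^+ 2 + 2 * m + 1 != 0 by rewrite -DE.
  have e : (m + d + 1) * (m - d + 1) = m ^+ 2 - d ^+ 2 + 2 * m + 1 by ring.
  rewrite /cinv DE; congr pair; rewrite -e; field; rewrite ?om0 ?a1 ?b1 //.
- rewrite /cm dE /cinv /=; field; rewrite ?om0 ?d0 //.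
- rewrite /cD dE /cinv /=; field; rewrite ?om0 ?d0 //.
Qed.

(* [om * ub b] runs over the unit circle minus [om] itself. *)
Definition ub (b : R) : C := ('i * b%:C + 1) / ('i * b%:C - 1).

Lemma ub_den (b : R) : 'i * b%:C - 1 != 0 :> C.
Proof. by apply/eqP => /(congr1 (@complex.Re _)) /=; arith. Qed.

Lemma cn_ub b : cn (ub b) = 1.
Proof.
have h : cn ('i * b%:C + 1 : C) = cn ('i * b%:C - 1 : C).
  by congr Num.sqrt; ring.
by rewrite /ub cnM cnV h divff// gt_eqF// cn_gt0 ub_den.
Qed.

Lemma Hs_shift_neq0 (m D : C) (b : R) : Hs m D -> (m - 'i * b%:C) ^+ 2 - D != 0.
Proof.
move=> /Hs_sqrt[d [-> h1 h2]].
rewrite (_ : _ - _ = (m + d - 'i * b%:C) * (m - d - 'i * b%:C)); last by ring.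
rewrite mulf_neq0//; apply/eqP => /(congr1 (@complex.Re _)); rewrite rpB.
  rewrite (_ : rp ('i * b%:C) = 0) ?subr0 /=; last by ring.
  by move=> e; move: h1; rewrite e ltxx.
rewrite (_ : rp ('i * b%:C) = 0) ?subr0 /=; last by ring.
by move=> e; move: h2; rewrite e ltxx.
Qed.

Lemma sq_i : ('i : C) * 'i = -1. Proof. by rewrite -expr2 sqr_i. Qed.

(** On each half-plane coordinate [a] of the two roots the change of chart is
    [a -> - i b + (1 + b^2) / (a - i b)]. The mean over the two coordinates gives the formula, since
    [1 / (m + d - i b)] and [1 / (m - d - i b)] have mean [(m - i b) / ((m - i b)^2 - d^2)]. *)
Lemma cm_shift om x b : cn om = 1 -> G x ->
  cm (om * ub b) x = - ('i * b%:C) + (1 + b%:C ^+ 2) *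
    ((cm om x - 'i * b%:C) / ((cm om x - 'i * b%:C) ^+ 2 - cD om x)).
Proof.
move=> o1 Gx; have h := Hs_shift_neq0 b (G_Hs o1 Gx).
have d0 := cden_neq0 o1 Gx.
have o1' : cn (om * ub b) = 1 by rewrite cnM o1 cn_ub mulr1.
have d1 := cden_neq0 o1' Gx.
have ub0 := ub_den b.
have bb : b%:C ^+ 2 = - ('i * b%:C) ^+ 2 :> C by have i2 := sq_i; ring: i2.
rewrite bb; move: d1; rewrite /cm {1}/cden /ub.
have -> : 1 - om * (('i * b%:C + 1) / ('i * b%:C - 1)) * x.1 +
   (om * (('i * b%:C + 1) / ('i * b%:C - 1))) ^+ 2 * x.2 =
   ((('i * b%:C - 1) ^+ 2 - om * ('i * b%:C + 1) * ('i * b%:C - 1) * x.1 +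
    om ^+ 2 * ('i * b%:C + 1) ^+ 2 * x.2)) / ('i * b%:C - 1) ^+ 2 by field.
move: h ub0; rewrite {1}/cm /cD; move: d0; rewrite {1 2 3 4}/cden.
move: ('i * b%:C) => c; case: x {Gx} => s p /= d0 h u0 d1.
have n1 : (c - 1) ^+ 2 - om * (c + 1) * (c - 1) * s + om ^+ 2 * (c + 1) ^+ 2 * p != 0.
  by apply: contra d1 => /eqP ->; rewrite mul0r.
have E : ((1 - om ^+ 2 * p) / (1 - om * s + om ^+ 2 * p) - c) ^+ 2 -
   (om ^+ 2 * s ^+ 2 - 4 * (om ^+ 2 * p)) / (1 - om * s + om ^+ 2 * p) ^+ 2 =
  ((c - 1) ^+ 2 - om * (c + 1) * (c - 1) * s + om ^+ 2 * (c + 1) ^+ 2 * p) / (1 - om * s + om ^+ 2 * p).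
  by field.
rewrite /cden /= E.
by field; rewrite exprMn n1 u0 d0.
Qed.
End Charts.

(** * A geodesic through two points *)

Section Existence.
Variable R : realType.
Notation C := R[i].
Notation G := (symmetrized_bidisc R).

(** With [rho] the pseudohyperbolic distance of the two values of [cm], this is
    [4 rho^2 / (1 - rho^2)], an increasing function of [rho] that is rational in the chart
    parameter. *)
Definition chart_dist (om : C) (x y : Cplx2 R) : R :=
  cn (cm om x - cm om y) ^+ 2 / (rp (cm om x) * rp (cm om y)).

Lemma rp_inv (z : C) : rp (z^-1) = rp z / cn z ^+ 2.
Proof.
have [->|z0] := eqVneq z 0; first by rewrite invr0 /= mul0r.
rewrite cn_sqr; case: z z0 => a b z0 /=; by rewrite mulrC.
Qed.

Lemma rpRM (r : R) (z : C) : rp (r%:C * z) = r * rp z.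
Proof. by case: z => a b /=; rewrite mul0r subr0. Qed.

Lemma rp_divE (z w : C) : rp (z / w) = rp (z * cj w) / cn w ^+ 2.
Proof.
have [->|w0] := eqVneq w 0; first by rewrite invr0 mulr0 conjc0 mulr0 /= mul0r.
have s0 : 0 < cn w ^+ 2 by rewrite exprn_gt0// cn_gt0.
have c0 : cj w != 0 by rewrite conjc_eq0.
have -> : z / w = ((cn w ^+ 2)^-1)%:C * (z * cj w).
  by rewrite fmorphV /= -mulcJ; move: (cj _) c0 => y c0; field; rewrite w0 c0.
by rewrite rpRM mulrC.
Qed.

Lemma rpi (b : R) : rp ('i * b%:C) = 0.
Proof. by rewrite /=; ring. Qed.

Lemma ipi (b : R) : ip ('i * b%:C) = b.
Proof. by rewrite /=; ring. Qed.

Definition sden (b : R) (m D : C) : C := (m - 'i * b%:C) ^+ 2 - D.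

Lemma Lpol_rp (b : R) (m D : C) :
  rp ((m - 'i * b%:C) * cj (sden b m D)) = Lpol (rp m) (ip m) (rp D) (ip D) b.
Proof.
rewrite /sden /Lpol; move: (rpi b) (ipi b); move: ('i * b%:C) => c h1 h2.
rewrite rpM rpJ ipJ !(rpB, ipB) expr2 !(rpM, ipM, rpB, ipB) h1 h2; ring.
Qed.

Lemma Npol_cn (b : R) (m0 D0 m1 D1 : C) :
  Npol (rp m0) (ip m0) (rp D0) (ip D0) (rp m1) (ip m1) (rp D1) (ip D1) b =
  cn ((m0 - 'i * b%:C) * sden b m1 D1 - (m1 - 'i * b%:C) * sden b m0 D0) ^+ 2.
Proof.
have -> : 'i * b%:C = 0 +i* b :> C by apply: cxP; rewrite /=; ring.
rewrite /sden (_ : 'i * b%:C = 0 +i* b :> C); last by apply: cxP; rewrite /=; ring.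
case: m0 => x0 y0; case: D0 => P0 Q0; case: m1 => x1 y1; case: D1 => P1 Q1.
rewrite cn_sqr /Npol !expr2 /=; ring.
Qed.

Lemma chart_dist_shift om x y b : cn om = 1 -> G x -> G y ->
  let m0 := cm om x in let D0 := cD om x in let m1 := cm om y in let D1 := cD om y in
  chart_dist (om * ub b) x y =
  Npol (rp m0) (ip m0) (rp D0) (ip D0) (rp m1) (ip m1) (rp D1) (ip D1) b /
  (Lpol (rp m0) (ip m0) (rp D0) (ip D0) b * Lpol (rp m1) (ip m1) (rp D1) (ip D1) b).
Proof.
move=> o1 Gx Gy m0 D0 m1 D1; rewrite /chart_dist !cm_shift// -!Lpol_rp -/m0 -/D0 -/m1 -/D1.
have q0 : sden b m0 D0 != 0 := Hs_shift_neq0 b (G_Hs o1 Gx).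
have q1 : sden b m1 D1 != 0 := Hs_shift_neq0 b (G_Hs o1 Gy).
have bE : (1 + b%:C ^+ 2 : C) = (1 + b ^+ 2)%:C by rewrite rmorphD rmorph1 rmorphXn.
have b0 : 0 < 1 + b ^+ 2 by rewrite ltr_pwDl// sqr_ge0.
rewrite bE -!/(sden b _ _) !rpD rpN rpi oppr0 !add0r.
have L0 := Hs_Lpol b (_ : Hs (rp m0 +i* ip m0) (rp D0 +i* ip D0)).
have L1 := Hs_Lpol b (_ : Hs (rp m1 +i* ip m1) (rp D1 +i* ip D1)).
have eC (z : C) : rp z +i* ip z = z by case: z.
rewrite !eC -Lpol_rp in L0; rewrite !eC -Lpol_rp in L1.
have {}L0 := L0 (G_Hs o1 Gx); have {}L1 := L1 (G_Hs o1 Gy).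
rewrite !rpRM.
have -> : - ('i * b%:C) + (1 + b ^+ 2)%:C * ((m0 - 'i * b%:C) / sden b m0 D0) -
   (- ('i * b%:C) + (1 + b ^+ 2)%:C * ((m1 - 'i * b%:C) / sden b m1 D1)) =
   (1 + b ^+ 2)%:C * (((m0 - 'i * b%:C) * sden b m1 D1 - (m1 - 'i * b%:C) * sden b m0 D0) /
     (sden b m0 D0 * sden b m1 D1)).
  move: (sden b m0 D0) (sden b m1 D1) q0 q1 => q0 q1 n0 n1.
  by move: ((1 + b ^+ 2)%:C) ('i * b%:C) => B c; field; rewrite ?n0 ?n1.
have -> : Npol (rp m0) (ip m0) (rp D0) (ip D0) (rp m1) (ip m1) (rp D1) (ip D1) b =
  cn ((m0 - 'i * b%:C) * sden b m1 D1 - (m1 - 'i * b%:C) * sden b m0 D0) ^+ 2.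
  exact: Npol_cn.
rewrite cnM cnR gtr0_norm// exprMn cnM cnV cnM !rp_divE.
have s0 : 0 < cn (sden b m0 D0) by rewrite cn_gt0.
have s1 : 0 < cn (sden b m1 D1) by rewrite cn_gt0.
move: L0 L1 s0 s1.
move: (rp ((m0 - _) * _)) (rp ((m1 - _) * _)) (cn (sden b m0 D0)) (cn (sden b m1 D1)) (cn (_ - _)).
move=> l0 l1 t0 t1 t L0 L1 s0 s1; field.
by rewrite !gt_eqF.
Qed.

Lemma continuous_Lpol (x y P Q : R) : continuous (fun b : R => Lpol x y P Q b).
Proof.
move=> b; rewrite /Lpol.
have cb : {for b, continuous (fun b : R => y - b)} by apply: cvgB; [exact: cvg_cst|exact: cvg_id].
apply: cvgB.
  apply: cvgM; first exact: cvg_cst.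
  apply: cvgD; first exact: cvg_cst.
  exact: (cvgM cb cb).
apply: cvgD; first exact: cvg_cst.
by apply: cvgM; first exact: cvg_cst.
Qed.

Lemma continuous_Npol (x0 y0 P0 Q0 x1 y1 P1 Q1 : R) :
  continuous (fun b : R => Npol x0 y0 P0 Q0 x1 y1 P1 Q1 b).
Proof.
pose p : {poly R} :=
  let t0 := y0%:P - 'X in let t1 := y1%:P - 'X in let dx := (x0 - x1)%:P in let dy := (y0 - y1)%:P in
  let u := x0%:P * x1%:P - t0 * t1 in let v := x0%:P * t1 + x1%:P * t0 in
  (dx * u - dy * v - (P0%:P * x1%:P - Q0%:P * t1) + (P1%:P * x0%:P - Q1%:P * t0)) ^+ 2 +
  (dx * v + dy * u - (P0%:P * t1 + Q0%:P * x1%:P) + (P1%:P * t0 + Q1%:P * x0%:P)) ^+ 2.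
rewrite (_ : (fun b => _) = (fun b => p.[b])); last by apply/funext => b; rewrite /p /Npol !hornerE.
exact: continuous_horner.
Qed.

(** Two compact arcs cover the circle, so that the extreme value theorem applies although [ub]
    itself omits a point. *)
Lemma circle_cover (om : C) : cn om = 1 -> exists (s : bool) (b : R),
  -1 <= b <= 1 /\ om = (-1) ^+ s * ub b.
Proof.
have key (z : C) : cn z = 1 -> rp z <= 0 -> exists b : R, -1 <= b <= 1 /\ z = ub b.
  move=> z1 z0; have := cn_sqr z; rewrite z1 expr1n; case: z z1 z0 => c s z1 /= c0 h.
  have d0 : 0 < 1 - c by arith.
  exists (- (s / (1 - c))).
  have h2 : s ^+ 2 <= (1 - c) ^+ 2 by narith.
  split.
    rewrite -ler_norml normrN normrM normfV ler_pdivrMr ?normr_gt0 ?gt_eqF// mul1r.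
    by rewrite -(@ler_pXn2r _ 2) ?nnegrE// !real_normK ?num_real.
  have n0 := ub_den (- (s / (1 - c))).
  rewrite /ub; apply: (mulIf n0); rewrite divfK//.
  apply: cxP => /=.
    apply: (mulIf (lt0r_neq0 d0)); rewrite [LHS](_ : _ = - c * (1 - c) + s ^+ 2); last by field; rewrite gt_eqF.
    by rewrite [RHS](_ : _ = 1 - c); [narith|ring].
  by field; rewrite gt_eqF.
move=> o1; have [h0|h0] := leP (rp om) 0.
  by have [b [h1 h2]] := key _ o1 h0; exists false, b; rewrite mul1r.
have n1 : cn (- om) = 1 by rewrite cnN.
have n2 : rp (- om) <= 0 by rewrite rpN oppr_le0 ltW.
have [b [h1 h2]] := key _ n1 n2.
by exists true, b; rewrite expr1 -h2 mulN1r opprK.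
Qed.

Lemma chart_dist_max x y : G x -> G y -> exists om : C, cn om = 1 /\
  forall o, cn o = 1 -> chart_dist o x y <= chart_dist om x y.
Proof.
move=> Gx Gy.
have sg (s : bool) : cn ((-1) ^+ s : C) = 1 by rewrite cnX cnN cn1 expr1n.
have key (s : bool) : exists2 c : R, -1 <= c <= 1 & forall b : R, -1 <= b <= 1 ->
    chart_dist ((-1) ^+ s * ub b) x y <= chart_dist ((-1) ^+ s * ub c) x y.
  have cf : {within `[-1, 1], continuous (fun b => chart_dist ((-1) ^+ s * ub b) x y)}.
    apply: continuous_subspaceT => b.
    pose L (z : Cplx2 R) (b' : R) := Lpol (rp (cm ((-1) ^+ s) z)) (ip (cm ((-1) ^+ s) z))
      (rp (cD ((-1) ^+ s) z)) (ip (cD ((-1) ^+ s) z)) b'.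
    rewrite (_ : (fun b => _) = (fun b' => Npol (rp (cm ((-1) ^+ s) x)) (ip (cm ((-1) ^+ s) x))
      (rp (cD ((-1) ^+ s) x)) (ip (cD ((-1) ^+ s) x)) (rp (cm ((-1) ^+ s) y))
      (ip (cm ((-1) ^+ s) y)) (rp (cD ((-1) ^+ s) y)) (ip (cD ((-1) ^+ s) y)) b' / (L x b' * L y b')));
      last by apply/funext => b'; exact: chart_dist_shift.
    have eC (z : C) : rp z +i* ip z = z by case: z.
    have L0 := Hs_Lpol b (_ : Hs (rp (cm ((-1) ^+ s) x) +i* ip (cm ((-1) ^+ s) x))
      (rp (cD ((-1) ^+ s) x) +i* ip (cD ((-1) ^+ s) x))).
    have L1 := Hs_Lpol b (_ : Hs (rp (cm ((-1) ^+ s) y) +i* ip (cm ((-1) ^+ s) y))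
      (rp (cD ((-1) ^+ s) y) +i* ip (cD ((-1) ^+ s) y))).
    rewrite !eC in L0; rewrite !eC in L1.
    have {}L0 := L0 (G_Hs (sg s) Gx); have {}L1 := L1 (G_Hs (sg s) Gy).
    apply: cvgM; first exact: continuous_Npol.
    apply: cvgV; first by rewrite gt_eqF// mulr_gt0.
    apply: cvgM; exact: continuous_Lpol.
  have le11 : -1 <= 1 :> R by arith.
  have [c hc hm] := EVT_max le11 cf.
  exists c; first by move: hc; rewrite in_itv.
  by move=> b hb; apply: hm => //; rewrite in_itv.
have [c0 hc0 h0] := key false; have [c1 hc1 h1] := key true.
have [le|/ltW le] := leP (chart_dist ((-1) ^+ false * ub c0) x y) (chart_dist ((-1) ^+ true * ub c1) x y).
  exists ((-1) ^+ true * ub c1); split; first by rewrite cnM sg cn_ub mulr1.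
  move=> o /circle_cover[[] [b [hb ->]]]; first exact: h1.
  exact: le_trans (h0 _ hb) le.
exists ((-1) ^+ false * ub c0); split; first by rewrite cnM sg cn_ub mulr1.
move=> o /circle_cover[[] [b [hb ->]]]; last exact: h0.
exact: le_trans (h1 _ hb) le.
Qed.

Lemma chart_dist_fit om x y : cn om = 1 -> G x -> G y -> cm om x != cm om y ->
  (forall b, chart_dist (om * ub b) x y <= chart_dist om x y) ->
  exists al be ga : R, [/\ good_quad al be ga,
      cD om x = quad al be ga (cm om x) & cD om y = quad al be ga (cm om y)].
Proof.
move=> o1 Gx Gy mm hm.
have eC (z : C) : rp z +i* ip z = z by case: z.
have hx := G_Hs o1 Gx; have hy := G_Hs o1 Gy.
have [] := @fit_real R (rp (cm om x)) (ip (cm om x)) (rp (cD om x)) (ip (cD om x))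
  (rp (cm om y)) (ip (cm om y)) (rp (cD om y)) (ip (cD om y)); rewrite ?eC //.
- by case=> h1 h2; move/eqP: mm; apply; apply: cxP.
- move=> b; have := hm b.
  rewrite chart_dist_shift// /Fpol.
  have L0 := Hs_Lpol b (_ : Hs (rp (cm om x) +i* ip (cm om x)) (rp (cD om x) +i* ip (cD om x))).
  have L1 := Hs_Lpol b (_ : Hs (rp (cm om y) +i* ip (cm om y)) (rp (cD om y) +i* ip (cD om y))).
  rewrite !eC in L0; rewrite !eC in L1; have {}L0 := L0 hx; have {}L1 := L1 hy.
  have x0 := cm_gt0 o1 Gx; have y0 := cm_gt0 o1 Gy.
  rewrite ler_pdivrMr ?mulr_gt0// /chart_dist mulrAC ler_pdivlMr ?mulr_gt0// cn_sqr rpB ipB.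
  by rewrite subr_ge0 -mulrA.
- move=> al [be [ga [h1 h2 h3]]]; exists al, be, ga; split=> //; by rewrite -?h2 -?h3 ?eC.
Qed.

(* The chart in which the two points are farthest apart is the one in which
   they lie on a quadratic geodesic. *)
Lemma fit_exists x y : G x -> G y -> x <> y -> exists (om : C) (al be ga : R),
  [/\ cn om = 1, good_quad al be ga, cm om x != cm om y,
      cD om x = quad al be ga (cm om x) & cD om y = quad al be ga (cm om y)].
Proof.
move=> Gx Gy xy; have [ om [ o1 hm]] := chart_dist_max Gx Gy.
have hx := G_Hs o1 Gx; have hy := G_Hs o1 Gy.
have mm : cm om x != cm om y.
  apply/eqP => e; apply: xy; rewrite -(cinvK o1 Gx) -(cinvK o1 Gy) e; congr (cinv _ _ _).
  (* If [cm om] agreed at the two points, the maximal distance would be zero and [cm] would agree in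
     every chart. The chart [om * ub 0] involves [cD om] as well, so the points would coincide. *)
  have o1' : cn (om * ub 0) = 1 by rewrite cnM o1 cn_ub mulr1.
  have e' : cm (om * ub 0) x = cm (om * ub 0) y.
    have : chart_dist (om * ub 0) x y <= 0.
      by apply: le_trans (hm _ o1') _; rewrite /chart_dist e subrr cn0 expr0n mul0r.
    rewrite /chart_dist ler_pdivrMr ?mulr_gt0 ?cm_gt0// mul0r => h; apply/subr0_eq/eqP.
    by rewrite -cn_eq0 -sqrf_eq0 eq_le h sqr_ge0.
  move: e'; rewrite !cm_shift// e rmorph0 mulr0 oppr0 !add0r expr0n !addr0 !mul1r.
  have n0 : cm om y != 0 by apply/eqP => e0; have := cm_gt0 o1 Gy; rewrite e0 ltxx.
  have q0 := Hs_shift_neq0 0 hx; have q1 := Hs_shift_neq0 0 hy.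
  rewrite e rmorph0 mulr0 subr0 in q0; rewrite rmorph0 mulr0 subr0 in q1.
  by move=> /(mulfI n0) /invr_inj /addrI /oppr_inj.
have hm' b : chart_dist (om * ub b) x y <= chart_dist om x y by apply: hm; rewrite cnM o1 cn_ub mulr1.
have [al [be [ga [h1 h2 h3]]]] := chart_dist_fit o1 Gx Gy mm hm'.
by exists om, al, be, ga.
Qed.
End Existence.

(** * Second order estimates and the infinitesimal Schwarz lemma *)

Section Taylor.
Variable R : realType.
Notation C := R[i].

Lemma rCD (x y : R) : (x + y)%:C = x%:C + y%:C :> C. Proof. exact: rmorphD. Qed.
Lemma rCN (x : R) : (- x)%:C = - x%:C :> C. Proof. exact: rmorphN. Qed.
Lemma rCM (x y : R) : (x * y)%:C = x%:C * y%:C :> C. Proof. exact: rmorphM. Qed.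
Lemma rCV (x : R) : (x^-1)%:C = x%:C^-1 :> C. Proof. exact: fmorphV. Qed.
Lemma rCX (x : R) n : (x ^+ n)%:C = x%:C ^+ n :> C. Proof. exact: rmorphXn. Qed.
Lemma rCnat n : (n%:R : R)%:C = n%:R :> C. Proof. exact: rmorph_nat. Qed.
Lemma rC1 : (1 : R)%:C = 1 :> C. Proof. by []. Qed.
Lemma rC0 : (0 : R)%:C = 0 :> C. Proof. by []. Qed.
Lemma cmean_bound (r : R) (F : C -> C) N M : 0 < r -> 0 <= M ->
  (forall w, cn w = r -> cn (F w) <= M) -> cn (cmean r F N) <= M.
Proof.
move=> r0 M0 h; rewrite /cmean cnM.
case: N => [|N]; first by rewrite big_ord0 cn0 mulr0.
have N0 : 0 < N.+1%:R :> R by rewrite ltr0n.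
have -> : cn (N.+1%:R^-1 : C) = N.+1%:R^-1.
  by rewrite cnV -(rmorph_nat (real_complex R)) cnR gtr0_norm.
rewrite mulrC ler_pdivrMr//; apply: le_trans (cn_sum _ _ _) _.
rewrite (_ : M * N.+1%:R = \sum_(j < N.+1) M).
  by apply: ler_sum => j _; apply: h; exact: cn_circ.
by rewrite sumr_const card_ord mulr_natr.
Qed.

(** Cauchy's formula is used at [z], at 0 and at an auxiliary small [u]: the combination that
    interpolates at 0 and [u] has kernel [z (z - u) / ((w - z) (w - u))], whose denominators are at
    least 1/4 on the circle of radius 3/4. Taking [u] small replaces the divided difference by [l].
    The constant does not depend on [f]. *)
Lemma taylor2 (f : Cplx R -> Cplx R) (l z : C) :
  holomorphic_on (unit_disc R) f -> (forall w : C, cn w < 1 -> cn (f w) <= 1) ->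
  cdif f 0 l -> cn z <= 2^-1 -> cn (f z - f 0 - l * z) <= 16 * cn z ^+ 2.
Proof.
move=> hf f1 hl z2; apply/ler_addgt0Pr => e e0.
have z0 := cn_ge0 z.
have [d d0 hd] := hl _ e0.
pose t := Num.min (2^-1) (Num.min (d / 2) (e / 32)).
have t0 : 0 < t by rewrite /t !lt_min invr_gt0 !divr_gt0 ?ltr0n.
have t2 : t <= 2^-1 by rewrite /t ge_min lexx.
have td : t <= d / 2 by rewrite /t !ge_min lexx orbT.
have te : t <= e / 32 by rewrite /t !ge_min lexx !orbT.
clearbody t.
have [u [u0 ut]] : exists u : C, u != 0 /\ cn u = t.
  by exists t%:C; split; [exact: rC_neq0|rewrite cnR gtr0_norm].
have r1 : (3 / 4 : R) < 1 by arith.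
have zr : cn z < 3 / 4 by arith.
have ur : cn u < 3 / 4 by rewrite ut; arith.
have or : cn (0 : C) < 3 / 4 by rewrite cn0; arith.
have hz := cauchy_lim hf r1 zr; have hu := cauchy_lim hf r1 ur; have h0 := cauchy_lim hf r1 or.
have hT := climD (climD hz (climZ (z / u - 1) h0)) (climZ (- (z / u)) hu).
have {}hT : cn (f z + (z / u - 1) * f 0 + (- (z / u)) * f u) <= 16 * cn z * (cn z + t).
  apply: (clim_cn_le hT) => N.
  have nz (w v : C) : cn v < 3 / 4 -> cn w = 3 / 4 -> w - v != 0.
    by move=> v1 w1; rewrite subr_eq0; apply/eqP => wv; move: v1; rewrite -wv w1 ltxx.
  have r0 : 0 < 3 / 4 :> R by arith.
  rewrite (_ : _ + _ = cmean (3 / 4) (fun w => 1 * (1 * (f w * (w / (w - z))) +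
      (z / u - 1) * (f w * (w / (w - 0)))) + (- (z / u)) * (f w * (w / (w - u)))) N); last first.
    by rewrite !cmean_lin; ring.
  rewrite (@eq_cmean _ _ _ (fun w => f w * (z * (z - u) / ((w - z) * (w - u)))))//; last first.
    move=> w wr; have := nz _ _ zr wr; have := nz _ _ ur wr; have := nz _ _ or wr.
    by rewrite subr0 => w0 w1 w2; field; rewrite u0 w0 w1 w2.
  apply: cmean_bound => //; first by rewrite !mulr_ge0// addr_ge0// ltW.
  move=> w wr; rewrite !cnM cnV cnM.
  have w1 : 4^-1 <= cn (w - z) by have := cnD (w - z) z; rewrite subrK wr; clear - z2; lra.
  have w2 : 4^-1 <= cn (w - u) by have := cnD (w - u) u; rewrite subrK wr ut; clear - t2; lra.
  have w3 : cn (f w) <= 1 by apply: f1; rewrite wr.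
  have w4 : cn (z - u) <= cn z + t by rewrite -ut cnB.
  have w5 : (cn (w - z) * cn (w - u))^-1 <= 16.
    rewrite -[16]invrK lef_pV2 ?posrE ?mulr_gt0//; try (clear - w1 w2; lra).
    by move: (cn (w - z)) (cn (w - u)) w1 w2 => p q w1 w2; clear - w1 w2; nra.
  have w6 : 0 <= (cn (w - z) * cn (w - u))^-1 by rewrite invr_ge0 mulr_ge0// cn_ge0.
  have := cn_ge0 (f w); have := cn_ge0 (z - u).
  move: w3 w4 w5 w6; move: (cn (f w)) (cn (z - u)) (_^-1) => a b c a1 b1 c1 c0 b0 a0.
  have h1 : cn z * b <= cn z * (cn z + t) by rewrite ler_wpM2l.
  have h2 : cn z * b * c <= cn z * (cn z + t) * 16 by apply: ler_pM => //; rewrite mulr_ge0.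
  have h3 : a * (cn z * b * c) <= 1 * (cn z * (cn z + t) * 16).
    by apply: ler_pM => //; rewrite !mulr_ge0.
  by move: h3; rewrite mul1r; clear; lra.
have hdu : cn ((f u - f 0) / u - l) <= e.
  have := hd u; rewrite subr0 ut => /(_ ltac:(clear - td d0 t0; lra)) hdu.
  rewrite (_ : _ - l = (f u - f 0 - l * u) / u); last by field.
  by rewrite cnM cnV ut ler_pdivrMr.
have -> : f z - f 0 - l * z = (f z + (z / u - 1) * f 0 + - (z / u) * f u) + z * ((f u - f 0) / u - l).
  by field.
apply: le_trans (cnD _ _) _; rewrite cnM.
have : cn z * cn ((f u - f 0) / u - l) <= 2^-1 * e by apply: ler_pM => //; exact: cn_ge0.
have : 16 * cn z * (cn z + t) <= 16 * cn z ^+ 2 + 8 * t by narith.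
arith.
Qed.

(** Minimise over the multiples [v = - s cj B]: the choice is [s = 1 / A], or a large [s] when
    [A = 0]. *)
Lemma form_ge0_det (A D : R) (B : C) : (forall v : C, 0 <= A * cn v ^+ 2 + 2 * rp (v * B) + D) ->
  0 <= A -> cn B ^+ 2 <= A * D.
Proof.
move=> h A0.
have hs (s : R) : 0 <= A * s ^+ 2 * cn B ^+ 2 - 2 * s * cn B ^+ 2 + D.
  have := h (- (s%:C * cj B)); rewrite cnN cnM cnR cnJ exprMn real_normK ?num_real//.
  have -> : - (s%:C * cj B) * B = - (s%:C * (B * cj B)) by ring.
  by rewrite mulcJ rpN rpRM /=; arith.
have b0 : 0 <= cn B ^+ 2 by exact: sqr_ge0.
have [A00|A1] := eqVneq A 0.
  rewrite A00 mul0r leNgt; apply/negP => B0.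
  have := hs ((D + 1) / (2 * cn B ^+ 2)); rewrite A00 !mul0r add0r.
  have -> : 2 * ((D + 1) / (2 * cn B ^+ 2)) * cn B ^+ 2 = D + 1.
    by move: (cn B ^+ 2) B0 => q q0; field; rewrite gt_eqF.
  arith.
have A2 : 0 < A by rewrite lt_def A1.
have := hs A^-1; rewrite (_ : A * A^-1 ^+ 2 * cn B ^+ 2 = A^-1 * cn B ^+ 2); last by field.
move=> h2; rewrite mulrC -ler_pdivrMr// mulrC; arith.
Qed.

(* Uniqueness in the infinitesimal Schwarz lemma, from the Pick matrix of
   [m0], a point [u] tending to [m0], and [z]. *)
Lemma schwarz_inf (g : Cplx R -> Cplx R) (m0 z : C) :
  holomorphic_on (@half_plane R) g -> (forall x : C, 0 < rp x -> cn (g x) <= 1) ->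
  0 < rp m0 -> 0 < rp z -> g m0 = 0 -> cdif g m0 (2 * rp m0)^-1%:C ->
  g z = (z - m0) / (z + cj m0).
Proof.
move=> hg g1 h0 hz e0 hd.
pose ph (x : C) := (x - m0) / (x + cj m0).
have E0 (x : C) : x + cj x = (2 * rp x)%:C by case: x => a b; apply: cxP => /=; ring.
have nJ (x y : C) : 0 < rp x -> 0 < rp y -> cj x + y != 0.
  by move=> x0 y0; rewrite addrC; exact: hp_sum_neq0.
pose B u := (ph u * cj (ph z) - g u * cj (g z)) / (u + cj z).
pose A u := (cn (ph u) ^+ 2 - cn (g u) ^+ 2) / (2 * rp u).
have sch u : 0 < rp u -> cn (g u) <= cn (ph u).
  move=> hu; rewrite /ph cnM cnV ler_pdivlMr ?cn_gt0 ?hp_sum_neq0//.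
  exact: schwarz_hp.
have AE u : 0 < rp u -> (A u)%:C = (ph u * cj (ph u) - g u * cj (g u)) / (u + cj u).
  by move=> hu; rewrite E0 !mulcJ -rmorphB -fmorphV -rmorphM.
have form u (v : C) : 0 < rp u -> 0 <= A u * cn v ^+ 2 + 2 * rp (v * B u) + A z.
  (* This weight at [m0] eliminates [m0]; the form left in [u] and [z] compares [g] with the
     extremal map [ph]. *)
  move=> hu; have := schur_pick3 (- (2 * rp m0)%:C * (v / (u + cj m0) + 1 / (z + cj m0))) v 1 hg g1 h0 hu hz.
  set X := (X in rp X); suff -> : X = (A u)%:C * (v * cj v) + (v * B u + cj (v * B u)) + (A z)%:C.
    by rewrite mulcJ !rpD rpRM rpJ /=; arith.
  rewrite /X !AE// /B /pk e0 /ph !cjE -(E0 m0).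
  have a1 := hp_sum_neq0 h0 h0; have a2 := hp_sum_neq0 h0 hu; have a3 := hp_sum_neq0 h0 hz.
  have a4 := hp_sum_neq0 hu h0; have a5 := hp_sum_neq0 hu hu; have a6 := hp_sum_neq0 hu hz.
  have a7 := hp_sum_neq0 hz h0; have a8 := hp_sum_neq0 hz hu; have a9 := hp_sum_neq0 hz hz.
  have b2 := nJ _ _ h0 hu; have b4 := nJ _ _ hu h0; have b3 := nJ _ _ h0 hz; have b7 := nJ _ _ hz h0.
  have b6 := nJ _ _ hu hz; have b8 := nJ _ _ hz hu.
  move: (g u) (g z) (cj (g u)) (cj (g z)) (cj u) (cj z) (cj m0) (cj v) a1 a2 a3 a4 a5 a6 a7 a8 a9 b2 b3 b4 b6 b7 b8 => *.
  field.
  by do ?(apply/andP; split) => //.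
have z1 := cn_ge0 (g z).
have [L LE] : exists L : C, L = cj (ph z) - cj (g z) by eexists.
suff L0 : L = 0.
  apply/(can_inj (@cjK R)); apply/esym/subr0_eq; rewrite -L0 LE //.
have [K [K0 hK]] : exists K : R, 0 < K /\ K = (cn (m0 + cj z) + 1) ^+ 2 / (2 * rp m0 * (2 * rp z)).
  eexists; split; last by reflexivity.
  by rewrite divr_gt0 ?exprn_gt0 ?mulr_gt0// ltr_wpDl// cn_ge0.
(* With [ph u = q] and [g u = q (1 + h)], [A u] is of order [q^2 h] and [B u] is essentially [q L].
   The determinant inequality divided by [q^2] bounds the square of [L] in terms of [h], which the
   derivative hypothesis makes small. *)
have small (e : R) : 0 < e -> e <= 1 -> cn L ^+ 2 <= e * (4 * K + 2).
  move=> e_0 e_1; have x1 : 0 < 2 * (2 * rp m0 + 1) by arith.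
  have [d d0 hdd] := hd (e / (2 * (2 * rp m0 + 1))) ltac:(by rewrite divr_gt0).
  have [t [t0 t1 td tx]] : exists t : R, [/\ 0 < t, t <= 1, t < d & t <= rp m0 * e].
    exists (Num.min 1 (Num.min (d / 2) (rp m0 * e))).
    split; first by rewrite !lt_min divr_gt0 ?mulr_gt0 ?ltr0n ?ltr01.
    - by rewrite ge_min lexx.
    - apply: (@le_lt_trans _ _ (d / 2)); last by arith.
      by rewrite !ge_min lexx orbT.
    - by rewrite !ge_min lexx !orbT.
  pose u : C := m0 + t%:C.
  have hu : 0 < rp u by rewrite rpD /=; arith.
  have uE : u + cj m0 = (2 * rp m0 + t)%:C.
    by rewrite /u addrAC E0 -rmorphD.
  have s0 : 0 < 2 * rp m0 + t by arith.
  have phE : ph u = (t / (2 * rp m0 + t))%:C.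
    by rewrite /ph uE /u addrC addKr rCM rCV.
  have q0 : 0 < t / (2 * rp m0 + t) by rewrite divr_gt0.
  have [q [qE q1]] : exists q, q = t / (2 * rp m0 + t) /\ 0 < q by exists (t / (2 * rp m0 + t)).
  rewrite -qE in phE.
  have qC := rC_neq0 q1.
  have [h hE] : exists h : C, h = g u / q%:C - 1 by eexists.
  have gE : g u = q%:C * (1 + h) by rewrite hE addrC subrK mulrC divfK.
  have hs : cn h <= e.
    have um : u - m0 = t%:C by rewrite /u addrC addKr.
    have := hdd u; rewrite um cnR gtr0_norm// e0 subr0 => /(_ td) hg2.
    have -> : h = ((g u - (2 * rp m0)^-1%:C * t%:C) * (2 * rp m0 + t)%:C + (2 * rp m0)^-1%:C * t%:C * t%:C) / t%:C.
      rewrite hE qE rCM !rCV rCD.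
      have tC := rC_neq0 t0; have a0 : 0 < 2 * rp m0 by clear - h0; lra.
      have aC := rC_neq0 a0.
      have bC := rC_neq0 s0; rewrite rCD in bC.
      move: aC bC; move: ((2 * rp m0)%:C) => a aC bC.
            by field; rewrite ?tC ?aC ?bC.
    rewrite cnM cnV cnR (gtr0_norm t0) ler_pdivrMr//.
    apply: le_trans (cnD _ _) _; rewrite !cnM !cnR !(gtr0_norm t0) gtr0_norm//.
    rewrite gtr0_norm ?invr_gt0 ?mulr_gt0//.
    have b1 : (2 * rp m0)^-1 * t <= e / 2.
      by rewrite mulrC ler_pdivrMr ?mulr_gt0//; clear - tx; lra.
    have b2 : cn (g u - (2 * rp m0)^-1%:C * t%:C) * (2 * rp m0 + t) <= e / 2 * t.
      apply: le_trans (_ : e / (2 * (2 * rp m0 + 1)) * t * (2 * rp m0 + 1) <= _).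
        by apply: ler_pM; [exact: cn_ge0|exact: ltW|exact: hg2|rewrite lerD2l].
      have X0 : 0 < 2 * rp m0 + 1 by clear - h0; lra.
      move: X0; move: (2 * rp m0 + 1) => X X0.
      by rewrite le_eqVlt; apply/orP; left; apply/eqP; field; rewrite gt_eqF.
    have b3 : (2 * rp m0)^-1 * t * t <= e / 2 * t by rewrite ler_wpM2r// ltW.
    clear - b2 b3; lra.
  have A0 : 0 <= A u.
    by rewrite /A divr_ge0 ?subr_ge0 ?ler_pXn2r ?nnegrE ?cn_ge0 ?sch ?mulr_ge0// ltW.
  have := form_ge0_det (fun v => form u v hu) A0.
  have -> : B u = q%:C * (L - h * cj (g z)) / (u + cj z).
    by rewrite /B LE phE gE; ring.
  have -> : A u = q ^+ 2 * (1 - cn (1 + h) ^+ 2) / (2 * rp u).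
    by rewrite /A gE phE cnM cnR gtr0_norm//; ring.
  have n0 : 0 < cn (u + cj z) by rewrite cn_gt0 hp_sum_neq0.
  rewrite !cnM cnV cnR gtr0_norm// !exprMn.
  have hn : cn (u + cj z) <= cn (m0 + cj z) + 1.
    rewrite /u addrAC; apply: le_trans (cnD _ _) _; rewrite lerD2l cnR gtr0_norm//.
  have Az : A z <= (2 * rp z)^-1.
    rewrite /A ler_pdivrMr ?mulr_gt0// mulVf ?gt_eqF ?mulr_gt0//.
    have : cn (ph z) <= 1.
      rewrite /ph cnM cnV ler_pdivrMr ?cn_gt0 ?hp_sum_neq0// mul1r.
      rewrite -(@ler_pXn2r _ 2) ?nnegrE ?cn_ge0//.
      by rewrite !cn_sqr !(rpD, rpN, ipD, ipN, rpJ, ipJ); clear - h0 hz; nra.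
    by have := cn_ge0 (ph z); have := sqr_ge0 (cn (g z)); clear - hz; nra.
  have Az0 : 0 <= A z.
    by rewrite /A divr_ge0 ?subr_ge0 ?ler_pXn2r ?nnegrE ?cn_ge0 ?sch ?mulr_ge0// ltW.
  have h1 : 1 - cn (1 + h) ^+ 2 <= 2 * cn h.
    have := cn_distD 1 h; rewrite cn1; have := cn_ge0 (1 + h); have := cn_ge0 h.
    move: (cn h) (cn (1 + h)) => a b; clear - a b; have [|] := leP a 1; nra.
  move=> h2.
  have h3 : cn (L - h * cj (g z)) ^+ 2 <= 2 * cn h * K.
    have D0 : 0 <= 1 - cn (1 + h) ^+ 2.
      have := sch u hu; rewrite gE phE cnM !cnR gtr0_norm// ger_pMr// => h5.
      by rewrite subr_ge0 exprn_ile1// cn_ge0.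
    have w1 : (1 - cn (1 + h) ^+ 2) / (2 * rp u) * A z <= 2 * cn h / (2 * rp m0) / (2 * rp z).
      apply: ler_pM => //; first by rewrite divr_ge0// mulr_ge0// ltW.
      apply: ler_pM => //; first by rewrite invr_ge0 mulr_ge0// ltW.
      by rewrite lef_pV2 ?posrE ?mulr_gt0// /u rpD /=; clear - h0 t0; lra.
    have w2 : cn (L - h * cj (g z)) ^+ 2 <= cn (u + cj z) ^+ 2 * (2 * cn h / (2 * rp m0) / (2 * rp z)).
      rewrite [X in _ <= X]mulrC -ler_pdivrMr ?exprn_gt0//; apply: le_trans w1.
      by move: h2; rewrite exprVn -mulrA -[X in _ <= X]mulrA -[X in _ <= X]mulrA ler_pM2l ?exprn_gt0// mulrA.
    apply: le_trans w2 _; rewrite hK.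
    have M2 : cn (u + cj z) ^+ 2 <= (cn (m0 + cj z) + 1) ^+ 2.
      by rewrite ler_pXn2r ?nnegrE ?cn_ge0// addr_ge0// cn_ge0.
    have ch := cn_ge0 h.
    apply: le_trans (ler_wpM2r _ M2) _; first by rewrite !divr_ge0 ?mulr_ge0// ltW.
    by rewrite le_eqVlt; apply/orP; left; apply/eqP; field; rewrite !gt_eqF.
  have h4 : cn L <= cn (L - h * cj (g z)) + cn h.
    rewrite -{1}(subrK (h * cj (g z)) L); apply: le_trans (cnD _ _) _; rewrite lerD2l cnM cnJ.
    by rewrite ler_piMr ?cn_ge0// g1.
  have := cn_ge0 L; have := cn_ge0 h; have := cn_ge0 (L - h * cj (g z)).
  move: h3 h4 hs; move: (cn L) (cn (L - _)) (cn h) => a b c h3 h4 hs b0 c0 a0.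
  have : a ^+ 2 <= 2 * b ^+ 2 + 2 * c ^+ 2.
    apply: le_trans (_ : (b + c) ^+ 2 <= _); first by rewrite ler_pXn2r ?nnegrE ?addr_ge0.
    by have := sqr_ge0 (b - c); rewrite sqrrB sqrrD; clear - a b c; lra.
  have : c ^+ 2 <= e.
    rewrite expr2; apply: le_trans (_ : c * 1 <= _); last by rewrite mulr1.
    by rewrite ler_wpM2l// (le_trans hs).
  have : 2 * c * K <= 2 * e * K by rewrite ler_wpM2r ?ler_wpM2l// ltW.
  clear - h3; lra.
apply/eqP; rewrite -cn_eq0 -sqrf_eq0 eq_le sqr_ge0 andbT; apply/ler_addgt0Pl => e e_0; rewrite addr0.
have D0 : 0 < 4 * K + 2 by arith.
apply: le_trans (small (Num.min 1 (e / (4 * K + 2))) _ _) _.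
- by rewrite lt_min ltr01 divr_gt0.
- by rewrite ge_min lexx.
- by rewrite -ler_pdivlMr// ge_min lexx orbT.
Qed.
End Taylor.

Section Calculus.
Variable R : realType.
Notation C := R[i].

Lemma diff_cdif (f : Cplx R -> Cplx R) (w : Cplx R) : differentiable f w -> cdif f w ('d f w 1).
Proof.
move=> df e e0; have [d d0 hd] := differentiable_eps df e0.
exists d => // v hv; have := hd (v - w); rewrite subrK cnoE ltcR => /(_ hv).
have -> : 'd f w (v - w) = ('d f w 1) * (v - w).
  have -> : 'd f w 1 * (v - w) = (v - w) *: ('d f w 1 : Cplx R) by rewrite mulrC.
  by rewrite -linearZ /= [_ *: _]mulr1.
by rewrite !cnoE -rmorphM lecR.
Qed.

Lemma cdif_unique (f : C -> C) (w l k : C) : cdif f w l -> cdif f w k -> l = k.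
Proof.
move=> hl hk; apply/subr0_eq/eqP; rewrite -cn_eq0 eq_le cn_ge0 andbT.
apply/ler_addgt0Pl => e e0; rewrite addr0.
have e2 : 0 < e / 2 by arith.
have [d1 d10 h1] := hl _ e2; have [d2 d20 h2] := hk _ e2.
have [t [t0 t1 t2]] : exists t : R, [/\ 0 < t, t < d1 & t < d2].
  exists (Num.min (d1 / 2) (d2 / 2)); rewrite !lt_min !gt_min.
  split; rewrite ?(divr_gt0 d10) ?(divr_gt0 d20) ?ltr0n //; apply/orP; [left|right]; arith.
have vE : w + t%:C - w = t%:C by rewrite addrC addKr.
have {}h1 := h1 (w + t%:C); have {}h2 := h2 (w + t%:C).
rewrite !vE cnR gtr0_norm// in h1 h2.
have : cn ((l - k) * t%:C) <= e * t.
  rewrite (_ : (l - k) * t%:C = (f (w + t%:C) - f w - k * t%:C) - (f (w + t%:C) - f w - l * t%:C)); last by ring.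
  by apply: le_trans (cnB _ _) _; have := h1 t1; have := h2 t2; arith.
by rewrite cnM cnR gtr0_norm// ler_pM2r.
Qed.

Lemma cdif_comp (f g : C -> C) (w l k : C) : cdif f w l -> cdif g (f w) k ->
  cdif (fun x => g (f x)) w (k * l).
Proof.
move=> hf hg e e0; have k0 := cn_ge0 k; have l0 := cn_ge0 l.
have e1 : 0 < e / (2 * (cn l + 1)) by rewrite divr_gt0//; arith.
have [d1 d10 h1] := hg _ e1.
have e2 : 0 < Num.min 1 (e / (2 * (cn k + 1))).
  by rewrite lt_min ltr01 divr_gt0//; arith.
have [d2 d20 h2] := hf _ e2.
exists (Num.min d2 (d1 / (cn l + 1))).
  by rewrite lt_min d20 divr_gt0//; arith.
move=> v; rewrite lt_min => /andP[v2 v1]; have := h2 _ v2 => hv.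
have v0 := cn_ge0 (v - w).
have hv1 : cn (f v - f w - l * (v - w)) <= cn (v - w).
  by apply: le_trans hv _; rewrite -[X in _ <= X]mul1r ler_wpM2r// ge_min lexx.
have hv2 : cn (f v - f w - l * (v - w)) <= e / (2 * (cn k + 1)) * cn (v - w).
  by apply: le_trans hv _; rewrite ler_wpM2r// ge_min lexx orbT.
have hf1 : cn (f v - f w) <= (cn l + 1) * cn (v - w).
  rewrite -[f v - f w](subrK (l * (v - w))); apply: le_trans (cnD _ _) _.
  by rewrite cnM mulrDl mul1r addrC lerD2l.
have hf2 : cn (f v - f w) < d1.
  by apply: le_lt_trans hf1 _; rewrite mulrC -ltr_pdivlMr//; arith.
have := h1 _ hf2 => hg1.
rewrite [X in cn X <= _](_ : _ = (g (f v) - g (f w) - k * (f v - f w)) + k * (f v - f w - l * (v - w))); last by ring.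
apply: le_trans (cnD _ _) _; rewrite cnM.
have b1 : cn (g (f v) - g (f w) - k * (f v - f w)) <= e / 2 * cn (v - w).
  apply: le_trans hg1 _; apply: le_trans (ler_wpM2l (ltW e1) hf1) _.
  rewrite mulrA ler_wpM2r//.
  have X0 : 0 < cn l + 1 by arith.
  move: X0; move: (cn l + 1) => X X0.
  by rewrite le_eqVlt; apply/orP; left; apply/eqP; field; rewrite gt_eqF.
have b2 : cn k * cn (f v - f w - l * (v - w)) <= e / 2 * cn (v - w).
  apply: le_trans (ler_wpM2l k0 hv2) _; rewrite mulrA ler_wpM2r//.
  have X0 : 0 < cn k + 1 by arith.
  rewrite (_ : e / 2 = (cn k + 1) * (e / (2 * (cn k + 1)))).
    have P : 0 <= e / (2 * (cn k + 1)) by rewrite divr_ge0//; [exact: ltW|arith].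
    by rewrite ler_wpM2r//; arith.
  by move: X0; move: (cn k + 1) => X X0; field; rewrite gt_eqF.
arith.
Qed.
End Calculus.

Section Sections.
Variable R : realType.
Notation C := R[i].

(** Once the value at [m0] is given, only [al] is left free: the imaginary coefficient depends on
    that value alone. Comparisons of curves through a common point become comparisons of one real
    number. *)
Lemma quad_base (al be ga : R) (m0 m : C) : 0 < rp m0 ->
  quad al be ga m = quad al be ga m0 +
    (m - m0) * ('i * (ip (quad al be ga m0) / rp m0)%:C + al%:C * (m + cj m0)).
Proof.
case: m0 => x0 y0 /= h0; case: m => x y; rewrite !quadE.
apply: cxP => /=; field; rewrite ?gt_eqF//.
Qed.

Lemma quad_inj (al be ga al' be' ga' : R) (m0 m1 : C) : 0 < rp m0 -> 0 < rp m1 -> m0 != m1 ->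
  quad al be ga m0 = quad al' be' ga' m0 -> quad al be ga m1 = quad al' be' ga' m1 ->
  [/\ al = al', be = be' & ga = ga'].
Proof.
move=> h0 h1 ne e0 e1.
have n0 := hp_sum_neq0 h1 h0.
have al_eq : al = al'.
  have := e1; rewrite (quad_base _ _ _ m1 h0) (quad_base al' _ _ m1 h0) e0 => /addrI.
  have n1 : m1 - m0 != 0 by rewrite subr_eq0 eq_sym.
  by move=> /(mulfI n1) /addrI /(mulIf n0) [].
subst al'; move: e0 h0; case: m0 {ne e1 n0} => x y; rewrite !quadE /= => -[e1 e2] x0.
have be_eq : be = be'.
  by have /addrI /(mulIf (lt0r_neq0 x0)) := e2.
by subst be'; split => //; move: e1; arith.
Qed.

(** The difference between [D] and the curve at [m2] is a real multiple of each of two complex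
    numbers whose ratio is not real. *)
Lemma third_point (al be ga al1 be1 ga1 al2 be2 ga2 : R) (m0 m1 m2 D : C) :
  0 < rp m0 -> 0 < rp m1 ->
  ip ((m2 - m0) * (m2 + cj m0) * cj ((m2 - m1) * (m2 + cj m1))) <> 0 ->
  quad al1 be1 ga1 m0 = quad al be ga m0 -> quad al1 be1 ga1 m2 = D ->
  quad al2 be2 ga2 m1 = quad al be ga m1 -> quad al2 be2 ga2 m2 = D ->
  D = quad al be ga m2.
Proof.
move=> h0 h1 hN e0 d0 e1 d1.
have a0 : D - quad al be ga m2 = (al1 - al)%:C * ((m2 - m0) * (m2 + cj m0)).
  by rewrite -d0 (quad_base al1 _ _ m2 h0) (quad_base al _ _ m2 h0) e0 rCD rCN; ring.
have a1 : D - quad al be ga m2 = (al2 - al)%:C * ((m2 - m1) * (m2 + cj m1)).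
  by rewrite -d1 (quad_base al2 _ _ m2 h1) (quad_base al _ _ m2 h1) e1 rCD rCN; ring.
apply/subr0_eq; rewrite a0; move: hN; rewrite a1 in a0; move: a0.
move: ((m2 - m0) * _) ((m2 - m1) * _) => p q pq hN.
suff -> : al1 - al = 0 by rewrite mul0r.
have : ip ((al1 - al)%:C * (p * cj q)) = 0.
  by rewrite mulrA -pq -mulrA mulcJ -rCM.
rewrite ipM /= mul0r addr0 => /eqP; rewrite mulf_eq0 => /orP[/eqP //|/eqP].
by move=> e; case: hN.
Qed.

(** The values at 1 and 2 fix one curve. Off the real axis these two base points settle any third
    point; a real point needs the base points 1 and [1 +i* 1], the latter being already settled. *)
Lemma section_quad (Dt : C -> C) :
  (forall m m', 0 < rp m -> 0 < rp m' -> m != m' -> exists al be ga,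
    [/\ good_quad al be ga, Dt m = quad al be ga m & Dt m' = quad al be ga m']) ->
  exists al be ga, good_quad al be ga /\ forall m, 0 < rp m -> Dt m = quad al be ga m.
Proof.
move=> H.
have r1 : 0 < rp (1 : C) by rewrite /=.
have r2 : 0 < rp (2 : C) by rewrite -rCnat /=; arith.
have n12 : 1 != 2 :> C by rewrite -subr_eq0 (_ : 1 - 2 = -1); [rewrite oppr_eq0 oner_eq0|ring].
have [al [be [ga [gq q1 q2]]]] := H _ _ r1 r2 n12.
exists al, be, ga; split => //.
have gen m0 m1 m : 0 < rp m0 -> 0 < rp m1 -> 0 < rp m -> 
    Dt m0 = quad al be ga m0 -> Dt m1 = quad al be ga m1 ->
    ip ((m - m0) * (m + cj m0) * cj ((m - m1) * (m + cj m1))) <> 0 -> Dt m = quad al be ga m.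
  move=> h0 h1 h2 e0 e1 hN.
  have [m01|m01] := eqVneq m0 m; first by rewrite -m01.
  have [m11|m11] := eqVneq m1 m; first by rewrite -m11.
  have [al1 [be1 [ga1 [_ f1 g1]]]] := H _ _ h0 h2 m01.
  have [al2 [be2 [ga2 [_ f2 g2]]]] := H _ _ h1 h2 m11.
  exact: (third_point h0 h1 hN (etrans (esym f1) e0) (esym g1) (etrans (esym f2) e1) (esym g2)).
have nonreal m : 0 < rp m -> ip m != 0 -> Dt m = quad al be ga m.
  move=> h y0; apply: (gen _ _ _ r1 r2 h q1 q2).
  case: m h y0 => x y /= x0 y0.
  rewrite [X in X <> _](_ : _ = - 6 * (x * y)); last by ring.
  by apply/eqP; rewrite mulf_neq0 ?oppr_eq0 ?mulf_neq0 ?pnatr_eq0// gt_eqF.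
move=> m h; have [y0|] := eqVneq (ip m) 0; last exact: nonreal.
have [->//|m1] := eqVneq m 1.
have r3 : 0 < rp (1 +i* 1 : C) by [].
have i3 : ip (1 +i* 1 : C) != 0 by rewrite oner_eq0.
apply: (gen _ _ _ r1 r3 h q1 (nonreal _ r3 i3)).
case: m h y0 m1 => x y /= x0 -> m1.
have x1 : x != 1 by apply: contra m1 => /eqP ->.
rewrite [X in X <> _](_ : _ = 2 * (x - 1) * (x + 1) * x); last by ring.
have x2 : 0 < x + 1 by arith.
by apply/eqP; rewrite !mulf_neq0 ?pnatr_eq0 ?subr_eq0 ?(gt_eqF x0) ?(gt_eqF x2).
Qed.
End Sections.

(** * Parametrised geodesics and their uniqueness *)

Section Curves.
Variable R : realType.
Notation C := R[i].
Notation G := (symmetrized_bidisc R).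
Notation H := (@half_plane R).

Definition gk (om : C) (al be ga : R) (m : Cplx R) : Cplx2 R := cinv om m (quad al be ga m).
Definition geod (om : C) (al be ga : R) : set (Cplx2 R) :=
  [set x | G x /\ cD om x = quad al be ga (cm om x)].

Lemma gkP om al be ga m : cn om = 1 -> good_quad al be ga -> 0 < rp m ->
  [/\ G (gk om al be ga m), cm om (gk om al be ga m) = m &
      cD om (gk om al be ga m) = quad al be ga m].
Proof. by move=> o1 gq hm; apply: Hs_G => //; exact: good_quad_Hs. Qed.

Lemma gk_geod om al be ga m : cn om = 1 -> good_quad al be ga -> 0 < rp m ->
  geod om al be ga (gk om al be ga m).
Proof. by move=> o1 gq hm; have [h1 h2 h3] := gkP o1 gq hm; split; rewrite ?h2. Qed.

Lemma geod_gk om al be ga x : cn om = 1 -> geod om al be ga x ->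
  x = gk om al be ga (cm om x).
Proof. by move=> o1 [Gx e]; rewrite /gk -e cinvK. Qed.

Lemma cden_differentiable om (x : Cplx2 R) : differentiable (cden om : Cplx2 R -> Cplx R) x.
Proof.
exact: (dfD (dfB (dfc x 1) (dfM (dfc x om) (differentiable_fst x)))
  (dfM (dfc x (om ^+ 2)) (differentiable_snd x))).
Qed.

Lemma cm_differentiable om (x : Cplx2 R) : cn om = 1 -> G x ->
  differentiable (cm om : Cplx2 R -> Cplx R) x.
Proof.
move=> o1 Gx; have d0 := cden_neq0 o1 Gx.
exact: (df_div (dfB (dfc x 1) (dfM (dfc x (om ^+ 2)) (differentiable_snd x)))
  (cden_differentiable om x) d0).
Qed.

Lemma cD_differentiable om (x : Cplx2 R) : cn om = 1 -> G x ->
  differentiable (cD om : Cplx2 R -> Cplx R) x.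
Proof.
move=> o1 Gx; have d0 : cden om x ^+ 2 != 0 by rewrite expf_neq0// cden_neq0.
exact: (df_div (dfB (dfM (dfc x (om ^+ 2)) (dfX 2 (differentiable_fst x)))
  (dfM (dfc x 4) (dfM (dfc x (om ^+ 2)) (differentiable_snd x))))
  (dfX 2 (cden_differentiable om x)) d0).
Qed.

Lemma quad_differentiable al be ga (m : Cplx R) :
  differentiable (quad al be ga : Cplx R -> Cplx R) m.
Proof.
exact: (dfB (dfD (dfM (dfc m al%:C) (dfX 2 (dfid m))) (dfM (dfc m ('i * be%:C)) (dfid m))) (dfc m ga%:C)).
Qed.

Lemma cinv_differentiable (U : normedModType C) om (f g : U -> Cplx R) (x : U) :
  differentiable f x -> differentiable g x -> Hs (f x) (g x) ->
  differentiable (fun y => cinv om (f y) (g y)) x.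
Proof.
move=> df dg /Hs_den_neq0 d0.
have de := dfB (dfX 2 df) dg.
have d2 := dfM (dfc x 2) df.
have dd := dfD (dfD de d2) (dfc x 1).
exact: (differentiable_pair
  (dfM (dfc x om^-1) (df_div (dfM (dfc x 2) (dfB de (dfc x 1))) dd d0))
  (dfM (dfc x (om ^- 2)) (df_div (dfD (dfB de d2) (dfc x 1)) dd d0))).
Qed.

Lemma gk_differentiable om al be ga (m : Cplx R) : good_quad al be ga -> 0 < rp m ->
  differentiable (gk om al be ga) m.
Proof.
move=> gq hm.
exact: (cinv_differentiable om (dfid m) (quad_differentiable al be ga m) (good_quad_Hs gq hm)).
Qed.

Lemma cayley_differentiable (m : Cplx R) : m + 1 != 0 ->
  differentiable (fun m : Cplx R => (m - 1) / (m + 1) : Cplx R) m.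
Proof. exact: (df_div (dfB (dfid m) (dfc m 1)) (dfD (dfid m) (dfc m 1))). Qed.

Lemma cayley_inj (x y : C) : x + 1 != 0 -> y + 1 != 0 ->
  (x - 1) / (x + 1) = (y - 1) / (y + 1) -> x = y.
Proof. by move=> x1 y1 e; rewrite -(cayleyK x1) e cayleyK. Qed.

Lemma cn_sum_sub (x y : C) : cn (x + cj y) ^+ 2 = cn (x - y) ^+ 2 + 4 * (rp x * rp y).
Proof. by rewrite !cn_sqr !(rpD, rpN, ipD, ipN, rpJ, ipJ); ring. Qed.

Lemma cn_hp_cayley (x y : C) : 0 < rp x -> 0 < rp y -> cn ((x - y) / (x + cj y)) <= 1.
Proof.
move=> x0 y0; rewrite cnM cnV ler_pdivrMr ?cn_gt0 ?hp_sum_neq0// mul1r.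
by rewrite -(@ler_pXn2r _ 2) ?nnegrE ?cn_ge0// cn_sum_sub lerDl mulr_ge0// mulr_ge0// ltW.
Qed.

Lemma hp_cayley_inj (m0 x y : C) : 0 < rp m0 -> 0 < rp x -> 0 < rp y ->
  (x - m0) / (x + cj m0) = (y - m0) / (y + cj m0) -> x = y.
Proof.
move=> h0 hx hy; have n1 := hp_sum_neq0 hx h0; have n2 := hp_sum_neq0 hy h0.
move/eqP; rewrite eqr_div// => /eqP e.
have : (x - y) * (m0 + cj m0) = 0.
  rewrite (_ : _ * _ = (x - m0) * (y + cj m0) - (y - m0) * (x + cj m0)); last by ring.
  by rewrite e subrr.
by move/eqP; rewrite mulf_eq0 (negPf (hp_sum_neq0 h0 h0)) orbF => /eqP /subr0_eq.
Qed.

Lemma pick_contraction (F : Cplx R -> Cplx R) (m0 m1 : C) : holomorphic_on H F ->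
  (forall m : C, 0 < rp m -> 0 < rp (F m)) -> 0 < rp m0 -> 0 < rp m1 ->
  cn (F m0 - F m1) ^+ 2 / (rp (F m0) * rp (F m1)) <= cn (m0 - m1) ^+ 2 / (rp m0 * rp m1).
Proof.
move=> hF F0 h0 h1.
pose g (m : Cplx R) : Cplx R := (F m - F m0) / (F m + cj (F m0)).
have hg : holomorphic_on H g.
  move=> m hm; have dF := hF _ hm; have n0 := hp_sum_neq0 (F0 _ hm) (F0 _ h0).
  exact: (df_div (dfB dF (dfc m (F m0))) (dfD dF (dfc m (cj (F m0)))) n0).
have := @schwarz_hp _ g m0 m1 hg (fun m hm => cn_hp_cayley (F0 _ hm) (F0 _ h0)) h0 h1.
have -> : g m0 = 0 by rewrite /g subrr mul0r.
move=> /(_ erefl); rewrite /g cnM cnV.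
have a0 : 0 < cn (m1 + cj m0) by rewrite cn_gt0 hp_sum_neq0.
have b0 : 0 < cn (F m1 + cj (F m0)) by rewrite cn_gt0 (hp_sum_neq0 (F0 _ h1) (F0 _ h0)).
rewrite mulrAC ler_pdivrMr// => h.
have : (cn (F m1 - F m0) * cn (m1 + cj m0)) ^+ 2 <= (cn (m1 - m0) * cn (F m1 + cj (F m0))) ^+ 2.
  by rewrite ler_pXn2r ?nnegrE ?mulr_ge0 ?cn_ge0.
rewrite !exprMn !cn_sum_sub (cnBC m0) (cnBC (F m0)) (mulrC (rp m1)) (mulrC (rp (F m1))).
have p0 : 0 < rp m0 * rp m1 by exact: mulr_gt0.
have q0 : 0 < rp (F m0) * rp (F m1) by rewrite mulr_gt0 ?F0.
move: (cn (F m1 - F m0) ^+ 2) (cn (m1 - m0) ^+ 2) (rp m0 * rp m1) (rp (F m0) * rp (F m1)) p0 q0 => a b p q p0 q0 h2.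
by rewrite ler_pdivrMr// mulrAC ler_pdivlMr//; arith.
Qed.

(** In any other chart, [cm] composed with the section is a holomorphic self-map of the half-plane,
    hence a contraction. So the chart [om] separates any two points of the section best, and the fit
    applies in this chart. *)
Lemma section_geod om (kt : Cplx R -> Cplx2 R) : cn om = 1 -> holomorphic_on H kt ->
  (forall m : C, 0 < rp m -> G (kt m) /\ cm om (kt m) = m) ->
  exists al be ga, good_quad al be ga /\ forall m : C, 0 < rp m -> kt m = gk om al be ga m.
Proof.
move=> o1 hk kP.
have [|al [be [ga [gq e]]]] := @section_quad R (fun m => cD om (kt m)).
  move=> m m' h h' mm; have [G1 e1] := kP _ h; have [G2 e2] := kP _ h'.
  have [||al [be [ga]]] := chart_dist_fit o1 G1 G2; rewrite ?e1 ?e2 //; last by exists al, be, ga.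
  move=> b; rewrite /chart_dist e1 e2.
  have o2 : cn (om * ub b) = 1 by rewrite cnM o1 cn_ub mulr1.
  have hF : holomorphic_on H (fun m => cm (om * ub b) (kt m) : Cplx R).
    by move=> v hv; exact: (dfcomp (hk _ hv) (cm_differentiable o2 (kP _ hv).1)).
  have F0 (v : C) : 0 < rp v -> 0 < rp (cm (om * ub b) (kt v)).
    by move=> hv; exact: (cm_gt0 o2 (kP _ hv).1).
  have := pick_contraction hF F0 h h'; exact.
exists al, be, ga; split=> // m hm; have [Gm em] := kP _ hm.
by rewrite /gk -e // -{2}em cinvK.
Qed.

Lemma gk_inj2 om al be ga al' be' ga' m0 m1 : cn om = 1 -> good_quad al be ga ->
  good_quad al' be' ga' -> 0 < rp m0 -> 0 < rp m1 -> m0 != m1 ->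
  gk om al be ga m0 = gk om al' be' ga' m0 -> gk om al be ga m1 = gk om al' be' ga' m1 ->
  [/\ al = al', be = be' & ga = ga'].
Proof.
move=> o1 g1 g2 h0 h1 ne e0 e1.
have q (m : C) : 0 < rp m -> gk om al be ga m = gk om al' be' ga' m -> quad al be ga m = quad al' be' ga' m.
  move=> hm e; have [_ _ <-] := gkP o1 g1 hm; have [_ _ <-] := gkP o1 g2 hm; by rewrite e.
exact: (quad_inj h0 h1 ne (q _ h0 e0) (q _ h1 e1)).
Qed.

(** The image of the geodesic under [rho], followed by [cm], fixes two points of the half-plane and
    is the identity by uniqueness in the Schwarz lemma. The image is thus a section, hence again a
    quadratic curve, and it shares two points with the original one. *)
Lemma fix_two_points om al be ga (rho : Cplx2 R -> Cplx2 R) m0 m1 : cn om = 1 -> good_quad al be ga ->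
  holomorphic_on G rho -> (forall x, G x -> G (rho x)) -> 0 < rp m0 -> 0 < rp m1 -> m0 != m1 ->
  rho (gk om al be ga m0) = gk om al be ga m0 -> rho (gk om al be ga m1) = gk om al be ga m1 ->
  forall m : C, 0 < rp m -> rho (gk om al be ga m) = gk om al be ga m.
Proof.
move=> o1 gq hr rG h0 h1 ne e0 e1.
pose kt (m : Cplx R) := rho (gk om al be ga m).
have Gk (m : C) : 0 < rp m -> G (gk om al be ga m) by move=> hm; have [] := gkP o1 gq hm.
have hkt : holomorphic_on H kt.
  by move=> m hm; exact: (dfcomp (gk_differentiable om gq hm) (hr _ (Gk _ hm))).
have Gkt (m : C) : 0 < rp m -> G (kt m) by move=> hm; apply: rG; exact: Gk.
pose g (m : Cplx R) : Cplx R := (cm om (kt m) - 1) / (cm om (kt m) + 1).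
have hg : holomorphic_on H g.
  move=> m hm; have hc := cm_gt0 o1 (Gkt _ hm).
  have d1 := dfcomp (hkt _ hm) (cm_differentiable o1 (Gkt _ hm)).
  exact: (dfcomp d1 (cayley_differentiable (hp1_neq0 hc))).
have g1 (m : C) : 0 < rp m -> cn (g m) <= 1.
  by move=> hm; apply/ltW/cn_cayley/cm_gt0 => //; exact: Gkt.
have c0 : cm om (kt m0) = m0 by rewrite /kt e0; have [] := gkP o1 gq h0.
have c1 : cm om (kt m1) = m1 by rewrite /kt e1; have [] := gkP o1 gq h1.
have cE (m : C) : 0 < rp m -> cm om (kt m) = m.
  move=> hm; apply: (cayley_inj (hp1_neq0 (cm_gt0 o1 (Gkt _ hm))) (hp1_neq0 hm)).
  have G0 : g m0 = (m0 - 1) / (m0 + 1) by rewrite /g c0.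
  have G1 : g m1 = (m1 - 1) / (m1 + 1) by rewrite /g c1.
  exact: (schwarz_unique hg g1 h0 h1 hm ne G0 G1).
have [al' [be' [ga' [gq' kE]]]] := section_geod o1 hkt (fun m hm => conj (Gkt m hm) (cE m hm)).
have [] := gk_inj2 o1 gq gq' h0 h1 ne.
- by rewrite -kE.
- by rewrite -kE.
by move=> ea eb eg m hm; rewrite -[LHS]/(kt m) kE// -ea -eb -eg.
Qed.

Lemma geod_retraction om al be ga : cn om = 1 -> good_quad al be ga ->
  exists rho : Cplx2 R -> Cplx2 R,
  [/\ holomorphic_on G rho, forall u, G u -> geod om al be ga (rho u) &
      forall u, geod om al be ga u -> rho u = u].
Proof.
move=> o1 gq; pose rho (u : Cplx2 R) := gk om al be ga (cm om u); exists rho; split.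
- by move=> u Gu; exact: (dfcomp (cm_differentiable o1 Gu) (gk_differentiable om gq (cm_gt0 o1 Gu))).
- by move=> u Gu; apply: gk_geod => //; exact: cm_gt0.
- by move=> u /(geod_gk o1) e; rewrite /rho -e.
Qed.

(** The retraction onto the second geodesic fixes two points of the first, hence all of it. *)
Lemma geod_unique om al be ga om' al' be' ga' x y : cn om = 1 -> good_quad al be ga ->
  cn om' = 1 -> good_quad al' be' ga' -> x <> y ->
  geod om al be ga x -> geod om al be ga y -> geod om' al' be' ga' x -> geod om' al' be' ga' y ->
  geod om al be ga `<=` geod om' al' be' ga'.
Proof.
move=> o1 gq o1' gq' xy kx ky kx' ky' z kz.
have [rho [hr rG fixr]] := geod_retraction o1' gq'.
have cx := cm_gt0 o1 kx.1; have cy := cm_gt0 o1 ky.1; have cz := cm_gt0 o1 kz.1.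
have ne : cm om x != cm om y.
  by apply/eqP => e; apply: xy; rewrite (geod_gk o1 kx) (geod_gk o1 ky) e.
have := @fix_two_points om al be ga rho _ _ o1 gq hr (fun x Gx => (rG x Gx).1) cx cy ne.
rewrite -(geod_gk o1 kx) -(geod_gk o1 ky) !fixr// => /(_ erefl erefl _ cz).
by rewrite -(geod_gk o1 kz) => <-; apply: rG; exact: kz.1.
Qed.
End Curves.

(** * Retracts *)

Section Retracts.
Variable R : realType.
Notation C := R[i].
Notation G := (symmetrized_bidisc R).
Notation H := (@half_plane R).

Lemma cdif_id (m : C) : cdif (fun x => x) m 1.
Proof. by move=> e e0; exists 1 => // v _; rewrite mul1r subrr cn0 mulr_ge0 ?cn_ge0// ltW. Qed.

Lemma cdif_quad al be ga (m : C) : cdif (@quad R al be ga) m (2 * al%:C * m + 'i * be%:C).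
Proof.
move=> e e0; have a0 := cn_ge0 (al%:C : C).
exists (e / (cn (al%:C : C) + 1)); first by rewrite divr_gt0//; arith.
move=> v; rewrite ltr_pdivlMr; last by arith.
move=> hv; rewrite /quad.
rewrite [X in cn X <= _](_ : _ = al%:C * (v - m) * (v - m)); last by ring.
rewrite !cnM ler_wpM2r ?cn_ge0//.
by have := cn_ge0 (v - m); move: (cn (al%:C : C)) (cn (v - m)) a0 hv => *; narith.
Qed.

Lemma cdif_hp_cayley (m : C) : 0 < rp m ->
  cdif (fun v => (v - m) / (v + cj m)) m (2 * rp m)^-1%:C.
Proof.
move=> h0 e e0; have x0 : 0 < rp m ^+ 2 by rewrite exprn_gt0.
exists (Num.min (rp m) (e * rp m ^+ 2)); first by rewrite lt_min h0 mulr_gt0.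
move=> v; rewrite lt_min => /andP[v1 v2].
have vr : rp m <= cn (v + cj m).
  apply: le_trans (rp_le_cn _); apply: le_trans (ler_norm _).
  have := rp_le_cn (v - m); rewrite rpB rpD rpJ ler_norml => /andP[+ _]; arith.
have n0 : v + cj m != 0 by rewrite -cn_gt0; arith.
have E0 : m + cj m = (2 * rp m)%:C by case: (m) => a b; apply: cxP => /=; ring.
have n1 : m + cj m != 0 by rewrite E0 rC_neq0//; arith.
rewrite subrr mul0r subr0 rCV -E0.
rewrite [X in cn X <= _](_ : _ = - ((v - m) * (v - m) / ((v + cj m) * (m + cj m)))); last first.
  by move: (cj m) n0 n1 => y n0 n1; field; rewrite ?n0 ?n1.
rewrite cnN cnM cnV !cnM E0 cnR gtr0_norm; last by arith.
rewrite ler_pdivrMr; last by rewrite mulr_gt0//; arith.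
rewrite [X in _ <= X]mulrAC ler_wpM2r ?cn_ge0//; apply: le_trans (ltW v2) _.
rewrite ler_wpM2l ?(ltW e0)// expr2.
by move: (cn (v + cj m)) vr => a vr; narith.
Qed.

Lemma diff_gk_cm om al be ga (m : Cplx R) : cn om = 1 -> good_quad al be ga -> 0 < rp m ->
  'd (cm om : Cplx2 R -> Cplx R) (gk om al be ga m) ('d (gk om al be ga) m 1) = 1.
Proof.
move=> o1 gq hm; have [Gk _ _] := gkP o1 gq hm.
have dk := gk_differentiable om gq hm; have dc := cm_differentiable o1 Gk.
have := diff_cdif (differentiable_comp dk dc); rewrite diff_comp//= => h.
apply: (cdif_unique h); apply: (@cdif_local _ (fun x => x) _ _ _ (rp m) hm _ (cdif_id m)).
move=> v hv; have [] := @gkP R om al be ga v o1 gq _ => //.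
by have := rp_le_cn (v - m); rewrite rpB ler_norml => /andP[+ _]; arith.
Qed.

Lemma diff_cD_section om al be ga (k : Cplx R -> Cplx2 R) (m : Cplx R) : cn om = 1 ->
  good_quad al be ga -> 0 < rp m -> differentiable k m ->
  (forall v : C, 0 < rp v -> k v = gk om al be ga v) ->
  'd (cD om : Cplx2 R -> Cplx R) (k m) ('d k m 1) = 2 * al%:C * m + 'i * be%:C.
Proof.
move=> o1 gq hm dk kE.
have Gk : G (k m) by rewrite kE//; have [] := gkP o1 gq hm.
have dc := cD_differentiable o1 Gk.
have E := f_equal (fun f : Cplx R -> Cplx R => f 1) (diff_comp dk dc).
have h := diff_cdif (differentiable_comp dk dc).
apply: (etrans (esym E)); apply: (cdif_unique h).
apply: (@cdif_local _ (quad al be ga) _ _ _ (rp m) hm _ (@cdif_quad al be ga m)).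
move=> v hv; have hv' : 0 < rp v.
  by have := rp_le_cn (v - m); rewrite rpB ler_norml => /andP[+ _]; arith.
by rewrite /= kE//; have [] := gkP o1 gq hv'.
Qed.

(** Same scheme as for two fixed points, with the infinitesimal Schwarz lemma showing that the image
    is a section. The coefficients agree because the derivative of [cD] along a section at [m0] is
    [2 al m0 + i be], whose real and imaginary parts determine [al] and then [be]. *)
Lemma fix_tangent om al be ga (rho : Cplx2 R -> Cplx2 R) (m0 : Cplx R) : cn om = 1 -> good_quad al be ga ->
  holomorphic_on G rho -> (forall x, G x -> G (rho x)) -> 0 < rp m0 ->
  rho (gk om al be ga m0) = gk om al be ga m0 ->
  'd rho (gk om al be ga m0) ('d (gk om al be ga) m0 1) = 'd (gk om al be ga) m0 1 ->
  forall m : C, 0 < rp m -> rho (gk om al be ga m) = gk om al be ga m.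
Proof.
move=> o1 gq hr rG h0 e0 e1.
have Gk (m : C) : 0 < rp m -> G (gk om al be ga m) by move=> hm; have [] := gkP o1 gq hm.
pose kt (m : Cplx R) := rho (gk om al be ga m).
have dk0 := gk_differentiable om gq h0; have dr0 := hr _ (Gk _ h0).
have hkt : holomorphic_on H kt.
  by move=> m hm; exact: (dfcomp (gk_differentiable om gq hm) (hr _ (Gk _ hm))).
have Gkt (m : C) : 0 < rp m -> G (kt m) by move=> hm; apply: rG; exact: Gk.
have kt0 : kt m0 = gk om al be ga m0 by [].
have dkt : 'd kt m0 1 = 'd (gk om al be ga) m0 1.
  have E : 'd kt m0 = 'd rho (gk om al be ga m0) \o 'd (gk om al be ga) m0 :> (Cplx R -> Cplx2 R).
    exact: diff_comp dk0 dr0.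
  exact: (etrans (f_equal (fun f : Cplx R -> Cplx2 R => f 1) E) e1).
pose F (m : Cplx R) : Cplx R := cm om (kt m).
have F0 : F m0 = m0 by rewrite /F kt0; have [] := gkP o1 gq h0.
have hF : holomorphic_on H F.
  by move=> m hm; exact: (dfcomp (hkt _ hm) (cm_differentiable o1 (Gkt _ hm))).
have Fp (m : C) : 0 < rp m -> 0 < rp (F m) by move=> hm; exact: (cm_gt0 o1 (Gkt _ hm)).
have dF : cdif F m0 1.
  have dc : differentiable (cm om : Cplx2 R -> Cplx R) (kt m0) := cm_differentiable o1 (Gkt _ h0).
  have E : 'd F m0 = 'd (cm om : Cplx2 R -> Cplx R) (kt m0) \o 'd kt m0 :> (Cplx R -> Cplx R).
    exact: diff_comp (hkt _ h0) dc.
  have E1 := f_equal (fun f : Cplx R -> Cplx R => f 1) E.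
  have {}E1 := etrans E1 (f_equal ('d (cm om : Cplx2 R -> Cplx R) (kt m0)) dkt).
  have D1 : 'd (cm om : Cplx2 R -> Cplx R) (kt m0) ('d (gk om al be ga) m0 1) = 1.
    by rewrite kt0; exact: diff_gk_cm.
  have {}E1 := etrans E1 D1.
  have := diff_cdif (hF _ h0); move: ('d F m0 1) E1 => d ->; exact.
have FE (m : C) : F m = cm om (kt m) by [].
clearbody F.
pose g (m : Cplx R) : Cplx R := (F m - m0) / (F m + cj m0).
have hg : holomorphic_on H g.
  move=> m hm; have dF' := hF _ hm; have n0 := hp_sum_neq0 (Fp _ hm) h0.
  exact: (df_div (dfB dF' (dfc m m0)) (dfD dF' (dfc m (cj m0))) n0).
have g1 (m : C) : 0 < rp m -> cn (g m) <= 1.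
  by move=> hm; exact: (cn_hp_cayley (Fp _ hm) h0).
have dg : cdif g m0 (2 * rp m0)^-1%:C.
  have h : cdif (fun v => (v - m0) / (v + cj m0)) (F m0) (2 * rp m0)^-1%:C.
    by rewrite F0; exact: cdif_hp_cayley.
  have := cdif_comp dF h; rewrite mulr1; exact.
have cE (m : C) : 0 < rp m -> cm om (kt m) = m.
  move=> hm; have g0 : g m0 = 0 by rewrite /g F0 subrr mul0r.
  rewrite -FE; exact: (hp_cayley_inj h0 (Fp _ hm) hm (schwarz_inf hg g1 h0 hm g0 dg)).
have [al' [be' [ga' [gq' kE]]]] := section_geod o1 hkt (fun m hm => conj (Gkt m hm) (cE m hm)).
have e2 : quad al' be' ga' m0 = quad al be ga m0.
  have [_ _ d1] := gkP o1 gq' h0; have [_ _ d2] := gkP o1 gq h0.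
  by rewrite -d1 -d2 -(kE _ h0) kt0.
have e3 : 2 * al'%:C * m0 + 'i * be'%:C = 2 * al%:C * m0 + 'i * be%:C.
  rewrite -(diff_cD_section o1 gq' h0 (hkt _ h0) kE) -(diff_cD_section o1 gq h0 dk0 (fun m _ => erefl)).
  apply: (etrans (f_equal ('d (cD om : Cplx2 R -> Cplx R) (kt m0)) dkt)).
  exact: (f_equal (fun z => 'd (cD om : Cplx2 R -> Cplx R) z ('d (gk om al be ga) m0 1)) kt0).
clear dkt dk0 dr0 e1 dF dg hkt hr.
have alE : al' = al.
  have h1 := congr1 (@complex.Re _) e3; move: h1.
  have r2 (a b : R) (z : C) : rp (2 * a%:C * z + 'i * b%:C) = 2 * a * rp z.
    by rewrite -rCnat -rCM rpD rpRM rpi addr0.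
  rewrite !r2 => h1.
  by apply: (mulIf (lt0r_neq0 h0)); arith.
have beE : be' = be.
  have h1 := congr1 (@complex.Im _) e3; move: h1; rewrite alE.
  by rewrite !ipD !ipi => /addrI.
have gaE : ga' = ga.
  by move: e2; rewrite alE beE /quad => /addrI /oppr_inj [].
by move=> m hm; rewrite -[LHS]/(kt m) kE// alE beE gaE.
Qed.

Lemma two_vectors (a b : Cplx2 R) : a.1 * b.2 - a.2 * b.1 != 0 ->
  forall v : Cplx2 R, exists s t : C, v = s *: a + t *: b.
Proof.
case: a => a1 a2; case: b => b1 b2 /= d0 [v1 v2].
exists ((v1 * b2 - v2 * b1) / (a1 * b2 - a2 * b1)), ((a1 * v2 - a2 * v1) / (a1 * b2 - a2 * b1)).
by congr pair; rewrite /= /GRing.scale /=; field; rewrite d0.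
Qed.

Lemma proportional_vectors (a b : Cplx2 R) : a.1 * b.2 - a.2 * b.1 = 0 -> b != 0 ->
  exists s : C, a = s *: b.
Proof.
case: a => a1 a2; case: b => b1 b2 /= d0 n0.
have [b10|b1n] := eqVneq b1 0.
  have b2n : b2 != 0.
    by apply: contra n0 => /eqP b20; rewrite b10 b20.
  exists (a2 / b2); congr pair; rewrite /GRing.scale /=; last by rewrite divfK.
  by move: d0; rewrite b10 !mulr0 subr0 => /eqP; rewrite mulf_eq0 (negPf b2n) orbF => /eqP.
exists (a1 / b1); congr pair; rewrite /GRing.scale /=; first by rewrite divfK.
by apply: (mulIf b1n); rewrite mulrAC divfK//; apply/esym/subr0_eq.
Qed.

Lemma fixed_tangent om al be ga (rho : Cplx2 R -> Cplx2 R) z : cn om = 1 -> good_quad al be ga ->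
  differentiable rho z -> (forall u, geod om al be ga u -> rho u = u) -> geod om al be ga z ->
  'd rho z ('d (gk om al be ga) (cm om z : Cplx R) 1) = 'd (gk om al be ga) (cm om z : Cplx R) 1.
Proof.
move=> o1 gq dr fixr kz; have c1 := cm_gt0 o1 kz.1; have zE := geod_gk o1 kz.
have dk := gk_differentiable om gq c1.
rewrite zE in dr.
have dc := diff_comp dk dr; rewrite -zE in dc.
have dck := differentiable_comp dk dr.
have h e : 0 < e -> `|'d rho z ('d (gk om al be ga) (cm om z : Cplx R) 1) - 'd (gk om al be ga) (cm om z : Cplx R) 1| <= e%:C.
  move=> e0; have e2 : 0 < e / 2 by arith.
  have [d1 d10 h1] := differentiable_eps dk e2; have [d2 d20 h2] := differentiable_eps dck e2.
  have [t [t0 t1 t2 t3]] : exists t : R, [/\ 0 < t, t < d1, t < d2 & t < rp (cm om z)].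
    exists (Num.min (d1 / 2) (Num.min (d2 / 2) (rp (cm om z) / 2))).
    split; first by rewrite !lt_min !divr_gt0 ?ltr0n.
    - by apply: (@le_lt_trans _ _ (d1 / 2)); [rewrite ge_min lexx|arith].
    - by apply: (@le_lt_trans _ _ (d2 / 2)); [rewrite !ge_min lexx orbT|arith].
    - by apply: (@le_lt_trans _ _ (rp (cm om z) / 2)); [rewrite !ge_min lexx !orbT|arith].
  have tn : `|t%:C : Cplx R| = t%:C by rewrite cnoE cnR gtr0_norm.
  have {}h1 := h1 t%:C; have {}h2 := h2 t%:C; rewrite tn !ltcR in h1 h2.
  have {}h1 := h1 t1; have {}h2 := h2 t2.
  have kt : (rho \o gk om al be ga) (t%:C + cm om z) = gk om al be ga (t%:C + cm om z).
    by apply: fixr; apply: gk_geod => //; rewrite rpD /=; arith.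
  have k0 : (rho \o gk om al be ga) (cm om z) = gk om al be ga (cm om z) by apply: fixr; rewrite -zE.
  rewrite kt k0 dc /= in h2.
  have l1 (W : normedModType C) (f : {linear Cplx R -> W}) : f (t%:C : Cplx R) = t%:C *: f 1.
    by rewrite -linearZ /= [_ *: _]mulr1.
  rewrite l1 in h1; rewrite l1 linearZ /= in h2.
  have : `|t%:C *: ('d rho z ('d (gk om al be ga) (cm om z : Cplx R) 1) - 'd (gk om al be ga) (cm om z : Cplx R) 1)| <= e%:C * t%:C.
    rewrite scalerBr.
    move: h1 h2; move: (gk _ _ _ _ (_ + _) - _) (_ *: _) (_ *: _) => A X Y h1 h2.
    rewrite -[X in `|X|](_ : (A - Y) - (A - X) = _); last by rewrite opprB addrC addrA subrK.
    apply: le_trans (ler_normB _ _) _; apply: le_trans (lerD h1 h2) _.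
    by rewrite -mulrDl -rCD -splitr.
  rewrite normrZ [`|t%:C|]tn mulrC ler_pM2r//; by rewrite posC.
apply/subr0_eq/eqP; rewrite -normr_le0; apply/ler_addgt0Pl => e e0; rewrite addr0.
have [-> e1] := pos_complexE e0; exact: h.
Qed.

(** The retraction onto the second geodesic fixes the common tangent direction, hence fixes the
    first geodesic pointwise. *)
Lemma geod_tangent om al be ga om' al' be' ga' z (s : C) : cn om = 1 -> good_quad al be ga ->
  cn om' = 1 -> good_quad al' be' ga' -> geod om al be ga z -> geod om' al' be' ga' z ->
  'd (gk om al be ga) (cm om z : Cplx R) 1 = s *: 'd (gk om' al' be' ga') (cm om' z : Cplx R) 1 ->
  geod om al be ga `<=` geod om' al' be' ga'.
Proof.
move=> o1 gq o1' gq' kz kz' e w kw.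
have [rho [hr rG fixr]] := geod_retraction o1' gq'.
have c1 := cm_gt0 o1 kz.1; have c1' := cm_gt0 o1' kz'.1.
have zE := geod_gk o1 kz.
have drz := fixed_tangent o1' gq' (hr _ kz.1) fixr kz'.
have := @fix_tangent om al be ga rho (cm om z) o1 gq hr (fun x Gx => (rG x Gx).1) c1.
rewrite -zE fixr// e linearZ /= drz => /(_ erefl erefl (cm om w) (cm_gt0 o1 kw.1)).
by rewrite -(geod_gk o1 kw) => <-; apply: rG; exact: kw.1.
Qed.

Lemma gk_tangent_neq0 om al be ga (m : Cplx R) : cn om = 1 -> good_quad al be ga -> 0 < rp m ->
  'd (gk om al be ga) m 1 != 0.
Proof.
move=> o1 gq hm; apply/eqP => e; have := diff_gk_cm o1 gq hm.
by rewrite e linear0 => /esym/eqP; rewrite oner_eq0.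
Qed.

Lemma geod_exists x y : G x -> G y -> x <> y -> exists (om : C) (al be ga : R),
  [/\ cn om = 1, good_quad al be ga, geod om al be ga x & geod om al be ga y].
Proof.
move=> Gx Gy xy; have [ om [al [be [ga [ o1 gq _ e1 e2]]]]] := fit_exists Gx Gy xy.
by exists om, al, be, ga.
Qed.

Lemma fix_geod om al be ga (rho : Cplx2 R -> Cplx2 R) x y : cn om = 1 -> good_quad al be ga ->
  holomorphic_on G rho -> (forall x, G x -> G (rho x)) -> x <> y ->
  geod om al be ga x -> geod om al be ga y -> rho x = x -> rho y = y ->
  forall z, geod om al be ga z -> rho z = z.
Proof.
move=> o1 gq hr rG xy kx ky e0 e1 z kz.
have cx := cm_gt0 o1 kx.1; have cy := cm_gt0 o1 ky.1; have cz := cm_gt0 o1 kz.1.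
have ne : cm om x != cm om y.
  by apply/eqP => e; apply: xy; rewrite (geod_gk o1 kx) (geod_gk o1 ky) e.
have := @fix_two_points _ om al be ga rho _ _ o1 gq hr rG cx cy ne.
by rewrite -(geod_gk o1 kx) -(geod_gk o1 ky) => /(_ e0 e1 _ cz); rewrite -(geod_gk o1 kz).
Qed.

Lemma geod_two om al be ga : cn om = 1 -> good_quad al be ga -> exists x y : Cplx2 R,
  [/\ geod om al be ga x, geod om al be ga y & x <> y].
Proof.
move=> o1 gq.
have r1 : 0 < rp (1 : C) by rewrite /=.
have r2 : 0 < rp (2 : C) by rewrite -rCnat /=; arith.
exists (gk om al be ga 1), (gk om al be ga 2); split; [exact: gk_geod|exact: gk_geod|].
move=> /(congr1 (cm om)); have [_ -> _] := gkP o1 gq r1; have [_ -> _] := gkP o1 gq r2.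
move=> /eqP; rewrite -subr_eq0 (_ : 1 - 2 = -1); last by ring.
by rewrite oppr_eq0 oner_eq0.
Qed.

(* A retract containing two geodesics through a point has the identity as
   derivative there, since two such geodesics have independent tangents. *)
Lemma retract_cases (V : set (Cplx2 R)) x y : retract_in G V -> V x -> V y -> x <> y ->
  exists (om : C) (al be ga : R),
  [/\ cn om = 1, good_quad al be ga, geod om al be ga x, geod om al be ga y &
      geod om al be ga `<=` V /\ (V = geod om al be ga \/ V = G)].
Proof.
move=> [rho [hr rG rr VE]] Vx Vy xy.
have fixV z : V z <-> G z /\ rho z = z.
  rewrite VE; split=> [[w Gw <-]|[Gz <-]]; last by exists z.
  by split; [exact: rG|exact: rr].
have [Gx ex] := (fixV x).1 Vx; have [Gy ey] := (fixV y).1 Vy.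
have [ om [al [be [ga [ o1 gq kx ky]]]]] := geod_exists Gx Gy xy.
have KV z : geod om al be ga z -> V z.
  by move=> kz; apply/fixV; split; [exact: kz.1|exact: (fix_geod o1 gq hr rG xy kx ky ex ey kz)].
exists om, al, be, ga; split=> //; split; first exact: KV.
have [VK|/existsNP[z /not_implyP[Vz nz]]] := pselect (forall z, V z -> geod om al be ga z).
  by left; apply/seteqP; split.
right; have [Gz ez] := (fixV z).1 Vz.
have [w1 [w2 [kw1 kw2 w12]]] := geod_two o1 gq.
have zw1 : z <> w1 by move=> e; apply: nz; rewrite e.
have zw2 : z <> w2 by move=> e; apply: nz; rewrite e.
have [ om1 [al1 [be1 [ga1 [ o11 gq1 k1z k1w]]]]] := geod_exists Gz kw1.1 zw1.
have [ om2 [al2 [be2 [ga2 [ o12 gq2 k2z k2w]]]]] := geod_exists Gz kw2.1 zw2.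
have c1 := cm_gt0 o11 Gz; have c2 := cm_gt0 o12 Gz.
pose v1 : Cplx2 R := 'd (gk om1 al1 be1 ga1) (cm om1 z : Cplx R) 1.
pose v2 : Cplx2 R := 'd (gk om2 al2 be2 ga2) (cm om2 z : Cplx R) 1.
(* Dependent tangents would put the geodesic from [z] to [w1] inside the one from [z] to [w2].
   Containing both [w1] and [w2], the latter would lie in the original geodesic, which misses
   [z]. *)
have indep : v1.1 * v2.2 - v1.2 * v2.1 != 0.
  apply/eqP => d0; have [s es] := proportional_vectors d0 (gk_tangent_neq0 o12 gq2 c2).
  have k12 := geod_tangent o11 gq1 o12 gq2 k1z k2z es.
  by apply: nz; apply: (geod_unique o12 gq2 o1 gq w12 (k12 _ k1w) k2w kw1 kw2).
have dv om' al' be' ga' w : cn om' = 1 -> good_quad al' be' ga' -> geod om' al' be' ga' z -> 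
    geod om' al' be' ga' w -> z <> w -> V w ->
    'd rho z ('d (gk om' al' be' ga') (cm om' z : Cplx R) 1) = 'd (gk om' al' be' ga') (cm om' z : Cplx R) 1.
  move=> o1' gq' kz kw zw Vw; have [Gw ew] := (fixV w).1 Vw.
  exact: (fixed_tangent o1' gq' (hr _ Gz) (fix_geod o1' gq' hr rG zw kz kw ez ew) kz).
have dv1 : 'd rho z v1 = v1 := dv _ _ _ _ _ o11 gq1 k1z k1w zw1 (KV _ kw1).
have dv2 : 'd rho z v2 = v2 := dv _ _ _ _ _ o12 gq2 k2z k2w zw2 (KV _ kw2).
have drho (v : Cplx2 R) : 'd rho z v = v.
  have [s [t ->]] := two_vectors indep v.
  by move: v1 v2 dv1 dv2 {indep} => u1 u2 e1 e2; rewrite linearD !linearZ /= e1 e2.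
apply/seteqP; split=> u; first by move=> /fixV[].
move=> Gu; apply/fixV; split=> //.
have [->//|zu] := pselect (u = z).
have zu' : z <> u by move=> e; apply: zu.
(* Since the derivative at [z] is the identity, [rho] fixes every geodesic through [z], and each
   point of [G] lies on one. *)
have [ om3 [al3 [be3 [ga3 [ o13 gq3 k3z k3u]]]]] := geod_exists Gz Gu zu'.
have := @fix_tangent om3 al3 be3 ga3 rho (cm om3 z) o13 gq3 hr rG (cm_gt0 o13 Gz).
rewrite -(geod_gk o13 k3z) => /(_ ez (drho _) _ (cm_gt0 o13 Gu)).
by rewrite -(geod_gk o13 k3u).
Qed.
End Retracts.

(** * Perturbations and the nodes of the charts *)

Section Domain.
Variable R : realType.
Notation C := R[i].
Notation G := (symmetrized_bidisc R).

Lemma ball2P (x y : Cplx2 R) (d : R) :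
  `|y - x| < d%:C <-> cn (y.1 - x.1) < d /\ cn (y.2 - x.2) < d.
Proof.
rewrite prod_normE /= !cnoE /Order.max ltcR; case: ifPn => h; rewrite ltcR.
  by split=> [h2|[]//]; split=> //; exact: lt_trans h2.
by split=> [h2|[]//]; split=> //; move: h; rewrite -leNgt => h; exact: le_lt_trans h2.
Qed.

Lemma nbhs2P (x : Cplx2 R) (P : set (Cplx2 R)) :
  nbhs x P <-> exists2 d : R, 0 < d &
    forall y : Cplx2 R, cn (y.1 - x.1) < d -> cn (y.2 - x.2) < d -> P y.
Proof.
split=> [/nbhs_normC[d d0 h]|[d d0 h]].
  by exists d => // y h1 h2; apply: h; apply/ball2P.
by apply/nbhs_normC; exists d => // y /ball2P[]; exact: h.
Qed.

Lemma open2P (A : set (Cplx2 R)) : (forall x, A x -> nbhs x A) -> open A.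
Proof. by move=> h; rewrite openE => x /h. Qed.

Lemma df_near (f : Cplx2 R -> Cplx R) (x : Cplx2 R) : differentiable f x ->
  forall e : R, 0 < e -> exists2 d : R, 0 < d &
    forall y : Cplx2 R, cn (y.1 - x.1) < d -> cn (y.2 - x.2) < d -> cn (f y - f x) < e.
Proof.
move=> /differentiable_continuous df e e0.
have : nbhs x (f @^-1` [set y | `|y - f x| < e%:C]).
  by apply: df; apply/nbhs_normC; exists e.
by move=> /nbhs2P[d d0 h]; exists d => // y h1 h2; have := h y h1 h2; rewrite /= cnoE ltcR.
Qed.

Lemma G_identity (z w : C) :
  (1 - cn (z * w) ^+ 2) ^+ 2 - cn (z + w - cj (z + w) * (z * w)) ^+ 2 =
  (1 - cn z ^+ 2) * (1 - cn w ^+ 2) * cn (1 - cj z * w) ^+ 2.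
Proof. by rewrite cnM exprMn !cn_sqr; case: z => a b; case: w => c d /=; ring. Qed.

Lemma G_roots (s p : C) : cn (s - cj s * p) < 1 - cn p ^+ 2 ->
  exists z w : C, [/\ cn z < 1, cn w < 1, s = z + w & p = z * w].
Proof.
move=> h.
have [d dd] : exists d : C, d ^+ 2 = s ^+ 2 - 4 * p by exists (sqrtc (s ^+ 2 - 4 * p)); rewrite sqr_sqrtc.
have [z [w [sE pE]]] : exists z w : C, s = z + w /\ p = z * w.
  exists ((s + d) / 2), ((s - d) / 2); split; first by field.
  rewrite [RHS](_ : _ = (s ^+ 2 - d ^+ 2) / 4); last by field.
  by rewrite dd; field.
exists z, w; rewrite -sE -pE.
have : 0 < (1 - cn (z * w) ^+ 2) ^+ 2 - cn (z + w - cj (z + w) * (z * w)) ^+ 2.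
  rewrite -sE -pE subr_gt0 ltr_pXn2r ?nnegrE ?cn_ge0//.
  by apply: le_trans (ltW h); exact: cn_ge0.
have p1 : cn p < 1.
  rewrite -(@ltr_pXn2r _ 2) ?nnegrE ?cn_ge0// expr1n -subr_gt0; apply: le_lt_trans h; exact: cn_ge0.
rewrite G_identity => hp.
have {}hp : 0 < (1 - cn z ^+ 2) * (1 - cn w ^+ 2).
  move: hp; have := sqr_ge0 (cn (1 - cj z * w)); rewrite le_eqVlt => /orP[/eqP <-|h2].
    by rewrite mulr0 ltxx.
  by rewrite pmulr_lgt0.
have := cn_ge0 z; have := cn_ge0 w; move: p1 hp; rewrite pE cnM.
move: (cn z) (cn w) => a b p1 hp w0 z0.
have lt1 (t : R) : 0 <= t -> 0 < 1 - t ^+ 2 -> t < 1.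
  by move=> t0 ht; have [//|t1] := ltP t 1; have h3 := exprn_ege1 2 t1; arith.
have [z1|z1] := ltP a 1.
  by split=> //; apply: lt1 => //; move: hp; rewrite pmulr_rgt0// subr_gt0 exprn_ilt1.
have w1 : b < 1 by narith.
exfalso; have h2 : 0 < 1 - b ^+ 2 by rewrite subr_gt0 exprn_ilt1.
have h1 : 1 - a ^+ 2 <= 0 by rewrite subr_le0 exprn_ege1.
by have := mulr_le0_ge0 h1 (ltW h2); arith.
Qed.

(** By [G_identity] the factors [1 - cn z ^+ 2] and [1 - cn w ^+ 2] have the same sign, and
    [cn p < 1] excludes that both are negative. In this form openness of [G] is seen without
    choosing roots. *)
Lemma G_criterion (x : Cplx2 R) : G x <-> cn (x.1 - cj x.1 * x.2) < 1 - cn x.2 ^+ 2.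
Proof.
split.
  move=> /G_cn[z [w [z1 w1 ->]]] /=.
  have zw : cn (z * w) < 1.
    rewrite cnM; have := cn_ge0 z; have := cn_ge0 w; move: (cn z) (cn w) z1 w1 => *; narith.
  have p0 : 0 <= 1 - cn (z * w) ^+ 2 by rewrite subr_ge0 exprn_ile1 ?cn_ge0// ltW.
  rewrite -(@ltr_pXn2r _ 2) ?nnegrE ?cn_ge0// -subr_gt0 G_identity.
  have f1 : 0 < 1 - cn z ^+ 2 by rewrite subr_gt0 exprn_ilt1 ?cn_ge0.
  have f2 : 0 < 1 - cn w ^+ 2 by rewrite subr_gt0 exprn_ilt1 ?cn_ge0.
  have f3 : 0 < cn (1 - cj z * w) ^+ 2.
    rewrite exprn_gt0// cn_gt0; apply: lt1_neq; rewrite cnM cnJ.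
    by have := cn_ge0 z; have := cn_ge0 w; move: (cn z) (cn w) z1 w1 => *; narith.
  by apply: mulr_gt0 f3; apply: mulr_gt0.
case: x => s p /= h; apply/G_cn.
by have [z [w [z1 w1 -> ->]]] := G_roots h; exists z, w.
Qed.

Lemma G_bound (x : Cplx2 R) : G x -> cn x.1 < 2 /\ cn x.2 < 1.
Proof.
move=> /G_cn[z [w [z1 w1 ->]]] /=; split; first by apply: le_lt_trans (cnD _ _) _; arith.
by rewrite cnM; have := cn_ge0 z; have := cn_ge0 w; move: (cn z) (cn w) z1 w1 => *; narith.
Qed.

Lemma G_nbhs_aux (Y P S a b X : R) : 0 <= Y -> 0 <= P -> 0 <= S -> 0 <= a -> 0 <= b ->
  Y <= P + (1 - P ^+ 2 - X) / 9 -> Y <= 2 -> a < 1 -> a < (1 - P ^+ 2 - X) / 9 ->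
  b < 1 -> b < (1 - P ^+ 2 - X) / 9 -> S < 2 -> P < 1 ->
  X + (a + (a * Y + S * b)) < 1 - Y ^+ 2.
Proof.
move=> Y0 P0 S0 a0 b0 e1 e1' a1 a2 b1 b2 s2 p1.
have h1 : a * Y <= a * 2 by apply: ler_wpM2l.
have h2 : S * b <= 2 * b by apply: ler_wpM2r => //; exact: ltW.
have h3 : Y ^+ 2 <= P ^+ 2 + (1 - P ^+ 2 - X) / 9 * 3.
  have [h|h] := leP Y P; first by narith.
  have : (Y - P) * (Y + P) <= (Y - P) * 3 by apply: ler_wpM2l; arith.
  narith.
arith.
Qed.

Lemma G_nbhs (x : Cplx2 R) : G x -> nbhs x G.
Proof.
move=> Gx; have [s2 p1] := G_bound Gx; have /G_criterion h := Gx.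
pose g := 1 - cn x.2 ^+ 2 - cn (x.1 - cj x.1 * x.2); have g0 : 0 < g by rewrite subr_gt0.
apply/nbhs2P; exists (Num.min 1 (g / 9)); first by rewrite lt_min ltr01 divr_gt0 ?ltr0n.
move=> y; rewrite !lt_min => /andP[a1 a2] /andP[b1 b2]; apply/G_criterion.
have e1 : cn y.2 <= cn x.2 + g / 9.
  rewrite -(subrK x.2 y.2); apply: le_trans (cnD _ _) _; rewrite addrC lerD2l; exact: ltW.
have e1' : cn y.2 <= 2.
  rewrite -(subrK x.2 y.2); apply: le_trans (cnD _ _) _; arith.
have e2 : cn (y.1 - cj y.1 * y.2) <= cn (x.1 - cj x.1 * x.2) + (cn (y.1 - x.1) + (cn (y.1 - x.1) * cn y.2 + cn x.1 * cn (y.2 - x.2))).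
  rewrite [X in cn X](_ : _ = (x.1 - cj x.1 * x.2) + ((y.1 - x.1) - (cj (y.1 - x.1) * y.2 + cj x.1 * (y.2 - x.2)))); last first.
    by rewrite !cjE; ring.
  apply: le_trans (cnD _ _) _; rewrite lerD2l; apply: le_trans (cnB _ _) _; rewrite lerD2l.
  by apply: le_trans (cnD _ _) _; rewrite !cnM !cnJ.
apply: le_lt_trans e2 _.
exact: (G_nbhs_aux (cn_ge0 _) (cn_ge0 _) (cn_ge0 _) (cn_ge0 _) (cn_ge0 _) e1 e1' a1 a2 b1 b2 s2 p1).
Qed.

Lemma G_open : open G.
Proof. by apply: open2P => x; exact: G_nbhs. Qed.

(** Compactness of the closed bidisc for a property monotone in [e]. It is used on a product of
    squares around the discs, where points outside the discs satisfy the local condition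
    vacuously. *)
Lemma bidisc_cover (Q : R -> C -> C -> Prop) :
  (forall e e' z w, 0 < e' -> e' <= e -> Q e z w -> Q e' z w) ->
  (forall z0 w0, cn z0 <= 1 -> cn w0 <= 1 -> exists2 d : R, 0 < d & exists2 e, 0 < e &
     forall z w, cn (z - z0) < d -> cn (w - w0) < d -> Q e z w) ->
  exists2 e, 0 < e & forall z w, cn z <= 1 -> cn w <= 1 -> Q e z w.
Proof.
move=> mono loc.
pose I : set R := `[-1, 1]%classic.
have cI : compact I by exact: segment_compact.
pose K := ((I `*` I) `*` (I `*` I)).
have cK : compact K by apply: compact_setX; exact: compact_setX.
pose pt (x : R * R) : C := x.1 +i* x.2.
pose P (e : R) (x : (R * R) * (R * R)) := cn (pt x.1) <= 1 -> cn (pt x.2) <= 1 -> Q e (pt x.1) (pt x.2).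
have loc' (z0 w0 : C) : exists2 d : R, 0 < d & exists2 e, 0 < e &
     forall z w, cn (z - z0) < d -> cn (w - w0) < d -> cn z <= 1 -> cn w <= 1 -> Q e z w.
  have outside (u v : C) : 1 < cn v -> cn (u - v) < cn v - 1 -> cn u <= 1 -> False.
    move=> h1 h2 h3; have := cnD u (v - u); rewrite addrC subrK (cnBC v); arith.
  have [z1|z1] := leP (cn z0) 1; last first.
    exists (cn z0 - 1); first by arith.
    by exists 1 => // z w h1 _ h2; case: (outside z z0).
  have [w1|w1] := leP (cn w0) 1; last first.
    exists (cn w0 - 1); first by arith.
    by exists 1 => // z w _ h1 _ h2; case: (outside w w0).
  by have [d d0 [e e0 h]] := loc _ _ z1 w1; exists d => //; exists e => // z w h1 h2 _ _; exact: h.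
have nearK : \forall e \near (0 : R)^'+, K `<=` P e.
  apply: ((compact_near_coveringP K).1 cK _ _ P _) => -[[x1 y1] [x2 y2]] _.
  have [d d0 [e e0 h]] := loc' (x1 +i* y1) (x2 +i* y2).
  have d2 : 0 < d / 2 by arith.
  pose A (x' : (R * R) * (R * R)) := (`|x1 - x'.1.1| < d / 2 /\ `|y1 - x'.1.2| < d / 2) /\
    (`|x2 - x'.2.1| < d / 2 /\ `|y2 - x'.2.2| < d / 2).
  have near1 (t : R) : nbhs t [set t' | `|t - t'| < d / 2] by apply/nbhs_normP; exists (d / 2).
  have nA : nbhs ((x1, y1), (x2, y2)) A.
    exists ([set u | `|x1 - u.1| < d / 2 /\ `|y1 - u.2| < d / 2], [set u | `|x2 - u.1| < d / 2 /\ `|y2 - u.2| < d / 2]).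
      split.
        by exists ([set t' | `|x1 - t'| < d / 2], [set t' | `|y1 - t'| < d / 2]); [split; exact: near1|move=> [u v] []].
      by exists ([set t' | `|x2 - t'| < d / 2], [set t' | `|y2 - t'| < d / 2]); [split; exact: near1|move=> [u v] []].
    by move=> [u v] [].
  exists (A, [set e' | 0 < e' /\ e' <= e]) => /=.
    split => //; apply: filterI; first exact: nbhs_right_gt.
    exact: nbhs_right_ltW.
  move=> [[[a1 b1] [a2 b2]] e'] /= [[[A1 B1] [A2 B2]] [e'0 e'e]].
  have dist (p q p' q' : R) : `|p - p'| < d / 2 -> `|q - q'| < d / 2 -> cn ((p' +i* q') - (p +i* q) : C) < d.
    move=> h1 h2; apply: le_lt_trans (cn_le_ReIm _) _; rewrite rpB ipB /= distrC [`|q' - q|]distrC; arith.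
  move=> n1 n2; apply: (mono e) => //; apply: h n1 n2; exact: dist.
have [e [Ke e0]] : exists e, K `<=` P e /\ 0 < e.
  have h : \forall e \near (0 : R)^'+, K `<=` P e /\ 0 < e.
    by apply: filterI nearK _; exact: nbhs_right_gt.
  exact: (@filter_ex _ _ (at_right_proper_filter (0 : R)) _ h).
exists e => // z w z1 w1.
have pE (v : C) : cn v <= 1 -> I (rp v) /\ I (ip v).
  move=> v1; have := rp_le_cn v; have := ip_le_cn v; rewrite !ler_norml /I /= !in_itv /=.
  by move=> /andP[i1 i2] /andP[r1 r2]; split; apply/andP; split; arith.
have eC (v : C) : pt (rp v, ip v) = v by case: v.
have key (u u' : R * R) : P e (u, u') -> cn (pt u) <= 1 -> cn (pt u') <= 1 -> Q e (pt u) (pt u') by [].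
have [i1 i2] := pE _ z1; have [i3 i4] := pE _ w1.
have := key _ _ (Ke ((rp z, ip z), (rp w, ip w)) (conj (conj i1 i2) (conj i3 i4))).
by rewrite !eC; apply.
Qed.
End Domain.

Section Node.
Variable R : realType.
Notation C := R[i].
Notation G := (symmetrized_bidisc R).

(* First order perturbation: if [chi] points strictly inwards wherever [F] is
   unimodular, then [F + e chi] is bounded by one for small [e]. *)
Lemma perturb (A : C -> C -> Prop) (F chi : Cplx2 R -> Cplx R) :
  (forall z w, A z w -> cn (F (z, w)) <= 1) ->
  (forall z w, cn z <= 1 -> cn w <= 1 ->
     (exists2 d, 0 < d & forall z' w', cn (z' - z) < d -> cn (w' - w) < d -> ~ A z' w') \/
     [/\ differentiable F ((z, w) : Cplx2 R), differentiable chi ((z, w) : Cplx2 R), cn (F (z, w)) <= 1 &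
         cn (F (z, w)) = 1 -> rp (cj (F (z, w)) * chi (z, w)) < 0]) ->
  exists2 e, 0 < e & forall z w, cn z <= 1 -> cn w <= 1 -> A z w ->
    cn (F (z, w) + e%:C * chi (z, w)) <= 1.
Proof.
move=> A1 loc.
have [||e e0 he] := @bidisc_cover R (fun e z w => A z w -> forall e', 0 < e' -> e' <= e ->
    cn (F (z, w) + e'%:C * chi (z, w)) <= 1); last by exists e => // z w z1 w1 Az; exact: he.
  by move=> e e' z w e0 ee h Az e'' h1 h2; apply: h => //; exact: le_trans ee.
move=> z0 w0 z1 w1; have [[d d0 h]|[dF dchi F1 hF]] := loc _ _ z1 w1.
  by exists d => //; exists 1 => // z w hz hw Az; case: (h z w).
pose f0 := F (z0, w0); pose c0 := chi (z0, w0); pose M := cn c0 + 1.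
have M0 : 0 < M by rewrite ltr_wpDl// cn_ge0.
have [dc dc0 hc] := df_near dchi ltr01.
have near_c z w : cn (z - z0) < dc -> cn (w - w0) < dc -> cn (chi (z, w)) <= M.
  move=> hz hw; have := hc (z, w) hz hw => h; rewrite /M -[chi _](subrK c0).
  by apply: le_trans (cnD _ _) _; rewrite addrC lerD2l ltW.
have [lt1|ge1] := ltP (cn f0) 1.
  have t0 : 0 < (1 - cn f0) / 2 by rewrite divr_gt0 ?subr_gt0.
  have [df df0 hf] := df_near dF t0.
  exists (Num.min dc df); first by rewrite lt_min dc0.
  exists ((1 - cn f0) / 2 / M); first by rewrite divr_gt0.
  move=> z w; rewrite !lt_min => /andP[z2 z3] /andP[w2 w3] _ e' e'0 e'e.
  apply: le_trans (cnD _ _) _; rewrite cnM cnR gtr0_norm//.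
  have h1 : cn (F (z, w)) <= cn f0 + (1 - cn f0) / 2.
    rewrite -[F _](subrK f0) addrC; apply: le_trans (cnD _ _) _; rewrite lerD2l ltW//.
    exact: hf.
  have h2 : e' * cn (chi (z, w)) <= (1 - cn f0) / 2.
    apply: le_trans (_ : (1 - cn f0) / 2 / M * M <= _); last by rewrite divfK// gt_eqF.
    by apply: ler_pM => //; [exact: ltW|exact: cn_ge0|exact: near_c].
  by move: h1 h2; move: (cn (F _)) (e' * _) (cn f0) => a b c; arith.
have f1 : cn f0 = 1 by apply/eqP; rewrite eq_le F1.
have r0 := hF f1; set r := rp _ in r0.
pose eta := - r / (4 * (M + 1)).
have eta0 : 0 < eta by rewrite divr_gt0 ?oppr_gt0// mulr_gt0//; arith.
have [df df0 hf] := df_near dF eta0; have [dg dg0 hg] := df_near dchi eta0.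
exists (Num.min dc (Num.min df dg)); first by rewrite !lt_min dc0 df0.
(* Nearby, [cn (F + e' chi) ^+ 2] is at most [1 + e' r + (e' M)^2], since the first order real part
   stays below [r / 2]; this is at most 1 as soon as [e' <= - r / M^2]. *)
exists (- r / M ^+ 2); first by rewrite divr_gt0 ?oppr_gt0 ?exprn_gt0.
move=> z w; rewrite !lt_min => /and3P[z2 z3 z4] /and3P[w2 w3 w4] Az e' e'0 e'e.
have hc' := near_c _ _ z2 w2; have hf' := hf (z, w) z3 w3; have hg' := hg (z, w) z4 w4.
have a1 := A1 _ _ Az.
have rE : rp (cj (F (z, w)) * chi (z, w)) <= r / 2.
  have -> : cj (F (z, w)) * chi (z, w) = cj f0 * c0 + (cj (F (z, w) - f0) * chi (z, w) + cj f0 * (chi (z, w) - c0)).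
    by rewrite /f0 /c0 cjD cjN; ring.
  rewrite rpD -/r.
  have : rp (cj (F (z, w) - f0) * chi (z, w) + cj f0 * (chi (z, w) - c0)) <= eta * M + eta.
    apply: le_trans (ler_norm _) _; apply: le_trans (rp_le_cn _) _; apply: le_trans (cnD _ _) _.
    rewrite !cnM !cnJ f1 mul1r lerD ?(ltW hg')//.
    by apply: ler_pM => //; rewrite ?cn_ge0// ltW.
  rewrite (_ : eta * M + eta = - r / 4); last first.
    have M1 : 0 < M + 1 by arith.
    by rewrite /eta; field; rewrite gt_eqF.
  by arith.
rewrite -(@ler_pXn2r _ 2) ?nnegrE ?cn_ge0// expr1n.
have -> : cn (F (z, w) + e'%:C * chi (z, w)) ^+ 2 = cn (F (z, w)) ^+ 2 +
    2 * e' * rp (cj (F (z, w)) * chi (z, w)) + e' ^+ 2 * cn (chi (z, w)) ^+ 2.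
  by rewrite !cn_sqr; case: (F _) => a b; case: (chi _) => c d /=; ring.
have s1 : cn (F (z, w)) ^+ 2 <= 1 by rewrite exprn_ile1// cn_ge0.
have s2 : cn (chi (z, w)) ^+ 2 <= M ^+ 2 by rewrite ler_pXn2r ?nnegrE ?cn_ge0// ltW.
have s3 : e' * M ^+ 2 <= - r by rewrite -ler_pdivlMr// exprn_gt0.
have s4 : e' * (e' * cn (chi (z, w)) ^+ 2) <= e' * - r.
  by rewrite ler_pM2l//; apply: le_trans s3; rewrite ler_pM2l.
have s5 : e' * rp (cj (F (z, w)) * chi (z, w)) <= e' * (r / 2) by rewrite ler_pM2l.
by move: s1 s4 s5; rewrite expr2 [e' ^+ 2]expr2; arith.
Qed.

Lemma npep_use (V : set (Cplx2 R)) (f : Cplx2 R -> Cplx R) : norm_preserving_extension G V ->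
  V !=set0 -> analytic_on_subset G V f -> (forall x, V x -> cn (f x) <= 1) ->
  exists g : Cplx2 R -> Cplx R, [/\ holomorphic_on G g, forall x, V x -> g x = f x &
    forall x, G x -> cn (g x) <= 1].
Proof.
move=> [VG H] [x0 Vx0] af f1.
have [|g [hg gf sup]] := H f af; first by exists 1.
exists g; split=> // x Gx.
have : ((cn (g x))%:E <= sup_norm G g)%E.
  by apply: ereal_sup_ubound; exists x.
rewrite sup => h; have : (sup_norm V f <= 1%:E)%E.
  by apply: ge_ereal_sup => _ [y Vy <-]; rewrite lee_fin f1.
by move=> /(le_trans h); rewrite lee_fin.
Qed.

Lemma npep_nonempty (V : set (Cplx2 R)) : norm_preserving_extension G V -> V !=set0.
Proof.
move=> [VG H]; apply/set0P/eqP => V0.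
have [||g [_ _]] := H (fun=> 0).
- by move=> z; rewrite V0.
- by exists 0 => x; rewrite V0.
rewrite /sup_norm V0 image_set0 ereal_sup0 => e.
have G0 : G (0, 0) by apply/G_cn; exists 0, 0; rewrite cn0 addr0 mulr0 ltr01.
have : ((cn (g (0, 0)))%:E <= -oo)%E by rewrite -e; apply: ereal_sup_ubound; exists (0, 0).
by rewrite leeNy_eq.
Qed.

Lemma hol_analytic (V : set (Cplx2 R)) (f : Cplx2 R -> Cplx R) : V `<=` G ->
  holomorphic_on G f -> analytic_on_subset G V f.
Proof.
move=> VG hf z Vz; exists G; split=> //; [exact: G_open|exact: VG|].
by exists f.
Qed.

Lemma geod_schwarz om al be ga (g : Cplx2 R -> Cplx R) x y : cn om = 1 -> good_quad al be ga ->
  holomorphic_on G g -> (forall x, G x -> cn (g x) <= 1) ->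
  geod om al be ga x -> geod om al be ga y -> g x = 0 ->
  cn (g y) <= cn ((cm om y - cm om x) / (cm om y + cj (cm om x))).
Proof.
move=> o1 gq hg g1 kx ky gx.
have cx := cm_gt0 o1 kx.1; have cy := cm_gt0 o1 ky.1.
rewrite cnM cnV ler_pdivlMr ?cn_gt0 ?hp_sum_neq0//.
pose F (m : Cplx R) : Cplx R := g (gk om al be ga m).
have Gk (m : C) : 0 < rp m -> G (gk om al be ga m) by move=> hm; have [] := gkP o1 gq hm.
have hF : holomorphic_on (@half_plane R) F.
  by move=> m hm; exact: (dfcomp (gk_differentiable om gq hm) (hg _ (Gk _ hm))).
have Fx : F (cm om x) = 0 by rewrite /F -(geod_gk o1 kx).
have := schwarz_hp hF (fun m hm => g1 _ (Gk _ hm)) cx cy Fx.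
by rewrite /F -(geod_gk o1 ky).
Qed.

(** The function equal to 1 at an isolated point and to 0 elsewhere would be analytic on [V]. An
    extension bounded by one would violate the Schwarz lemma on the geodesic through this point and
    another point of [V]. *)
Lemma no_isolated (V : set (Cplx2 R)) x y (W : set (Cplx2 R)) : norm_preserving_extension G V ->
  V x -> V y -> x <> y -> open W -> W x -> exists z, [/\ V z, W z & z <> x].
Proof.
move=> HV Vx Vy xy oW Wx; apply: contrapT => none.
have iso z : V z -> W z -> z = x by move=> Vz Wz; apply: contrapT => zx; apply: none; exists z.
have [VG _] := HV.
pose f (z : Cplx2 R) : Cplx R := if pselect (z = x) then 1 else 0.
have fx : f x = 1 by rewrite /f; case: pselect.
have f0 z : z <> x -> f z = 0 by rewrite /f; case: pselect.
have af : analytic_on_subset G V f.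
  move=> z Vz; have [->|zx] := pselect (z = x).
    exists (W `&` G); split.
    - by apply: openI; [exact: oW|exact: G_open].
    - by split=> //; exact: VG.
    - by move=> ? [].
    exists (fun=> 1); split; first by move=> ? _; exact: dfc.
    by move=> w [Ww _] Vw; rewrite (iso _ Vw Ww) fx.
  exists (G `&` [set w | w <> x]); split.
  - apply: openI; first exact: G_open.
    apply: open2P => w /= wx.
    have [n0|n0] := eqVneq w.1 x.1; have [n1|n1] := eqVneq w.2 x.2.
    + by case: wx; case: w x n0 n1 {Vx xy iso none f fx f0 Wx zx} => w1 w2 [x1 x2] /= -> ->.
    + apply/nbhs2P; exists (cn (w.2 - x.2)); first by rewrite cn_gt0 subr_eq0.
      by move=> y' _ h e; move: h; rewrite e cnBC ltxx.
    + apply/nbhs2P; exists (cn (w.1 - x.1)); first by rewrite cn_gt0 subr_eq0.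
      by move=> y' h _ e; move: h; rewrite e cnBC ltxx.
    + apply/nbhs2P; exists (cn (w.1 - x.1)); first by rewrite cn_gt0 subr_eq0.
      by move=> y' h _ e; move: h; rewrite e cnBC ltxx.
  - by split=> //; exact: VG.
  - by move=> ? [].
  - exists (fun=> 0); split; first by move=> ? _; exact: dfc.
    by move=> w [_ wx] _; rewrite f0.
have f1 z : V z -> cn (f z) <= 1.
  by move=> _; have [->|zx] := pselect (z = x); rewrite ?fx ?f0// ?cn1 ?cn0.
have [g [hg gf g1]] := npep_use HV (ex_intro _ x Vx) af f1.
have [ om [al [be [ga [ o1 gq kx ky]]]]] := geod_exists (VG _ Vx) (VG _ Vy) xy.
have gy : g y = 0 by rewrite gf// f0//; exact: nesym.
have := geod_schwarz o1 gq hg g1 ky kx gy; rewrite gf// fx cn1 leNgt => /negP; apply.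
have cx := cm_gt0 o1 kx.1; have cy := cm_gt0 o1 ky.1.
rewrite cnM cnV ltr_pdivrMr ?cn_gt0 ?hp_sum_neq0// mul1r.
rewrite -(@ltr_pXn2r _ 2) ?nnegrE ?cn_ge0// cn_sum_sub ltrDl mulr_gt0// mulr_gt0//.
Qed.
End Node.

Section NodeLemma.
Variable R : realType.
Notation C := R[i].
Notation G := (symmetrized_bidisc R).

(* In terms of [sg = 2 - om s] and [pi = 1 - om s + om^2 p] the functions below
   are, with [m = cm om] and [e = m^2 - cD om],
   [nF = (m - m0) / (m + conj m0)], [nQ = pi (c0 + c1 m + c2 e)] and
   [nG = dl m / (1 + dl m)]; they extend continuously to the boundary of the
   domain away from the node [sg = 0]. *)
Definition nF (m0 sg pi : C) : C := (sg - (1 + m0) * pi) / (sg + (cj m0 - 1) * pi).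
Definition nQ (c0 c1 c2 sg pi : C) : C := c0 * pi + c1 * (sg - pi) + c2 * (4 - 2 * sg + pi).
Definition nG (dl : R) (sg pi : C) : C := dl%:C * (sg - pi) / (pi + dl%:C * (sg - pi)).
(** On the torus [m] is imaginary and [e] real, so the two [nQ] factors are conjugate up to [pi],
    and [cj nF] times [nchi] has the nonpositive real part of [- |Q|^2 / |m + cj m0|^2 - K nG],
    where [Q = nQ / pi]. On the edge [pi = 0] the product of the [nQ] factors has no sign; there
    [nG = 1] and a large [K] prevails. *)
Definition nchi (m0 c0 c1 c2 : C) (K dl : R) (sg pi : C) : C :=
  (nQ c0 c1 c2 sg pi * nQ (cj c0) (- cj c1) (cj c2) sg pi -
   K%:C * ((sg - (1 + m0) * pi) * (sg + (cj m0 - 1) * pi)) * nG dl sg pi) /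
  (sg + (cj m0 - 1) * pi) ^+ 2.

Lemma nval (m0 c0 c1 c2 : C) (K dl : R) (sg pi m e : C) : pi != 0 ->
  sg - pi = m * pi -> 4 - 2 * sg + pi = e * pi -> m + cj m0 != 0 -> 1 + dl%:C * m != 0 ->
  [/\ nF m0 sg pi = (m - m0) / (m + cj m0), nG dl sg pi = dl%:C * m / (1 + dl%:C * m) &
   nchi m0 c0 c1 c2 K dl sg pi =
    ((c0 + c1 * m + c2 * e) * (cj c0 - cj c1 * m + cj c2 * e) -
     K%:C * ((m - m0) * (m + cj m0)) * (dl%:C * m / (1 + dl%:C * m))) / (m + cj m0) ^+ 2].
Proof.
move=> p0 e1 e2 n0 n1.
have gE : nG dl sg pi = dl%:C * m / (1 + dl%:C * m).
  rewrite /nG e1; move: (dl%:C) n1 => d n1.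
  have -> : pi + d * (m * pi) = pi * (1 + d * m) by ring.
  by field; rewrite p0 n1.
have a0 : sg - (1 + m0) * pi = (m - m0) * pi.
  by rewrite (_ : sg - _ = (sg - pi) - m0 * pi); [rewrite e1; ring|ring].
have a1 : sg + (cj m0 - 1) * pi = (m + cj m0) * pi.
  by rewrite (_ : sg + _ = (sg - pi) + cj m0 * pi); [rewrite e1; ring|ring].
split=> //.
  by rewrite /nF a0 a1; move: (cj m0) n0 => y n0; field; rewrite n0 p0.
rewrite /nchi gE a0 a1 /nQ e1 e2.
move: (dl%:C * m / _) (K%:C) (cj m0) (cj c0) (cj c1) (cj c2) n0 => q k y d0 d1 d2 n0.
by field; rewrite n0 p0.
Qed.

Lemma half_le_inv (al : C) : al != 0 -> cn (1 - al) <= 1 -> 2^-1 <= rp al^-1.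
Proof.
move=> a0 h; rewrite rp_inv ler_pdivlMr ?exprn_gt0 ?cn_gt0//.
have : cn (1 - al) ^+ 2 <= 1 by rewrite exprn_ile1// cn_ge0.
by rewrite !cn_sqr !(rpB, ipB) /=; narith.
Qed.

(** [2 / al - 1] and [2 / be - 1] are the half-plane coordinates of the two roots, [m] is their mean
    and [e] their product. If [m] is imaginary then so are both, and their product is real. *)
Lemma bd_point (al be : C) : al != 0 -> be != 0 -> cn (1 - al) <= 1 -> cn (1 - be) <= 1 ->
  exists m e : C, [/\ 0 <= rp m, al + be - al * be = m * (al * be),
    4 - 2 * (al + be) + al * be = e * (al * be) & rp m = 0 -> ip e = 0].
Proof.
move=> a0 b0 a1 b1; exists (al^-1 + be^-1 - 1), ((2 / al - 1) * (2 / be - 1)).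
have ha := half_le_inv a0 a1; have hb := half_le_inv b0 b1.
split.
- by rewrite rpB rpD /=; arith.
- by field; rewrite a0 b0.
- by field; rewrite a0 b0.
- rewrite rpB rpD /= => h.
  have ra : rp al^-1 = 2^-1 by arith.
  have rb : rp be^-1 = 2^-1 by arith.
  move: ra rb; move: (al^-1) (be^-1) => [x y] [x' y'] ra rb; rewrite /= in ra rb; rewrite ra rb.
  have e2 (u v : R) : 2 * (u +i* v) - 1 = (2 * u - 1) +i* (2 * v) :> C.
    by rewrite -rCnat; apply: cxP => /=; ring.
  by rewrite !e2 /=; field.
Qed.

Lemma nchi_bd_torus (m0 c0 c1 c2 : C) (K dl : R) (m e : C) : 0 < rp m0 -> 0 <= K -> 0 < dl ->
  rp m = 0 -> ip e = 0 ->
  rp (cj ((m - m0) / (m + cj m0)) * (((c0 + c1 * m + c2 * e) * (cj c0 - cj c1 * m + cj c2 * e) -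
     K%:C * ((m - m0) * (m + cj m0)) * (dl%:C * m / (1 + dl%:C * m))) / (m + cj m0) ^+ 2)) <= 0.
Proof.
move=> h0 K0 d0 rm ie.
have mJ : cj m = - m by case: m rm => x y /= ->; rewrite /conjc /=; apply: cxP => /=; rewrite ?oppr0.
have eJ : cj e = e by case: e ie => x y /= ->; apply: cxP => /=; rewrite ?oppr0.
have n0 : m + cj m0 != 0.
  by apply/eqP => /(congr1 (@complex.Re _)); rewrite rpD rpJ rm /=; arith.
have n2 : m - m0 != 0.
  by apply/eqP => /(congr1 (@complex.Re _)); rewrite rpB rm /=; arith.
have n1 : 1 + dl%:C * m != 0.
  by apply/eqP => /(congr1 (@complex.Re _)); rewrite rpD rpRM rm /=; arith.
have [Q QE] : exists Q : C, Q = c0 + c1 * m + c2 * e by eexists.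
have QJ : cj c0 - cj c1 * m + cj c2 * e = cj Q by rewrite QE !cjE mJ eJ; ring.
rewrite QJ -QE !cjE mJ.
have -> : (- m - cj m0) / (- m + m0) * ((Q * cj Q - K%:C * ((m - m0) * (m + cj m0)) *
    (dl%:C * m / (1 + dl%:C * m))) / (m + cj m0) ^+ 2) =
  Q * cj Q / ((m - m0) * (m + cj m0)) - K%:C * (dl%:C * m / (1 + dl%:C * m)).
  have n3 : - m + m0 != 0 by rewrite addrC -opprB oppr_eq0.
  move: (Q * cj Q) (K%:C) (dl%:C) (cj m0) n0 n1 n2 n3 => q k d y n0 n1 n2 n3.
  by field; rewrite n0 n1 n2.
have -> : (m - m0) * (m + cj m0) = (- cn (m + cj m0) ^+ 2)%:C.
  by rewrite rCN -mulcJ !cjE mJ; ring.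
have Z0 : 0 < cn (m + cj m0) ^+ 2 by rewrite exprn_gt0// cn_gt0.
rewrite mulcJ -rCV -rCM rpB rpRM /= subr_le0.
apply: (@le_trans _ _ 0).
  by rewrite invrN mulrN oppr_le0 divr_ge0// ?sqr_ge0// ltW.
rewrite mulr_ge0// rp_divE divr_ge0 ?sqr_ge0//.
case: m rm {mJ n0 n2 n1 Q QE QJ Z0} => x y /= ->.
by rewrite !(mulr0, mul0r, addr0, add0r, subr0, oppr0); narith.
Qed.

(** Here one root sits at the boundary point that the chart sends to infinity. The constant [8 / c]
    bounds [(4 - 2 sg) / sg], and [K] dominates the remaining product. *)
Lemma nchi_bd_edge (m0 c0 c1 c2 : C) (K dl c : R) (sg : C) : 0 < dl -> 0 < c ->
  c <= cn sg -> cn sg <= 2 -> (cn c1 + cn c2 * (8 / c)) ^+ 2 <= K ->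
  nF m0 sg 0 = 1 /\ rp (nchi m0 c0 c1 c2 K dl sg 0) <= 0.
Proof.
move=> d0 c00 cs s2 hK; have sg0 : sg != 0 by rewrite -cn_gt0; arith.
have dC := rC_neq0 d0.
have gE : nG dl sg 0 = 1 by rewrite /nG add0r subr0 divff// mulf_neq0.
split; first by rewrite /nF !mulr0 subr0 addr0 divff.
rewrite /nchi gE /nQ !mulr0 !addr0 !subr0 !add0r mulr1.
set t := 4 - 2 * sg.
have -> : ((c1 * sg + c2 * t) * (- cj c1 * sg + cj c2 * t) - K%:C * (sg * sg)) / sg ^+ 2 =
  (c1 + c2 * (t / sg)) * (- cj c1 + cj c2 * (t / sg)) - K%:C.
  by move: (cj c1) (cj c2) (K%:C) => d1 d2 k; field.
rewrite rpB [rp K%:C]/= subr_le0; apply: le_trans (ler_norm _) _; apply: le_trans (rp_le_cn _) _.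
apply: le_trans hK; rewrite cnM expr2.
have ht : cn (t / sg) <= 8 / c.
  rewrite cnM cnV; apply: ler_pM; rewrite ?cn_ge0 ?invr_ge0 ?cn_ge0//.
    apply: le_trans (cnB _ _) _; rewrite cnM -!rCnat !cnR !ger0_norm//; arith.
  by rewrite lef_pV2// posrE ?cn_gt0.
have hc2 : cn c2 * cn (t / sg) <= cn c2 * (8 / c) by rewrite ler_wpM2l ?cn_ge0.
apply: ler_pM; rewrite ?cn_ge0//; apply: le_trans (cnD _ _) _; rewrite ?cnN cnM ?cnJ lerD2l//.
Qed.

Lemma n_den_neq0 (m0 al be : C) (dl : R) : 0 < rp m0 -> 0 < dl ->
  cn (1 - al) <= 1 -> cn (1 - be) <= 1 -> al + be != 0 ->
  al + be + (cj m0 - 1) * (al * be) != 0 /\ al * be + dl%:C * (al + be - al * be) != 0.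
Proof.
move=> h0 d0 a1 b1 s0; have dC := rC_neq0 d0.
have [p0|p0] := eqVneq (al * be) 0.
  by rewrite p0 mulr0 addr0 subr0 add0r mulf_neq0.
have [an bn] : al != 0 /\ be != 0 by move: p0; rewrite mulf_eq0 negb_or => /andP.
have [m [e [m1 e1 _ _]]] := bd_point an bn a1 b1.
rewrite (_ : _ + (cj m0 - 1) * _ = (al + be - al * be) + cj m0 * (al * be)); last by ring.
rewrite e1 -mulrDl (_ : al * be + _ = (1 + dl%:C * m) * (al * be)); last by ring.
split; rewrite mulf_neq0//; apply/eqP => /(congr1 (@complex.Re _)).
  by rewrite rpD rpJ /=; arith.
by rewrite rpD rpRM /=; narith.
Qed.

Lemma nF_le1 (m0 al be : C) : 0 < rp m0 -> cn (1 - al) <= 1 -> cn (1 - be) <= 1 -> al + be != 0 ->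
  cn (nF m0 (al + be) (al * be)) <= 1.
Proof.
move=> h0 a1 b1 s0.
have [p0|p0] := eqVneq (al * be) 0.
  by rewrite p0 /nF !mulr0 subr0 addr0 divff// cn1.
have [an bn] : al != 0 /\ be != 0 by move: p0; rewrite mulf_eq0 negb_or => /andP.
have [m [e [m1 e1 e2 _]]] := bd_point an bn a1 b1.
have n0 : m + cj m0 != 0 by apply/eqP => /(congr1 (@complex.Re _)); rewrite rpD rpJ /=; arith.
have n1 : 1 + (1 : R)%:C * m != 0.
  by apply/eqP => /(congr1 (@complex.Re _)); rewrite rpD rpRM /=; arith.
have [-> _ _] := nval 0 0 0 0 p0 e1 e2 n0 n1.
rewrite cnM cnV ler_pdivrMr ?cn_gt0// mul1r.
rewrite -(@ler_pXn2r _ 2) ?nnegrE ?cn_ge0// cn_sum_sub lerDl; apply: mulr_ge0 => //.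
by apply: mulr_ge0 => //; exact: ltW.
Qed.

Lemma nchi_bd (m0 c0 c1 c2 : C) (K dl c : R) (al be : C) : 0 < rp m0 -> 0 < dl -> 0 < c ->
  cn (1 - al) <= 1 -> cn (1 - be) <= 1 -> c <= cn (al + be) ->
  (cn c1 + cn c2 * (8 / c)) ^+ 2 <= K ->
  cn (nF m0 (al + be) (al * be)) = 1 ->
  rp (cj (nF m0 (al + be) (al * be)) * nchi m0 c0 c1 c2 K dl (al + be) (al * be)) <= 0.
Proof.
move=> h0 d0 c00 a1 b1 cs hK hF.
have K0 : 0 <= K by apply: le_trans hK; exact: sqr_ge0.
have [p0|p0] := eqVneq (al * be) 0.
  have s2 : cn (al + be) <= 2.
    have le2 (t : C) : cn (1 - t) <= 1 -> cn t <= 2.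
      by move=> h; have := cnB 1 (1 - t); rewrite opprB addrC subrK cn1; arith.
    by move: p0 => /eqP; rewrite mulf_eq0 => /orP[] /eqP ->; rewrite ?add0r ?addr0 le2.
  rewrite p0; have [-> h] := nchi_bd_edge m0 c0 d0 c00 cs s2 hK.
  by rewrite cj1 mul1r.
have [an bn] : al != 0 /\ be != 0 by move: p0; rewrite mulf_eq0 negb_or => /andP.
have [m [e [m1 e1 e2 hr]]] := bd_point an bn a1 b1.
have n0 : m + cj m0 != 0 by apply/eqP => /(congr1 (@complex.Re _)); rewrite rpD rpJ /=; arith.
have n1 : 1 + dl%:C * m != 0.
  by apply/eqP => /(congr1 (@complex.Re _)); rewrite rpD rpRM /=; narith.
have [fE _ cE] := nval c0 c1 c2 K p0 e1 e2 n0 n1.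
rewrite fE in hF *; rewrite cE.
have rm : rp m = 0.
  move: hF; rewrite cnM cnV => /eqP; rewrite -subr_eq0 => /eqP hF.
  have h2 : cn (m - m0) = cn (m + cj m0).
    have k0 : cn (m + cj m0) != 0 by rewrite cn_eq0.
    by apply/eqP; rewrite -subr_eq0; apply/eqP/(mulIf (invr_neq0 k0)); rewrite mul0r mulrBl divff.
  have := cn_sum_sub m m0; rewrite -h2 => /eqP; rewrite eq_sym addrC -subr_eq0 addrK.
  by rewrite mulf_eq0 pnatr_eq0 /= mulf_eq0 (gt_eqF h0) orbF => /eqP.
exact: (nchi_bd_torus c0 c1 c2 h0 K0 d0 rm (hr rm)).
Qed.

Lemma df_nF (U : normedModType C) (m0 : C) (f g : U -> Cplx R) (x : U) :
  differentiable f x -> differentiable g x -> (f x : C) + (cj m0 - 1) * g x != 0 ->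
  differentiable (fun y => nF m0 (f y) (g y) : Cplx R) x.
Proof.
move=> df dg n0.
exact: (df_div (dfB df (dfM (dfc x (1 + m0)) dg)) (dfD df (dfM (dfc x (cj m0 - 1)) dg)) n0).
Qed.

Lemma df_nchi (U : normedModType C) (m0 c0 c1 c2 : C) (K dl : R) (f g : U -> Cplx R) (x : U) :
  differentiable f x -> differentiable g x -> (f x : C) + (cj m0 - 1) * g x != 0 ->
  (g x : C) + dl%:C * (f x - g x) != 0 ->
  differentiable (fun y => nchi m0 c0 c1 c2 K dl (f y) (g y) : Cplx R) x.
Proof.
move=> df dg n0 n1; have dfg := dfB df dg.
have dt := dfD (dfB (dfc x 4) (dfM (dfc x 2) df)) dg.
have dQ (d0 d1 d2 : C) := dfD (dfD (dfM (dfc x d0) dg) (dfM (dfc x d1) dfg)) (dfM (dfc x d2) dt).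
have dD := dfD df (dfM (dfc x (cj m0 - 1)) dg).
have dN := dfB df (dfM (dfc x (1 + m0)) dg).
have dG := df_div (dfM (dfc x dl%:C) dfg) (dfD dg (dfM (dfc x dl%:C) dfg)) n1.
have n2 : ((f x : C) + (cj m0 - 1) * g x) ^+ 2 != 0 by rewrite expf_neq0.
exact: (df_div (dfB (dfM (dQ c0 c1 c2) (dQ (cj c0) (- cj c1) (cj c2)))
  (dfM (dfM (dfc x K%:C) (dfM dN dD)) dG)) (dfX 2 dD) n2).
Qed.

Lemma cm_sg (om : C) (x : Cplx2 R) : cn om = 1 -> G x ->
  2 - om * x.1 - cden om x = cm om x * cden om x /\
  4 - 2 * (2 - om * x.1) + cden om x = (cm om x ^+ 2 - cD om x) * cden om x.
Proof.
move=> o1 Gx; have d0 := cden_neq0 o1 Gx; split.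
  by rewrite /cm divfK// /cden; ring.
move: (d0); rewrite /cm /cD; rewrite {1}/cden => d1.
have -> : 4 - 2 * (2 - om * x.1) + cden om x = 1 + om * x.1 + om ^+ 2 * x.2 by rewrite /cden; ring.
apply: (mulIf d0); rewrite [RHS](_ : _ = (1 - om ^+ 2 * x.2) ^+ 2 - (om ^+ 2 * x.1 ^+ 2 - 4 * (om ^+ 2 * x.2))).
  by rewrite /cden; ring.
by move: (cden om x) d0 => d d0; field.
Qed.

(* If [V] stays away from the node, [nF + e nchi] has modulus at most one on [V] for
   small [e > 0]; it vanishes at [x], and at [y] it exceeds the Schwarz bound [nF]. *)
Lemma node_in_closure (V : set (Cplx2 R)) om al be ga x y : norm_preserving_extension G V ->
  V x -> V y -> x <> y -> cn om = 1 -> good_quad al be ga -> al <> 1 ->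
  geod om al be ga x -> geod om al be ga y ->
  forall c : R, 0 < c -> exists2 v, V v & cn (2 - om * v.1) < c.
Proof.
move=> HV Vx Vy xy o1 gq al1 kx ky c c00; have [VG _] := HV.
apply: contrapT => none.
have far v : V v -> c <= cn (2 - om * v.1).
  by move=> Vv; rewrite leNgt; apply/negP => h; apply: none; exists v.
have h0 := cm_gt0 o1 kx.1; have h1 := cm_gt0 o1 ky.1.
have [m0 m0E] : exists m0, m0 = cm om x by eexists.
have [m1 m1E] : exists m1, m1 = cm om y by eexists.
rewrite -m0E in h0; rewrite -m1E in h1.
have alt : al < 1 by case: gq => a1 _ _; rewrite lt_neqAle a1 andbT; apply/eqP.
have A0 : 0 < 1 - al by arith.
have AC := rC_neq0 A0.
(* Chosen so that on the geodesic [nQ / pi] and its companion are [m - m0] and [m + cj m0] times the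
   common factor [m - 'i ip m1], which is real and nonzero at [m1]. Expressing [m^2] through [e]
   along the geodesic needs [al <> 1]. *)
pose c2 : C := ((1 - al)%:C)^-1.
pose c1 : C := - (m0 + 'i * (ip m1)%:C) + c2 * ('i * be%:C).
pose c0 : C := m0 * ('i * (ip m1)%:C) - c2 * ga%:C.
have eE (v : Cplx2 R) : geod om al be ga v ->
    cm om v ^+ 2 - cD om v = (1 - al)%:C * cm om v ^+ 2 - 'i * be%:C * cm om v + ga%:C.
  by move=> [_ ->]; rewrite /quad rCD rCN; ring.
have QE (v : Cplx2 R) : geod om al be ga v ->
    c0 + c1 * cm om v + c2 * (cm om v ^+ 2 - cD om v) = (cm om v - m0) * (cm om v - 'i * (ip m1)%:C).
  move=> kv; rewrite (eE _ kv) /c0 /c1 /c2; move: ((1 - al)%:C) AC => a a0; field; exact: a0.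
have iJ : cj ('i : C) = - 'i by apply: cxP; rewrite /= ?oppr0.
have QsE (v : Cplx2 R) : geod om al be ga v ->
    cj c0 - cj c1 * cm om v + cj c2 * (cm om v ^+ 2 - cD om v) = (cm om v + cj m0) * (cm om v - 'i * (ip m1)%:C).
  move=> kv; rewrite (eE _ kv) /c0 /c1 /c2 !cjE !iJ.
  move: ((1 - al)%:C) (cj m0) AC => a n a0; field; exact: a0.
pose K : R := (cn c1 + cn c2 * (8 / c)) ^+ 2.
have K0 : 0 <= K by exact: sqr_ge0.
clearbody c0 c1 c2.
(* [q] turns the weak boundary inequality into a strict one, and [dl] keeps the loss from the [K]
   term below [q]; the gain [rp m1 ^+ 2 = 4 q] at [y] outweighs both. *)
pose q : R := rp m1 ^+ 2 / 4; have q0 : 0 < q by rewrite divr_gt0 ?exprn_gt0 ?ltr0n.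
have M0 : 0 < (K + 1) * (cn m1 + 1).
  by have := cn_ge0 m1; move: (cn m1) => t t0; narith.
pose dl : R := q / ((K + 1) * (cn m1 + 1)).
have dl0 : 0 < dl by rewrite divr_gt0.
pose sg (v : Cplx2 R) : Cplx R := 2 - om * v.1.
pose pi (v : Cplx2 R) : Cplx R := cden om v.
pose F (v : Cplx2 R) : Cplx R := nF m0 (sg v) (pi v).
pose X (v : Cplx2 R) : Cplx R := nchi m0 c0 c1 c2 K dl (sg v) (pi v) - q%:C * F v.
pose phi (z : Cplx2 R) : Cplx2 R := (z.1 + z.2 : C, z.1 * z.2 : C).
have dsg v : differentiable sg v by exact: (dfB (dfc v 2) (dfM (dfc v om) (differentiable_fst v))).
have dpi v : differentiable pi v by exact: cden_differentiable.
have dphi z : differentiable phi z.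
  exact: (differentiable_pair (dfD (differentiable_fst z) (differentiable_snd z))
    (dfM (differentiable_fst z) (differentiable_snd z))).
have sgE z w : sg (phi (z, w)) = (1 - om * z) + (1 - om * w) by rewrite /sg /phi /=; ring.
have piE z w : pi (phi (z, w)) = (1 - om * z) * (1 - om * w) by rewrite /pi /phi /cden /=; ring.
have unit1 (z : C) : cn z <= 1 -> cn (1 - (1 - om * z)) <= 1.
  by move=> z1; rewrite opprB addrC subrK cnM o1 mul1r.
have dF v : (sg v : C) + (cj m0 - 1) * pi v != 0 -> differentiable F v by exact: df_nF.
have dX v : (sg v : C) + (cj m0 - 1) * pi v != 0 -> (pi v : C) + dl%:C * (sg v - pi v) != 0 -> differentiable X v.
  by move=> n0 n1; exact: (dfB (df_nchi c0 c1 c2 K (dsg v) (dpi v) n0 n1) (dfM (dfc v q%:C) (dF v n0))).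
have dens z w : cn z <= 1 -> cn w <= 1 -> sg (phi (z, w)) != 0 ->
    (sg (phi (z, w)) : C) + (cj m0 - 1) * pi (phi (z, w)) != 0 /\
    (pi (phi (z, w)) : C) + dl%:C * (sg (phi (z, w)) - pi (phi (z, w))) != 0.
  by move=> z1 w1; rewrite sgE piE => s0; exact: n_den_neq0 h0 dl0 (unit1 _ z1) (unit1 _ w1) s0.
have F1 z w : cn z <= 1 -> cn w <= 1 -> sg (phi (z, w)) != 0 -> cn (F (phi (z, w))) <= 1.
  by move=> z1 w1; rewrite /F sgE piE => s0; exact: nF_le1 h0 (unit1 _ z1) (unit1 _ w1) s0.
have sg0 v : V v -> sg v != 0 by move=> /far h; rewrite -cn_gt0; exact: lt_le_trans h.
have Vphi v : V v -> exists z w : C, [/\ cn z < 1, cn w < 1 & v = phi (z, w)].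
  by move=> /VG /G_cn[z [w [z1 w1 ->]]]; exists z, w.
have [||eps e0 he] := @perturb R (fun z w => [/\ cn z < 1, cn w < 1 & V (phi (z, w))])
  (fun z => F (phi z)) (fun z => X (phi z)).
- by move=> z w [z1 w1 Vz]; apply: F1; rewrite ?ltW//; exact: sg0.
(* Points close to the node are not over [V]; away from it the boundary estimates apply. *)
- move=> z w z1 w1; have [near|far'] := ltP (cn (sg (phi (z, w)))) c.
    left; exists ((c - cn (sg (phi (z, w)))) / 2); first by rewrite divr_gt0// subr_gt0.
    move=> z' w' hz hw [_ _ /far]; rewrite leNgt => /negP; apply.
    rewrite -[2 - _]/(sg (phi (z', w'))) -(subrK (sg (phi (z, w))) (sg (phi (z', w')))).
    apply: le_lt_trans (cnD _ _) _.
    have -> : sg (phi (z', w')) - sg (phi (z, w)) = - (om * ((z' - z) + (w' - w))).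
      by rewrite /sg /phi /=; ring.
    rewrite cnN cnM o1 mul1r; have := cnD (z' - z) (w' - w); arith.
  right; have s0 : sg (phi (z, w)) != 0 by rewrite -cn_gt0; exact: lt_le_trans far'.
  have [n0 n1] := dens _ _ z1 w1 s0; split.
  + exact: (dfcomp (dphi (z, w)) (dF _ n0)).
  + exact: (dfcomp (dphi (z, w)) (dX _ n0 n1)).
  + exact: F1.
  move=> hF; rewrite /X mulrBr rpB.
  have -> : cj (F (phi (z, w))) * (q%:C * F (phi (z, w))) = q%:C * (F (phi (z, w)) * cj (F (phi (z, w)))) by ring.
  rewrite mulcJ hF expr1n mulr1 [rp q%:C]/= subr_lt0; apply: le_lt_trans q0.
  rewrite /F sgE piE in hF far' *.
  have hK : (cn c1 + cn c2 * (8 / c)) ^+ 2 <= K by exact: lexx.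
  have B := nchi_bd c0 h0 dl0 c00 (unit1 _ z1) (unit1 _ w1) far' hK hF.
  exact: B.
pose f (v : Cplx2 R) : Cplx R := F v + eps%:C * X v.
have Vsg v : G v -> sg v != 0.
  move=> Gv; rewrite /sg -cn_gt0; have [s2 _] := G_bound Gv.
  by have := cnD (2 - om * v.1) (om * v.1); rewrite subrK cnM o1 mul1r -{1}rCnat cnR ger0_norm//; arith.
have hf : holomorphic_on G f.
  move=> v Gv; have /G_cn[z [w [z1 w1 vE]]] := Gv.
  have vE' : v = phi (z, w) by rewrite vE.
  have s0 := Vsg _ Gv; have [n0 n1] : (sg v : C) + (cj m0 - 1) * pi v != 0 /\
    (pi v : C) + dl%:C * (sg v - pi v) != 0.
    by move: s0; rewrite vE' => s0; exact: dens (ltW z1) (ltW w1) s0.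
  exact: (dfD (dF _ n0) (dfM (dfc v eps%:C) (dX _ n0 n1))).
have f1 v : V v -> cn (f v) <= 1.
  by move=> Vv; have [z [w [z1 w1 vE]]] := Vphi _ Vv; rewrite vE; apply: he; rewrite ?ltW// -vE.
have [g [hg gf g1]] := npep_use HV (ex_intro _ x Vx) (hol_analytic VG hf) f1.
have val v : geod om al be ga v -> F v = (cm om v - m0) / (cm om v + cj m0) /\
    X v = (cm om v - m0) / (cm om v + cj m0) *
      ((cm om v - 'i * (ip m1)%:C) ^+ 2 - K%:C * (dl%:C * cm om v / (1 + dl%:C * cm om v)) - q%:C).
  move=> kv; have [e1 e2] := cm_sg o1 kv.1; have hv := cm_gt0 o1 kv.1.
  have n0 := hp_sum_neq0 hv h0.
  have n1 : 1 + dl%:C * cm om v != 0.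
    by apply/eqP => /(congr1 (@complex.Re _)); rewrite rpD rpRM /=; narith.
  have [FE _ XE] := nval c0 c1 c2 K (cden_neq0 o1 kv.1) e1 e2 n0 n1.
  rewrite /X /F /sg /pi FE; split=> //; rewrite XE QE// QsE//.
  move: (dl%:C * _ / _) (K%:C) (q%:C) ('i * _) (cj m0) n0 => t k r i n n0; field; exact: n0.
have fx : g x = 0.
  by rewrite gf// /f; have [-> ->] := val _ kx; rewrite -m0E subrr !mul0r mulr0 addr0.
have := geod_schwarz o1 gq hg g1 kx ky fx; rewrite gf// /f; have [-> ->] := val _ ky.
rewrite -m0E -m1E.
set P := (m1 - m0) / _; set T := (_ - q%:C).
have P0 : 0 < cn P.
  rewrite cn_gt0 mulf_neq0 ?invr_neq0 ?hp_sum_neq0// subr_eq0; apply/eqP => e.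
  by apply: xy; rewrite (geod_gk o1 kx) (geod_gk o1 ky) -m0E -m1E e.
rewrite (_ : P + _ = P * (1 + eps%:C * T)); last by ring.
rewrite cnM ger_pMr// leNgt => /negP; apply.
apply: lt_le_trans (rp_le_cn _); apply: lt_le_trans (ler_norm _).
rewrite rpD rpRM [rp 1]/= ltrDl mulr_gt0// /T !rpB [rp q%:C]/= rpRM.
have -> : m1 - 'i * (ip m1)%:C = (rp m1)%:C by case: (m1) => u v; apply: cxP => /=; ring.
rewrite -rCX [rp (_ ^+ 2)%:C]/=.
have den1 : 1 <= cn (1 + dl%:C * m1).
  by apply: le_trans (rp_le_cn _); apply: le_trans (ler_norm _); rewrite rpD rpRM /= lerDl mulr_ge0// ltW.
have gs : rp (dl%:C * m1 / (1 + dl%:C * m1)) <= dl * cn m1.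
  apply: le_trans (ler_norm _) _; apply: le_trans (rp_le_cn _) _.
  rewrite cnM cnV cnM cnR gtr0_norm// ler_pdivrMr; last by arith.
  by rewrite ler_peMr// mulr_ge0 ?cn_ge0// ltW.
have ks : K * rp (dl%:C * m1 / (1 + dl%:C * m1)) <= q.
  apply: le_trans (ler_wpM2l K0 gs) _.
  rewrite (_ : q = (K + 1) * (dl * (cn m1 + 1))); last first.
    rewrite /dl; move: M0; have k1 : 0 < K + 1 by arith.
    have t1 : 0 < cn m1 + 1 by have := cn_ge0 m1; arith.
    by move: (K + 1) (cn m1 + 1) k1 t1 => a b a0 b0 _; field; rewrite !gt_eqF.
  have t0 := cn_ge0 m1; apply: ler_pM; [exact: K0|by rewrite mulr_ge0// ltW|by arith|].
  by apply: ler_wpM2l; [exact: ltW|arith].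
have x2 : 0 < rp m1 ^+ 2 by rewrite exprn_gt0.
by move: ks x2; rewrite /q; move: (rp (_ / _)) (rp m1 ^+ 2) => t Y; arith.
Qed.
End NodeLemma.

(** * Arcs in algebraic sets *)

Section Polynomials.
Variable R : realType.
Notation C := R[i].

Lemma poly2_subst (P : {poly {poly C}}) (A B E : {poly C}) : exists (N : nat) (T : {poly C}),
  forall m : C, E.[m] != 0 -> P.[A.[m] / E.[m], B.[m] / E.[m]] = T.[m] / E.[m] ^+ N.
Proof.
have inner (c : {poly C}) : exists (N : nat) (T : {poly C}),
    forall m : C, E.[m] != 0 -> c.[B.[m] / E.[m]] = T.[m] / E.[m] ^+ N.
  elim/poly_ind: c => [|c k [N [T h]]]; first by exists 0%N, 0 => m _; rewrite !horner0 mul0r.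
  exists N.+1, (T * B + k%:P * E ^+ N.+1) => m m0.
  rewrite hornerMXaddC h// hornerD !hornerM hornerC horner_exp !exprS.
  move: (E.[m] ^+ N) (expf_neq0 N m0) => u u0; move: (E.[m]) m0 => v v0.
  by field; rewrite u0 v0.
elim/poly_ind: P => [|P c [N [T h]]]; first by exists 0%N, 0 => m _; rewrite !horner0 mul0r.
have [M [U hc]] := inner c.
exists (N + M).+1, (T * A * E ^+ M + U * E ^+ N.+1) => m m0.
rewrite hornerMXaddC hornerD hornerM hornerC h// hc// hornerD !hornerM !horner_exp !exprS !exprD.
move: (E.[m] ^+ N) (expf_neq0 N m0) (E.[m] ^+ M) (expf_neq0 M m0) => u u0 v v0; move: (E.[m]) m0 => w w0.
by field; rewrite u0 v0 w0.
Qed.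

Lemma poly_roots_accum (q : {poly C}) (s0 : C) :
  (forall d : R, 0 < d -> exists s, [/\ s != s0, cn (s - s0) < d & q.[s] = 0]) -> q = 0.
Proof.
move=> h; apply/eqP/negP => /negP q0.
have key (n : nat) : exists rs : seq C, [/\ size rs = n, uniq rs, all (root q) rs & s0 \notin rs].
  elim: n => [|n [rs [sz u ar ns]]]; first by exists [::].
  have [d d0 hd] : exists2 d : R, 0 < d & forall r, r \in rs -> d <= cn (r - s0).
    elim: rs ns {sz u ar} => [|r rs IH]; first by exists 1.
    rewrite inE negb_or => /andP[rn /IH[d d0 hd]].
    exists (Num.min d (cn (r - s0))).
      by rewrite lt_min d0 cn_gt0 subr_eq0 eq_sym.
    by move=> t; rewrite inE => /orP[/eqP ->|/hd h2]; rewrite ge_min ?lexx ?orbT// h2.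
  have [s [sn sd sr]] := h _ d0.
  exists (s :: rs); split=> /=.
  - by rewrite sz.
  - rewrite u andbT; apply/negP => /hd; arith.
  - by rewrite ar andbT; apply/rootP.
  - by rewrite inE negb_or ns andbT eq_sym.
have [rs [sz u ar _]] := key (size q).
by have := max_poly_roots q0 ar u; rewrite sz ltnn.
Qed.

Lemma poly_nonzero_near (q : {poly C}) (s0 : C) (d : R) : q != 0 -> 0 < d ->
  exists2 s, cn (s - s0) < d & q.[s] != 0.
Proof.
move=> q0 d0; apply: contrapT => none; move/negP: q0; apply; apply/eqP.
apply: (@poly_roots_accum q s0) => e e0.
have [t [t0 td te]] : exists t : R, [/\ 0 < t, t < d & t < e].
  exists (Num.min (d / 2) (e / 2)); rewrite lt_min !divr_gt0//; split=> //.
    by apply: (@le_lt_trans _ _ (d / 2)); [rewrite ge_min lexx|arith].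
  by apply: (@le_lt_trans _ _ (e / 2)); [rewrite ge_min lexx orbT|arith].
have e1 : s0 + t%:C - s0 = t%:C by rewrite addrC addKr.
have nt : cn (t%:C : C) = t by rewrite cnR gtr0_norm.
exists (s0 + t%:C); split; rewrite ?e1 ?nt//.
  by rewrite -subr_eq0 e1 rC_neq0.
by apply/eqP/negP => /negP n0; apply: none; exists (s0 + t%:C); rewrite // e1 nt.
Qed.

(** If every root were at distance at least [rho] from [s], the logarithmic derivative, a sum of
    terms [1 / (s - r)] over the roots, would be at most the degree divided by [rho]. *)
Lemma root_near (q : {poly C}) (s : C) : q^`().[s] != 0 -> q.[s] != 0 ->
  exists r, q.[r] = 0 /\ cn (r - s) * cn q^`().[s] < 2 * (size q)%:R * cn q.[s].
Proof.
move=> d0 q0.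
have key (rs : seq C) (rho : R) : 0 <= rho -> (forall r, r \in rs -> rho <= cn (r - s)) ->
    cn (\prod_(z <- rs) ('X - z%:P))^`().[s] * rho <= (size rs)%:R * cn (\prod_(z <- rs) ('X - z%:P)).[s].
  move=> rho0; elim: rs => [|r rs IH] h.
    by rewrite big_nil derivC horner0 cn0 !mul0r.
  rewrite big_cons derivM derivXsubC mul1r hornerD !hornerM hornerXsubC.
  have h1 : rho <= cn (s - r) by rewrite cnBC h// mem_head.
  have {}IH := IH (fun t tr => h t (mem_behead (s := r :: rs) tr)).
  set a := (\prod_(z <- rs) _).[s] in IH *; set b := (\prod_(z <- rs) _)^`().[s] in IH *.
  apply: le_trans (_ : (cn a + cn (s - r) * cn b) * rho <= _).
    by rewrite ler_wpM2r//; apply: le_trans (cnD _ _) _; rewrite cnM.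
  rewrite /= cnM -natr1 !mulrDl mul1r addrC.
  have h2 : cn a * rho <= cn (s - r) * cn a by rewrite mulrC ler_wpM2r ?cn_ge0.
  have h3 : cn (s - r) * cn b * rho <= (size rs)%:R * (cn (s - r) * cn a).
    by rewrite -mulrA [X in _ <= X]mulrCA ler_wpM2l ?cn_ge0.
  arith.
have [rs qE] := closed_field_poly_normal q.
have l0 : lead_coef q != 0.
  by rewrite lead_coef_eq0; apply: contra q0 => /eqP ->; rewrite horner0.
have szq : size q = (size rs).+1 by rewrite qE size_scale// size_prod_XsubC.
pose rho := 2 * (size q)%:R * cn q.[s] / cn q^`().[s].
have dp : 0 < cn q^`().[s] by rewrite cn_gt0.
have qp : 0 < cn q.[s] by rewrite cn_gt0.
have sp : 0 < (size q)%:R :> R by rewrite szq ltr0n.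
have rho0 : 0 < rho by rewrite divr_gt0// !mulr_gt0.
have [all_far|] := pselect (forall r, r \in rs -> rho <= cn (r - s)).
  exfalso; have := key rs rho (ltW rho0) all_far.
  set Pi := \prod_(z <- rs) _ in qE *.
  have e1 : cn q.[s] = cn (lead_coef q) * cn Pi.[s] by rewrite {1}qE hornerZ cnM.
  have e2 : cn q^`().[s] = cn (lead_coef q) * cn Pi^`().[s] by rewrite {1}qE derivZ hornerZ cnM.
  have lp : 0 < cn (lead_coef q) by rewrite cn_gt0.
  rewrite -(ler_pM2l lp) mulrA -e2 [X in _ <= X]mulrCA -e1 /rho mulrC divfK ?gt_eqF//.
  rewrite szq -[(size rs).+1%:R]natr1; have : 0 <= (size rs)%:R * cn q.[s] by rewrite mulr_ge0// ltW.
  by move: qp; move: (size rs)%:R (cn q.[s]) => t a; arith.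
move=> /existsNP[r /not_implyP[rrs /negP]]; rewrite -ltNge => hr.
exists r; split; last by rewrite -ltr_pdivlMr.
by apply/rootP; rewrite qE rootZ// root_prod_XsubC.
Qed.

(** In [P.[s, p]] the outer variable of [P] is [s]; freezing [p] leaves a polynomial in [s]. *)
Definition evy (p : C) (P : {poly {poly C}}) : {poly C} := map_poly (horner_eval p) P.

Lemma evyE p P s : (evy p P).[s] = P.[s, p].
Proof.
rewrite /evy -{1}(hornerC s p : (horner_eval p s%:P) = s) horner_map.
by rewrite /horner_eval.
Qed.

Lemma evy_deriv p P : (evy p P)^`() = evy p P^`().
Proof. by rewrite /evy deriv_map. Qed.

Lemma size_evy p P : (size (evy p P) <= size P)%N.
Proof. by rewrite /evy; exact: size_poly. Qed.
End Polynomials.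

(** * Implicit functions and regular arcs *)

Section Implicit.
Variable R : realType.
Notation C := R[i].
Notation G := (symmetrized_bidisc R).

Lemma df_poly (U : normedModType C) (c : {poly C}) (f : U -> Cplx R) (x : U) :
  differentiable f x -> differentiable (fun y => c.[f y] : Cplx R) x.
Proof.
move=> df; elim/poly_ind: c => [|c k IH].
  rewrite (_ : (fun y => _) = (fun=> 0)); first exact: dfc.
  by apply/funext => y; rewrite horner0.
rewrite (_ : (fun y => _) = (fun y => (c.[f y] : C) * f y + k : Cplx R)).
  exact: (dfD (dfM IH df) (dfc x k)).
by apply/funext => y; rewrite hornerMXaddC.
Qed.

Lemma df_poly2 (U : normedModType C) (P : {poly {poly C}}) (f g : U -> Cplx R) (x : U) :
  differentiable f x -> differentiable g x -> differentiable (fun y => P.[f y, g y] : Cplx R) x.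
Proof.
move=> df dg; elim/poly_ind: P => [|P c IH].
  rewrite (_ : (fun y => _) = (fun=> 0)); first exact: dfc.
  by apply/funext => y; rewrite !horner0.
rewrite (_ : (fun y => _) = (fun y => (P.[f y, g y] : C) * f y + c.[g y] : Cplx R)).
  exact: (dfD (dfM IH df) (df_poly c dg)).
by apply/funext => y; rewrite hornerMXaddC hornerD hornerM hornerC.
Qed.

(** The divided difference in the first variable, as a function differentiable in all three
    arguments. Its value on the diagonal being the derivative, it stays bounded away from zero near
    a simple root. *)
Lemma diff_quotient (P : {poly {poly C}}) : exists D : (Cplx2 R * Cplx R)%type -> Cplx R,
  [/\ forall x, differentiable D x,
   forall s s' p : C, P.[s, p] - P.[s', p] = (s - s') * D ((s, s'), p) &
   forall s p : C, D ((s, s), p) = P^`().[s, p]].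
Proof.
elim/poly_ind: P => [|P c [D [dD hD hd]]].
  exists (fun=> 0); split=> [x|s s' p|s p]; first exact: dfc.
    by rewrite !horner0 mulr0 subr0.
  by rewrite deriv0 !horner0.
pose U := (Cplx2 R * Cplx R)%type.
pose f1 (x : U) : Cplx R := x.1.1; pose f2 (x : U) : Cplx R := x.1.2; pose f3 (x : U) : Cplx R := x.2.
have dfst x : differentiable (fst : U -> Cplx2 R) x by apply: linear_differentiable => ?; exact: cvg_fst.
have dsnd x : differentiable (snd : U -> Cplx R) x by apply: linear_differentiable => ?; exact: cvg_snd.
have d1 x : differentiable f1 x := dfcomp (dfst x) (differentiable_fst x.1).
have d2 x : differentiable f2 x := dfcomp (dfst x) (differentiable_snd x.1).
have d3 x : differentiable f3 x := dsnd x.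
exists (fun x => (D x : C) * f1 x + P.[f2 x, f3 x]); split=> [x|s s' p|s p].
- exact: (dfD (dfM (dD x) (d1 x)) (df_poly2 P (d2 x) (d3 x))).
- rewrite /f1 /f2 /f3 /= !hornerMXaddC !hornerD !hornerM !hornerC.
  have := hD s s' p; move: (D _) (P.[s, p]) (P.[s', p]) => d a b h.
  rewrite (_ : a * s + c.[p] - (b * s' + c.[p]) = (a - b) * s + b * (s - s')); last by ring.
  by rewrite h; ring.
- by rewrite /f1 /f2 /f3 /= hd derivD derivC addr0 derivM derivX mulr1 hornerD hornerM hornerX !hornerD hornerM hornerC.
Qed.

Lemma df_near1 (f : Cplx R -> Cplx R) (x : Cplx R) : differentiable f x ->
  forall e : R, 0 < e -> exists2 d : R, 0 < d & forall y : C, cn (y - x) < d -> cn (f y - f x) < e.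
Proof.
move=> df e e0; have [d d0 h] := cdif_ctn (diff_cdif df) e0.
by exists d.
Qed.

Lemma df_near3 (f : (Cplx2 R * Cplx R)%type -> Cplx R) (s s' p : C) : differentiable f (((s, s'), p) : (Cplx2 R * Cplx R)%type) ->
  forall e : R, 0 < e -> exists2 d : R, 0 < d & forall t t' q : C,
    cn (t - s) < d -> cn (t' - s') < d -> cn (q - p) < d -> cn (f ((t, t'), q) - f ((s, s'), p)) < e.
Proof.
pose x0 : (Cplx2 R * Cplx R)%type := ((s, s'), p).
rewrite -/x0 => /differentiable_continuous df e e0.
have : nbhs x0 (f @^-1` [set y | `|y - f x0| < e%:C]).
  by apply: df; apply/nbhs_normC; exists e.
move=> /nbhs_normC[d d0 h]; exists d => // t t' q h1 h2 h3.
have := h ((t, t'), q); rewrite /= cnoE ltcR; apply.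
rewrite prod_normE /=.
have h4 : `|((t, t') - (s, s') : Cplx2 R)| < d%:C by apply/ball2P.
have h5 : `|(q - p : Cplx R)| < d%:C by rewrite cnoE ltcR.
by rewrite /Order.max; case: ifP.
Qed.

Lemma cdif_differentiable (f : Cplx R -> Cplx R) (w : Cplx R) (l : C) : cdif f w l -> differentiable f w.
Proof.
move=> h; have cg : continuous ( *:%R l : Cplx R -> Cplx R).
  by move=> x; exact: (differentiable_continuous (dfM (dfc x l) (dfid x))).
apply: (eps_differentiable (g := *:%R l) cg) => e e0.
have [d d0 hd] := h e e0; exists d => // v; rewrite cnoE ltcR => hv.
have := hd (v + w); rewrite addrK => /(_ hv) h2.
by rewrite !cnoE -rCM lecR.
Qed.

(** A root near [s0] is chosen for each [p] by [root_near]. Regularity does not depend on the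
    choice: any two chosen roots satisfy [(phi p - phi p1) D = - c p] with [D] bounded below, which
    gives continuity and then the derivative [- l / D1]. *)
Lemma implicit (P : {poly {poly C}}) (s0 p0 : C) (tau : R) : 0 < tau ->
  P.[s0, p0] = 0 -> P^`().[s0, p0] != 0 -> exists2 r : R, 0 < r & exists phi : Cplx R -> Cplx R,
    forall p : C, cn (p - p0) < r -> [/\ P.[phi p, p] = 0, cn (phi p - s0) < tau & differentiable phi (p : Cplx R)].
Proof.
move=> tau0 P0 dv0; have [D [dD hD hd]] := diff_quotient P.
have [dv dvE] : exists dv, dv = P^`().[s0, p0] by eexists.
rewrite -dvE in dv0; have dvp : 0 < cn dv by rewrite cn_gt0.
have dv2 : 0 < cn dv / 2 by arith.
have [d1 d10 h1] := df_near3 (dD ((s0, s0), p0)) dv2.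
pose t := Num.min d1 tau; have t0 : 0 < t by rewrite lt_min d10.
pose n : R := (size P).+1%:R; have n0 : 0 < n by rewrite ltr0n.
have eta0 : 0 < t * cn dv / (8 * n) by rewrite divr_gt0// mulr_gt0.
have dP (Q : {poly {poly C}}) (s : C) (p : Cplx R) : differentiable (fun p : Cplx R => Q.[s, p] : Cplx R) p.
  exact: (df_poly2 Q (dfc p s) (dfid p)).
have [d2 d20 h2] := df_near1 (dP P s0 p0) eta0.
have [d3 d30 h3] := df_near1 (dP P^`() s0 p0) dv2.
pose r := Num.min t (Num.min d2 d3); have r0 : 0 < r by rewrite lt_min t0 lt_min d20.
have td1 : t <= d1 by rewrite ge_min lexx.
have tt : t <= tau by rewrite ge_min lexx orbT.
have rt : r <= t by rewrite ge_min lexx.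
have rd2 : r <= d2 by rewrite !ge_min lexx orbT.
have rd3 : r <= d3 by rewrite !ge_min lexx !orbT.
clearbody r t.
have Dlow s s' p : cn (s - s0) < t -> cn (s' - s0) < t -> cn (p - p0) < r -> cn dv / 2 < cn (D ((s, s'), p)).
  move=> a b c; have := h1 s s' p ltac:(clear - a b c td1 rt; lra) ltac:(clear - a b c td1 rt; lra) ltac:(clear - a b c td1 rt; lra).
  rewrite hd -dvE => h; have := cnD (D (s, s', p)) (dv - D (s, s', p)); rewrite addrC subrK (cnBC dv); clear - dv2 h; lra.
have ex (p : C) : exists s : C, cn (p - p0) < r -> P.[s, p] = 0 /\ cn (s - s0) < t.
  have [pr|pr] := ltP (cn (p - p0)) r; last by exists 0.
  have := h2 p ltac:(arith); rewrite P0 subr0 => a.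
  have := h3 p ltac:(clear - pr rd3; lra); rewrite -dvE => b.
  have {}b : cn dv / 2 < cn P^`().[s0, p].
    by have := cnD P^`().[s0, p] (dv - P^`().[s0, p]); rewrite addrC subrK (cnBC dv); clear - b; lra.
  have [e0|e0] := eqVneq P.[s0, p] 0; first by exists s0; rewrite subrr cn0.
  have q1 : (evy p P)^`().[s0] != 0 by rewrite evy_deriv evyE -cn_gt0; clear - b dvp; lra.
  have q2 : (evy p P).[s0] != 0 by rewrite evyE.
  have [s [sr hs]] := root_near q1 q2; rewrite evyE in sr.
  exists s => _; split=> //; move: hs; rewrite evy_deriv !evyE => hs.
  have sz : (size (evy p P))%:R <= n.
    by rewrite ler_nat; apply: leq_trans (size_evy p P) _.
  have c0 : 0 <= cn P.[s0, p] by exact: cn_ge0.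
  have h4 : 2 * (size (evy p P))%:R * cn P.[s0, p] <= 2 * n * (t * cn dv / (8 * n)).
    apply: ler_pM => //; rewrite ?mulr_ge0//; last exact: ltW.
    by rewrite ler_wpM2l.
  have h5 : 2 * n * (t * cn dv / (8 * n)) = t * (cn dv / 4) by field; rewrite gt_eqF.
  have h6 : cn (s - s0) * (cn dv / 2) <= cn (s - s0) * cn P^`().[s0, p].
    by rewrite ler_wpM2l ?cn_ge0// ltW.
  rewrite -(ltr_pM2r dv2); apply: le_lt_trans h6 _; apply: lt_le_trans hs _; apply: le_trans h4 _.
  by rewrite h5; apply: ler_wpM2l; [exact: ltW|clear - dvp; lra].
have [phi hphi] := choice ex.
exists r => //; exists phi => p1 pr1; have [z1 s1] := hphi _ pr1.
split=> //; first by clear - s1 tt; lra.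
pose D1 := D ((phi p1, phi p1), p1).
have D1p : cn dv / 2 < cn D1 by apply: Dlow.
have D10 : D1 != 0 by rewrite -cn_gt0; clear - D1p dvp; lra.
pose c (p : Cplx R) : Cplx R := P.[phi p1, p].
have c1 : c p1 = 0 by [].
have dc : differentiable c (p1 : Cplx R) := dP P (phi p1) p1.
have rel p : cn (p - p0) < r -> (phi p - phi p1) * D ((phi p, phi p1), p) = - c p.
  by move=> pr; rewrite -hD (hphi _ pr).1 sub0r.
have rr0 : 0 < r - cn (p1 - p0) by rewrite subr_gt0.
have close p : cn (p - p1) < r - cn (p1 - p0) -> cn (p - p0) < r.
  by move=> h; have := cn_tri p1 p p0; clear - h; lra.
have phic e : 0 < e -> exists2 d, 0 < d & forall p : C, cn (p - p1) < d -> cn (phi p - phi p1) < e.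
  move=> e0; have e1 : 0 < e * (cn dv / 2) by rewrite mulr_gt0.
  have [d d0 h] := df_near1 dc e1; exists (Num.min d (r - cn (p1 - p0))); first by rewrite lt_min d0.
  move=> p; rewrite lt_min => /andP[pd /close pr]; have := h _ pd; rewrite c1 subr0 => cp.
  have Dp := Dlow _ _ _ (hphi _ pr).2 s1 pr.
  have E : cn ((phi p - phi p1) * D ((phi p, phi p1), p)) = cn (- c p) by rewrite (rel _ pr).
  rewrite cnM cnN in E; rewrite -E in cp.
  have : cn (phi p - phi p1) * (cn dv / 2) <= cn (phi p - phi p1) * cn (D (phi p, phi p1, p)).
    by rewrite ler_wpM2l ?cn_ge0// ltW.
  by move=> h4; rewrite -(ltr_pM2r dv2); apply: le_lt_trans h4 cp.
have [l hc] : exists l : C, cdif c p1 l by eexists; exact: (diff_cdif dc).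
have key : cdif phi p1 (- (l / D1)); last exact: (cdif_differentiable key).
move=> e e0.
have [e1 e10 e1E] : exists2 e1, 0 < e1 & e1 * 2 / cn dv <= e / 2.
  exists (e * cn dv / 4); first by rewrite divr_gt0// mulr_gt0.
  by rewrite le_eqVlt; apply/orP; left; apply/eqP; field; rewrite gt_eqF.
have [e2 e20 e2E] : exists2 e2, 0 < e2 & cn l * e2 * (2 / cn dv) ^+ 2 <= e / 2.
  have l0 := cn_ge0 l.
  exists (e * cn dv ^+ 2 / (8 * (cn l + 1))).
    by rewrite divr_gt0// ?mulr_gt0 ?exprn_gt0//; clear - l0; lra.
  have X0 : 0 < cn l + 1 by clear - l0; lra.
  rewrite (_ : cn l * _ * _ = (e / 2) * (cn l / (cn l + 1))); last by field; rewrite !gt_eqF.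
  by rewrite ler_piMr ?divr_ge0 ?(ltW e0)// ler_pdivrMr// mul1r; clear - l0; lra.
have [da da0 ha] := hc _ e10.
have [db db0 hb] := df_near3 (dD ((phi p1, phi p1), p1)) e20.
have [dp dp0 hp] := phic _ db0.
exists (Num.min (r - cn (p1 - p0)) (Num.min da (Num.min db dp))).
  by rewrite !lt_min rr0 da0 db0.
move=> p; rewrite !lt_min => /and4P[/close pr pa pb pp].
have Dp := Dlow _ _ _ (hphi _ pr).2 s1 pr.
have D0 : D ((phi p, phi p1), p) != 0 by rewrite -cn_gt0; clear - Dp dvp; lra.
have hb' := hb (phi p) (phi p1) p (hp _ pp) ltac:(by rewrite subrr cn0) pb.
have ha' := ha _ pa; rewrite c1 subr0 in ha'.
have E := rel _ pr; rewrite -/D1 in hb'.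
move: E D0 Dp hb' ha'; move: (D (phi p, phi p1, p)) (c p) => Dv cp E D0 Dp hb' ha'.
have -> : phi p - phi p1 - - (l / D1) * (p - p1) =
    - ((cp - l * (p - p1)) / Dv) + l * (p - p1) * (Dv - D1) / (Dv * D1).
  have -> : phi p - phi p1 = - cp / Dv by rewrite -E mulfK.
  by field; rewrite D0 D10.
have v0 := cn_ge0 (p - p1).
have iD (z : C) : cn dv / 2 < cn z -> (cn z)^-1 <= 2 / cn dv.
  move=> h; rewrite -[2 / _]invrK invf_div lef_pV2 ?posrE//; first exact: ltW.
  by apply: lt_trans h.
apply: le_trans (cnD _ _) _; rewrite cnN !cnM !cnV !cnM.
have b1 : cn (cp - l * (p - p1)) * (cn Dv)^-1 <= e / 2 * cn (p - p1).
  apply: le_trans (_ : e1 * cn (p - p1) * (2 / cn dv) <= _).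
    by apply: ler_pM => //; rewrite ?cn_ge0 ?invr_ge0 ?cn_ge0// iD.
  by rewrite mulrAC mulrA ler_wpM2r.
have b2 : cn l * cn (p - p1) * cn (Dv - D1) * (cn Dv * cn D1)^-1 <= e / 2 * cn (p - p1).
  apply: le_trans (_ : cn l * cn (p - p1) * e2 * (2 / cn dv) ^+ 2 <= _).
    apply: ler_pM; rewrite ?mulr_ge0 ?cn_ge0 ?invr_ge0 ?mulr_ge0 ?cn_ge0//.
      by rewrite ler_wpM2l ?mulr_ge0 ?cn_ge0// ltW.
    by rewrite invfM expr2 ler_pM ?invr_ge0 ?cn_ge0 ?iD.
  rewrite (_ : cn l * _ * _ * _ = cn l * e2 * (2 / cn dv) ^+ 2 * cn (p - p1)); last by ring.
  by rewrite ler_wpM2r.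
clear - b1 b2; lra.
Qed.

Lemma nat_least (Q : nat -> Prop) : (exists n, Q n) -> exists n, Q n /\ forall m, Q m -> (n <= m)%N.
Proof.
move=> [n Qn]; have e : exists n, `[< Q n >] by exists n; apply/asboolP.
exists (ex_minn e); case: ex_minnP => m /asboolP Qm h; split=> // k Qk; apply: h; exact/asboolP.
Qed.

(* Let [P] have least outer degree among the polynomials vanishing on [V]. Then
   [P'] does not vanish on all of [V], and pseudo-division by [P] shows that every
   equation of [V] holds on the graph of the implicit function. *)
Lemma local_curve (V : set (Cplx2 R)) (S : set {poly {poly C}}) (P0 : {poly {poly C}}) :
  V = G `&` [set x : Cplx2 R | forall p, S p -> p.[x.1, x.2] = 0] -> V !=set0 ->
  (forall x W, V x -> open W -> W x -> exists z, [/\ V z, W z & z <> x]) ->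
  P0 != 0 -> S P0 ->
  exists (t0 : C) (r : R) (gam : Cplx R -> Cplx2 R), 0 < r /\
   forall t : C, cn (t - t0) < r -> [/\ V (gam t), differentiable gam (t : Cplx R) &
     forall t' : C, gam t' = gam t -> t' = t].
Proof.
move=> VE [x0 Vx0] iso P00 SP0.
have VS T x : S T -> V x -> T.[x.1, x.2] = 0 by move=> ST; rewrite VE => -[_]; exact.
have [n [[P [Pn0 PV szP]] minP]] := @nat_least (fun n => exists P : {poly {poly C}},
  [/\ P != 0, forall x, V x -> P.[x.1, x.2] = 0 & size P = n])
  (ex_intro _ (size P0) (ex_intro _ P0 (And3 P00 (fun x => VS P0 x SP0) erefl))).
have small T : (forall x, V x -> T.[x.1, x.2] = 0) -> (size T < n)%N -> T = 0.
  move=> hT sT; apply/eqP/negP => /negP T0.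
  by have := minP (size T) (ex_intro _ T (And3 T0 hT erefl)); rewrite leqNgt sT.
have VG x : V x -> G x by rewrite VE => -[].
have [sz1|sz1] := leqP n 1.
  (* Here [P] involves only the second variable, so near [x0] the set lies on the line [p = x0.2].
     As [x0] is not isolated, each equation has accumulating zeros on that line and vanishes on it
     identically. *)
  have PC : P = (P`_0)%:P by apply: size1_polyC; rewrite szP.
  pose c := P`_0; have c0 : c != 0 by apply: contra Pn0 => /eqP e; rewrite PC -/c e polyC0.
  have Vc x : V x -> c.[x.2] = 0 by move=> /PV; rewrite PC hornerC.
  have [d d0 hd] : exists2 d : R, 0 < d & forall y, V y -> cn (y.2 - x0.2) < d -> y.2 = x0.2.
    apply: contrapT => none; move/negP: c0; apply; apply/eqP; apply: (@poly_roots_accum _ c x0.2) => d d0.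
    apply: contrapT => none2; apply: none; exists d => // y Vy yd; apply: contrapT => yx.
    by apply: none2; exists y.2; split; [apply/eqP|exact: yd|exact: Vc].
  have T0 T s : S T -> T.[s, x0.2] = 0.
    move=> ST; rewrite -evyE (_ : evy x0.2 T = 0) ?horner0//.
    apply: (@poly_roots_accum _ _ x0.1) => e e0.
    pose W : set (Cplx2 R) := [set y | cn (y.1 - x0.1) < e /\ cn (y.2 - x0.2) < d].
    have oW : open W.
      apply: open2P => y [y1 y2]; apply/nbhs2P.
      exists (Num.min (e - cn (y.1 - x0.1)) (d - cn (y.2 - x0.2))); first by rewrite lt_min !subr_gt0 y1.
      move=> z; rewrite !lt_min => /andP[z1 _] /andP[_ z2]; split.
        by have := cn_tri y.1 z.1 x0.1; arith.
      by have := cn_tri y.2 z.2 x0.2; arith.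
    have Wx : W x0 by rewrite /W /= !subrr cn0.
    have [z [Vz [z1 z2] zx]] := iso _ _ Vx0 oW Wx.
    have e2 := hd _ Vz z2; exists z.1; split=> //.
      apply/eqP => e1; apply: zx; move: e1 e2; case: (z) => ? ?; case: (x0) => ? ? /= -> ->; done.
    by rewrite evyE -e2 VS.
  have /nbhs2P[r r0 hr] := G_nbhs (VG _ Vx0).
  exists x0.1, r, (fun t => (t, x0.2)); split=> // t tr; split.
  - by rewrite VE; split; [apply: hr; rewrite //= subrr cn0|move=> T ST; exact: T0].
  - exact: (differentiable_pair (dfid (t : Cplx R)) (dfc (t : Cplx R) x0.2)).
  - by move=> t' [].
have dP0 : P^`() != 0.
  have [k kE] : exists k, size P = k.+2.
    by move: sz1; rewrite -szP; case: (size P) => [|[|k]] // _; exists k.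
  apply/eqP => e; have := coef_deriv P k; rewrite e coef0 -scaler_nat => /esym/eqP.
  by rewrite scaler_eq0 pnatr_eq0 /= (_ : P`_k.+1 = lead_coef P) ?lead_coef_eq0 ?(negPf Pn0)// /lead_coef kE.
have [x1 Vx1 dx1] : exists2 x, V x & P^`().[x.1, x.2] != 0.
  apply: contrapT => none; move/negP: dP0; apply; apply/eqP/small; last by rewrite -szP lt_size_deriv.
  by move=> x Vx; apply/eqP/negP => /negP h; apply: none; exists x.
have /nbhs2P[tau tau0 htau] := G_nbhs (VG _ Vx1).
have [r r0 [phi hphi]] := implicit tau0 (PV _ Vx1) dx1.
have rt0 : 0 < Num.min r tau by rewrite lt_min r0.
have lP : lead_coef P != 0 by rewrite lead_coef_eq0.
(* Pseudo-division multiplies by a power of the leading coefficient, so the arc is restricted to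
   parameters where that coefficient does not vanish. *)
have [p1 p1r lc0] := poly_nonzero_near x1.2 lP rt0.
have [p1r' p1t] : cn (p1 - x1.2) < r /\ cn (p1 - x1.2) < tau by move: p1r; rewrite lt_min => /andP.
have lcp : 0 < cn (lead_coef P).[p1] by rewrite cn_gt0 lc0.
have [d d0 hd] := df_near1 (df_poly (lead_coef P) (dfid (p1 : Cplx R))) lcp.
pose rr := Num.min d (Num.min (r - cn (p1 - x1.2)) (tau - cn (p1 - x1.2))).
exists p1, rr, (fun t => (phi t, t)); split; first by rewrite !lt_min d0 !subr_gt0 p1r'.
move=> t; rewrite !lt_min => /and3P[td tr tt].
have tr' : cn (t - x1.2) < r by have := cn_tri p1 t x1.2; arith.
have tt' : cn (t - x1.2) < tau by have := cn_tri p1 t x1.2; arith.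
have [Pt pt dt] := hphi _ tr'.
have lt0 : (lead_coef P).[t] != 0.
  by apply/eqP => e; have := hd _ td; rewrite e sub0r cnN ltxx.
split; last by move=> t' [].
  rewrite VE; split; first exact: htau.
  move=> T ST /=.
  have E := Pdiv.WeakIdomain.divp_eq T P.
  have R0 : T %% P = 0.
    apply: small; last by rewrite -szP Pdiv.CommonIdomain.ltn_modp.
    move=> x Vx; have := congr1 (fun Q : {poly {poly C}} => Q.[x.1, x.2]) E.
    by rewrite hornerZ hornerM (VS _ _ ST Vx) mulr0 hornerD hornerD hornerM hornerM (PV _ Vx) mulr0 add0r => <-.
  have := congr1 (fun Q : {poly {poly C}} => Q.[phi t, t]) E.
  rewrite R0 addr0 hornerZ !hornerM Pt mulr0 horner_exp => /eqP.
  by rewrite mulf_eq0 expf_eq0 (negPf lt0) andbF => /eqP.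
exact: (differentiable_pair dt (dfid (t : Cplx R))).
Qed.
End Implicit.

(** * Sets not containing the royal variety *)

Section Generic.
Variable R : realType.
Notation C := R[i].
Notation G := (symmetrized_bidisc R).

(** The function ['i * q] has zero real part. Its Pick form at the centre and at [t], with weights 1
    and ['i * s], reduces to [s (q t0 - q t)], which is nonnegative for both signs of [s]. *)
Lemma holo_real_const (q : Cplx R -> Cplx R) (t0 : C) (r : R) :
  (forall t : C, cn (t - t0) < r -> differentiable q (t : Cplx R) /\ ip (q t) = 0) ->
  forall t : C, cn (t - t0) < r -> q t = q t0.
Proof.
move=> hq t tr; have r0 : 0 < r := le_lt_trans (cn_ge0 _) tr.
have h0 : cn (t0 - t0) < r by rewrite subrr cn0.
pose F (z : Cplx R) : Cplx R := 'i * q (t0 + r%:C * z).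
have inr (z : C) : cn z < 1 -> cn (t0 + r%:C * z - t0) < r.
  by move=> z1; rewrite addrC addKr cnM cnR gtr0_norm// gtr_pMr.
have dF : holomorphic_on (unit_disc R) F.
  move=> z z1; have z1' : cn z < 1 by rewrite -ltcR.
  exact: (dfM (dfc _ 'i) (dfcomp (dfD (dfc _ t0) (dfM (dfc _ r%:C) (dfid z))) (hq _ (inr _ z1')).1)).
have F0 z : cn z < 1 -> 0 <= rp (F z).
  by move=> /inr/hq[_ h]; rewrite /F rpM h mulr0 subr0 mul0r.
have [z1 z1E] : exists z1 : C, z1 = (t - t0) / r%:C by eexists.
have z11 : cn z1 < 1 by rewrite z1E cnM cnV cnR gtr0_norm// ltr_pdivrMr// mul1r.
have E1 : t0 + r%:C * z1 = t by rewrite z1E mulrC divfK ?rC_neq0// addrC subrK.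
have sgn (s : R) : 0 <= s * (rp (q t0) - rp (q t)).
  pose z (i : 'I_2) : C := if i == ord0 then 0 else z1.
  pose w (i : 'I_2) : C := if i == ord0 then 1 else s%:C * 'i.
  have hz i : cn (z i) < 1 by rewrite /z; case: ifP => // _; rewrite cn0.
  have := pick_disc dF F0 w hz.
  rewrite !big_ord_recl !big_ord0.
  have -> : z ord0 = 0 by []. 
  have -> : z (lift ord0 ord0) = z1 by [].
  have -> : w ord0 = 1 by [].
  have -> : w (lift ord0 ord0) = s%:C * 'i by [].
  rewrite !cjE !addr0 !(mul0r, mulr0, mul1r, mulr1, subr0, divr1).
  rewrite /F !mulr0 addr0 E1 mulcJ -rC1 -rCN -rCD -rCV.
  have [_ i0] := hq _ h0; have [_ i1] := hq _ tr.
  rewrite !(rpD, rpM, ipM, rpJ, ipJ, rpN, ipN) /= i0 i1 => h; apply: le_trans h _.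
  by rewrite le_eqVlt; apply/orP; left; apply/eqP; ring.
by apply: cxP; [have := sgn 1; have := sgn (-1); arith|rewrite (hq _ h0).2 (hq _ tr).2].
Qed.

Lemma dense_cover (T : eqType) (A : T -> C -> Prop) (s : seq T) : forall (t0 : C) (r : R), 0 < r ->
  (forall t, cn (t - t0) < r -> exists2 i, i \in s & A i t) ->
  exists i t1 r1, [/\ 0 < r1, forall t, cn (t - t1) < r1 -> cn (t - t0) < r &
    forall t e, cn (t - t1) < r1 -> 0 < e -> exists t', [/\ cn (t' - t) < e, cn (t' - t1) < r1 & A i t']].
Proof.
elim: s => [|i s IH] t0 r r0 h.
  by have [|j] := h t0; rewrite ?subrr ?cn0.
have [d|nd] := pselect (forall t e, cn (t - t0) < r -> 0 < e ->
  exists t', [/\ cn (t' - t) < e, cn (t' - t0) < r & A i t']).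
  by exists i, t0, r.
have [t [e [tr e0 none]]] : exists t e, [/\ cn (t - t0) < r, 0 < e &
    forall t', cn (t' - t) < e -> cn (t' - t0) < r -> ~ A i t'].
  apply: contrapT => h1; apply: nd => t e tr e0; apply: contrapT => h2; apply: h1.
  by exists t, e; split=> // t' a b c; apply: h2; exists t'.
have r'0 : 0 < Num.min e (r - cn (t - t0)) by rewrite lt_min e0 subr_gt0.
have sub t' : cn (t' - t) < Num.min e (r - cn (t - t0)) -> cn (t' - t) < e /\ cn (t' - t0) < r.
  by rewrite lt_min => /andP[a b]; split=> //; have := cn_tri t t' t0; arith.
have [|j [t1 [r1 [r10 s1 dn]]]] := IH t _ r'0.
  move=> t' /sub[a b]; have [j] := h _ b; rewrite inE => /orP[/eqP->|js Aj]; last by exists j.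
  by move=> Ai; case: (none _ a b Ai).
by exists j, t1, r1; split=> // t' /s1/sub[].
Qed.

(** For [al = 1] the denominator [cden] divides the equation of the curve, and a linear equation is
    left. *)
Lemma flat_coords om be ga (x : Cplx2 R) : cn om = 1 -> G x ->
  (cD om x = quad 1 be ga (cm om x)) <->
  ((1 + ga%:C) * (om * x.1) = (ga%:C - 1 - 'i * be%:C) + (ga%:C - 1 + 'i * be%:C) * (om ^+ 2 * x.2)).
Proof.
move=> o1 Gx; have := cden_neq0 o1 Gx; rewrite /cD /cm /quad /cden -exprMn.
move: (om * x.1) (om ^+ 2 * x.2) (ga%:C) ('i * be%:C) => s p g b n.
have key : (s ^+ 2 - 4 * p) / (1 - s + p) ^+ 2 -
    (1 * ((1 - p) / (1 - s + p)) ^+ 2 + b * ((1 - p) / (1 - s + p)) - g) =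
  - (1 - s + p)^-1 * ((1 + g) * s - ((g - 1 - b) + (g - 1 + b) * p)).
  by field.
split=> [/eqP|/eqP]; rewrite -subr_eq0 => h; apply/eqP; rewrite -subr_eq0; last first.
  by rewrite key (eqP h) mulr0.
by move: h; rewrite key mulf_eq0 oppr_eq0 invr_eq0 (negPf n).
Qed.

(** For [c] in the unit disc these lines foliate [G]: every point lies on exactly one, by
    [flat_exists] and [flat_unique]. *)
Definition flat (c : C) : set (Cplx2 R) := [set x | G x /\ x.1 = c + cj c * x.2].

Lemma disc_real_lt1 (z : C) : cn z < 1 -> rp z < 1.
Proof. by move=> h; apply: le_lt_trans h; apply: le_trans (rp_le_cn z); exact: ler_norm. Qed.

Lemma geod_flat om be ga : cn om = 1 -> good_quad 1 be ga ->
  exists2 c, cn c < 1 & geod om 1 be ga = flat c.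
Proof.
move=> o1 [_ _ /(_ erefl) h]; rewrite /Rb in h.
have g0 : 0 < ga by have := h 0; arith.
have b2 : be ^+ 2 < 4 * ga by have := h (- be / 2); narith.
have [a aE] : exists a : C, a = ((ga - 1) / (1 + ga)) +i* (- be / (1 + ga)) by eexists.
have g1 : 1 + ga != 0 by rewrite gt_eqF//; arith.
have G1 : 1 + ga%:C != 0 :> C by rewrite -rC1 -rCD rC_neq0//; arith.
have aM : (1 + ga%:C) * a = ga%:C - 1 - 'i * be%:C.
  by rewrite aE; apply: cxP => /=; field.
have aJ : (1 + ga%:C) * cj a = ga%:C - 1 + 'i * be%:C.
  by rewrite aE; apply: cxP => /=; field.
exists (cj om * a).
  rewrite cnM cnJ o1 mul1r -(ltr_pXn2r (n := 2)) ?nnegrE ?cn_ge0// expr1n cn_sqr aE /=.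
  rewrite !expr_div_n -mulrDl ltr_pdivrMr ?mul1r ?exprn_gt0//; last by arith.
  by narith.
have oo : om * cj om = 1 by rewrite mulcJ o1 expr1n.
apply/seteqP; split=> x [Gx hx]; split=> //.
  have /(flat_coords _ _ o1 Gx) := hx; rewrite -aM -aJ -!mulrA -mulrDr => /(mulfI G1) E.
  rewrite !cjE; transitivity (cj om * (om * x.1)); first by rewrite mulrA [cj om * om]mulrC oo mul1r.
  rewrite E.
  by rewrite mulrDr; congr (_ + _); ring: oo.
apply/(flat_coords _ _ o1 Gx); rewrite -aM -aJ -!mulrA -mulrDr hx !cjE; congr (_ * _).
by rewrite mulrDr; ring: oo.
Qed.

Lemma flat_geod om c : cn om = 1 -> cn c < 1 ->
  exists be ga, good_quad 1 be ga /\ geod om 1 be ga = flat c.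
Proof.
move=> o1 c1; have oo : om * cj om = 1 by rewrite mulcJ o1 expr1n.
have [a aE] : exists a : C, a = om * c by eexists.
have a1 : cn a < 1 by rewrite aE cnM o1 mul1r.
have ar := disc_real_lt1 a1.
have d0 : 0 < 1 - rp a by arith.
have d1 : 1 - rp a != 0 by rewrite gt_eqF.
pose ga := (1 + rp a) / (1 - rp a); pose be := - ip a * (1 + ga).
have g1E : 1 + ga = 2 / (1 - rp a) by rewrite /ga; field.
have g1 : 0 < 1 + ga by rewrite g1E divr_gt0.
have disc : be ^+ 2 < 4 * ga.
  rewrite /be g1E /ga (_ : (_ * _) ^+ 2 = 4 * ip a ^+ 2 / (1 - rp a) ^+ 2); last by field.
  rewrite ltr_pdivrMr ?exprn_gt0// (_ : _ * _ * _ = 4 * ((1 + rp a) * (1 - rp a))); last by field.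
  have : cn a ^+ 2 < 1 by rewrite expr_lt1// cn_ge0.
  by rewrite cn_sqr; narith.
have gq : good_quad 1 be ga.
  have h b : 0 < Rb 1 be ga b by rewrite /Rb; have := sqr_ge0 (b + be / 2); narith.
  by split=> // b; exact: ltW.
exists be, ga; split=> //.
have G1 : 1 + ga%:C != 0 :> C by rewrite -rC1 -rCD rC_neq0.
have aM : (1 + ga%:C) * a = ga%:C - 1 - 'i * be%:C.
  by case: (a) @ga @be d1 g1E {g1 disc gq G1 aE a1 ar d0} => u v ga be d1 g1E; apply: cxP; rewrite /be /ga /=; field.
have aJ : (1 + ga%:C) * cj a = ga%:C - 1 + 'i * be%:C.
  by case: (a) @ga @be d1 g1E {aM g1 disc gq G1 aE a1 ar d0} => u v ga be d1 g1E; apply: cxP; rewrite /be /ga /=; field.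
have cE : c = cj om * a by rewrite aE mulrA [cj om * _]mulrC oo mul1r.
apply/seteqP; split=> x [Gx hx]; split=> //.
  have /(flat_coords _ _ o1 Gx) := hx; rewrite -aM -aJ -!mulrA -mulrDr => /(mulfI G1) E.
  rewrite cE !cjE; transitivity (cj om * (om * x.1)); first by rewrite mulrA [cj om * om]mulrC oo mul1r.
  rewrite E.
  by rewrite mulrDr; congr (_ + _); ring: oo.
apply/(flat_coords _ _ o1 Gx); rewrite -aM -aJ -!mulrA -mulrDr hx cE !cjE; congr (_ * _).
by rewrite mulrDr; ring: oo.
Qed.

(** Solving [s = c + cj c p] together with its conjugate gives [c = (s - cj s p) / (1 - |p|^2)], and
    [G_criterion] is the condition that this be in the disc. *)
Lemma flat_exists x : G x -> exists2 c, cn c < 1 & flat c x.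
Proof.
move=> Gx; have /G_criterion h := Gx; have [_ p1] := G_bound Gx.
have d0 : 0 < 1 - cn x.2 ^+ 2 by rewrite subr_gt0 expr_lt1// cn_ge0.
have [d dE] : exists d : R, d = 1 - cn x.2 ^+ 2 by eexists.
rewrite -dE in h d0.
exists ((x.1 - cj x.1 * x.2) / d%:C).
  by rewrite cnM cnV cnR gtr0_norm// ltr_pdivrMr// mul1r.
split=> //; rewrite !cjE; have dn : d%:C != 0 :> C by rewrite rC_neq0.
have dC : d%:C = 1 - x.2 * cj x.2 by rewrite dE mulcJ rCD rCN.
have E : d%:C * x.1 = x.1 - cj x.1 * x.2 + (cj x.1 - x.1 * cj x.2) * x.2 by rewrite dC; ring.
by rewrite -[LHS](mulKf dn) E; field.
Qed.

Lemma flat_unique c c' x : flat c x -> flat c' x -> c = c'.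
Proof.
move=> [Gx h] [_ h']; have [_ p1] := G_bound Gx.
have d0 : 0 < 1 - cn x.2 ^+ 2 by rewrite subr_gt0 expr_lt1// cn_ge0.
have E a : x.1 = a + cj a * x.2 -> x.1 - cj x.1 * x.2 = a * (1 - cn x.2 ^+ 2)%:C.
  by move=> ->; rewrite !cjE rCD rCN -mulcJ rC1; ring.
have n : (1 - cn x.2 ^+ 2)%:C != 0 :> C by rewrite rC_neq0.
by apply: (mulIf n); rewrite -(E _ h) -(E _ h').
Qed.

(** With [a = 1 - om z], and [b] likewise, [cn a ^+ 2 <= 2 rp a]; so if [a + b] is small then the
    product [a b] is small too. *)
Lemma node_near om (v : Cplx2 R) c : cn om = 1 -> G v -> cn (2 - om * v.1) < c ->
  cn (om ^+ 2 * v.2 - 1) < 2 * c.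
Proof.
move=> o1 /G_cn[z [w [z1 w1 ->]]] /=.
have cc (u : C) : cn u < 1 -> exists a, [/\ a = 1 - om * u, 0 <= rp a & cn a ^+ 2 <= 2 * rp a].
  move=> u1; exists (1 - om * u); have h : cn (om * u) < 1 by rewrite cnM o1 mul1r.
  have := disc_real_lt1 h; have : cn (om * u) ^+ 2 < 1 by rewrite expr_lt1// cn_ge0.
  by rewrite !cn_sqr !(rpD, ipD, rpN, ipN) rp1 ip1 => h1 h2; split=> //; narith.
have [a [aE a0 a2]] := cc _ z1; have [b [bE b0 b2]] := cc _ w1.
have -> : om ^+ 2 * (z * w) - 1 = a * b - (2 - om * (z + w)) by rewrite aE bE; ring.
have -> : 2 - om * (z + w) = a + b by rewrite aE bE; ring.
move=> h; apply: le_lt_trans (cnB _ _) _.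
have h1 : rp a + rp b <= cn (a + b) by rewrite -rpD; apply: le_trans (rp_le_cn _); exact: ler_norm.
have h2 : cn (a * b) <= rp a + rp b.
  rewrite -(@ler_pXn2r _ 2) ?nnegrE ?cn_ge0 ?addr_ge0// cnM exprMn.
  apply: le_trans (_ : (2 * rp a) * (2 * rp b) <= _); last by have := sqr_ge0 (rp a - rp b); narith.
  by apply: ler_pM; rewrite ?sqr_ge0.
arith.
Qed.

Lemma royal_G (z : C) : cn z < 1 -> G (2 * z, z ^+ 2).
Proof. by move=> z1; apply/G_cn; exists z, z; split=> //; rewrite mulr2n mulrDl mul1r expr2. Qed.

(** Some equation [p] of [V] does not vanish identically on the royal variety, so [p(2 z, z^2)] is a
    nonzero polynomial in [z]. A node in the closure of [V] is the royal point with [z = 1 / om],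
    and [p] vanishes there by continuity. *)
Lemma node_roots (V : set (Cplx2 R)) (S : set {poly {poly C}}) :
  V = G `&` [set x : Cplx2 R | forall p, S p -> p.[x.1, x.2] = 0] ->
  norm_preserving_extension G V -> ~ (royal_variety R `<=` V) ->
  exists2 w : {poly C}, w != 0 & forall om al be ga x y, V x -> V y -> x <> y ->
    cn om = 1 -> good_quad al be ga -> al <> 1 -> geod om al be ga x -> geod om al be ga y ->
    w.[ om^-1] = 0.
Proof.
move=> VE np nR.
have [z z1 nV] : exists2 z : C, cn z < 1 & ~ V (2 * z, z ^+ 2).
  apply: contrapT => h; apply: nR => _ [z [z1 ->]]; apply: contrapT => nV.
  by apply: h; exists z => //; rewrite -ltcR.
have [p Sp pz] : exists2 p, S p & p.[2 * z, z ^+ 2] != 0.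
  apply: contrapT => h; apply: nV; rewrite VE; split; first exact: royal_G.
  by move=> p Sp; apply/eqP/negP => /negP pz; apply: h; exists p.
have [N [T hT]] := poly2_subst p (2%:P * 'X) ('X^2) 1.
have TE m : p.[2 * m, m ^+ 2] = T.[m].
  have := hT m; rewrite hornerC oner_neq0 => /(_ isT).
  by rewrite expr1n !divr1 hornerM hornerC hornerX hornerXn.
exists T; first by apply: contra pz => /eqP T0; rewrite TE T0 horner0.
move=> om al be ga x y Vx Vy xy o1 gq al1 gx gy.
have on := unit_neq0 o1; rewrite -TE; apply/eqP/negP => /negP ne.
have e0 : 0 < cn p.[2 * om^-1, om^-1 ^+ 2] by rewrite cn_gt0.
pose nd : Cplx2 R := (2 * om^-1, om^-1 ^+ 2).
have [d d0 hd] := df_near (df_poly2 p (differentiable_fst nd) (differentiable_snd nd)) e0.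
have c0 : 0 < d / 2 by arith.
have [v Vv hv] := node_in_closure np Vx Vy xy o1 gq al1 gx gy c0.
have Gv : G v by move: Vv; rewrite VE => -[].
have h2 := node_near o1 Gv hv.
have v1 : cn (v.1 - 2 * om^-1) < d.
  have -> : v.1 - 2 * om^-1 = - om^-1 * (2 - om * v.1) by field.
  by rewrite cnM cnN cnV o1 invr1 mul1r; arith.
have v2 : cn (v.2 - om^-1 ^+ 2) < d.
  have -> : v.2 - om^-1 ^+ 2 = om^-1 ^+ 2 * (om ^+ 2 * v.2 - 1) by field.
  by rewrite cnM cnX cnV o1 invr1 expr1n mul1r; arith.
have := hd v v1 v2; have -> : p.[v.1, v.2] = 0 by move: Vv; rewrite VE => -[_]; exact.
by rewrite sub0r cnN ltxx.
Qed.

(** Each point of the arc is joined to [x] by the flat geodesic of [x] or by a geodesic in one of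
    finitely many charts, and one of these alternatives holds on a dense part of a smaller disc. In
    the flat case continuity suffices. Otherwise the coefficient [al] of the joining curve is a
    holomorphic function of the arc parameter, real on a dense set, hence constant. *)
Lemma generic_conic (V : set (Cplx2 R)) (w : {poly C}) x (gam : Cplx R -> Cplx2 R) t0 r :
  V `<=` G -> w != 0 ->
  (forall om al be ga y, V y -> x <> y -> cn om = 1 -> good_quad al be ga -> al <> 1 ->
     geod om al be ga x -> geod om al be ga y -> w.[ om^-1] = 0) ->
  V x -> 0 < r -> (forall t : C, cn (t - t0) < r -> V (gam t) /\ differentiable gam (t : Cplx R)) ->
  exists om al be ga t1 r1, [/\ cn om = 1, good_quad al be ga, geod om al be ga x, 0 < r1 &
    forall t : C, cn (t - t1) < r1 -> cn (t - t0) < r /\ geod om al be ga (gam t)].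
Proof.
move=> VG w0 hw Vx r0 hg; have Gx := VG _ Vx.
have [rs rsE] := closed_field_poly_normal w.
(* [None] stands for the flat geodesic through [x], and [Some z] for the chart with [om = 1 / z];
   [z] will run over the roots of [w]. *)
pose A (i : option C) (t : C) : Prop := match i with
  | None => exists2 c, cn c < 1 & flat c x /\ flat c (gam t)
  | Some z => [/\ cn z = 1, x <> gam t & exists al be ga, [/\ good_quad al be ga,
      geod z^-1 al be ga x & geod z^-1 al be ga (gam t)]] end.
have [i [t1 [r1 [r10 sub dn]]]] : exists i t1 r1, [/\ 0 < r1,
    forall t, cn (t - t1) < r1 -> cn (t - t0) < r &
    forall t e, cn (t - t1) < r1 -> 0 < e -> exists t', [/\ cn (t' - t) < e, cn (t' - t1) < r1 & A i t']].
  apply: (@dense_cover _ A (None :: map Some rs)) => // t tr; have [Vg _] := hg _ tr.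
  have [e|ne] := pselect (x = gam t).
    by have [c c1 fc] := flat_exists Gx; exists None; [rewrite inE|exists c => //; rewrite -e].
  have [ om [al [be [ga [ o1 gq gx gg]]]]] := geod_exists Gx (VG _ Vg) ne.
  have [al1|al1] := pselect (al = 1).
    rewrite al1 in gq gx gg; have [c c1 E] := geod_flat o1 gq; exists None; first by rewrite inE.
    by exists c => //; rewrite -E.
  have root0 := hw _ _ _ _ _ Vg ne o1 gq al1 gx gg.
  exists (Some om^-1).
    rewrite inE orFb mem_map; last by move=> ? ? [].
    have : root w om^-1 by rewrite /root root0.
    by rewrite rsE rootZ ?lead_coef_eq0// root_prod_XsubC.
  by split=> //; [rewrite cnV o1 invr1|exists al, be, ga; rewrite invrK].
have hg1 t : cn (t - t1) < r1 -> V (gam t) /\ differentiable gam (t : Cplx R) by move=> /sub/hg.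
case: i dn => [z|] dn; last first.
  have [c c1 fc] := flat_exists Gx.
  have [be [ga [gq E]]] := flat_geod (cn1 R) c1.
  exists 1, 1, be, ga, t1, r1; rewrite E; split=> //; first exact: (cn1 R).
  move=> t tr; split; first exact: sub.
  have [Vg dg] := hg1 _ tr; split; first exact: VG.
  apply/eqP; rewrite -subr_eq0; apply/negP => /negP ne.
  have d1 : differentiable (fun t => (gam t).1 : Cplx R) (t : Cplx R) := dfcomp dg (differentiable_fst _).
  have d2 : differentiable (fun t => (gam t).2 : Cplx R) (t : Cplx R) := dfcomp dg (differentiable_snd _).
  have dd := dfB d1 (dfD (dfc _ c) (dfM (dfc _ (cj c)) d2)).
  have e0 : 0 < cn ((gam t).1 - (c + cj c * (gam t).2)) by rewrite cn_gt0.
  have [d d0 hd] := df_near1 dd e0.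
  have [t' [td t1' [c' _ [f1 [_ f2]]]]] := dn t d tr d0.
  by have := hd _ td; rewrite f2 (flat_unique f1 fc) subrr sub0r cnN ltxx.
have t11 : cn (t1 - t1) < r1 by rewrite subrr cn0.
have [t2 [_ t2r [z1 xg [al [be [ga [gq gx gg]]]]]]] := dn t1 1 t11 ltr01.
have o1 : cn z^-1 = 1 by rewrite cnV z1 invr1.
pose om := z^-1; rewrite -/om in o1 gx gg.
have dnA t e : cn (t - t1) < r1 -> 0 < e -> exists t' al be ga, [/\ cn (t' - t) < e, x <> gam t',
   cn (t' - t1) < r1, geod om al be ga x & geod om al be ga (gam t')].
  by move=> tr e0; have [t' [a b [_ c [al' [be' [ga' [_ d1 d2]]]]]]] := dn t e tr e0; exists t', al', be', ga'.
clearbody om; clear dn.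
pose m0 : C := cm om x; pose k0 : C := 'i * (ip (quad al be ga m0) / rp m0)%:C.
have m00 : 0 < rp m0 := cm_gt0 o1 Gx.
pose mt (t : Cplx R) : Cplx R := cm om (gam t).
pose M (t : Cplx R) : Cplx R := (mt t - m0) * (mt t + cj m0).
pose N (t : Cplx R) : Cplx R := cD om (gam t) - cD om x - (mt t - m0) * k0.
have dmt (t : C) : cn (t - t1) < r1 -> differentiable mt (t : Cplx R).
  by move=> /hg1[/VG Gg dg]; exact: (dfcomp dg (cm_differentiable o1 Gg)).
have dM (t : C) : cn (t - t1) < r1 -> differentiable M (t : Cplx R).
  move=> tr; have d := dmt _ tr.
  exact: (dfM (dfB d (dfc _ m0)) (dfD d (dfc _ (cj m0)))).
have dN (t : C) : cn (t - t1) < r1 -> differentiable N (t : Cplx R).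
  move=> tr; have d := dmt _ tr; have [/VG Gg dg] := hg1 _ tr.
  exact: (dfB (dfB (dfcomp dg (cD_differentiable o1 Gg)) (dfc _ (cD om x))) (dfM (dfB d (dfc _ m0)) (dfc _ k0))).
(* A curve through [x] has one free coefficient, and [N / M] recovers it holomorphically from the
   point of the arc. *)
have NM (t : C) a b g : geod om a b g x -> geod om a b g (gam t) -> N t = a%:C * M t.
  move=> [_ Dx] [_ Dt]; rewrite /N /M /mt Dt (quad_base a b g _ m00) Dx /k0 -/m0.
  have -> : quad al be ga m0 = quad a b g m0 by rewrite -Dx (gx.2).
  by ring.
have M0 (t : C) a b g : cn (t - t1) < r1 -> x <> gam t -> geod om a b g x -> geod om a b g (gam t) -> M t != 0.
  move=> tr ne g1 g2; have Gg := VG _ (hg1 _ tr).1; rewrite /M mulf_eq0 negb_or.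
  rewrite (hp_sum_neq0 (cm_gt0 o1 Gg) m00) andbT subr_eq0; apply/eqP => E; apply: ne.
  by rewrite (geod_gk o1 g1) (geod_gk o1 g2) -/(mt t) E.
have M2 := M0 _ _ _ _ t2r xg gx gg; have M2' : 0 < cn (M t2) by rewrite cn_gt0.
have [d d0 hd] := df_near1 (dM _ t2r) M2'.
pose r2 := Num.min d (r1 - cn (t2 - t1)).
have r20 : 0 < r2 by rewrite lt_min d0 subr_gt0.
have in2 t : cn (t - t2) < r2 -> M t != 0 /\ cn (t - t1) < r1.
  rewrite lt_min => /andP[/hd a b]; split; last by have := cn_tri t2 t t1; arith.
  by apply/eqP => e; move: a; rewrite e sub0r cnN ltxx.
pose q (t : Cplx R) : Cplx R := N t / M t.
have dq (t : C) : cn (t - t2) < r2 -> differentiable q (t : Cplx R).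
  by move=> /in2[Mt tr]; exact: (df_div (dN _ tr) (dM _ tr) Mt).
have qr (t : C) : cn (t - t2) < r2 -> ip (q t) = 0.
  move=> tr; have [Mt tr1] := in2 _ tr; apply/eqP/negP => /negP i0.
  have i1 : 0 < `|ip (q t)| by rewrite normr_gt0.
  have [e e0 he] := df_near1 (dq _ tr) i1.
  have [t' [a [b [g [te ne t1' g1 g2]]]]] := dnA t e tr1 e0.
  have := he _ te; have -> : q t' = a%:C by rewrite /q (NM _ _ _ _ g1 g2) mulfK// (M0 _ _ _ _ t1' ne g1 g2).
  move=> h; have := ip_le_cn (a%:C - q t); rewrite ipB /= sub0r normrN => h2.
  by have := le_lt_trans h2 h; rewrite ltxx.
exists om, al, be, ga, t2, r2; split=> // t tr; have [Mt tr1] := in2 _ tr; split; first exact: sub.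
split; first by exact: VG (hg1 _ tr1).1.
have qE : q t = al%:C.
  have t22 : cn (t2 - t2) < r2 by rewrite subrr cn0.
  rewrite (holo_real_const (fun t tr => conj (dq t tr) (qr t tr)) tr).
  by rewrite /q (NM _ _ _ _ gx gg) mulfK.
have NE : N t = al%:C * M t by rewrite -qE /q divfK.
rewrite (quad_base al be ga _ m00) -/(mt t) -/m0 -/k0 -(gx.2 : _ = quad al be ga m0).
by move: NE; rewrite /N /M => /eqP; rewrite !subr_eq => /eqP ->; ring.
Qed.

(** Along the geodesic an equation of [V] becomes a rational function of [m]. Its zeros accumulate
    at a value of [cm] on the arc, so its numerator is zero. *)
Lemma conic_in (V : set (Cplx2 R)) (S : set {poly {poly C}}) om al be ga (gam : Cplx R -> Cplx2 R) t1 r1 :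
  V = G `&` [set x : Cplx2 R | forall p, S p -> p.[x.1, x.2] = 0] -> cn om = 1 ->
  good_quad al be ga -> 0 < r1 ->
  (forall t : C, cn (t - t1) < r1 -> [/\ V (gam t), differentiable gam (t : Cplx R) & geod om al be ga (gam t)]) ->
  (forall t t' : C, cn (t - t1) < r1 -> cn (t' - t1) < r1 -> gam t' = gam t -> t' = t) ->
  geod om al be ga `<=` V.
Proof.
move=> VE o1 gq r0 hg inj y gy; rewrite VE; split; first by case: gy.
move=> p Sp; pose Q : {poly C} := al%:C *: 'X^2 + ('i * be%:C) *: 'X - ga%:C%:P.
have QE m : Q.[m] = quad al be ga m.
  by rewrite /Q /quad hornerD hornerN hornerD !hornerZ hornerC hornerX hornerXn.
pose E : {poly C} := om ^+ 2 *: ('X^2 - Q + 2 *: 'X + 1).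
pose A : {poly C} := om *: (2 *: ('X^2 - Q - 1)).
pose B : {poly C} := 'X^2 - Q - 2 *: 'X + 1.
have on := unit_neq0 o1.
have EE m : E.[m] = om ^+ 2 * (m ^+ 2 - quad al be ga m + 2 * m + 1).
  by rewrite /E hornerZ !hornerD hornerN QE hornerZ hornerX hornerXn hornerC.
have E0 m : 0 < rp m -> E.[m] != 0.
  by move=> h; rewrite EE mulf_neq0 ?expf_neq0// Hs_den_neq0//; exact: good_quad_Hs.
have gkE m : 0 < rp m -> gk om al be ga m = (A.[m] / E.[m], B.[m] / E.[m]).
  move=> h; have := E0 _ h; rewrite EE mulf_eq0 negb_or => /andP[_ D0]; rewrite /gk /cinv.
  have -> : A.[m] = om * (2 * (m ^+ 2 - quad al be ga m - 1)).
    by rewrite /A !hornerZ !hornerD !hornerN QE hornerXn hornerC.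
  have -> : B.[m] = m ^+ 2 - quad al be ga m - 2 * m + 1.
    by rewrite /B !hornerD !hornerN QE hornerZ hornerXn hornerX hornerC.
  by congr (_, _); move: (quad al be ga m) D0 => D D0; field; rewrite ?on ?D0.
have [N [T hT]] := poly2_subst p A B E.
have pT m : 0 < rp m -> p.[(gk om al be ga m).1, (gk om al be ga m).2] = T.[m] / E.[m] ^+ N.
  by move=> h; rewrite gkE// hT ?E0.
suff T0 : T = 0.
  rewrite (geod_gk o1 gy) pT ?T0 ?horner0 ?mul0r//; exact: cm_gt0 o1 gy.1.
have t11 : cn (t1 - t1) < r1 by rewrite subrr cn0.
have [_ dg1 gg1] := hg _ t11.
have dm := dfcomp dg1 (cm_differentiable o1 gg1.1).
apply: (@poly_roots_accum _ T (cm om (gam t1))) => e e0.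
have [d d0 hd] := df_near1 dm e0.
pose h := (Num.min d r1 / 2); have mn : 0 < Num.min d r1 by rewrite lt_min d0.
have h0 : 0 < h by rewrite divr_gt0.
have hm : h < Num.min d r1 by rewrite /h; arith.
have [hd1 hr1] : h < d /\ h < r1 by move: hm; rewrite lt_min => /andP.
clearbody h; pose t := t1 + h%:C.
have ht : cn (t - t1) = h by rewrite /t addrC addKr cnR gtr0_norm.
have tr : cn (t - t1) < r1 by rewrite ht.
have [Vt _ gt] := hg _ tr; exists (cm om (gam t)); split; last 2 first.
- by apply: hd; rewrite ht.
- have mp : 0 < rp (cm om (gam t)) := cm_gt0 o1 gt.1.
  have := pT _ mp; rewrite -(geod_gk o1 gt).
  have -> : p.[(gam t).1, (gam t).2] = 0 by move: Vt; rewrite VE => -[_]; exact.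
  by move=> /esym/eqP; rewrite mulf_eq0 invr_eq0 (negPf (expf_neq0 _ (E0 _ mp))) orbF => /eqP.
apply/eqP => E1; have : t = t1.
  by apply: inj => //; rewrite (geod_gk o1 gt) (geod_gk o1 gg1) E1.
by move=> E2; move: ht; rewrite E2 subrr cn0 => h00; move: h0; rewrite -h00 ltxx.
Qed.

(** An arc of [V] together with [x] produces a geodesic inside [V]. For any other point [z] of [V]
    the argument is repeated with an arc of that geodesic: the geodesic obtained through [z] shares
    an arc with it, so the two coincide. *)
Lemma single_geod (V : set (Cplx2 R)) (S : set {poly {poly C}}) x y :
  V = G `&` [set x : Cplx2 R | forall p, S p -> p.[x.1, x.2] = 0] ->
  norm_preserving_extension G V -> ~ (royal_variety R `<=` V) -> V <> G -> V x -> V y -> x <> y ->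
  exists om al be ga, [/\ cn om = 1, good_quad al be ga & V = geod om al be ga].
Proof.
move=> VE np nR nG Vx Vy xy; have VG : V `<=` G by rewrite VE => ? [].
have [P P0 SP] : exists2 P, P != 0 & S P.
  apply: contrapT => h; apply: nG; rewrite VE; apply/seteqP; split=> z; first by case.
  move=> Gz; split=> // p Sp; have [->|p0] := eqVneq p 0; first by rewrite horner0 horner0.
  by case: h; exists p.
have iso z W : V z -> open W -> W z -> exists z', [/\ V z', W z' & z' <> z].
  have [->|zx] := pselect (z = x); first by move=> _; exact: no_isolated np Vx Vy xy.
  by move=> Vz; exact: no_isolated np Vz Vx zx.
have [t0 [r [gam [r0 hg]]]] := local_curve VE (ex_intro _ _ Vx) iso P0 SP.
have [w w0 hw] := node_roots VE np nR.
have hg' (t : C) : cn (t - t0) < r -> V (gam t) /\ differentiable gam (t : Cplx R) by move=> /hg[].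
have [ om [al [be [ga [t1 [r1 [ o1 gq _ r10 h1]]]]]]] :=
  generic_conic VG w0 (fun om al be ga y Vy => hw om al be ga x y Vx Vy) Vx r0 hg'.
have KV : geod om al be ga `<=` V.
  apply: (conic_in VE o1 gq r10 (gam := gam)).
    by move=> t /h1[/hg[a b _] c].
  by move=> t t' /h1[/hg[_ _ a] _] _ /a.
exists om, al, be, ga; split=> //; apply/seteqP; split=> // z Vz.
have hk (m : C) : cn (m - 1) < 1 -> V (gk om al be ga m) /\ differentiable (gk om al be ga) (m : Cplx R).
  move=> m1; have mp : 0 < rp m.
    by have := disc_real_lt1 m1; have := rp_le_cn (m - 1); rewrite rpB rp1 ler_norml => /andP[+ _]; arith.
  by split; [apply: KV; exact: gk_geod|exact: gk_differentiable].
have [ o2 [a2 [b2 [g2 [t2 [r2 [ o21 gq2 gz r20 h2]]]]]]] :=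
  generic_conic VG w0 (fun om al be ga y Vy => hw om al be ga z y Vz Vy) Vz ltr01 hk.
have mp (m : C) : cn (m - t2) < r2 -> 0 < rp m.
  move=> /h2[m1 _]; have := rp_le_cn (m - 1); rewrite rpB rp1 ler_norml => /andP[+ _]; arith.
have t22 : cn (t2 - t2) < r2 by rewrite subrr cn0.
have h20 : 0 < r2 / 2 by arith.
have t23 : cn (t2 + (r2 / 2)%:C - t2) < r2 by rewrite addrC addKr cnR gtr0_norm//; arith.
have ne : gk om al be ga t2 <> gk om al be ga (t2 + (r2 / 2)%:C).
  move=> E; have [_ e1 _] := gkP o1 gq (mp _ t22); have [_ e2 _] := gkP o1 gq (mp _ t23).
  move: e2; rewrite -E e1 => /eqP; rewrite -subr_eq0 opprD addNKr oppr_eq0 => /eqP e.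
  by have := rC_neq0 h20; rewrite e eqxx.
apply: (geod_unique o21 gq2 o1 gq ne) gz.
- exact: (h2 _ t22).2.
- exact: (h2 _ t23).2.
- exact: gk_geod (mp _ t22).
- exact: gk_geod (mp _ t23).
Qed.
End Generic.

(** * Sets containing the royal variety *)

Section Flats.
Variable R : realType.
Notation C := R[i].
Notation G := (symmetrized_bidisc R).

(* [x |-> (fS a x, fT a x)] is the automorphism of [G] induced by [tau a]; it sends
   the royal variety to itself and the flat geodesic with centre [ctr a] to the
   points [(0, q)], and [kF a] parametrizes that geodesic by [q]. *)
Definition tau (a z : C) : C := (z - a) / (1 - cj a * z).
Definition fden (a : C) (x : Cplx2 R) : C := 1 - cj a * x.1 + cj a ^+ 2 * x.2.
Definition fT (a : C) (x : Cplx2 R) : C := (x.2 - a * x.1 + a ^+ 2) / fden a x.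
(** In the roots this is minus the square of half the difference of [tau a z] and [tau a w]. It
    vanishes on the royal variety, equals [q] at [kF a q], and on the closed bidisc is unimodular
    only where [tau a w = - tau a z] is unimodular. *)
Definition fpsi (a : C) (x : Cplx2 R) : C :=
  - ((1 - a * cj a) ^+ 2 * (x.1 ^+ 2 - 4 * x.2) / (4 * fden a x ^+ 2)).
Definition kF (a q : C) : Cplx2 R :=
  ((2 * a + 2 * cj a * q) / (1 + cj a ^+ 2 * q), (a ^+ 2 + q) / (1 + cj a ^+ 2 * q)).

Lemma tau_identity (a z : C) :
  cn (1 - cj a * z) ^+ 2 - cn (z - a) ^+ 2 = (1 - cn a ^+ 2) * (1 - cn z ^+ 2).
Proof. by case: a => u v; case: z => x y; rewrite !cn_sqr /=; ring. Qed.

Lemma tau_den (a z : C) : cn a < 1 -> cn z <= 1 -> 1 - cj a * z != 0.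
Proof. by move=> a1 z1; apply: lt1_neq; rewrite cnM cnJ; apply: le_lt_trans a1; rewrite ler_piMr ?cn_ge0. Qed.

Lemma tau_le1 (a z : C) : cn a < 1 -> cn z <= 1 -> cn (tau a z) <= 1.
Proof.
move=> a1 z1; have n := tau_den a1 z1; rewrite cnM cnV ler_pdivrMr ?cn_gt0// mul1r.
rewrite -(@ler_pXn2r _ 2) ?nnegrE ?cn_ge0// -subr_ge0 tau_identity.
by rewrite mulr_ge0// subr_ge0 expr_le1// ?cn_ge0// ltW.
Qed.

Lemma tau_lt1 (a z : C) : cn a < 1 -> cn z < 1 -> cn (tau a z) < 1.
Proof.
move=> a1 z1; have n := tau_den a1 (ltW z1); rewrite cnM cnV ltr_pdivrMr ?cn_gt0// mul1r.
rewrite -(@ltr_pXn2r _ 2) ?nnegrE ?cn_ge0// -subr_gt0 tau_identity.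
by rewrite mulr_gt0// subr_gt0 expr_lt1// cn_ge0.
Qed.

Lemma tauK (a z : C) : cn a < 1 -> cn z <= 1 -> tau (- a) (tau a z) = z.
Proof.
move=> a1 z1; have n := tau_den a1 z1; rewrite /tau cjN.
have n2 : 1 - cj a * a != 0 by apply: tau_den => //; exact: ltW.
have n3 : 1 - cj a * z + cj a * (z - a) != 0 by rewrite [X in X != 0](_ : _ = 1 - cj a * a)//; ring.
by field; rewrite n mulNr opprK n3.
Qed.

Lemma fden_sym (a z w : C) : fden a (z + w, z * w) = (1 - cj a * z) * (1 - cj a * w).
Proof. by rewrite /fden /=; ring. Qed.

Lemma fden_neq0 (a z w : C) : cn a < 1 -> cn z <= 1 -> cn w <= 1 -> fden a (z + w, z * w) != 0.
Proof. by move=> a1 z1 w1; rewrite fden_sym mulf_neq0// tau_den. Qed.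

Lemma fT_sym (a z w : C) : cn a < 1 -> cn z <= 1 -> cn w <= 1 -> fT a (z + w, z * w) = tau a z * tau a w.
Proof.
move=> a1 z1 w1; rewrite /fT fden_sym /tau /=.
by have := tau_den a1 z1; have := tau_den a1 w1; move: (cj a) => b n1 n2; field; rewrite n1 n2.
Qed.

Lemma fpsi_sym (a z w : C) : cn a < 1 -> cn z <= 1 -> cn w <= 1 ->
  fpsi a (z + w, z * w) = - ((tau a z - tau a w) / 2) ^+ 2.
Proof.
move=> a1 z1 w1; rewrite /fpsi fden_sym /tau /=.
by have := tau_den a1 z1; have := tau_den a1 w1; move: (cj a) => b n1 n2; field; rewrite n1 n2.
Qed.

Lemma cn_natr n : cn (n%:R : C) = n%:R.
Proof. by rewrite -(rCnat R n) cnR ger0_norm ?ler0n. Qed.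

Lemma parallelogram (a b : C) : cn (a - b) ^+ 2 + cn (a + b) ^+ 2 = 2 * cn a ^+ 2 + 2 * cn b ^+ 2.
Proof. by case: a => u v; case: b => x y; rewrite !cn_sqr /=; ring. Qed.

(** The parallelogram law: a half difference of modulus one leaves no room for [a + b]. *)
Lemma half_diff (a b : C) : cn a <= 1 -> cn b <= 1 ->
  cn (- ((a - b) / 2) ^+ 2) <= 1 /\ (cn (- ((a - b) / 2) ^+ 2) = 1 -> b = - a /\ cn a = 1).
Proof.
move=> a1 b1; have h := parallelogram a b.
have a2 : cn a ^+ 2 <= 1 by rewrite expr_le1 ?cn_ge0.
have b2 : cn b ^+ 2 <= 1 by rewrite expr_le1 ?cn_ge0.
have E : cn (- ((a - b) / 2) ^+ 2) = cn (a - b) ^+ 2 / 4.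
  rewrite cnN cnX cnM cnV cn_natr expr_div_n; congr (_ / _).
  by rewrite expr2; arith.
have s0 := sqr_ge0 (cn (a + b)); rewrite E; split; first by arith.
move=> e; have z : cn (a + b) ^+ 2 = 0 by arith.
split.
  by apply/eqP; rewrite -addr_eq0 addrC -cn_eq0 -sqrf_eq0 z.
by apply/eqP; rewrite -(sqrp_eq1 (cn_ge0 a)); apply/eqP; arith.
Qed.

Lemma cn_den2 (a q : C) : cn a < 1 -> cn q <= 1 -> 1 + cj a ^+ 2 * q != 0.
Proof.
move=> a1 q1; rewrite -[_ * q]opprK; apply: lt1_neq; rewrite cnN cnM cnX cnJ.
apply: le_lt_trans (_ : cn a ^+ 2 < 1); first by rewrite ler_piMr// sqr_ge0.
by rewrite expr_lt1// cn_ge0.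
Qed.

Lemma kF_sym (a t : C) : cn a < 1 -> cn t <= 1 ->
  kF a (- t ^+ 2) = (tau (- a) t + tau (- a) (- t), tau (- a) t * tau (- a) (- t)).
Proof.
move=> a1 t1; have an : cn (- a) < 1 by rewrite cnN.
have tn : cn (- t) <= 1 by rewrite cnN.
have n1 := tau_den an t1; have n2 := tau_den an tn.
have q1 : cn (- t ^+ 2) <= 1 by rewrite cnN cnX expr_le1// cn_ge0.
have n3 := cn_den2 a1 q1.
rewrite /kF /tau cjN; rewrite cjN in n1 n2; move: (cj a) n1 n2 n3 => b n1 n2 n3.
rewrite mulNr opprK in n1; rewrite mulrNN in n2.
by congr (_, _); field; rewrite mulrNN mulNr opprK n1 n2.
Qed.

Lemma kF_tau (a z w : C) : cn a < 1 -> cn z <= 1 -> cn w <= 1 -> tau a w = - tau a z ->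
  (z + w, z * w) = kF a (tau a z * tau a w).
Proof.
move=> a1 z1 w1 h; rewrite h mulrN -expr2 kF_sym ?tau_le1// -h !tauK//.
Qed.

Lemma kF_G (a q : C) : cn a < 1 -> cn q < 1 -> G (kF a q) /\ fT a (kF a q) = q.
Proof.
move=> a1 q1; have [t tE] : exists t : C, t ^+ 2 = - q by exists (sqrtc (- q)); rewrite sqr_sqrtc.
have t1 : cn t < 1.
  by rewrite -(@ltr_pXn2r _ 2) ?nnegrE ?cn_ge0// expr1n -cnX tE cnN.
have an : cn (- a) < 1 by rewrite cnN.
have tn : cn (- t) < 1 by rewrite cnN.
have -> : q = - t ^+ 2 by rewrite tE opprK.
have h1 := tau_lt1 an t1; have h2 := tau_lt1 an tn.
rewrite kF_sym ?(ltW t1)//; split; first by apply/G_cn; do 2 eexists; split; [exact: h1|exact: h2|].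
rewrite fT_sym ?ltW// -{1 3}(opprK a) !tauK ?ltW//; ring.
Qed.

Definition ctr (a : C) : C := 2 * a / (1 + a * cj a).

Lemma ctr_den (a : C) : 1 + a * cj a != 0.
Proof. by rewrite mulcJ -rC1 -rCD rC_neq0// ltr_pwDl// sqr_ge0. Qed.

(** The solution [a = c / (1 + q)] with [q^2 = 1 - cn c ^+ 2] is the hyperbolic midpoint of 0 and
    [c]. *)
Lemma ctr_exists (c : C) : cn c < 1 -> exists2 a, cn a < 1 & c = ctr a.
Proof.
move=> c1; have h0 : 0 <= 1 - cn c ^+ 2 by rewrite subr_ge0 expr_le1 ?cn_ge0// ltW.
have [q [q0 qE]] : exists q : R, 0 <= q /\ q ^+ 2 = 1 - cn c ^+ 2.
  by exists (Num.sqrt (1 - cn c ^+ 2)); rewrite sqr_sqrtr// sqrtr_ge0.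
have p0 : 0 < 1 + q by arith.
have n : (1 + q)%:C != 0 :> C by rewrite rC_neq0.
exists (c / (1 + q)%:C).
  by rewrite cnM cnV cnR gtr0_norm// ltr_pdivrMr//; arith.
rewrite /ctr cjM cjV cjR.
have E : c * cj c = 1 - ((1 + q)%:C - 1) ^+ 2.
  by rewrite mulcJ -rC1 -!rCN -!rCD -rCX -rCN -rCD; congr (_ %:C); rewrite [1 + q]addrC addrK qE; ring.
move: (cj c) ((1 + q)%:C) E n => u v E n.
have -> : 1 + c / v * (u / v) = (v ^+ 2 + c * u) / v ^+ 2 by field.
rewrite E (_ : (v ^+ 2 + _) / _ = 2 / v); last by field.
by field.
Qed.

Lemma ctrJ (a : C) : cj (ctr a) = 2 * cj a / (1 + a * cj a).
Proof. by rewrite /ctr !cjE [cj a * a]mulrC. Qed.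

Lemma kF_flat (a q : C) : cn a < 1 -> cn q < 1 -> flat (ctr a) (kF a q).
Proof.
move=> a1 q1; split; first exact: (kF_G a1 q1).1.
rewrite ctrJ /ctr /kF /=; have := ctr_den a; have := cn_den2 a1 (ltW q1).
by move: (cj a) => b n1 n2; field; rewrite n1 n2.
Qed.

Lemma flat_kF (a : C) (x : Cplx2 R) : cn a < 1 -> flat (ctr a) x -> cn (fT a x) < 1 /\ x = kF a (fT a x).
Proof.
move=> a1 [Gx E]; have [z [w [z1 w1 xE]]] := (G_cn x).1 Gx.
have [z1' w1'] := (ltW z1, ltW w1).
rewrite xE fT_sym//; split.
  by rewrite cnM; apply: le_lt_trans (tau_lt1 a1 z1); rewrite ler_piMr ?cn_ge0 ?tau_le1.
apply: kF_tau => //; apply/eqP; rewrite -addr_eq0; move: E; rewrite xE /= ctrJ /ctr => E.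
have n1 := tau_den a1 z1'; have n2 := tau_den a1 w1'; have n3 := ctr_den a.
rewrite /tau; move: (cj a) n1 n2 n3 E => b n1 n2 n3 E.
have -> : (w - a) / (1 - b * w) + (z - a) / (1 - b * z) =
   (1 + a * b) / ((1 - b * w) * (1 - b * z)) * ((z + w) - (2 * a / (1 + a * b) + 2 * b / (1 + a * b) * (z * w))).
  by field; rewrite n1 n2 n3.
by rewrite E subrr mulr0.
Qed.

Lemma royal_kF (a : C) : kF a 0 = (2 * a, a ^+ 2).
Proof. by rewrite /kF !mulr0 !addr0 !divr1. Qed.

Lemma royal_geod (om : C) : cn om = 1 -> royal_variety R = geod om 0 0 0.
Proof.
move=> o1; have on := unit_neq0 o1; apply/seteqP; split=> x.
  move=> [z [z1 ->]]; have zn : cn z < 1 by rewrite -ltcR.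
  by split; [exact: royal_G|rewrite /cD /quad /=; field; exact: cden_neq0 o1 (royal_G zn)].
move=> [Gx]; have dn := cden_neq0 o1 Gx; rewrite /cD /quad !mul0r mulr0 mul0r add0r subr0 => /eqP.
rewrite mulf_eq0 invr_eq0 expf_eq0/= (negPf dn) orbF => /eqP E.
have {}E : x.1 ^+ 2 = 4 * x.2.
  have : om ^+ 2 * (x.1 ^+ 2 - 4 * x.2) = 0 by rewrite -E; ring.
  by move/eqP; rewrite mulf_eq0 expf_eq0/= (negPf on) /= subr_eq0 => /eqP.
exists (x.1 / 2); split.
  have [h _] := G_bound Gx; rewrite cnoE ltcR cnM cnV cn_natr ltr_pdivrMr ?mul1r//.
case: x E {Gx dn} => s p /= E; congr (_, _); first by field.
by rewrite expr_div_n E; field.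
Qed.

Lemma good_royal : good_quad (0 : R) 0 0.
Proof. by split; [arith|move=> b; rewrite /Rb; arith|move=> h; arith]. Qed.

Lemma analytic_local (V : set (Cplx2 R)) (f : Cplx2 R -> Cplx R) : V `<=` G ->
  (forall z, V z -> exists (W : set (Cplx2 R)) (h : Cplx2 R -> Cplx R), [/\ nbhs z W,
     (forall x, W x -> G x -> differentiable h x) & forall x, W x -> V x -> h x = f x]) ->
  analytic_on_subset G V f.
Proof.
move=> VG H z Vz; have [W [h [zW hd hE]]] := H _ Vz.
exists (W^° `&` G); split.
- by apply: openI; [exact: open_interior|exact: G_open].
- by split; [|exact: VG].
- by move=> ? [].
exists h; split; first by move=> x [/interior_subset Wx Gx]; exact: hd.
by move=> x [/interior_subset Wx _]; exact: hE.
Qed.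

Lemma schwarz_disc (g : Cplx R -> Cplx R) (q : C) : holomorphic_on (unit_disc R) g ->
  (forall z : C, cn z < 1 -> cn (g z) <= 1) -> g 0 = 0 -> cn q < 1 -> cn (g q) <= cn q.
Proof.
move=> hg g1 g0 q1; pose h (m : Cplx R) : Cplx R := g ((m - 1) / (m + 1)).
have hh : holomorphic_on (@half_plane R) h.
  move=> m hm; apply: (dfcomp (cayley_differentiable (hp1_neq0 hm))); apply: hg.
  by rewrite /unit_disc /= cnoE ltcR; exact: cn_cayley.
have h1 (m : C) : 0 < rp m -> cn (h m) <= 1 by move=> hm; apply/g1/cn_cayley.
have h10 : 0 < rp (1 : C) by rewrite rp1.
have mp := hp_cayley q1; have h0 : h 1 = 0 by rewrite /h subrr mul0r.
have := schwarz_hp hh h1 h10 mp h0; have n := lt1_neq q1.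
have -> : h ((1 + q) / (1 - q)) = g q.
  rewrite /h; congr g; field; rewrite n /=.
  by rewrite (_ : _ + _ = 2) ?two_neq0//; ring.
rewrite cj1 (_ : _ + 1 = 2 / (1 - q)); last by field.
rewrite (_ : _ - 1 = q * (2 / (1 - q))); last by field.
by rewrite (cnM q) ler_pM2r// cn_gt0 mulf_neq0 ?invr_eq0 ?two_neq0.
Qed.
End Flats.

(** * Flat geodesics in sets containing the royal variety *)

Section RoyalCase.
Variable R : realType.
Notation C := R[i].
Notation G := (symmetrized_bidisc R).

Lemma fden_differentiable (a : C) (x : Cplx2 R) : differentiable (fden a : Cplx2 R -> Cplx R) x.
Proof.
exact: (dfD (dfB (dfc x 1) (dfM (dfc x (cj a)) (differentiable_fst x)))
  (dfM (dfc x (cj a ^+ 2)) (differentiable_snd x))).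
Qed.

Lemma fden_G (a : C) (x : Cplx2 R) : cn a < 1 -> G x -> fden a x != 0.
Proof. by move=> a1 /G_cn[z [w [z1 w1 ->]]]; apply: fden_neq0 => //; exact: ltW. Qed.

Lemma fT_differentiable (a : C) (x : Cplx2 R) : fden a x != 0 ->
  differentiable (fT a : Cplx2 R -> Cplx R) x.
Proof.
move=> n; exact: (df_div (dfD (dfB (differentiable_snd x) (dfM (dfc x a) (differentiable_fst x)))
  (dfc x (a ^+ 2))) (fden_differentiable a x) n).
Qed.

Lemma fpsi_differentiable (a : C) (x : Cplx2 R) : fden a x != 0 ->
  differentiable (fpsi a : Cplx2 R -> Cplx R) x.
Proof.
move=> n; have n4 : 4 * fden a x ^+ 2 != 0 by rewrite mulf_neq0 ?expf_neq0// pnatr_eq0.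
have d := df_div (dfM (dfc x ((1 - a * cj a) ^+ 2))
   (dfB (dfX 2 (differentiable_fst x)) (dfM (dfc x 4) (differentiable_snd x))))
   (dfM (dfc x 4) (dfX 2 (fden_differentiable a x))) n4.
have := dfB (dfc x 0) d; congr (differentiable _ _).
by apply: funext => y; rewrite sub0r.
Qed.

Lemma kF_differentiable (a q : C) : cn a < 1 -> cn q < 1 ->
  differentiable (kF a : Cplx R -> Cplx2 R) (q : Cplx R).
Proof.
move=> a1 q1; have n := cn_den2 a1 (ltW q1).
have dd := dfD (dfc (q : Cplx R) 1) (dfM (dfc (q : Cplx R) (cj a ^+ 2)) (dfid (q : Cplx R))).
have d1 := df_div (dfD (dfc (q : Cplx R) (2 * a)) (dfM (dfc (q : Cplx R) (2 * cj a)) (dfid (q : Cplx R)))) dd n.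
have d2 := df_div (dfD (dfc (q : Cplx R) (a ^+ 2)) (dfid (q : Cplx R))) dd n.
exact: (differentiable_pair d1 d2).
Qed.

Lemma flat_poly (P : {poly {poly C}}) (a : C) : cn a < 1 -> exists (N : nat) (T : {poly C}),
  forall q, cn q <= 1 -> P.[(kF a q).1, (kF a q).2] = T.[q] / (1 + cj a ^+ 2 * q) ^+ N.
Proof.
move=> a1; have [N [T hT]] := poly2_subst P ((2 * a)%:P + (2 * cj a) *: 'X) ((a ^+ 2)%:P + 'X) (1 + (cj a ^+ 2) *: 'X).
exists N, T => q q1; have := hT q.
rewrite !hornerD !hornerZ !hornerC hornerX => -> //; exact: cn_den2.
Qed.

(* [psi (1 + e u)] with [psi] vanishing on the royal variety and equal to the
   coordinate [q] on the flat: it exceeds the Schwarz bound at [x]. *)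
Lemma flat_in (V : set (Cplx2 R)) (S : set {poly {poly C}}) x c :
  V = G `&` [set x : Cplx2 R | forall p, S p -> p.[x.1, x.2] = 0] ->
  norm_preserving_extension G V -> royal_variety R `<=` V -> V x -> ~ royal_variety R x ->
  cn c < 1 -> flat c x -> flat c `<=` V.
Proof.
move=> VE np RV Vx nR c1 fx; have VG : V `<=` G by rewrite VE => ? [].
have [a a1 cE] := ctr_exists c1; rewrite cE in fx *.
move=> y fy; apply: contrapT => nVy.
have [P SP Py] : exists2 P, S P & P.[y.1, y.2] != 0.
  apply: contrapT => h; apply: nVy; rewrite VE; split; first exact: fy.1.
  by move=> p Sp; apply/eqP/negP => /negP pz; apply: h; exists p.
have PV z : V z -> P.[z.1, z.2] = 0 by rewrite VE => -[_]; exact.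
have [N [T hT]] := flat_poly P a1.
have [qy1 yE] := flat_kF a1 fy; have [q01 xE] := flat_kF a1 fx.
have T0 : T != 0.
  by apply: contra Py => /eqP T0; rewrite yE hT ?T0 ?horner0 ?mul0r// ltW.
have [q0 q0E] : exists q0, q0 = fT a x by eexists.
rewrite -q0E in q01 xE.
have q0n : q0 != 0.
  apply/eqP => e; apply: nR; rewrite xE e royal_kF; exists a; split=> //.
  by rewrite cnoE ltcR.
have [rs rsE] := closed_field_poly_normal T.
(* [U] collects the unimodular roots of [T], so [u] is -1 at them and 1 at [q0]. Where [F] is
   unimodular on the closure of [V], the coordinate is such a root and [chi = - F] points inwards;
   at [x] the perturbation enlarges the value. *)
pose U : {poly C} := \prod_(r <- rs | cn r == 1) ('X - r%:P).
have Uq0 : U.[q0] != 0.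
  rewrite horner_prod; rewrite prodf_seq_neq0; apply/allP => r _; apply/implyP => /eqP r1.
  by rewrite hornerXsubC subr_eq0; apply/eqP => e; move: q01; rewrite e r1 ltxx.
have Ubd q : cn q = 1 -> T.[q] = 0 -> U.[q] = 0.
  move=> q1 Tq; have : root T q by rewrite /root Tq.
  rewrite rsE rootZ ?lead_coef_eq0// root_prod_XsubC => qrs.
  by rewrite horner_prod (big_rem _ qrs) /= q1 eqxx hornerXsubC subrr mul0r.
pose u (q : Cplx R) : Cplx R := -1 + 2 / U.[q0] * U.[q].
have uq0 : u q0 = 1 by rewrite /u divfK//; ring.
have du (q : C) : differentiable u (q : Cplx R).
  exact: (dfD (dfc _ (-1)) (dfM (dfc _ (2 / U.[q0])) (df_poly U (dfid (q : Cplx R))))).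
pose sy (v : Cplx2 R) : Cplx2 R := ((v.1 : C) + v.2, (v.1 : C) * v.2).
have dsy v : differentiable sy v.
  exact: (differentiable_pair (dfD (differentiable_fst v) (differentiable_snd v))
     (dfM (differentiable_fst v) (differentiable_snd v))).
pose F (v : Cplx2 R) : Cplx R := fpsi a (sy v).
pose chi (v : Cplx2 R) : Cplx R := F v * u (fT a (sy v)).
pose A (z w : C) := [/\ cn z < 1, cn w < 1 & V (z + w, z * w)].
have Fle z w : cn z <= 1 -> cn w <= 1 -> cn (F (z, w)) <= 1.
  move=> z1 w1; rewrite /F /sy /= fpsi_sym//.
  by have [] := half_diff (tau_le1 a1 z1) (tau_le1 a1 w1).
have [e e0 he] : exists2 e, 0 < e & forall z w, cn z <= 1 -> cn w <= 1 -> A z w ->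
    cn (F (z, w) + e%:C * chi (z, w)) <= 1.
  apply: perturb; first by move=> z w [z1 w1 _]; apply: Fle; exact: ltW.
  move=> z w z1 w1; have n := fden_neq0 a1 z1 w1.
  have [P0|Pn] := eqVneq P.[z + w, z * w] 0; last first.
    left; have e0 : 0 < cn P.[z + w, z * w] by rewrite cn_gt0.
    have dP : differentiable (fun v => P.[(sy v).1, (sy v).2] : Cplx R) ((z, w) : Cplx2 R).
      exact: (df_poly2 P (dfcomp (dsy _) (differentiable_fst _)) (dfcomp (dsy _) (differentiable_snd _))).
    have [d d0 hd] := df_near dP e0; exists d => // z' w' hz hw [_ _ /PV /= V0].
    by have := hd (z', w') hz hw; rewrite /= V0 sub0r cnN ltxx.
  right; have n' : fden a (sy (z, w)) != 0 := n.
  have dF : differentiable F ((z, w) : Cplx2 R) := dfcomp (dsy (z, w)) (fpsi_differentiable n').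
  split; first exact: dF.
  - exact: (dfM dF (dfcomp (dfcomp (dsy _) (fT_differentiable n')) (du _))).
  - exact: Fle.
  move=> F1; have := F1; rewrite {1}/F /sy /= fpsi_sym// => F1'.
  have [_ /(_ F1')[tw t1]] := half_diff (tau_le1 a1 z1) (tau_le1 a1 w1).
  have pE := kF_tau a1 z1 w1 tw.
  have q1 : cn (tau a z * tau a w) = 1 by rewrite tw cnM cnN t1 mulr1.
  have Tq : T.[tau a z * tau a w] = 0.
    move: P0; rewrite -[z + w]/((z + w, z * w).1) -[z * w]/((z + w, z * w).2) pE hT ?q1// => /eqP.
    rewrite mulf_eq0 invr_eq0 (negPf (expf_neq0 _ (cn_den2 a1 _))) ?q1// orbF => /eqP //.
  rewrite /chi /sy /= fT_sym// /u (Ubd _ q1 Tq) mulr0 addr0 mulrA [cj _ * _]mulrC mulcJ F1 expr1n.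
  by rewrite mul1r rpN rp1; arith.
pose f (v : Cplx2 R) : Cplx R := fpsi a v * (1 + e%:C * u (fT a v)).
have hf : holomorphic_on G f.
  move=> v Gv; have n := fden_G a1 Gv.
  exact: (dfM (fpsi_differentiable n) (dfD (dfc _ 1) (dfM (dfc _ e%:C) (dfcomp (fT_differentiable n) (du _))))).
have f1 v : V v -> cn (f v) <= 1.
  move=> Vv; have [z [w [z1 w1 vE]]] := (G_cn v).1 (VG _ Vv).
  have := he z w (ltW z1) (ltW w1) (And3 z1 w1 _); rewrite -vE => /(_ Vv).
  by rewrite /f /chi /F /sy /= -vE; congr (cn _ <= _); ring.
have [g [hg gf g1]] := npep_use np (ex_intro _ _ Vx) (hol_analytic VG hf) f1.
have hgk : holomorphic_on (unit_disc R) (fun q : Cplx R => g (kF a q)).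
  move=> q q1; have {}q1 : cn q < 1 by rewrite -ltcR.
  exact: (dfcomp (kF_differentiable a1 q1) (hg _ (kF_G a1 q1).1)).
have gk1 (q : C) : cn q < 1 -> cn (g (kF a q)) <= 1 by move=> q1; apply: g1; exact: (kF_G a1 q1).1.
have psi0 : fpsi a (kF a 0) = 0.
  by rewrite royal_kF /fpsi /= (_ : (2 * a) ^+ 2 - 4 * a ^+ 2 = 0) ?mulr0 ?mul0r ?oppr0//; ring.
have g0 : g (kF a 0) = 0.
  rewrite gf; first by rewrite /f psi0 mul0r.
  by apply: RV; rewrite royal_kF; exists a; split=> //; rewrite cnoE ltcR.
have := schwarz_disc hgk gk1 g0 q01; rewrite -xE gf// /f -q0E uq0 mulr1.
have -> : fpsi a x = q0.
  have [t tE] : exists t : C, t ^+ 2 = - q0 by exists (sqrtc (- q0)); rewrite sqr_sqrtc.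
  have t1 : cn t < 1.
    by rewrite -(@ltr_pXn2r _ 2) ?nnegrE ?cn_ge0// expr1n -cnX tE cnN.
  have q0t : q0 = - t ^+ 2 by rewrite tE opprK.
  have an : cn (- a) < 1 by rewrite cnN.
  have tn : cn (- t) < 1 by rewrite cnN.
  have h1 := tau_lt1 an t1; have h2 := tau_lt1 an tn.
  rewrite xE q0t kF_sym ?(ltW t1)// fpsi_sym ?(ltW h1) ?(ltW h2)//.
  by rewrite -{1 3}(opprK a) !tauK ?(ltW t1) ?(ltW tn)//; field.
rewrite cnM -rC1 -rCD cnR ger0_norm; last by arith.
by rewrite -{2}[cn q0]mulr1 ler_pM2l ?cn_gt0//; arith.
Qed.

(* In coordinates, [cay om (s, p) = (s - 2 om p) / (2 - om s)]. *)
Definition cay (om : C) (x : Cplx2 R) : C := cj om * ((cm om x - 1) / (cm om x + 1)).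

Lemma cay_differentiable om (x : Cplx2 R) : cn om = 1 -> G x ->
  differentiable (cay om : Cplx2 R -> Cplx R) x.
Proof.
move=> o1 Gx; have n := hp1_neq0 (cm_gt0 o1 Gx).
exact: (dfM (dfc x (cj om)) (dfcomp (cm_differentiable o1 Gx) (cayley_differentiable n))).
Qed.

Lemma cay_le1 om (x : Cplx2 R) : cn om = 1 -> G x -> cn (cay om x) <= 1.
Proof. by move=> o1 Gx; rewrite cnM cnJ o1 mul1r ltW// cn_cayley// cm_gt0. Qed.

Lemma cay_royal om (z : C) : cn om = 1 -> cn z < 1 -> cay om (2 * z, z ^+ 2) = z.
Proof.
move=> o1 z1; have omJ : cj om * om = 1 by rewrite mulrC mulcJ o1 expr1n.
have n : 1 - om * z != 0 by apply: lt1_neq; rewrite cnM o1 mul1r.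
rewrite /cay /cm /cden /=; have -> : 1 - om * (2 * z) + om ^+ 2 * z ^+ 2 = (1 - om * z) ^+ 2 by ring.
have -> : (1 - om ^+ 2 * z ^+ 2) / (1 - om * z) ^+ 2 = (1 + om * z) / (1 - om * z) by field.
transitivity (cj om * (om * z)); last by rewrite mulrA omJ mul1r.
congr (_ * _).
by field; rewrite n (_ : _ + _ = 2) ?two_neq0//; ring.
Qed.

Lemma cay_gk om al be ga (m : C) : cn om = 1 -> good_quad al be ga -> 0 < rp m ->
  cay om (gk om al be ga m) = cj om * ((m - 1) / (m + 1)).
Proof. by move=> o1 gq hm; rewrite /cay; have [_ -> _] := gkP o1 gq hm. Qed.

Lemma cdif_geod (D : Cplx2 R -> Cplx R) om al be ga (y : Cplx2 R) : cn om = 1 -> good_quad al be ga ->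
  differentiable D y -> geod om al be ga y ->
  cdif (fun m => D (gk om al be ga m)) (cm om y) ('d D y ('d (gk om al be ga) (cm om y : Cplx R) 1)).
Proof.
move=> o1 gq dD gy; have m0 := cm_gt0 o1 gy.1; have yE := geod_gk o1 gy.
have dk := gk_differentiable om gq m0; rewrite yE in dD.
have dc := diff_comp dk dD; have h := diff_cdif (differentiable_comp dk dD).
rewrite dc /= in h; rewrite -yE in h; exact: h.
Qed.

Lemma hp_near (m v : C) : cn (v - m) < rp m -> 0 < rp v.
Proof. by have := rp_le_cn (v - m); rewrite rpB ler_norml => /andP[+ _]; arith. Qed.

Lemma cdif_geod0 (D : Cplx2 R -> Cplx R) om al be ga (y : Cplx2 R) : cn om = 1 -> good_quad al be ga ->
  differentiable D y -> geod om al be ga y -> (forall m : C, 0 < rp m -> D (gk om al be ga m) = 0) ->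
  'd D y ('d (gk om al be ga) (cm om y : Cplx R) 1) = 0.
Proof.
move=> o1 gq dD gy D0; have m0 := cm_gt0 o1 gy.1.
apply: (cdif_unique (cdif_geod o1 gq dD gy)).
apply: (@cdif_local _ (fun=> 0) _ _ _ (rp (cm om y)) m0); first by move=> v /hp_near/D0.
by move=> e e0; exists 1 => // v _; rewrite subrr mul0r subr0 cn0 mulr_ge0 ?cn_ge0// ltW.
Qed.

Lemma cayley_cdif_neq0 (k l m : C) : 0 < rp m -> l != 0 ->
  ~ cdif (fun v => k - l * ((v - 1) / (v + 1))) m 0.
Proof.
move=> m0 l0 h; have M0 := cn_ge0 m; have n := hp1_neq0 m0.
have l1 : 0 < cn l by rewrite cn_gt0.
have X0 : 0 < (cn m + 2) ^+ 2 by rewrite exprn_gt0//; arith.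
have e0 : 0 < cn l / (cn m + 2) ^+ 2 by rewrite divr_gt0.
have [d d0 hd] := h _ e0.
have [t [t0 t1 td]] : exists t : R, [/\ 0 < t, t <= 1 & t < d].
  exists (Num.min 1 (d / 2)); split; first by rewrite lt_min ltr01 divr_gt0.
    by rewrite ge_min lexx.
  by apply: (@le_lt_trans _ _ (d / 2)); [rewrite ge_min lexx orbT|arith].
have vE : m + t%:C - m = t%:C by rewrite addrC addKr.
have ct : cn (t%:C : C) = t by rewrite cnR gtr0_norm.
have v0 : 0 < rp (m + t%:C) by rewrite rpD /=; arith.
have n2 := hp1_neq0 v0.
have := hd (m + t%:C); rewrite vE ct => /(_ td).
have -> : k - l * ((m + t%:C - 1) / (m + t%:C + 1)) - (k - l * ((m - 1) / (m + 1))) - 0 * t%:C =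
   - (l * 2 * t%:C / ((m + t%:C + 1) * (m + 1))).
  by move: (t%:C) n2 {vE ct v0 t1 td hd} => T n2; field; rewrite n n2.
rewrite cnN cnM cnV !cnM ct cn_natr => h1.
have b1 : cn (m + t%:C + 1) <= cn m + 2.
  by have := cnD (m + t%:C) 1; have := cnD m t%:C; rewrite ct cn1; arith.
have b2 : cn (m + 1) <= cn m + 2 by have := cnD m 1; rewrite cn1; arith.
have c1 : 0 < cn (m + t%:C + 1) by rewrite cn_gt0.
have c2 : 0 < cn (m + 1) by rewrite cn_gt0.
have b3 : cn (m + t%:C + 1) * cn (m + 1) <= (cn m + 2) ^+ 2.
  by rewrite expr2; apply: ler_pM => //; exact: ltW.
move: h1; rewrite ler_pdivrMr ?mulr_gt0// -!mulrA => h1.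
have h2 : t * ((cn m + 2) ^- 2 * (cn (m + t%:C + 1) * cn (m + 1))) <= t.
  by rewrite ler_piMr ?(ltW t0)// mulrC ler_pdivrMr// mul1r.
have h3 : cn l * (2 * t) <= cn l * t.
  apply: le_trans h1 _; rewrite ler_pM2l//; apply: le_trans h2.
  by rewrite le_eqVlt; apply/orP; left; apply/eqP; ring.
by move: h3; rewrite ler_pM2l//; arith.
Qed.

Lemma flat_pt (c p : C) : cn c < 1 -> cn p < 1 -> flat c ((c + cj c * p, p) : Cplx2 R).
Proof.
move=> c1 p1; split=> //; apply/G_criterion => /=.
have p2 : 0 < 1 - cn p ^+ 2 by rewrite subr_gt0 expr_lt1// cn_ge0.
have -> : c + cj c * p - cj (c + cj c * p) * p = c * (1 - cn p ^+ 2)%:C.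
  by rewrite !cjE rCD rCN -mulcJ rC1; ring.
by rewrite cnM cnR gtr0_norm// gtr_pMl.
Qed.

(** Fix [p] in the disc with nonzero leading coefficient of [P] in [s]. Each flat geodesic in [V]
    then gives a root [c' + cj c' p] of one nonzero polynomial, different ones giving different
    roots. *)
Lemma flat_isolated (V : set (Cplx2 R)) (P : {poly {poly C}}) (c : C) : P != 0 ->
  (forall x, V x -> P.[x.1, x.2] = 0) -> cn c < 1 ->
  exists2 d : R, 0 < d & forall c', cn c' < 1 -> flat c' `<=` V -> cn (c' - c) < d -> c' = c.
Proof.
move=> P0 PV c1; have lP : lead_coef P != 0 by rewrite lead_coef_eq0.
have [p] := poly_nonzero_near 0 lP ltr01; rewrite subr0 => p1 lp.
apply: contrapT => none; move/negP: lp; apply; apply/eqP.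
suff E0 : evy p P = 0.
  by have := congr1 (fun q : {poly C} => q`_(size P).-1) E0; rewrite coef0 coef_map.
apply: (@poly_roots_accum _ _ (c + cj c * p)) => d d0; apply: contrapT => h; apply: none.
have d2 : 0 < d / 2 by arith.
exists (d / 2) => // c' c'1 fV hc; apply: contrapT => ne; apply: h.
exists (c' + cj c' * p); split.
- apply/eqP => e; apply: ne; apply: (flat_unique (flat_pt c'1 p1)).
  by rewrite e; exact: flat_pt.
- have -> : c' + cj c' * p - (c + cj c * p) = (c' - c) + cj (c' - c) * p by rewrite !cjE; ring.
  apply: le_lt_trans (cnD _ _) _; rewrite cnM cnJ.
  have : cn (c' - c) * cn p <= cn (c' - c) by rewrite ler_piMr ?cn_ge0// ltW.
  arith.
- by rewrite evyE; exact: (PV _ (fV _ (flat_pt c'1 p1))).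
Qed.

(** The difference of centres solves a real-linear equation with small right-hand side, which is
    invertible since [cn x.2] stays below 1. *)
Lemma flat_center_near (c : C) (y : Cplx2 R) (d : R) : flat c y -> cn c < 1 -> 0 < d ->
  nbhs y [set x : Cplx2 R | forall c', flat c' x -> cn (c' - c) < d].
Proof.
move=> [Gy yE] c1 d0; have [_ p1] := G_bound Gy.
have [k [k0 kE]] : exists k : R, 0 < k /\ 2 * k = 1 - cn y.2.
  by exists ((1 - cn y.2) / 2); split; arith.
apply/nbhs2P; exists (Num.min k (d * k / 2)); first by rewrite lt_min k0 divr_gt0// mulr_gt0.
move=> x; rewrite !lt_min => /andP[_ x1] /andP[x2 x2'] c' [Gx xE].
have E : (c' - c) + cj (c' - c) * x.2 = (x.1 - y.1) - cj c * (x.2 - y.2).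
  by rewrite xE yE !cjE; ring.
have h1 : cn (c' - c) * (1 - cn x.2) <= cn (x.1 - y.1) + cn (x.2 - y.2).
  apply: le_trans (_ : cn ((c' - c) + cj (c' - c) * x.2) <= _).
    have := cn_distD (c' - c) (cj (c' - c) * x.2); rewrite cnM cnJ; arith.
  rewrite E; apply: le_trans (cnB _ _) _; rewrite lerD2l cnM cnJ ler_piMl ?cn_ge0//; exact: ltW.
have h2 : k <= 1 - cn x.2 by have := cnD (x.2 - y.2) y.2; rewrite subrK; arith.
have h3 : cn (c' - c) * k <= cn (c' - c) * (1 - cn x.2) by rewrite ler_wpM2l ?cn_ge0.
rewrite -(ltr_pM2r k0); apply: le_lt_trans h3 _; apply: le_lt_trans h1 _; arith.
Qed.

(* A function on [G] equal to [z] at the royal point [(2 z, z ^ 2)] and constant on the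
   flat geodesic with centre [ctr a]. *)
Definition glue (a : C) (x : Cplx2 R) : C :=
  a + ((1 + a * cj a) * x.1 - 2 * a - 2 * cj a * x.2) / (2 - cj a * x.1).

Lemma glue_den a (x : Cplx2 R) : cn a < 1 -> G x -> 2 - cj a * x.1 != 0.
Proof.
move=> a1 Gx; have [h _] := G_bound Gx; apply/eqP => /eqP; rewrite subr_eq0 => /eqP e.
have : cn (2 : C) < 2.
  by rewrite e cnM cnJ; apply: le_lt_trans h; rewrite ler_piMl ?cn_ge0// ltW.
by rewrite cn_natr ltxx.
Qed.

Lemma glue_flat a (x : Cplx2 R) : flat (ctr a) x -> glue a x = a.
Proof.
move=> [Gx xE]; rewrite /glue {1}xE ctrJ /ctr; have n := ctr_den a.
rewrite (_ : _ * _ - _ - _ = 0) ?mul0r ?addr0//.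
by move: (cj a) n => b n; field.
Qed.

Lemma glue_royal (a z : C) : cn a < 1 -> cn z < 1 -> glue a (2 * z, z ^+ 2) = z.
Proof.
move=> a1 z1; have n := tau_den a1 (ltW z1); rewrite /glue /=; move: (cj a) n => b n.
have -> : 2 - b * (2 * z) = 2 * (1 - b * z) by ring.
by field.
Qed.

Lemma linear_eq0 (L : {linear Cplx2 R -> Cplx R}) (a b : Cplx2 R) :
  L a = 0 -> L b = 0 -> a.1 * b.2 - a.2 * b.1 != 0 -> forall v, L v = 0.
Proof.
move=> La Lb h v; have [s [t ->]] := two_vectors h v.
by rewrite linearD !linearZ /= La Lb !scaler0 addr0.
Qed.

(* Suppose [V] contains a second flat geodesic, meeting the royal variety at [y].
   The function equal to [a] on it and to [cay om] elsewhere on [V] is analytic on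
   [V]. A norm-preserving extension agrees with [cay om] on the royal variety and,
   by uniqueness in the Schwarz lemma, on the geodesic from [x] to [y]; hence its
   derivative at [y] is that of [cay om], which is nonzero along the second flat. *)
Lemma flats_unique (V : set (Cplx2 R)) (S : set {poly {poly C}}) P x c1 c2 :
  V = G `&` [set x : Cplx2 R | forall p, S p -> p.[x.1, x.2] = 0] -> P != 0 -> S P ->
  norm_preserving_extension G V -> royal_variety R `<=` V -> V x -> ~ royal_variety R x ->
  flat c1 x -> cn c2 < 1 -> flat c2 `<=` V -> c1 = c2.
Proof.
move=> VE P0 SP np RV Vx nR fx c21 FV; apply: contrapT => ne; have VG : V `<=` G by rewrite VE => ? [].
have PV z : V z -> P.[z.1, z.2] = 0 by rewrite VE => -[_]; exact.
have [a a1 cE] := ctr_exists c21.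
have [d d0 iso] := flat_isolated P0 PV c21.
have [y yE] : exists y : Cplx2 R, y = (2 * a, a ^+ 2) by eexists.
have z0 : cn (0 : C) < 1 by rewrite cn0.
have fy : flat c2 y by rewrite yE -royal_kF cE; exact: kF_flat.
have Ry : royal_variety R y by exists a; split=> //; rewrite cnoE ltcR.
have xy : x <> y by move=> e; apply: nR; rewrite e.
have [ om [al [be [ga [ o1 gq gx gy]]]]] := geod_exists (VG _ Vx) fy.1 xy.
have near2 z : V z -> (forall c', flat c' z -> cn (c' - c2) < d) -> flat c2 z \/ royal_variety R z.
  move=> Vz hz; have [Rz|nRz] := pselect (royal_variety R z); first by right.
  left; have [c' c'1 fz] := flat_exists (VG _ Vz).
  have := flat_in VE np RV Vz nRz c'1 fz; have := hz _ fz.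
  by move=> h1 h2; rewrite -(iso _ c'1 h2 h1).
pose f (v : Cplx2 R) : Cplx R := if pselect (flat c2 v) then a else cay om v.
have fF v : flat c2 v -> f v = a by rewrite /f; case: pselect.
have fN v : ~ flat c2 v -> f v = cay om v by rewrite /f; case: pselect.
have fR (z : C) : cn z < 1 -> f (2 * z, z ^+ 2) = z.
  move=> z1; have [fz|nf] := pselect (flat c2 (2 * z, z ^+ 2)); last by rewrite fN// cay_royal.
  by rewrite fF//; move: fz; rewrite cE => /glue_flat; rewrite glue_royal.
have af : analytic_on_subset G V f.
  apply: analytic_local => // z Vz; have [fz|nfz] := pselect (flat c2 z).
    (* Flat geodesics inside [V] being isolated, near this one [V] consists only of it and of points
       of the royal variety; on both [f] agrees with [glue a]. *)
    exists [set x : Cplx2 R | forall c', flat c' x -> cn (c' - c2) < d], (glue a); split.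
    - exact: flat_center_near.
    - move=> v _ Gv; have n := glue_den a1 Gv.
      exact: (dfD (dfc _ a) (df_div (dfB (dfB (dfM (dfc _ (1 + a * cj a)) (differentiable_fst v)) (dfc _ (2 * a)))
        (dfM (dfc _ (2 * cj a)) (differentiable_snd v))) (dfB (dfc _ 2) (dfM (dfc _ (cj a)) (differentiable_fst v))) n)).
    - move=> v hv Vv; have [fv|[w [w1 ->]]] := near2 _ Vv hv.
        by rewrite fF// glue_flat// -cE.
      by have w1' : cn w < 1; [rewrite -ltcR|rewrite fR// glue_royal].
  exists [set v : Cplx2 R | v.1 - (c2 + cj c2 * v.2) != 0], (cay om); split.
  - have ne0 : 0 < cn (z.1 - (c2 + cj c2 * z.2)).
      rewrite cn_gt0 subr_eq0; apply/eqP => e; apply: nfz; split=> //; exact: VG.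
    have dd := dfB (differentiable_fst z) (dfD (dfc z c2) (dfM (dfc z (cj c2)) (differentiable_snd z))).
    have [r r0 hr] := df_near dd ne0; apply/nbhs2P; exists r => // v v1 v2 /=.
    by apply/eqP => e; have := hr v v1 v2; rewrite e sub0r cnN ltxx.
  - by move=> v _ Gv; exact: cay_differentiable.
  - by move=> v /= hv _; rewrite fN// => -[_ e]; move: hv; rewrite e subrr eqxx.
have f1 v : V v -> cn (f v) <= 1.
  move=> Vv; have [fv|nf] := pselect (flat c2 v); first by rewrite fF// ltW.
  by rewrite fN// cay_le1//; exact: VG.
have [g [hg gf g1]] := npep_use np (ex_intro _ _ Vx) af f1.
pose D (v : Cplx2 R) : Cplx R := g v - cay om v.
have dD : differentiable D y := dfB (hg _ fy.1) (cay_differentiable o1 fy.1).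
have omJ : cj om * om = 1 by rewrite mulrC mulcJ o1 expr1n.
have DK (m : C) : 0 < rp m -> D (gk om al be ga m) = 0.
  move=> hm; pose G1 (m : Cplx R) : Cplx R := om * g (gk om al be ga m).
  have hG1 : holomorphic_on (@half_plane R) G1.
    move=> v hv; have [Gv _ _] := gkP o1 gq hv.
    exact: (dfM (dfc _ om) (dfcomp (gk_differentiable om gq hv) (hg _ Gv))).
  have G11 (v : C) : 0 < rp v -> cn (G1 v) <= 1.
    by move=> hv; have [Gv _ _] := gkP o1 gq hv; rewrite cnM o1 mul1r g1.
  have [m0 m1] := (cm_gt0 o1 gx.1, cm_gt0 o1 gy.1).
  have cayE v : om * cay om v = (cm om v - 1) / (cm om v + 1) by rewrite /cay mulrA [om * _]mulrC omJ mul1r.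
  have mm : cm om x != cm om y.
    by apply/eqP => e; apply: xy; rewrite (geod_gk o1 gx) (geod_gk o1 gy) e.
  have e0 : G1 (cm om x) = (cm om x - 1) / (cm om x + 1).
    rewrite /G1 -(geod_gk o1 gx) gf// fN ?cayE// => h; exact: ne (flat_unique fx h).
  have e1 : G1 (cm om y) = (cm om y - 1) / (cm om y + 1).
    rewrite /G1 -(geod_gk o1 gy) gf; last exact: FV.
    by rewrite -cayE fF// yE cay_royal.
  have := schwarz_unique hG1 G11 m0 m1 hm mm e0 e1; rewrite /G1 /D cay_gk// => <-.
  by rewrite mulrA omJ mul1r subrr.
have gR : geod om 0 0 0 y by rewrite -royal_geod.
have DR (m : C) : 0 < rp m -> D (gk om 0 0 0 m) = 0.
  move=> hm; have : royal_variety R (gk om 0 0 0 m) by rewrite (royal_geod o1); exact: gk_geod (good_royal R) hm.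
  move=> [z [z1 ->]]; have z1' : cn z < 1 by rewrite -ltcR.
  by rewrite /D gf; [rewrite fR// cay_royal// subrr|apply: RV; exists z].
have [be2 [ga2 [gq2 FE]]] := flat_geod o1 c21.
have gF : geod om 1 be2 ga2 y by rewrite FE.
have vK := cdif_geod0 o1 gq dD gy DK.
have vR := cdif_geod0 o1 (good_royal R) dD gR DR.
have vF := cdif_geod o1 gq2 dD gF.
have my := cm_gt0 o1 fy.1.
have nR0 := gk_tangent_neq0 o1 (good_royal R) my.
have L0 := linear_eq0 vK vR; rewrite L0 in vF; last first.
  (* Were the two tangents proportional, the geodesic from [x] to [y] would lie in the royal
     variety, and [x] with it. *)
  apply/eqP => e; have [s sE] := proportional_vectors e nR0.
  apply: nR; rewrite (royal_geod o1).
  exact: (geod_tangent o1 gq o1 (good_royal R) gy gR sE).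
have oJ : cj om != 0 by rewrite -cn_gt0 cnJ o1.
apply: (cayley_cdif_neq0 (k := a) my oJ).
apply: (cdif_local my _ vF) => v /hp_near hv; rewrite /D cay_gk//; congr (_ - _).
have fv : flat c2 (gk om 1 be2 ga2 v) by rewrite -FE; exact: gk_geod.
by rewrite gf ?fF//; exact: FV.
Qed.

Lemma royal_case (V : set (Cplx2 R)) (S : set {poly {poly C}}) P :
  V = G `&` [set x : Cplx2 R | forall p, S p -> p.[x.1, x.2] = 0] -> P != 0 -> S P ->
  norm_preserving_extension G V -> royal_variety R `<=` V ->
  V = royal_variety R \/ exists2 c, cn c < 1 & V = royal_variety R `|` flat c.
Proof.
move=> VE P0 SP np RV; have VG : V `<=` G by rewrite VE => ? [].
have [h|h] := pselect (V `<=` royal_variety R); first by left; apply/seteqP.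
right; have [x Vx nR] : exists2 x, V x & ~ royal_variety R x.
  by apply: contrapT => n; apply: h => x Vx; apply: contrapT => nR; apply: n; exists x.
have [c c1 fx] := flat_exists (VG _ Vx); have FV := flat_in VE np RV Vx nR c1 fx.
exists c => //; apply/seteqP; split=> y; last by case=> [/RV|/FV].
move=> Vy; have [Ry|nRy] := pselect (royal_variety R y); first by left.
right; have [c' c'1 fy] := flat_exists (VG _ Vy).
by rewrite -(flats_unique VE P0 SP np RV Vy nRy fy c1 FV).
Qed.
End RoyalCase.

(** * Extension from the royal variety and a flat geodesic *)

Section Montel.
Variable R : realType.
Notation C := R[i].
Notation G := (symmetrized_bidisc R).

Section UltraLimits.
Variable F : set_system nat.
Hypothesis FU : UltraFilter F.

Definition ulim (u : nat -> C) (l : C) := forall e : R, 0 < e -> F [set n | cn (u n - l) < e].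

Lemma ulim_real (u : nat -> R) (M : R) : (forall n, `|u n| <= M) ->
  exists l : R, forall e : R, 0 < e -> F [set n | `|u n - l| < e].
Proof.
move=> uM; have cpt : compact `[- M, M]%classic := @segment_compact R (- M) M.
have Fu : (u @ F) `[- M, M]%classic.
  have : F [set n | u n \in `[- M, M]] by apply: filterE => n /=; rewrite in_itv /= -ler_norml; exact: uM.
  by [].
have [l [_ lc]] := cpt _ (fmap_proper_filter u _) Fu.
exists l => e e0; have [//|Fn] := in_ultra_setVsetC [set n | `|u n - l| < e] FU.
have nb : nbhs l [set y : R | `|y - l| < e].
  by apply/nbhs_ballP; exists e => //= y; rewrite /ball /= distrC.
have Fn' : (u @ F) [set y : R | ~ `|y - l| < e] by [].
by have [y [h]] := lc _ _ Fn' nb.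
Qed.

Lemma ulim_exists (u : nat -> C) (M : R) : (forall n, cn (u n) <= M) -> exists l, ulim u l.
Proof.
move=> uM; have [n|x hx] := @ulim_real (fun n => rp (u n)) M.
  exact: le_trans (rp_le_cn _) (uM n).
have [n|y hy] := @ulim_real (fun n => ip (u n)) M.
  exact: le_trans (ip_le_cn _) (uM n).
exists (x +i* y) => e e0; have e2 : 0 < e / 2 by arith.
apply: filterS (filterI (hx _ e2) (hy _ e2)) => n /= [h1 h2].
by apply: le_lt_trans (cn_le_ReIm _) _; rewrite rpB ipB /=; arith.
Qed.

Lemma ulimD u v l k : ulim u l -> ulim v k -> ulim (fun n => u n + v n) (l + k).
Proof.
move=> hu hv e e0; have e2 : 0 < e / 2 by arith.
apply: filterS (filterI (hu _ e2) (hv _ e2)) => n /= [h1 h2].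
have -> : u n + v n - (l + k) = (u n - l) + (v n - k) by ring.
by have := cnD (u n - l) (v n - k); arith.
Qed.

Lemma ulimZ u l k : ulim u l -> ulim (fun n => k * u n) (k * l).
Proof.
move=> hu e e0; have k0 : 0 < cn k + 1 by have := cn_ge0 k; arith.
have e1 : 0 < e / (cn k + 1) by rewrite divr_gt0.
apply: filterS (hu _ e1) => n /=; rewrite -mulrBr cnM ltr_pdivlMr// => h.
by apply: le_lt_trans h; rewrite mulrDr mulr1 mulrC lerDl cn_ge0.
Qed.

Lemma ulim_le u l M : ulim u l -> (forall n, cn (u n) <= M) -> cn l <= M.
Proof.
move=> hu uM; rewrite leNgt; apply/negP => h; have e0 : 0 < cn l - M by arith.
have [n /= hn] := filter_ex (hu _ e0).
by have := cnD (l - u n) (u n); rewrite subrK (cnBC l (u n)); have := uM n; arith.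
Qed.

Lemma ulim_unique u l k : ulim u l -> ulim u k -> l = k.
Proof.
move=> hl hk; apply/eqP; rewrite -subr_eq0 -cn_eq0; apply/eqP/le_anti; rewrite cn_ge0 andbT.
apply/ler_addgt0Pr => e e0; rewrite add0r; have e2 : 0 < e / 2 by arith.
have [n /= [h1 h2]] := filter_ex (filterI (hl _ e2) (hk _ e2)).
have := cn_tri (u n) l k; rewrite (cnBC l (u n)); arith.
Qed.

Lemma clim_ulim u l : nbhs (\oo : set_system nat) `<=` F -> clim u l -> ulim u l.
Proof.
move=> sub hu e e0; have [N0 h] := hu _ e0; apply: sub.
by exists N0 => // n /= nN; exact: h.
Qed.
End UltraLimits.

Definition lin2 (p q : C) (h : Cplx2 R) : Cplx R := p * h.1 + q * h.2.

Lemma lin2_linear p q : linear (lin2 p q).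
Proof. by move=> k x y; rewrite /lin2 /= /GRing.scale /=; ring. Qed.

HB.instance Definition _ p q := GRing.isLinear.Build C (Cplx2 R) (Cplx R) _ (lin2 p q) (lin2_linear p q).

Lemma lin2_continuous p q : continuous (lin2 p q).
Proof.
move=> x; apply: differentiable_continuous.
exact: (dfD (dfM (dfc x p) (differentiable_fst x)) (dfM (dfc x q) (differentiable_snd x))).
Qed.

Lemma norm2E (h : Cplx2 R) : `|h| = (Num.max (cn h.1) (cn h.2))%:C.
Proof.
case: h => a b; rewrite prod_normE /= !cnoE.
have [le|lt] := leP (cn a) (cn b).
  by apply/max_idPr; rewrite lecR.
by rewrite /Order.max ltcR lt_gtF.
Qed.

(** The one-variable estimate is applied on complex lines through [x]. All constants depend only on
    [r], so the estimate passes to limits of bounded families and makes the limit differentiable. *)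
Lemma taylor_G (g : Cplx2 R -> Cplx R) (x : Cplx2 R) (r : R) : holomorphic_on G g ->
  (forall y, G y -> cn (g y) <= 1) -> 0 < r ->
  (forall y : Cplx2 R, cn (y.1 - x.1) < r -> cn (y.2 - x.2) < r -> G y) ->
  exists p q : C, [/\ cn p <= 12 / r, cn q <= 12 / r & forall (h : Cplx2 R) (t : R),
    cn h.1 <= t -> cn h.2 <= t -> t <= r / 4 -> cn (g (h + x) - g x - lin2 p q h) <= 64 * t ^+ 2 / r ^+ 2].
Proof.
move=> hg g1 r0 hG; have Gx : G x by apply: hG; rewrite subrr cn0.
have dg := hg _ Gx.
have line (k : Cplx2 R) (z : C) : cn k.1 <= r -> cn k.2 <= r -> cn z < 1 -> G (z *: k + x).
  move=> k1 k2 z1; apply: hG => /=; rewrite addrK cnM; apply: le_lt_trans (_ : cn z * r < r).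
  - by rewrite ler_wpM2l ?cn_ge0.
  - by rewrite gtr_pMl.
  - by rewrite ler_wpM2l ?cn_ge0.
  - by rewrite gtr_pMl.
have [L LE] : exists L : {linear Cplx2 R -> Cplx R}, L = 'd g x by eexists.
have tay (k : Cplx2 R) (z : C) : cn k.1 <= r -> cn k.2 <= r -> cn z <= 2^-1 ->
    cn (g (z *: k + x) - g x - L k * z) <= 16 * cn z ^+ 2.
  move=> k1 k2 z2; pose f (z : Cplx R) : Cplx R := g (z *: k + x).
  have dl (w : Cplx R) : differentiable (fun w : Cplx R => w *: k + x) w.
    have d1 := dfD (dfM (dfid w) (dfc w k.1)) (dfc w x.1).
    have d2 := dfD (dfM (dfid w) (dfc w k.2)) (dfc w x.2).
    have := differentiable_pair d1 d2; congr (differentiable _ _).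
  have hf : holomorphic_on (unit_disc R) f.
    move=> w w1; have {}w1 : cn w < 1 by rewrite -ltcR.
    exact: (dfcomp (dl w) (hg _ (line k w k1 k2 w1))).
  have f1 (w : C) : cn w < 1 -> cn (f w) <= 1 by move=> w1; apply: g1; exact: line.
  have f0 : f 0 = g x by rewrite /f scale0r add0r.
  rewrite -f0; apply: (taylor2 hf f1 _ z2) => e e0.
  have er : 0 < e / r by rewrite divr_gt0.
  have [d d0 hd] := differentiable_eps dg er; exists (d / r); first by rewrite divr_gt0.
  move=> v; rewrite subr0 ltr_pdivlMr// => vd; rewrite f0 /f.
  have mx : Num.max (cn (v *: k).1) (cn (v *: k).2) <= cn v * r.
    by rewrite ge_max /= !cnM !ler_wpM2l ?cn_ge0.
  have := hd (v *: k); rewrite norm2E ltcR => /(_ (le_lt_trans mx vd)).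
  rewrite cnoE -rCM lecR -LE linearZ /= => h; rewrite mulrC; apply: le_trans h _.
  by apply: le_trans (ler_wpM2l (ltW er) mx) _; rewrite mulrA mulrAC divfK// gt_eqF.
have Lh (h : Cplx2 R) : L h = lin2 (L (1, 0)) (L (0, 1)) h.
  have {1}-> : h = h.1 *: ((1, 0) : Cplx2 R) + h.2 *: ((0, 1) : Cplx2 R).
    apply: injective_projections; rewrite /= /GRing.scale /=; first by rewrite mulr1 mulr0 addr0.
    by rewrite mulr0 mulr1 add0r.
  by rewrite linearD !linearZ /= /lin2 [L (1, 0) * _]mulrC [L (0, 1) * _]mulrC.
have half : cn (2^-1 : C) = 2^-1 by rewrite cnV cn_natr.
(* At the parameter 1/2 in the direction [r e], the estimate bounds [r L(e) / 2] by 4 from the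
   remainder plus 2 from the two values of [g]. *)
have bnd (e : Cplx2 R) : cn e.1 <= 1 -> cn e.2 <= 1 -> cn (L e) <= 12 / r.
  move=> e1 e2.
  have sc (c : C) : cn c <= 1 -> cn (r%:C * c) <= r.
    by move=> c1; rewrite cnM cnR gtr0_norm// ler_piMr// ltW.
  have := @tay (r%:C *: e) 2^-1 (sc _ e1) (sc _ e2).
  rewrite half lexx => /(_ isT).
  have g2 := g1 _ Gx; have g3 : cn (g (2^-1 *: (r%:C *: e) + x)) <= 1.
    by apply: g1; apply: line; [exact: sc|exact: sc|rewrite half; arith].
  have E : L (r%:C *: e) = r%:C * L e by rewrite linearZ.
  rewrite E ler_pdivlMr//; move: (g _) (g x) g2 g3 => u v g2 g3 h.
  have h1 : cn (r%:C * L e * 2^-1) <= 6.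
    have := cnB (u - v) (u - v - r%:C * L e * 2^-1); rewrite opprB [X in cn X <= _]addrC subrK => h2.
    by have := cnB u v; move: h; rewrite expr2; arith.
  by move: h1; rewrite !cnM half cnR gtr0_norm// mulrC; arith.
have c11 : cn (1 : C) <= 1 by rewrite cn1.
have c01 : cn (0 : C) <= 1 by rewrite cn0 ler01.
exists (L (1, 0)), (L (0, 1)); split; [exact: (bnd (1, 0))|exact: (bnd (0, 1))|].
move=> h t h1 h2 tr; rewrite -Lh.
have t0 : 0 <= t := le_trans (cn_ge0 _) h1.
have [t00|tn] := eqVneq t 0.
  have hz c : cn c <= t -> c = 0 :> C.
    by rewrite t00 => c0; apply/eqP; rewrite -cn_eq0; apply/eqP/le_anti; rewrite c0 cn_ge0.
  have -> : h = 0 by case: h h1 h2 => a b /= /hz -> /hz ->.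
  by rewrite add0r linear0 subrr subr0 cn0 t00 expr0n /= mulr0 mul0r.
have tp : 0 < t by rewrite lt_neqAle eq_sym tn.
have tC : t%:C != 0 :> C := rC_neq0 tp.
have rC : r%:C != 0 :> C := rC_neq0 r0.
have sc (c : C) : cn c <= t -> cn ((r / t)%:C * c) <= r.
  move=> ct; rewrite cnM cnR gtr0_norm ?divr_gt0// mulrAC ler_pdivrMr// ler_wpM2l//.
  exact: ltW.
have zt : cn ((t / r)%:C : C) = t / r by rewrite cnR gtr0_norm// divr_gt0.
have := @tay ((r / t)%:C *: h) (t / r)%:C (sc _ h1) (sc _ h2).
have -> : (t / r)%:C *: ((r / t)%:C *: h) = h.
  rewrite scalerA -rCM (_ : t / r * (r / t) = 1) ?scale1r//.
  by field; rewrite !gt_eqF.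
have -> : L ((r / t)%:C *: h) * (t / r)%:C = L h.
  rewrite linearZ /= [_ *: _]mulrC -mulrA -rCM (_ : r / t * (t / r) = 1) ?mulr1//.
  by field; rewrite !gt_eqF.
rewrite zt => hh; apply: le_trans (hh _) _; first by rewrite ler_pdivrMr//; arith.
rewrite expr_div_n mulrA ler_pM2r ?invr_gt0 ?exprn_gt0// ler_wpM2r ?sqr_ge0//; arith.
Qed.

(* The limit is taken along an ultrafilter, which avoids extracting a subsequence. *)
Lemma montel (g : nat -> Cplx2 R -> Cplx R) : (forall n, holomorphic_on G (g n)) ->
  (forall n x, G x -> cn (g n x) <= 1) ->
  exists h : Cplx2 R -> Cplx R, [/\ holomorphic_on G h, forall x, G x -> cn (h x) <= 1 &
    forall x l, G x -> clim (fun n => g n x) l -> h x = l].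
Proof.
move=> hg g1; have [F [FU sub]] := ultraFilterLemma (eventually_filter : ProperFilter \oo).
have hex (x : Cplx2 R) : exists l, G x -> ulim F (fun n => g n x) l.
  have [Gx|nG] := pselect (G x); last by exists 0.
  by have [l hl] := ulim_exists FU (fun n => g1 n x Gx); exists l.
have [h hh] := choice hex; exists h; split; last 2 first.
- by move=> x Gx; exact: (ulim_le FU (hh _ Gx) (fun n => g1 n x Gx)).
- move=> x l Gx cl; have key := (ulim_unique FU (hh _ Gx) (clim_ulim sub cl)); exact: key.
move=> x Gx; have /nbhs2P[r r0 hr] := G_nbhs Gx.
have tay n := taylor_G (hg n) (g1 n) r0 hr.
have [p hp] := choice tay; have [q hq] := choice hp.
have [P lP] := ulim_exists FU (fun n => let: And3 a _ _ := hq n in a).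
have [Q lQ] := ulim_exists FU (fun n => let: And3 _ a _ := hq n in a).
have est (k : Cplx2 R) t : cn k.1 <= t -> cn k.2 <= t -> t <= r / 4 ->
    cn (h (k + x) - h x - lin2 P Q k) <= 64 * t ^+ 2 / r ^+ 2.
  move=> k1 k2 tr; have Gk : G (k + x).
    by apply: hr => /=; rewrite addrK; arith.
  have l1 := ulimD FU (hh _ Gk) (ulimZ FU (-1) (hh _ Gx)).
  have l2 := ulimD FU (ulimZ FU (- k.1) lP) (ulimZ FU (- k.2) lQ).
  have := ulim_le FU (ulimD FU l1 l2) (M := 64 * t ^+ 2 / r ^+ 2).
  rewrite (_ : _ + _ = h (k + x) - h x - lin2 P Q k); last by rewrite /lin2; ring.
  apply=> n; have [_ _ /(_ k t k1 k2 tr)] := hq n; congr (cn _ <= _).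
  by rewrite /lin2; ring.
apply: (@eps_differentiable _ _ _ _ _ (lin2 P Q)); first exact: lin2_continuous.
move=> e e0; have d0 : 0 < e * r ^+ 2 / 64 by rewrite divr_gt0// mulr_gt0// exprn_gt0.
exists (Num.min (r / 4) (e * r ^+ 2 / 64)); first by rewrite lt_min d0 divr_gt0.
move=> k; rewrite norm2E ltcR lt_min => /andP[t1 t2].
rewrite cnoE -rCM lecR; apply: le_trans (est k (Num.max (cn k.1) (cn k.2)) _ _ _) _.
- by rewrite le_max lexx.
- by rewrite le_max lexx orbT.
- exact: ltW.
have t0 : 0 <= Num.max (cn k.1) (cn k.2) by rewrite le_max cn_ge0.
move: (Num.max _ _) t0 t1 t2 => t t0 t1 t2.
have t3 : 64 * t <= e * r ^+ 2 by move: t2; rewrite ltr_pdivlMr//; arith.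
rewrite ler_pdivrMr ?exprn_gt0// mulrAC; apply: le_trans (ler_wpM2r t0 t3).
by rewrite expr2 mulrA.
Qed.
End Montel.

(** * Herglotz integrals and joint interpolation *)

Section Herglotz.
Variable R : realType.
Notation C := R[i].
Notation G := (symmetrized_bidisc R).

Lemma climM (u v : nat -> C) (l k : C) : clim u l -> clim v k -> clim (fun n => u n * v n) (l * k).
Proof.
move=> hu hv e e0; have l0 := cn_ge0 l; have k0 := cn_ge0 k.
pose d := Num.min 1 (e / (2 + cn l + cn k)).
have X0 : 0 < 2 + cn l + cn k by arith.
have d0 : 0 < d by rewrite lt_min ltr01 divr_gt0.
have [N1 h1] := hu _ d0; have [N2 h2] := hv _ d0; exists (maxn N1 N2) => n.
rewrite geq_max => /andP[/h1 a /h2 b].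
have -> : u n * v n - l * k = (u n - l) * (v n - k) + (l * (v n - k) + k * (u n - l)) by ring.
apply: le_lt_trans (cnD _ _) _; apply: le_lt_trans (lerD (lexx _) (cnD _ _)) _; rewrite !cnM.
have d1 : d <= 1 by rewrite ge_min lexx.
have d2 : d * (2 + cn l + cn k) <= e by rewrite -ler_pdivlMr// ge_min lexx orbT.
move: d d0 d1 d2 a b {hu hv h1 h2} => d d0 d1 d2.
move: (cn (u n - l)) (cn (v n - k)) (cn_ge0 (u n - l)) (cn_ge0 (v n - k)) => a b a0 b0 ad bd.
have p1 : a * b <= d * 1 by apply: ler_pM => //; arith.
have p2 : cn l * b <= cn l * d by rewrite ler_wpM2l// ltW.
have p3 : cn k * a <= cn k * d by rewrite ler_wpM2l// ltW.
by move: d2; rewrite !mulrDr; arith.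
Qed.

Lemma clim_ctn (u : nat -> C) (l : C) (phi : C -> C) : clim u l -> ctn phi l ->
  clim (fun n => phi (u n)) (phi l).
Proof. by move=> hu hc e /hc[d d0 hd]; have [N h] := hu _ d0; exists N => n /h /hd. Qed.

Lemma diff_ctn (f : Cplx R -> Cplx R) (w : C) : differentiable f (w : Cplx R) -> ctn f w.
Proof. by move=> /diff_cdif/cdif_ctn. Qed.

Lemma df_cmean (U : normedModType C) (H : C -> U -> Cplx R) (x : U) (r : R) (N : nat) : 0 < r ->
  (forall w, cn w = r -> differentiable (H w) x) ->
  differentiable (fun y => cmean r (fun w => H w y) N : Cplx R) x.
Proof.
move=> r0 h; apply: (dfM (dfc x (N%:R^-1))).
have : forall n, differentiable (fun y => \sum_(j < n) (H (circ N r j) y : C) : Cplx R) x.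
  elim=> [|n IH].
    have := dfc x 0; congr (differentiable _ _); apply: funext => y; by rewrite big_ord0.
  have := dfD IH (h _ (cn_circ N n r0)); congr (differentiable _ _); apply: funext => y.
  by rewrite big_ord_recr.
exact.
Qed.

Lemma cmeanZ (r : R) (F : C -> C) k N : cmean r (fun w => k * F w) N = k * cmean r F N.
Proof. by rewrite /cmean -mulr_sumr mulrCA. Qed.

Lemma cmeanD (r : R) (F H : C -> C) N : cmean r (fun w => F w + H w) N = cmean r F N + cmean r H N.
Proof. by rewrite /cmean -mulrDr -big_split. Qed.

(** The Herglotz kernel for the circle of radius [r], with [z] rescaled to the unit disc. *)
Definition pois (r : R) (v z : C) : C := (v + r%:C * z) / (v - r%:C * z).

Lemma pois_den (r : R) (v z : C) : 0 < r -> cn v = r -> cn z < 1 -> v - r%:C * z != 0.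
Proof.
move=> r0 vr z1; rewrite subr_eq0; apply/eqP => e; have : cn v < r.
  by rewrite e cnM cnR gtr0_norm// gtr_pMr.
by rewrite vr ltxx.
Qed.

(** The kernel is [2 v / (v - r z) - 1] and twice [rp F] is [F + cj F]. By [clim_kernel] the four
    resulting means converge to [F (r z)], [cj (F 0)] and minus one half of [F 0] and of its
    conjugate; all but the leading one cancel since [F 0 = 1]. *)
Lemma herglotz (F : Cplx R -> Cplx R) (z : C) (r : R) : holomorphic_on (unit_disc R) F ->
  F 0 = 1 -> 0 < r -> r < 1 -> cn z < 1 ->
  clim (cmean r (fun v => (rp (F v))%:C * pois r v z)) (F (r%:C * z)).
Proof.
move=> hF F0 r0 r1 z1; have z0 : cn (0 : C) < 1 by rewrite cn0.
have h1 := clim_kernel hF r0 r1 z1 z0.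
have h2 := climJ (clim_kernel hF r0 r1 z0 z1).
have h3 := clim_kernel hF r0 r1 z0 z0.
have h4 := climJ h3.
have := climD (climD h1 h2) (climD (climZ (- 2^-1) h3) (climZ (- 2^-1) h4)).
rewrite !(mulr0, mul0r, cj0, subr0, divr1) F0 !cj1.
rewrite (_ : _ + _ + _ = F (r%:C * z)); last by field.
congr clim; apply/funext => N; rewrite !cmean_J -!cmeanZ -!cmeanD; apply: eq_cmean => // v vr.
have vn : v != 0 by rewrite -cn_gt0 vr.
have vn2 : cj v != 0 by rewrite -cn_gt0 cnJ vr.
have dn := pois_den r0 vr z1.
have dn2 : cj v - r%:C * cj z != 0 by rewrite -[r%:C]cjR -cjM -rmorphB -cn_gt0 cnJ cn_gt0.
rewrite /pois !subr0 !cjE !divff// ?cj1 ?mulr1 ?mul1r.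
rewrite (_ : (rp (F v))%:C = (F v + cj (F v)) / 2); last by case: (F v) => x y; apply: cxP => /=; field.
by move: (F v) (cj (F v)) => x y; field.
Qed.

(* [magic c d] restricts to [c z] on the royal variety and to [d q] at [(0, q)], so that
   the Herglotz integrals of two functions given there combine into one on [G]. *)
Definition magic (c d : C) (x : Cplx2 R) : C := c * cay (- (d / c)) x.

Lemma magic_unit (c d : C) : cn c = 1 -> cn d = 1 -> cn (- (d / c)) = 1.
Proof. by move=> c1 d1; rewrite cnN cnM cnV c1 d1 invr1 mulr1. Qed.

Lemma magic_lt1 (c d : C) x : cn c = 1 -> cn d = 1 -> G x -> cn (magic c d x) < 1.
Proof.
move=> c1 d1 Gx; have o1 := magic_unit c1 d1.
by rewrite cnM c1 mul1r cnM cnJ o1 mul1r; apply: cn_cayley; exact: cm_gt0.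
Qed.

Lemma magic_differentiable (c d : C) (x : Cplx2 R) : cn c = 1 -> cn d = 1 -> G x ->
  differentiable (magic c d : Cplx2 R -> Cplx R) x.
Proof.
by move=> c1 d1 Gx; exact: (dfM (dfc x c) (cay_differentiable (magic_unit c1 d1) Gx)).
Qed.

Lemma magic_royal (c d z : C) : cn c = 1 -> cn d = 1 -> cn z < 1 -> magic c d (2 * z, z ^+ 2) = c * z.
Proof. by move=> c1 d1 z1; rewrite /magic cay_royal// magic_unit. Qed.

Lemma magic_flat (c d q : C) : cn c = 1 -> cn d = 1 -> cn q < 1 -> magic c d (0, q) = d * q.
Proof.
move=> c1 d1 q1; have o1 := magic_unit c1 d1; have cn0 := unit_neq0 c1.
rewrite /magic /cay /cm /cden /= mulr0 subr0.
have oJ : cj (- (d / c)) * (- (d / c)) ^+ 2 = - (d / c).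
  by rewrite expr2 mulrA [cj _ * _]mulrC mulcJ o1 expr1n mul1r.
have n : 1 + (- (d / c)) ^+ 2 * q != 0.
  rewrite -[_ * q]opprK; apply: lt1_neq; rewrite cnN cnM cnX o1 expr1n mul1r //.
move: (cj _) oJ => k oJ; have dE : d = - (- (d / c)) * c by rewrite opprK divfK.
rewrite [in RHS]dE; move: (- (d / c)) n oJ {dE o1} => o n oJ.
have -> : ((1 - o ^+ 2 * q) / (1 + o ^+ 2 * q) - 1) / ((1 - o ^+ 2 * q) / (1 + o ^+ 2 * q) + 1) = - (o ^+ 2 * q).
  by field; rewrite n (_ : _ + _ = 2) ?two_neq0//; ring.
by rewrite mulrN mulrA oJ; ring.
Qed.

Lemma cn_cayley_le (m : C) : 0 <= rp m -> m + 1 != 0 /\ cn ((m - 1) / (m + 1)) <= 1.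
Proof.
move=> m0; have n : m + 1 != 0.
  by apply/eqP => e; have := congr1 rp e; rewrite rpD rp1 rp0; arith.
split=> //; rewrite cnM cnV ler_pdivrMr ?cn_gt0// mul1r -(@ler_pXn2r _ 2) ?nnegrE ?cn_ge0//.
by rewrite !cn_sqr !(rpD, rpN, ipD, ipN) rp1 ip1; narith.
Qed.

Definition jker (A B : C -> C) (r : R) (v w : C) (x : Cplx2 R) : C := (rp (A v))%:C * (rp (B w))%:C *
  ((1 + magic (r%:C / v) (r%:C / w) x) / (1 - magic (r%:C / v) (r%:C / w) x)).

(** Integral of the Cayley transforms of the [magic] functions against the product of the two
    Herglotz measures, of densities [rp (A v)] and [rp (B w)]. *)
Definition joint (A B : C -> C) (r : R) (N : nat) (x : Cplx2 R) : C :=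
  cmean r (fun v => cmean r (fun w => jker A B r v w x) N) N.

Lemma unit_ratio (r : R) (v : C) : 0 < r -> cn v = r -> cn (r%:C / v) = 1.
Proof. by move=> r0 vr; rewrite cnM cnV cnR vr gtr0_norm// divff// gt_eqF. Qed.

Lemma joint_ge0 (A B : C -> C) (r : R) N x : 0 < r -> (forall v, cn v = r -> 0 <= rp (A v)) ->
  (forall v, cn v = r -> 0 <= rp (B v)) -> G x -> 0 <= rp (joint A B r N x).
Proof.
move=> r0 hA hB Gx; apply: cmean_rp_ge0 => // v vr; apply: cmean_rp_ge0 => // w wr.
rewrite /jker -rCM rpRM mulr_ge0 ?mulr_ge0 ?hA ?hB// ltW// hp_cayley// magic_lt1//; exact: unit_ratio.
Qed.

Lemma joint_differentiable (A B : C -> C) (r : R) N (x : Cplx2 R) : 0 < r -> G x ->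
  differentiable (joint A B r N : Cplx2 R -> Cplx R) x.
Proof.
move=> r0 Gx.
have inner v w : cn v = r -> cn w = r -> differentiable (jker A B r v w : Cplx2 R -> Cplx R) x.
  move=> vr wr; have [c1 d1] := (unit_ratio r0 vr, unit_ratio r0 wr).
  have dm := magic_differentiable c1 d1 Gx.
  have n := lt1_neq (magic_lt1 c1 d1 Gx).
  exact: (dfM (dfc x _) (df_div (dfD (dfc x 1) dm) (dfB (dfc x 1) dm) n)).
exact: (@df_cmean _ (fun v y => cmean r (fun w => jker A B r v w y) N : Cplx R) x r N r0
  (fun v vr => @df_cmean _ (fun w => jker A B r v w) x r N r0 (fun w => inner v w vr))).
Qed.

Lemma pois_ratio (r : R) (v z : C) : 0 < r -> cn v = r -> cn z < 1 ->
  (1 + r%:C / v * z) / (1 - r%:C / v * z) = pois r v z.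
Proof.
move=> r0 vr z1; have := pois_den r0 vr z1; have vn : v != 0 by rewrite -cn_gt0 vr.
rewrite /pois; move: (r%:C) => s n.
by field; rewrite n vn.
Qed.

Lemma pois0 (r : R) (v : C) : 0 < r -> cn v = r -> pois r v 0 = 1.
Proof. by move=> r0 vr; rewrite /pois mulr0 addr0 subr0 divff// -cn_gt0 vr. Qed.

(** On the royal variety the kernel depends only on [v] and on the points [(0, q)] only on [w]. The
    other variable integrates to 1 in the limit, because [A 0 = B 0 = 1]. *)
Lemma joint_royal (A B : Cplx R -> Cplx R) (r : R) (z : C) : holomorphic_on (unit_disc R) A ->
  holomorphic_on (unit_disc R) B -> A 0 = 1 -> B 0 = 1 -> 0 < r -> r < 1 -> cn z < 1 ->
  clim (fun N => joint A B r N (2 * z, z ^+ 2)) (A (r%:C * z)) /\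
  clim (fun N => joint A B r N (0, z)) (B (r%:C * z)).
Proof.
move=> hA hB A0 B0 r0 r1 z1; have z0 : cn (0 : C) < 1 by rewrite cn0.
have a1 := herglotz hA A0 r0 r1 z1; have a0 := herglotz hA A0 r0 r1 z0.
have b1 := herglotz hB B0 r0 r1 z1; have b0 := herglotz hB B0 r0 r1 z0.
rewrite mulr0 A0 in a0; rewrite mulr0 B0 in b0; split.
- have := climM a1 b0; rewrite mulr1; congr clim; apply/funext => N.
  rewrite /joint mulrC -cmeanZ; apply: eq_cmean => // v vr.
  rewrite mulrC -cmeanZ; apply: eq_cmean => // w wr.
  have [c1 d1] := (unit_ratio r0 vr, unit_ratio r0 wr).
  by rewrite /jker magic_royal// pois_ratio// pois0//; ring.
- have := climM b1 a0; rewrite mulr1; congr clim; apply/funext => N.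
  rewrite /joint -cmeanZ; apply: eq_cmean => // v vr.
  rewrite pois0// mulr1 mulrC -cmeanZ; apply: eq_cmean => // w wr.
  have [c1 d1] := (unit_ratio r0 vr, unit_ratio r0 wr).
  by rewrite /jker magic_flat// pois_ratio//; ring.
Qed.

Lemma tau_differentiable (a z : C) : cn a < 1 -> cn z <= 1 ->
  differentiable (tau a : Cplx R -> Cplx R) (z : Cplx R).
Proof.
move=> a1 z1; have n := tau_den a1 z1.
exact: (df_div (dfB (dfid (z : Cplx R)) (dfc (z : Cplx R) a))
  (dfB (dfc (z : Cplx R) 1) (dfM (dfc (z : Cplx R) (cj a)) (dfid (z : Cplx R)))) n).
Qed.

Lemma cayleyVK (w : C) : cn w < 1 -> ((1 + w) / (1 - w) - 1) / ((1 + w) / (1 - w) + 1) = w.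
Proof.
move=> w1; have n := lt1_neq w1; field; rewrite n (_ : _ + _ = 2) ?two_neq0//; ring.
Qed.

(** The factor [r] makes the data strictly smaller than one, so that Cayley transforms exist. Moving
    the common value [c0] at 0 to the origin by [tau c0] normalises both transforms to 1 at 0; the
    joint integrals are mapped back, and Montel's theorem gives the limit. *)
Lemma royal_flat0_ext_r (a b : Cplx R -> Cplx R) (r : R) : holomorphic_on (unit_disc R) a ->
  holomorphic_on (unit_disc R) b -> (forall t : C, cn t < 1 -> cn (a t) <= 1) ->
  (forall t : C, cn t < 1 -> cn (b t) <= 1) -> a 0 = b 0 -> 0 < r -> r < 1 ->
  exists g : Cplx2 R -> Cplx R, [/\ holomorphic_on G g, forall x, G x -> cn (g x) <= 1 &
    forall t : C, cn t < 1 -> g (2 * t, t ^+ 2) = r%:C * a (r%:C * t) /\ g (0, t) = r%:C * b (r%:C * t)].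
Proof.
move=> ha hb a1 b1 ab r0 r1.
have z0 : cn (0 : C) < 1 by rewrite cn0.
have sc c : cn c <= 1 -> cn (r%:C * c) < 1.
  by move=> h; rewrite cnM cnR gtr0_norm//; apply: le_lt_trans r1; rewrite ler_piMr// ltW.
have [c0 c0E] : exists c0 : C, c0 = r%:C * a 0 by eexists.
have c01 : cn c0 < 1 by rewrite c0E; apply: sc; exact: a1.
have c01' : cn (- c0) < 1 by rewrite cnN.
pose N (f : Cplx R -> Cplx R) (t : Cplx R) : Cplx R := tau c0 (r%:C * f t).
pose P (f : Cplx R -> Cplx R) (t : Cplx R) : Cplx R := (1 + N f t) / (1 - N f t).
have hN f (t : C) : (forall t : C, cn t < 1 -> cn (f t) <= 1) -> cn t < 1 -> cn (N f t) < 1.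
  by move=> f1 t1; apply: tau_lt1 => //; apply: sc; exact: f1.
have hP (f : Cplx R -> Cplx R) : holomorphic_on (unit_disc R) f -> (forall t : C, cn t < 1 -> cn (f t) <= 1) ->
    holomorphic_on (unit_disc R) (P f).
  move=> hf f1 t t1; have t1' : cn t < 1 by rewrite -ltcR.
  have dN : differentiable (N f) t.
    have h2 : cn (r%:C * f t) <= 1 by rewrite ltW// sc// f1.
    exact: (dfcomp (dfM (dfc t r%:C) (hf _ t1)) (tau_differentiable c01 h2)).
  exact: (df_div (dfD (dfc t 1) dN) (dfB (dfc t 1) dN) (lt1_neq (hN _ _ f1 t1'))).
have P0 (f : Cplx R -> Cplx R) : f 0 = a 0 -> P f 0 = 1.
  by move=> e; rewrite /P /N e -c0E /tau subrr mul0r addr0 subr0 divr1.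
have Pge f v : (forall t : C, cn t < 1 -> cn (f t) <= 1) -> cn v = r -> 0 <= rp (P f v).
  by move=> f1 vr; rewrite ltW// hp_cayley// hN// vr.
pose g (n : nat) (x : Cplx2 R) : Cplx R :=
  tau (- c0) ((joint (P a) (P b) r n x - 1) / (joint (P a) (P b) r n x + 1)).
have J0 n x : G x -> 0 <= rp (joint (P a) (P b) r n x).
  by move=> Gx; apply: joint_ge0 => // v vr; exact: Pge.
have hg n : holomorphic_on G (g n).
  move=> x Gx; have [n1 n2] := cn_cayley_le (J0 n x Gx).
  exact: (dfcomp (dfcomp (joint_differentiable (P a) (P b) n r0 Gx) (cayley_differentiable n1))
     (tau_differentiable c01' n2)).
have g1 n x : G x -> cn (g n x) <= 1.
  by move=> Gx; apply: tau_le1 => //; exact: (cn_cayley_le (J0 n x Gx)).2.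
have [h [hh h1 hl]] := montel hg g1; exists h; split=> // t t1.
have fin f (u : nat -> C) : (forall t : C, cn t < 1 -> cn (f t) <= 1) -> clim u (P f (r%:C * t)) ->
   clim (fun n => tau (- c0) ((u n - 1) / (u n + 1))) (r%:C * f (r%:C * t)).
  move=> f1 cl; have rt : cn (r%:C * t) < 1 by apply: sc; exact: ltW.
  have w1 := hN _ _ f1 rt.
  have n1 : P f (r%:C * t) + 1 != 0 by apply: hp1_neq0; exact: hp_cayley.
  have e1 : ((P f (r%:C * t)) - 1) / ((P f (r%:C * t)) + 1) = N f (r%:C * t) by exact: cayleyVK.
  have n2 : cn (((P f (r%:C * t)) - 1) / ((P f (r%:C * t)) + 1)) <= 1 by rewrite e1 ltW.
  have dphi := dfcomp (cayley_differentiable n1) (tau_differentiable c01' n2).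
  have := clim_ctn cl (diff_ctn dphi); rewrite e1 /N tauK// ltW// sc// f1//.
have Gt : G (0, t).
  have := kF_G z0 t1 => -[+ _]; rewrite /kF; congr G.
  by rewrite cj0 expr0n /= !(mulr0, mul0r, addr0, add0r, divr1).
have [j1 j2] := joint_royal (hP _ ha a1) (hP _ hb b1) (P0 _ erefl) (P0 _ (esym ab)) r0 r1 t1.
by split; [apply: (hl _ _ (royal_G t1)); exact: fin|apply: (hl _ _ Gt); exact: fin].
Qed.

(** The radius [r] tends to 1, with a second passage to the limit by Montel's theorem. *)
Lemma royal_flat0_ext (a b : Cplx R -> Cplx R) : holomorphic_on (unit_disc R) a ->
  holomorphic_on (unit_disc R) b -> (forall t : C, cn t < 1 -> cn (a t) <= 1) ->
  (forall t : C, cn t < 1 -> cn (b t) <= 1) -> a 0 = b 0 ->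
  exists g : Cplx2 R -> Cplx R, [/\ holomorphic_on G g, forall x, G x -> cn (g x) <= 1 &
    forall t : C, cn t < 1 -> g (2 * t, t ^+ 2) = a t /\ g (0, t) = b t].
Proof.
move=> ha hb a1 b1 ab.
pose r (n : nat) : R := 1 - n.+2%:R^-1.
have n0 n : 0 < (n.+2%:R : R)^-1 by rewrite invr_gt0 ltr0n.
have n1 n : (n.+2%:R : R)^-1 < 1 by rewrite invf_lt1 ?ltr0n// ltr1n.
have r0 n : 0 < r n by rewrite subr_gt0.
have r1 n : r n < 1 by rewrite ltrBlDr ltrDl.
have [g hg] := choice (fun n => royal_flat0_ext_r ha hb a1 b1 ab (r0 n) (r1 n)).
have [h [hh h1 hl]] := montel (fun n => let: And3 u _ _ := hg n in u) (fun n => let: And3 _ u _ := hg n in u).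
exists h; split=> // t t1.
have rl : clim (fun n => (r n)%:C) 1.
  move=> e e0; have [m hm] : exists m : nat, e^-1 < m%:R.
    by exists (Num.truncn e^-1).+1; exact: truncnS_gt.
  exists m => n mn; rewrite /r -rC1 -rCN -rCD addrAC subrr add0r cnR normrN gtr0_norm//.
  rewrite -[e]invrK ltf_pV2 ?posrE ?invr_gt0 ?ltr0n//; apply: lt_le_trans hm _.
  by rewrite ler_nat; apply: leq_trans mn _; rewrite ltnW.
have lim (f : Cplx R -> Cplx R) : holomorphic_on (unit_disc R) f -> clim (fun n => (r n)%:C * f ((r n)%:C * t)) (f t).
  move=> hf; pose phi (w : Cplx R) : Cplx R := w * f (w * t).
  have d1 : differentiable phi (1 : Cplx R).
    have ht : unit_disc R (1 * t) by rewrite mul1r /unit_disc /= cnoE ltcR.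
    exact: (dfM (dfid (1 : Cplx R)) (dfcomp (dfM (dfid (1 : Cplx R)) (dfc (1 : Cplx R) t)) (hf _ ht))).
  by have := clim_ctn rl (diff_ctn d1); rewrite /phi !mul1r.
have Gt : G (0, t).
  have z0 : cn (0 : C) < 1 by rewrite cn0.
  have := kF_G z0 t1 => -[+ _]; rewrite /kF; congr G.
  by rewrite cj0 expr0n /= !(mulr0, mul0r, addr0, add0r, divr1).
split.
- apply: (hl _ _ (royal_G t1)); have := lim _ ha; congr clim; apply/funext => n.
  by have [_ _ /(_ t t1)[-> _]] := hg n.
- apply: (hl _ _ Gt); have := lim _ hb; congr clim; apply/funext => n.
  by have [_ _ /(_ t t1)[_ ->]] := hg n.
Qed.
End Herglotz.

(** * Extension from retracts and from the royal variety with a flat geodesic *)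

Section Extension.
Variable R : realType.
Notation C := R[i].
Notation G := (symmetrized_bidisc R).

Lemma df_local (X : normedModType C) (f h : X -> Cplx R) (x : X) : differentiable h x ->
  (exists2 W, nbhs x W & forall y, W y -> f y = h y) -> differentiable f x.
Proof.
move=> dh [W /nbhs_normC[d d0 hd] E].
have dc : continuous ('d h x) := diff_continuous dh.
have Ex : f x = h x by apply/E/hd; rewrite subrr normr0 -rC0 ltcR.
apply: (eps_differentiable dc) => e e0.
have [d' d'0 hd'] := differentiable_eps dh e0; exists (Num.min d d'); first by rewrite lt_min d0.
move=> k; rewrite -[`|k|]/(`|k|) => kd.
have [k1 k2] : `|k| < d%:C /\ `|k| < d'%:C.
  split; apply: lt_le_trans kd _; rewrite lecR ge_min lexx ?orbT//.
rewrite (E (k + x)); last by apply: hd; rewrite addrK.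
by rewrite Ex; exact: hd'.
Qed.

(** [f] is a restriction of holomorphic functions only locally; continuity of [k] lets a single one
    represent [f] along [k] near the point. *)
Lemma analytic_comp (X : normedModType C) (V : set (Cplx2 R)) (f : Cplx2 R -> Cplx R)
    (k : X -> Cplx2 R) (x : X) : analytic_on_subset G V f -> differentiable k x ->
  (exists2 W, nbhs x W & forall y, W y -> V (k y)) -> differentiable (fun y => f (k y)) x.
Proof.
move=> af dk [N hN kV]; have Vx := kV _ (nbhs_singleton hN).
have [W [oW Wx _ [h [hh hE]]]] := af _ Vx.
apply: (df_local (dfcomp dk (hh _ Wx))).
have cW : nbhs x (k @^-1` W).
  by apply: (differentiable_continuous dk); apply: open_nbhs_nbhs; split.
exists (N `&` (k @^-1` W)); first exact: filterI.
by move=> y [Ny Wy]; rewrite hE//; exact: kV.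
Qed.

Lemma disc_nbhs (t : Cplx R) : unit_disc R t -> nbhs t (unit_disc R).
Proof.
rewrite /unit_disc /= cnoE ltcR => t1; apply/nbhs_normC; exists (1 - cn t); first by rewrite subr_gt0.
move=> v; rewrite !cnoE !ltcR => h; rewrite /unit_disc /= cnoE ltcR.
by have := cnD (v - t) t; rewrite subrK; arith.
Qed.

(** Scaling reduces to functions bounded by one. The supremum is finite since [V] is nonempty and
    [f] is bounded; a zero supremum cannot be divided by and is treated apart. *)
Lemma npe_intro (V : set (Cplx2 R)) : V `<=` G -> V !=set0 ->
  (forall f : Cplx2 R -> Cplx R, analytic_on_subset G V f -> (forall x, V x -> cn (f x) <= 1) ->
    exists g : Cplx2 R -> Cplx R, [/\ holomorphic_on G g, forall x, V x -> g x = f x &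
      forall x, G x -> cn (g x) <= 1]) ->
  norm_preserving_extension G V.
Proof.
move=> VG [v0 Vv0] H; split=> // f af [M hM].
have ub x : V x -> ((cn (f x))%:E <= sup_norm V f)%E by move=> Vx; apply: ereal_sup_ubound; exists x.
have leM : (sup_norm V f <= M%:E)%E by apply: ub_ereal_sup => _ [x Vx <-]; rewrite lee_fin; exact: hM.
have [m mE] : exists m : R, sup_norm V f = m%:E.
  have := ub _ Vv0; move: leM; case: (sup_norm V f) => [r|//|//]; by exists r.
have fm x : V x -> cn (f x) <= m by move=> /ub; rewrite mE lee_fin.
suff [g [hg gf gm]] : exists g : Cplx2 R -> Cplx R, [/\ holomorphic_on G g,
    forall x, V x -> g x = f x & forall x, G x -> cn (g x) <= m].
  exists g; split=> //; apply/eqP; rewrite eq_le; apply/andP; split.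
    by rewrite mE; apply: ub_ereal_sup => _ [x Gx <-]; rewrite lee_fin; exact: gm.
  apply: le_ereal_sup => _ [x Vx <-]; exists x; first exact: VG.
  by rewrite gf.
have m0 : 0 <= m := le_trans (cn_ge0 _) (fm _ Vv0).
have [m00|mn] := eqVneq m 0.
  exists (fun=> 0); split; first by move=> ? _; exact: dfc.
    move=> x /fm; rewrite m00 => h; apply/esym/eqP; rewrite -cn_eq0; apply/eqP/le_anti.
    by rewrite h cn_ge0.
  by move=> x _; rewrite cn0.
have mp : 0 < m by rewrite lt_neqAle eq_sym mn.
have mC : m%:C != 0 :> C := rC_neq0 mp.
pose f1 (x : Cplx2 R) : Cplx R := m%:C^-1 * f x.
have af1 : analytic_on_subset G V f1.
  move=> z /af[W [oW Wz WG [h [hh hE]]]]; exists W; split=> //; exists (fun x => m%:C^-1 * h x : Cplx R).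
  split; first by move=> x Wx; exact: (dfM (dfc x _) (hh _ Wx)).
  by move=> x Wx Vx; rewrite /f1 hE.
have f11 x : V x -> cn (f1 x) <= 1.
  by move=> /fm h; rewrite cnM cnV cnR gtr0_norm// mulrC ler_pdivrMr// mul1r.
have [g [hg gf g1]] := H f1 af1 f11.
exists (fun x => m%:C * g x : Cplx R); split.
- by move=> x Gx; exact: (dfM (dfc x _) (hg _ Gx)).
- by move=> x Vx; rewrite gf// /f1 mulVKf.
- by move=> x Gx; rewrite cnM cnR gtr0_norm// ler_piMr// g1.
Qed.

Lemma G0 : G (0, 0).
Proof. by apply/G_cn; exists 0, 0; split; rewrite ?cn0 ?addr0 ?mulr0. Qed.

Lemma retract_npe (V : set (Cplx2 R)) : retract_in G V -> norm_preserving_extension G V.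
Proof.
move=> [rho [hrho rG rr VE]].
have VG : V `<=` G by rewrite VE => _ [x Gx <-]; exact: rG.
have Vr x : G x -> V (rho x) by move=> Gx; rewrite VE; exists x.
have fixV x : V x -> rho x = x by rewrite VE => -[y Gy <-]; exact: rr.
apply: npe_intro => //; first by exists (rho (0, 0)); apply: Vr; exact: G0.
move=> f af f1; exists (fun x => f (rho x)); split.
- move=> x Gx; apply: (analytic_comp af (hrho _ Gx)); exists G; first exact: G_nbhs.
  exact: Vr.
- by move=> x Vx; rewrite fixV.
- by move=> x Gx; apply/f1/Vr.
Qed.

Definition fS (a : C) (x : Cplx2 R) : C :=
  ((1 + a * cj a) * x.1 - 2 * a - 2 * cj a * x.2) / fden a x.

Definition fTm (a : C) (x : Cplx2 R) : Cplx2 R := (fS a x, fT a x).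

Lemma fTm_sym (a z w : C) : cn a < 1 -> cn z <= 1 -> cn w <= 1 ->
  fTm a (z + w, z * w) = (tau a z + tau a w, tau a z * tau a w).
Proof.
move=> a1 z1 w1; rewrite /fTm fT_sym//; congr (_, _); rewrite /fS fden_sym /tau /=.
by have := tau_den a1 z1; have := tau_den a1 w1; move: (cj a) => b n1 n2; field; rewrite n1 n2.
Qed.

Lemma fTm_G (a : C) x : cn a < 1 -> G x -> G (fTm a x).
Proof.
move=> a1 /G_cn[z [w [z1 w1 ->]]]; rewrite fTm_sym//; try exact: ltW.
by apply/G_cn; exists (tau a z), (tau a w); split; rewrite ?tau_lt1.
Qed.

Lemma fTm_differentiable (a : C) (x : Cplx2 R) : cn a < 1 -> G x ->
  differentiable (fTm a : Cplx2 R -> Cplx2 R) x.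
Proof.
move=> a1 Gx; have n := fden_G a1 Gx.
have d1 := df_div (dfB (dfB (dfM (dfc x (1 + a * cj a)) (differentiable_fst x)) (dfc x (2 * a)))
   (dfM (dfc x (2 * cj a)) (differentiable_snd x))) (fden_differentiable a x) n.
exact: (differentiable_pair d1 (fT_differentiable n)).
Qed.

Lemma fTm_flat (a : C) x : flat (ctr a) x -> fTm a x = (0, fT a x).
Proof.
move=> [Gx xE]; congr (_, _); rewrite /fS xE ctrJ /ctr; have := ctr_den a.
rewrite (_ : _ * _ - _ - _ = 0) ?mul0r//.
by move: (ctr_den a); move: (cj a) => b n; field.
Qed.

Lemma royal_flat_npe c : cn c < 1 -> norm_preserving_extension G (royal_variety R `|` flat c).
Proof.
move=> c1; have [a a1 cE] := ctr_exists c1; rewrite cE.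
have an : cn (- a) < 1 by rewrite cnN.
have discP (t : Cplx R) : unit_disc R t <-> cn t < 1 by rewrite /unit_disc /= cnoE ltcR.
apply: npe_intro.
- by move=> x [[z [/discP z1 ->]]|[]//]; exact: royal_G.
- by exists (2 * 0, 0 ^+ 2); left; exists 0; split=> //; apply/discP; rewrite cn0.
move=> f af f1.
(* The automorphism acts on the royal variety by [tau a], so the data there are read through its
   inverse [tau (- a)]. *)
pose fa (t : Cplx R) : Cplx R := f (2 * tau (- a) t, tau (- a) t ^+ 2).
pose fb (t : Cplx R) : Cplx R := f (kF a t).
have VR (z : C) : cn z < 1 -> (royal_variety R `|` flat (ctr a)) (2 * z, z ^+ 2).
  by move=> z1; left; exists z; split=> //; exact/discP.
have ha : holomorphic_on (unit_disc R) fa.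
  move=> t td; have t1 := (discP t).1 td; have dt := tau_differentiable an (ltW t1).
  have dk : differentiable (fun t : Cplx R => (2 * tau (- a) t, tau (- a) t ^+ 2) : Cplx2 R) t.
    exact: (differentiable_pair (dfM (dfc t 2) dt) (dfX 2 dt)).
  apply: (analytic_comp af dk); exists (unit_disc R); first exact: disc_nbhs.
  by move=> v /discP v1; apply: VR; exact: tau_lt1.
have hb : holomorphic_on (unit_disc R) fb.
  move=> t td; have t1 := (discP t).1 td.
  apply: (analytic_comp af (kF_differentiable a1 t1)); exists (unit_disc R); first exact: disc_nbhs.
  by move=> v /discP v1; right; exact: kF_flat.
have fa1 (t : C) : cn t < 1 -> cn (fa t) <= 1 by move=> t1; apply/f1/VR; exact: tau_lt1.
have fb1 (t : C) : cn t < 1 -> cn (fb t) <= 1 by move=> t1; apply: f1; right; exact: kF_flat.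
have ab : fa 0 = fb 0.
  by rewrite /fa /fb royal_kF /tau mulr0 subr0 divr1 sub0r opprK.
have [g [hg g1 gE]] := royal_flat0_ext ha hb fa1 fb1 ab.
exists (fun x => g (fTm a x)); split.
- by move=> x Gx; exact: (dfcomp (fTm_differentiable a1 Gx) (hg _ (fTm_G a1 Gx))).
- move=> x [[z [/discP z1 ->]]|fx].
    have -> : fTm a (2 * z, z ^+ 2) = (2 * tau a z, tau a z ^+ 2).
      have -> : 2 * z = z + z by ring.
      by rewrite expr2 fTm_sym// ?ltW// -expr2; congr (_, _); ring.
    by rewrite (gE _ (tau_lt1 a1 z1)).1 /fa tauK// ltW.
  have [q1 xE] := flat_kF a1 fx.
  by rewrite fTm_flat// (gE _ q1).2 /fb -xE.
- by move=> x Gx; apply: g1; exact: fTm_G.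
Qed.
End Extension.

(** * Algebraic sets and the main theorem *)

Section Algebraic.
Variable R : realType.
Notation C := R[i].
Notation G := (symmetrized_bidisc R).

(** The closure rules for this predicate turn an explicit formula in [s] and [p] into a polynomial
    without computing coefficients. *)
Definition polyfun (f : C -> C -> C) := exists P : {poly {poly C}}, forall s p, P.[s, p] = f s p.

Lemma pfC c : polyfun (fun _ _ => c).
Proof. by exists c%:P%:P => s p; rewrite !hornerC. Qed.

Lemma pfs : polyfun (fun s _ => s).
Proof. by exists 'X => s p; rewrite hornerX hornerC. Qed.

Lemma pfp : polyfun (fun _ p => p).
Proof. by exists 'X%:P => s p; rewrite hornerC hornerX. Qed.

Lemma pfD f g : polyfun f -> polyfun g -> polyfun (fun s p => f s p + g s p).
Proof. by move=> [P hP] [Q hQ]; exists (P + Q) => s p; rewrite !hornerD hP hQ. Qed.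

Lemma pfB f g : polyfun f -> polyfun g -> polyfun (fun s p => f s p - g s p).
Proof. by move=> [P hP] [Q hQ]; exists (P - Q) => s p; rewrite !(hornerD, hornerN) hP hQ. Qed.

Lemma pfM f g : polyfun f -> polyfun g -> polyfun (fun s p => f s p * g s p).
Proof. by move=> [P hP] [Q hQ]; exists (P * Q) => s p; rewrite !hornerM hP hQ. Qed.

Lemma algebraic1 (V : set (Cplx2 R)) f : polyfun f ->
  (forall x, V x <-> G x /\ f x.1 x.2 = 0) -> algebraic_subset G V.
Proof.
move=> [P hP] h; exists [set P]; apply/seteqP; split=> x.
  by move=> /h[Gx fx]; split=> // _ ->; rewrite hP.
by move=> [Gx hx]; apply/h; split=> //; rewrite -hP; exact: hx.
Qed.

Lemma algebraic_point (x : Cplx2 R) : G x -> algebraic_subset G [set x].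
Proof.
move=> Gx; exists [set 'X - x.1%:P%:P; ('X - x.2%:P)%:P]; apply/seteqP; split=> y /=.
  move=> ->; split=> // p [->|->].
    by rewrite hornerXsubC hornerD hornerN !hornerC subrr.
  by rewrite hornerC hornerXsubC subrr.
move=> [_ h]; have := h _ (or_introl erefl); have := h _ (or_intror erefl).
rewrite hornerC hornerXsubC => /eqP; rewrite subr_eq0 => /eqP e2.
rewrite hornerXsubC hornerD hornerN !hornerC => /eqP; rewrite subr_eq0 => /eqP e1.
by case: y x e1 e2 {h Gx} => ? ? [? ?] /= -> ->.
Qed.

Lemma algebraic_geod om al be ga : cn om = 1 -> algebraic_subset G (geod om al be ga).
Proof.
move=> o1.
pose den (s p : C) : C := 1 - om * s + om ^+ 2 * p.
pose f (s p : C) : C := (om ^+ 2 * (s * s) - 4 * (om ^+ 2 * p)) -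
  (al%:C * ((1 - om ^+ 2 * p) * (1 - om ^+ 2 * p)) + ('i * be%:C) * ((1 - om ^+ 2 * p) * den s p) -
   ga%:C * (den s p * den s p)).
have pden : polyfun den := pfD (pfB (pfC 1) (pfM (pfC om) pfs)) (pfM (pfC (om ^+ 2)) pfp).
have pm : polyfun (fun _ p => 1 - om ^+ 2 * p) := pfB (pfC 1) (pfM (pfC (om ^+ 2)) pfp).
have pf : polyfun f.
  exact: (pfB (pfB (pfM (pfC (om ^+ 2)) (pfM pfs pfs)) (pfM (pfC 4) (pfM (pfC (om ^+ 2)) pfp)))
    (pfB (pfD (pfM (pfC al%:C) (pfM pm pm)) (pfM (pfC ('i * be%:C)) (pfM pm pden)))
      (pfM (pfC ga%:C) (pfM pden pden)))).
apply: (algebraic1 pf) => x.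
have key : G x -> cD om x - quad al be ga (cm om x) = f x.1 x.2 / den x.1 x.2 ^+ 2.
  move=> Gx; have := cden_neq0 o1 Gx; rewrite /cD /cm /quad /f /den /cden.
  by move: (al%:C) (be%:C) (ga%:C) => a b c n; field.
split=> -[Gx h]; split=> //; have n := cden_neq0 o1 Gx; have := key Gx.
  rewrite h subrr => /esym/eqP; rewrite mulf_eq0 invr_eq0 expf_eq0 /= -/(cden om x) (negPf n) orbF.
  by move/eqP.
by rewrite h mul0r => /eqP; rewrite subr_eq0 => /eqP.
Qed.

Lemma algebraic_G : algebraic_subset G G.
Proof. by exists set0; apply/seteqP; split=> [x Gx|x []//]; split. Qed.

Lemma algebraic_royal_flat c : algebraic_subset G (royal_variety R `|` flat c).
Proof.
pose f (s p : C) := (s * s - 4 * p) * (s - (c + cj c * p)).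
have pf : polyfun f := pfM (pfB (pfM pfs pfs) (pfM (pfC 4) pfp)) (pfB pfs (pfD (pfC c) (pfM (pfC (cj c)) pfp))).
apply: (algebraic1 pf) => x; rewrite (royal_geod (cn1 R)) /f; split.
  move=> [[Gx]|[Gx ->]]; last by rewrite subrr mulr0.
  rewrite /cD /quad !mul0r mulr0 mul0r add0r subr0 !expr1n !mul1r => /eqP.
  rewrite mulf_eq0 invr_eq0 expf_eq0 /= (negPf (cden_neq0 (cn1 R) Gx)) orbF => /eqP.
  by rewrite expr2 => ->; rewrite mul0r.
move=> [Gx /eqP]; rewrite mulf_eq0 => /orP[/eqP h|]; last by rewrite subr_eq0 => /eqP; right.
left; split=> //; rewrite /cD /quad !mul0r mulr0 mul0r add0r subr0 !expr1n !mul1r.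
by rewrite expr2 h mul0r.
Qed.

Lemma retract_algebraic (V : set (Cplx2 R)) : retract_in G V -> algebraic_subset G V.
Proof.
move=> rV; have [rho [_ rG _ VE]] := rV.
have Vx : V (rho (0, 0)) by rewrite VE; exists (0, 0) => //; exact: G0.
have Gx : G (rho (0, 0)) by apply: rG; exact: G0.
have [h|[y Vy ne]] : (forall y, V y -> y = rho (0, 0)) \/ exists2 y, V y & rho (0, 0) <> y.
  have [h|h] := pselect (forall y, V y -> y = rho (0, 0)); [by left|right].
  by apply: contrapT => n; apply: h => y Vy; apply: contrapT => e; apply: n; exists y => // /esym.
  rewrite (_ : V = [set rho (0, 0)]); first exact: algebraic_point.
  by apply/seteqP; split=> z; [exact: h|move=> ->].
have [ om [al [be [ga [ o1 gq _ _ [_ [->|->]]]]]]] := retract_cases rV Vx Vy ne.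
- exact: algebraic_geod.
- exact: algebraic_G.
Qed.
End Algebraic.

(** * Flat geodesics as lines, and the characterisation *)

Section Main.
Variable R : realType.
Notation C := R[i].
Notation G := (symmetrized_bidisc R).

Lemma flat_is_flat_geodesic c : cn c < 1 -> flat_geodesic G (@flat R c).
Proof.
move=> c1; have [a a1 cE] := ctr_exists c1.
have discP (t : Cplx R) : unit_disc R t <-> cn t < 1 by rewrite /unit_disc /= cnoE ltcR.
split.
  exists (kF a), (fT a); split.
  - split; first by move=> z /discP z1; exact: kF_differentiable.
    by move=> z /discP z1; exact: (kF_G a1 z1).1.
  - split; first by move=> x Gx; apply: fT_differentiable; exact: fden_G.
    move=> x /G_cn[z [w [z1 w1 ->]]]; apply/discP; rewrite fT_sym ?ltW// cnM.
    by apply: le_lt_trans (tau_lt1 a1 z1); rewrite ler_piMr ?cn_ge0 ?tau_le1// ltW.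
  - by move=> z /discP z1; exact: (kF_G a1 z1).2.
  apply/seteqP; split=> x.
    rewrite cE => fx; have [q1 xE] := flat_kF a1 fx; exists (fT a x); last exact: esym.
    exact/discP.
  by move=> [q /discP q1 <-]; rewrite cE; exact: kF_flat.
exists [set x : Cplx2 R | x.1 = c + cj c * x.2].
  exists (c, 0), (cj c, 1); split.
    by apply/eqP => e; have := congr1 snd e; move/eqP; rewrite /= oner_eq0.
  apply/seteqP; split=> x /=.
    move=> xE; exists x.2; apply: injective_projections; rewrite /= /GRing.scale /=.
      by rewrite xE mulrC.
    by rewrite mulr1 add0r.
  by move=> [t ->]; rewrite /= /GRing.scale /= mulr1 add0r mulrC.
by apply/seteqP; split=> x [].
Qed.

Lemma geodesic_retract (D : set (Cplx2 R)) : complex_geodesic G D -> retract_in G D.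
Proof.
move=> [k [c [[hk kG] [hc cD] ck DE]]]; exists (fun x => k (c x)); split.
- by move=> x Gx; exact: (dfcomp (hc _ Gx) (hk _ (cD _ Gx))).
- by move=> x Gx; apply/kG/cD.
- by move=> x Gx; rewrite ck//; exact: cD.
- rewrite DE; apply/seteqP; split=> x.
    by move=> [z z1 <-]; exists (k z); [exact: kG|rewrite ck].
  by move=> [y Gy <-]; exists (c y) => //; exact: cD.
Qed.

Lemma three_roots (a b c : C) : (forall m : C, 0 < rp m -> a * m ^+ 2 + b * m + c = 0) ->
  [/\ a = 0, b = 0 & c = 0].
Proof.
move=> h; have h1 := h 1; have h2 := h 2; have h3 := h 3.
have p1 : 0 < rp (1 : C) by rewrite rp1.
have p2 : 0 < rp (2 : C) by rewrite -(rCnat R 2) /= ltr0n.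
have p3 : 0 < rp (3 : C) by rewrite -(rCnat R 3) /= ltr0n.
have {}h1 := h1 p1; have {}h2 := h2 p2; have {}h3 := h3 p3.
have a0 : a = 0.
  have : 2 * a = 0.
    transitivity ((a * 3 ^+ 2 + b * 3 + c) - 2 * (a * 2 ^+ 2 + b * 2 + c) + (a * 1 ^+ 2 + b * 1 + c)).
      by ring.
    by rewrite h1 h2 h3; ring.
  by move/eqP; rewrite mulf_eq0 (negPf (two_neq0 R)) => /eqP.
have b0 : b = 0.
  transitivity ((a * 2 ^+ 2 + b * 2 + c) - (a * 1 ^+ 2 + b * 1 + c) - 3 * a); first by ring.
  by rewrite h1 h2 a0; ring.
by split=> //; move: h1; rewrite a0 b0 !mul0r !add0r.
Qed.

Lemma line_relation (L : set (Cplx2 R)) : complex_line L -> exists u v w : C,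
  (u != 0 \/ v != 0) /\ forall x, L x -> u * x.1 + v * x.2 = w.
Proof.
move=> [a [b [b0 ->]]]; exists b.2, (- b.1), (b.2 * a.1 - b.1 * a.2); split.
  have [e2|] := eqVneq b.2 0; [right|by left].
  rewrite oppr_eq0; apply: contra b0 => /eqP e1; apply/eqP.
  by case: b e1 e2 => ? ? /= -> ->.
by move=> x [t ->]; rewrite /= /GRing.scale /=; ring.
Qed.

(** A geodesic is a retract with two points, hence a quadratic curve or [G]. Pulled back to the
    curve, the equation of the line is a polynomial identity of degree two in [m]; for [al <> 1] its
    coefficients force the equation of the line to be trivial. [G] itself lies on no line, as the
    points [(0, 0)], [(0, 1/2)] and [(1/2, 0)] show. *)
Lemma flat_geodesic_flat (D : set (Cplx2 R)) : flat_geodesic G D ->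
  exists2 c, cn c < 1 & D = flat c.
Proof.
move=> [gD [L lL DE]]; have rD := geodesic_retract gD.
have [u [v [w [uv rel]]]] := line_relation lL.
have [k [c [[_ kG] _ ck kE]]] := gD.
have discP (t : Cplx R) : unit_disc R t <-> cn t < 1 by rewrite /unit_disc /= cnoE ltcR.
have d0 : unit_disc R (0 : Cplx R) by apply/discP; rewrite cn0.
have d1 : unit_disc R (2^-1 : Cplx R) by apply/discP; rewrite cnV cn_natr invf_lt1 ?ltr1n ?ltr0n.
have D0 : D (k 0) by rewrite kE; exists 0.
have D1 : D (k 2^-1) by rewrite kE; exists 2^-1.
have ne : k 0 <> k 2^-1.
  move=> e; have := ck _ d1; rewrite -e ck// => /esym/eqP.
  by rewrite invr_eq0 (negPf (two_neq0 R)).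
have [ om [al [be [ga [ o1 gq _ _ [gD' cases]]]]]] := retract_cases rD D0 D1 ne.
have on := unit_neq0 o1.
have al1 : al = 1.
  apply/eqP/negP => /negP aln.
  pose A : C := 2 * u * om^-1; pose B : C := v * om ^- 2.
  have hm (m : C) : 0 < rp m -> (A + B - w) * (1 - al%:C) * m ^+ 2 +
      ((A + B - w) * (- ('i * be%:C)) - 2 * B - 2 * w) * m + ((A + B - w) * ga%:C - A + B - w) = 0.
    move=> hm; have [Gm _ _] := gkP o1 gq hm.
    have Dm : D (gk om al be ga m) by apply: gD'; exact: gk_geod.
    have := Dm; rewrite DE => -[_ /rel]; rewrite /gk /cinv /=.
    have n := Hs_den_neq0 (good_quad_Hs gq hm).
    rewrite /quad in n *; rewrite /A /B; move: (al%:C) ('i * be%:C) (ga%:C) n => x y z n E.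
    have {}E := congr1 (fun q => q * (m ^+ 2 - (x * m ^+ 2 + y * m - z) + 2 * m + 1)) E.
    rewrite /= in E; apply/eqP; rewrite -subr_eq0 subr0.
    move/eqP: E; rewrite -subr_eq0 => /eqP <-; apply/eqP.
    by field; rewrite on n.
  have [a0 b0 c0] := three_roots hm.
  have aC : 1 - al%:C != 0 :> C.
    by rewrite -rC1 -rCN -rCD; apply/eqP => e; have := congr1 rp e => /= /eqP; rewrite subr_eq0 eq_sym (negPf aln).
  have s0 : A + B - w = 0 by move/eqP: a0; rewrite mulf_eq0 (negPf aC) orbF => /eqP.
  rewrite s0 !mul0r !add0r in b0 c0.
  have wE : w = - B.
    have : 2 * (w + B) = 0 by rewrite -[RHS]oppr0 -b0; ring.
    by move/eqP; rewrite mulf_eq0 (negPf (two_neq0 R)) addr_eq0 => /eqP.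
  have AE : A = 2 * B by move: c0; rewrite wE opprK => /eqP; rewrite addrAC -addrA addrC subr_eq0 => /eqP <-; ring.
  have B0 : B = 0.
    have : 4 * B = 0 by rewrite -s0 AE wE; ring.
    by move/eqP; rewrite mulf_eq0 pnatr_eq0 => /eqP.
  have A0 : A = 0 by rewrite AE B0 mulr0.
  case: uv => /negP; apply.
    by move/eqP: A0; rewrite /A !mulf_eq0 (negPf (two_neq0 R)) invr_eq0 (negPf on) orbF.
  by move/eqP: B0; rewrite /B mulf_eq0 invr_eq0 expf_eq0 (negPf on) orbF.
rewrite al1 in gq gD' cases; have [c0 c01 fE] := geod_flat o1 gq.
exists c0 => //; case: cases => [->//|DG]; exfalso.
have GL (x : Cplx2 R) : G x -> u * x.1 + v * x.2 = w by rewrite -DG DE => -[_ /rel].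
have h0 : cn (0 : C) < 1 by rewrite cn0.
have h2 : cn (2^-1 : C) < 1 by rewrite cnV cn_natr invf_lt1 ?ltr1n ?ltr0n.
have w0 : w = 0 by have := GL _ (@G0 R); rewrite !mulr0 addr0.
have Gp : G (0, 2^-1) by have := (flat_pt h0 h2).1; rewrite cj0 mul0r addr0.
have Gs : G (2^-1, 0) by have := (flat_pt h2 h0).1; rewrite mulr0 addr0.
have half0 (t : C) : t * 2^-1 = 0 -> t = 0.
  by move/eqP; rewrite mulf_eq0 invr_eq0 (negPf (two_neq0 R)) orbF => /eqP.
have v0 : v = 0 by apply: half0; have := GL _ Gp; rewrite w0 /= mulr0 add0r.
have u0 : u = 0 by apply: half0; have := GL _ Gs; rewrite w0 /= mulr0 addr0.
by case: uv; rewrite ?u0 ?v0 eqxx.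
Qed.

Lemma geod_retract om al be ga : cn om = 1 -> good_quad al be ga -> retract_in G (@geod R om al be ga).
Proof.
move=> o1 gq; have [rho [hr rK fr]] := geod_retraction o1 gq.
exists rho; split=> //.
- by move=> x /rK[].
- by move=> x /rK/fr.
- by apply/seteqP; split=> x; [move=> Kx; exists x; [case: Kx|exact: fr]|move=> [y Gy <-]; exact: rK].
Qed.
Lemma cst2_differentiable (x z : Cplx2 R) : differentiable (fun _ : Cplx2 R => x) z.
Proof. by case: x => a b; exact: (differentiable_pair (dfc z a) (dfc z b)). Qed.

End Main.

Theorem theorem1p4 (R : realType) (V : set (Cplx2 R)) :
  (algebraic_subset (symmetrized_bidisc R) V /\
   norm_preserving_extension (symmetrized_bidisc R) V)
  <->
  (retract_in (symmetrized_bidisc R) V \/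
   exists D : set (Cplx2 R),
     flat_geodesic (symmetrized_bidisc R) D /\ V = royal_variety R `|` D).
Proof.
split; last first.
  move=> [rV|[D [/flat_geodesic_flat[c c1 ->] ->]]].
    by split; [exact: retract_algebraic|exact: retract_npe].
  by split; [exact: algebraic_royal_flat|exact: royal_flat_npe].
move=> [[S VE] np]; have [x Vx] := npep_nonempty np.
have VG : V `<=` symmetrized_bidisc R by rewrite VE => ? [].
have [single|[y Vy xy]] : (forall y, V y -> y = x) \/ exists2 y, V y & x <> y.
  have [h|h] := pselect (forall y, V y -> y = x); [by left|right].
  by apply: contrapT => n; apply: h => y Vy; apply: contrapT => e; apply: n; exists y => // /esym.
  left; exists (fun=> x); split.
  - by move=> z _; exact: cst2_differentiable.
  - by move=> z _; exact: VG.
  - by [].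
  - apply/seteqP; split=> z; last by move=> [_ _ <-].
    by move=> /single ->; exists x => //; exact: VG.
have [VisG|nG] := pselect (V = symmetrized_bidisc R).
  left; exists id; split=> //; by rewrite VisG image_id.
have [RV|nRV] := pselect (royal_variety R `<=` V); last first.
  have [ om [al [be [ga [ o1 gq ->]]]]] := single_geod VE np nRV nG Vx Vy xy.
  by left; exact: geod_retract.
have [P P0 SP] : exists2 P, P != 0 & S P.
  apply: contrapT => h; apply: nG; rewrite VE; apply/seteqP; split=> z; first by case.
  move=> Gz; split=> // p Sp; have [->|p0] := eqVneq p 0; first by rewrite horner0 horner0.
  by case: h; exists p.
have [->|[c c1 ->]] := royal_case VE P0 SP np RV.
  left; rewrite (royal_geod (cn1 R)); exact: geod_retract (cn1 R) (good_royal R).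
by right; exists (flat c); split=> //; exact: flat_is_flat_geodesic.
Qed.
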